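(* Let $H$ be a coquasi-Hopf algebra with bijective antipode, $A$ a right $H$-comodule algebra and $B=A^{coH}$. Then the following are equivalent: (1) there exists a total integral $\gamma:H\to A$ and the map $can:A\otimes_BA\to A\otimes H$ is surjective; (2) the functor of coinvariants $(-)^{coH}$ and the induction functor $(-)\otimes_BA$ are a pair of inverse equivalences between $\mathcal{M}_A^H$ and $\mathcal{M}_B$; (3) the functor of coinvariants $(-)^{coH}$ and the induction functor $A\otimes_B(-)$ are a pair of inverse equivalences between ${}_A\mathcal{M}^H$ and ${}_B\mathcal{M}$; (4) $A$ is faithfully flat as a left $B$-module, and $A$ is a Galois extension of $B$; (5) $A$ is faithfully flat as a right $B$-module, and $A$ is a Galois extension of $B$.
   Context: Everything is over a field $k$; $\otimes=\otimes_k$. Sweedler notation: $\Delta(h)=h_1\otimes h_2$ (summation suppressed); for a right comodule, $\rho(m)=m_0\otimes m_1$, iterated as $m_0\otimes m_1\otimes m_2$, etc. A coquasi-bialgebra is a coassociative counital coalgebra $(H,\Delta,\varepsilon)$ with coalgebra morphisms $H\otimes H\to H$, $h\otimes g\mapsto hg$, and $k\to H$, $1\mapsto 1_H$, and a convolution invertible $\omega\in(H\otimes H\otimes H)^*$ such that for all $h,g,x,y\in H$: $h_1(g_1x_1)\omega(h_2,g_2,x_2)=\omega(h_1,g_1,x_1)(h_2g_2)x_2$; $1_Hh=h1_H=h$; $\omega(h_1,g_1,x_1y_1)\omega(h_2g_2,x_2,y_2)=\omega(g_1,x_1,y_1)\omega(h_1,g_2x_2,y_2)\omega(h_2,g_3,x_3)$;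 $\omega(h,1_H,g)=\varepsilon(h)\varepsilon(g)$. A coquasi-Hopf algebra is a coquasi-bialgebra with a coalgebra antihomomorphism $S:H\to H$ (antipode) and $\alpha,\beta\in H^*$ such that $S(h_1)\alpha(h_2)h_3=\alpha(h)1_H$, $h_1\beta(h_2)S(h_3)=\beta(h)1_H$, $\omega(h_1\beta(h_2),S(h_3),\alpha(h_4)h_5)=\omega^{-1}(S(h_1),\alpha(h_2)h_3\beta(h_4),S(h_5))=\varepsilon(h)$. The triple $(S,\alpha,\beta)$ is fixed and normalized by $\alpha(1_H)=\beta(1_H)=1$. A right $H$-comodule algebra is a right $H$-comodule $A$ with a multiplication and an element $1_A$ such that $\rho(ab)=a_0b_0\otimes a_1b_1$, $\rho(1_A)=1_A\otimes 1_H$, $1_Aa=a=a1_A$, $(ab)c=a_0(b_0c_0)\omega(a_1,b_1,c_1)$. $B=A^{coH}=\{a\in A:\rho(a)=a\otimes 1_H\}$ is an associative unital algebra, and $A$ is a $B$-bimodule by multiplication. $\mathcal{M}_A^H$ (right relative Hopf modules): right $H$-comodules $M$ with a right action $M\otimes A\to M$ satisfying $\rho(ma)=m_0a_0\otimes m_1a_1$, $m1_A=m$, $(ma)b=m_0(a_0b_0)\omega(m_1,a_1,b_1)$. ${}_A\mathcal{M}^H$ (left relative Hopf modules): right $H$-comodules $M$ with a left action $A\otimes M\to M$ satisfying $\rho(am)=a_0m_0\otimes a_1m_1$, $1_Am=m$, $(ab)m=a_0(b_0m_0)\omega(a_1,b_1,m_1)$. In both cases morphisms are the $H$-colinear maps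 respecting the action, and $M^{coH}=\{m:\rho(m)=m\otimes1_H\}$ is a right (resp. left) $B$-module. For a right $B$-module $N\in\mathcal{M}_B$, $N\otimes_BA\in\mathcal{M}_A^H$ with coaction and action on the factor $A$; for a left $B$-module $N\in{}_B\mathcal{M}$, $A\otimes_BN\in{}_A\mathcal{M}^H$ with coaction and action on the factor $A$. The functors $(-)\otimes_BA$, resp. $A\otimes_B(-)$, are left adjoint to the respective functors $(-)^{coH}$. The canonical map is $can:A\otimes_BA\to A\otimes H$, $can(a\otimes_Bb)=a_0b_0\otimes b_4\,\omega^{-1}(a_1,b_1\beta(b_2),S(b_3))$, and $A$ is a Galois extension of $B$ if $can$ is bijective. A total integral is an $H$-colinear map $\gamma:H\to A$ ($H$ a right comodule via $\Delta$) with $\gamma(1_H)=1_A$. *)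

(* Defs.v *)
From HB Require Import structures.
From mathcomp Require Import all_boot all_order all_algebra.
From mathcomp Require Import boolp ring.

Set Implicit Arguments.
Unset Strict Implicit.
Unset Printing Implicit Defensive.

Import GRing.Theory.
Local Open Scope quotient_scope.
Local Open Scope ring_scope.

(* For abelian groups M, N and families of maps ra r : M -> M, la r : N -> N    *)
(* indexed by a type R, [tensor ra la] is the quotient of formal sums of pairs  *)
(* by the relations of biadditivity and (ra r m, n) = (m, la r n): two formal   *)
(* sums are identified when no balanced map to an abelian group separates them. *)
Section Tensor.
Variables (R : Type) (M N : zmodType) (ra : R -> M -> M) (la : R -> N -> N).

Definition balanced (G : zmodType) (f : M -> N -> G) : Prop :=
  [/\ forall m m' n, f (m + m') n = f m n + f m' n,
      forall m n n', f m (n + n') = f m n + f m n'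
    & forall r m n, f (ra r m) n = f m (la r n)].

Definition fsum (G : zmodType) (f : M -> N -> G) (s : seq (M * N)) : G :=
  \sum_(p <- s) f p.1 p.2.

Definition tensor_eq (s t : seq (M * N)) : bool :=
  `[< forall (G : zmodType) (f : M -> N -> G), balanced f -> fsum f s = fsum f t >].

Lemma tensor_eq_refl : reflexive tensor_eq.
Proof. by move=> s; apply/asboolP. Qed.

Lemma tensor_eq_sym : symmetric tensor_eq.
Proof.
by move=> s t; apply/asboolP/asboolP => e G f fb; rewrite e.
Qed.

Lemma tensor_eq_trans : transitive tensor_eq.
Proof.
move=> t s u /asboolP e1 /asboolP e2; apply/asboolP => G f fb.
by rewrite e1 // e2.
Qed.

Canonical tensor_equiv :=
  EquivRel tensor_eq tensor_eq_refl tensor_eq_sym tensor_eq_trans.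

Definition tensor : Type := {eq_quot tensor_equiv}.
HB.instance Definition _ := Choice.on tensor.
HB.instance Definition _ := Quotient.on tensor.

Let tpi (s : seq (M * N)) : tensor := \pi_{eq_quot tensor_equiv} s.

Let tpiP s t : (tpi s = tpi t) <->
  forall (G : zmodType) (f : M -> N -> G), balanced f -> fsum f s = fsum f t.
Proof.
split=> [/eqP|H].
  by rewrite /tpi eqmodE => /asboolP.
by apply/eqP; rewrite /tpi eqmodE; apply/asboolP.
Qed.

Definition pure (m : M) (n : N) : tensor := tpi [:: (m, n)].

(* [tfold f t] applies f to a representative of t; it does not depend on the  *)
(* representative as soon as f is balanced (lemma [tfold_pure]).              *)
Definition tfold (G : zmodType) (f : M -> N -> G) (t : tensor) : G :=
  fsum f (repr (t : {eq_quot tensor_equiv})).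

Let tpi_repr (t : tensor) : tpi (repr (t : {eq_quot tensor_equiv})) = t.
Proof. exact: reprK. Qed.

Let tfold_tpi (G : zmodType) (f : M -> N -> G) s :
  balanced f -> tfold f (tpi s) = fsum f s.
Proof. by move=> fb; have /tpiP := tpi_repr (tpi s); apply. Qed.

Let tadd (s t : tensor) := tpi (repr (s : {eq_quot tensor_equiv}) ++
                                repr (t : {eq_quot tensor_equiv})).
Let topp (s : tensor) :=
  tpi [seq (- p.1, p.2) | p <- repr (s : {eq_quot tensor_equiv})].

Let fsum_cat (G : zmodType) (f : M -> N -> G) s t :
  fsum f (s ++ t) = fsum f s + fsum f t.
Proof. by rewrite /fsum big_cat. Qed.

Let balanced0 (G : zmodType) (f : M -> N -> G) n : balanced f -> f 0 n = 0.
Proof. by case=> fD _ _; apply: (addrI (f 0 n)); rewrite -fD !addr0. Qed.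

Let fsum_opp (G : zmodType) (f : M -> N -> G) s : balanced f ->
  fsum f [seq (- p.1, p.2) | p <- s] = - fsum f s.
Proof.
move=> fb; rewrite /fsum big_map -sumrN; apply: eq_bigr => p _ /=.
case: (fb) => fD _ _; apply: (addrI (f p.1 p.2)).
by rewrite -fD !subrr balanced0.
Qed.

Let tpi_add s t : tadd (tpi s) (tpi t) = tpi (s ++ t).
Proof.
apply/tpiP => G f fb; rewrite !fsum_cat.
by congr (_ + _); exact: tfold_tpi.
Qed.

Let tpi_opp s : topp (tpi s) = tpi [seq (- p.1, p.2) | p <- s].
Proof.
apply/tpiP => G f fb; rewrite !fsum_opp //.
by congr (- _); exact: tfold_tpi.
Qed.

Let taddA : associative tadd.
Proof.
move=> x y z; rewrite -(tpi_repr x) -(tpi_repr y) -(tpi_repr z).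
by rewrite !tpi_add catA.
Qed.

Let taddC : commutative tadd.
Proof.
move=> x y; rewrite -(tpi_repr x) -(tpi_repr y) !tpi_add.
by apply/tpiP => G f fb; rewrite !fsum_cat addrC.
Qed.

Let tadd0 : left_id (tpi [::]) tadd.
Proof. by move=> x; rewrite -(tpi_repr x) tpi_add. Qed.

Let taddN : left_inverse (tpi [::]) topp tadd.
Proof.
move=> x; rewrite -(tpi_repr x) tpi_opp tpi_add; apply/tpiP => G f fb.
by rewrite fsum_cat fsum_opp // addNr /fsum big_nil.
Qed.

HB.instance Definition _ := GRing.isZmodule.Build tensor taddA taddC tadd0 taddN.

Lemma pure_balanced : balanced pure.
Proof.
split=> [m m' n|m n n'|r m n].
- rewrite [RHS]tpi_add; apply/tpiP => G f [fD _ _].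
  by rewrite /fsum !big_cons !big_nil /= !addr0 fD.
- rewrite [RHS]tpi_add; apply/tpiP => G f [_ fD _].
  by rewrite /fsum !big_cons !big_nil /= !addr0 fD.
- by apply/tpiP => G f [_ _ fr]; rewrite /fsum !big_cons !big_nil /= fr.
Qed.

Lemma tfold_pure (G : zmodType) (f : M -> N -> G) m n :
  balanced f -> tfold f (pure m n) = f m n.
Proof. by move=> fb; rewrite tfold_tpi // /fsum big_seq1. Qed.

Lemma tfoldD (G : zmodType) (f : M -> N -> G) s t :
  balanced f -> tfold f (s + t) = tfold f s + tfold f t.
Proof. by move=> fb; rewrite [LHS]tfold_tpi // fsum_cat. Qed.

Lemma tfold0 (G : zmodType) (f : M -> N -> G) : balanced f -> tfold f 0 = 0.
Proof. by move=> fb; rewrite [LHS]tfold_tpi // /fsum big_nil. Qed.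

Lemma tfold_id t : tfold pure t = t.
Proof.
rewrite -[RHS](tpi_repr t) /tfold.
elim: (repr _) => [|[m n] s IHs]; first by rewrite /fsum big_nil.
by rewrite -cat1s -tpi_add -IHs fsum_cat /fsum big_seq1.
Qed.

Lemma tfold_sum (G : zmodType) (f : M -> N -> G) I (r : seq I) (F : I -> tensor) :
  balanced f -> tfold f (\sum_(i <- r) F i) = \sum_(i <- r) tfold f (F i).
Proof.
move=> fb; elim: r => [|i r IHr]; first by rewrite !big_nil tfold0.
by rewrite !big_cons tfoldD // IHr.
Qed.

Lemma eq_tfold (G : zmodType) (f g : M -> N -> G) t :
  (forall m n, f m n = g m n) -> tfold f t = tfold g t.
Proof. by move=> e; apply: eq_bigr. Qed.

Lemma tfold_add (G : zmodType) (f g : M -> N -> G) t :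
  tfold (fun m n => f m n + g m n) t = tfold f t + tfold g t.
Proof. exact: big_split. Qed.

Lemma tensor_ind (P : tensor -> Prop) :
  (forall m n, P (pure m n)) -> (forall s t, P s -> P t -> P (s + t)) ->
  P 0 -> forall t, P t.
Proof.
move=> P1 PD P0 t; rewrite -(tfold_id t) /tfold /fsum.
by apply: big_ind.
Qed.

End Tensor.

Section TensorField.
Variables (k : fieldType) (M N : lmodType k).

Definition ktensor_type : Type :=
  tensor (fun (c : k) (m : M) => c *: m) (fun (c : k) (n : N) => c *: n).

HB.instance Definition _ := GRing.Zmodule.on ktensor_type.

Let tens (m : M) (n : N) : ktensor_type := pure _ _ m n.

Let kscale (c : k) (t : ktensor_type) : ktensor_type :=
  tfold (fun m n => tens (c *: m) n) t.

Let kbal := @pure_balanced k M N (fun c m => c *: m) (fun c n => c *: n).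

Let kscale_balanced c : balanced (fun (c : k) (m : M) => c *: m)
  (fun (c : k) (n : N) => c *: n) (fun m n => tens (c *: m) n).
Proof.
case: kbal => bl br bs; split=> [m m' n|m n n'|r m n].
- by rewrite scalerDr; exact: bl.
- exact: br.
- by rewrite scalerA mulrC -scalerA; exact: bs.
Qed.

Let kscaleE c m n : kscale c (tens m n) = tens (c *: m) n.
Proof. by rewrite /kscale tfold_pure //; exact: kscale_balanced. Qed.

Let kscaleDr c : {morph kscale c : s t / s + t}.
Proof. by move=> s t; rewrite /kscale tfoldD //; exact: kscale_balanced. Qed.

Let kscale0 c : kscale c 0 = 0.
Proof. by rewrite /kscale tfold0 //; exact: kscale_balanced. Qed.

Let kscaleA c d t : kscale c (kscale d t) = kscale (c * d) t.
Proof.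
elim/tensor_ind: t => [m n|s t IHs IHt|]; last by rewrite !kscale0.
  by rewrite !kscaleE scalerA.
by rewrite !kscaleDr IHs IHt.
Qed.

Let kscale1 : left_id 1 kscale.
Proof.
move=> t; elim/tensor_ind: t => [m n|s t IHs IHt|]; last by rewrite kscale0.
  by rewrite kscaleE scale1r.
by rewrite kscaleDr IHs IHt.
Qed.

Let kscaleDl t : {morph kscale^~ t : c d / c + d}.
Proof.
move=> c d; elim/tensor_ind: t => [m n|s t IHs IHt|]; last by rewrite !kscale0 addr0.
  by rewrite !kscaleE scalerDl; case: kbal => bl _ _; exact: bl.
by rewrite !kscaleDr IHs IHt addrACA.
Qed.

HB.instance Definition _ := GRing.Zmodule_isLmodule.Build k ktensor_type
  kscaleA kscale1 kscaleDr kscaleDl.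

Definition ktensor : lmodType k := GRing.Lmodule.clone k ktensor_type _.

Definition ktens (m : M) (n : N) : ktensor := tens m n.
End TensorField.
Notation "M ⊗ N" := (ktensor M N) (at level 40, left associativity) : type_scope.
Notation "m ⊗ n" := (ktens m n) (at level 40, left associativity) : ring_scope.

Definition kfold (k : fieldType) (M N : lmodType k) (G : zmodType)
  (f : M -> N -> G) (t : (M ⊗ N)%type) : G := tfold f t.

(* Sweedler notation: t is written as a finite sum of pure tensors x ⊗ y and the *)
(* values of E at these x, y are added up. In every use below E is bilinear in   *)
(* (x, y), so that the choice of the decomposition is irrelevant (kfold_tens).   *)
Notation "\Sw_ ( x , y <- t ) E" := (kfold (fun x y => E) t)
  (at level 41, E at level 41, x binder, y binder,
   format "'[' \Sw_ ( x ,  y  <-  t ) '/  '  E ']'") : ring_scope.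

Section KTensor.
Variables (k : fieldType) (M N : lmodType k).

Let kbal := @pure_balanced k M N (fun c m => c *: m) (fun c n => c *: n).

Let ktensE c (m : M) (n : N) : c *: (m ⊗ n) = (c *: m) ⊗ n.
Proof.
rewrite [LHS]tfold_pure //; case: kbal => bl br bs; split=> [m1 m' n1|m1 n1 n'|r m1 n1].
- by rewrite scalerDr; exact: bl.
- exact: br.
- by rewrite scalerA mulrC -scalerA; exact: bs.
Qed.

Lemma ktensPl c (m m' : M) (n : N) : (c *: m + m') ⊗ n = c *: (m ⊗ n) + m' ⊗ n.
Proof. by rewrite ktensE; case: kbal => bl _ _; exact: bl. Qed.

Lemma ktensPr c (m : M) (n n' : N) : m ⊗ (c *: n + n') = c *: (m ⊗ n) + m ⊗ n'.
Proof.
by rewrite ktensE; case: kbal => bl br bs; rewrite [(c *: m) ⊗ n]bs; exact: br.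
Qed.

Lemma ktensDl (m m' : M) (n : N) : (m + m') ⊗ n = m ⊗ n + m' ⊗ n.
Proof. by have := ktensPl 1 m m' n; rewrite !scale1r. Qed.

Lemma ktensDr (m : M) (n n' : N) : m ⊗ (n + n') = m ⊗ n + m ⊗ n'.
Proof. by have := ktensPr 1 m n n'; rewrite !scale1r. Qed.

Lemma ktens0l (n : N) : (0 : M) ⊗ n = 0.
Proof. by apply: (addrI ((0 : M) ⊗ n)); rewrite -ktensDl !addr0. Qed.

Lemma ktens0r (m : M) : m ⊗ (0 : N) = 0.
Proof. by apply: (addrI (m ⊗ (0 : N))); rewrite -ktensDr !addr0. Qed.

Lemma ktensZl c (m : M) (n : N) : (c *: m) ⊗ n = c *: (m ⊗ n).
Proof. by rewrite -[c *: m]addr0 ktensPl ktens0l addr0. Qed.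

Lemma ktensZr c (m : M) (n : N) : m ⊗ (c *: n) = c *: (m ⊗ n).
Proof. by rewrite -[c *: n]addr0 ktensPr ktens0r addr0. Qed.

Lemma ktensBl (m m' : M) (n : N) : (m - m') ⊗ n = m ⊗ n - m' ⊗ n.
Proof. by rewrite -scaleN1r addrC ktensPl scaleN1r addrC. Qed.

Lemma ktensor_ind (P : (M ⊗ N)%type -> Prop) :
  (forall m n, P (m ⊗ n)) -> (forall s t, P s -> P t -> P (s + t)) ->
  P 0 -> forall t, P t.
Proof. exact: tensor_ind. Qed.

Lemma kfold_id (t : (M ⊗ N)%type) : \Sw_(m, n <- t) (m ⊗ n) = t.
Proof. exact: tfold_id. Qed.

Lemma eq_kfold (G : zmodType) (f g : M -> N -> G) t :
  (forall m n, f m n = g m n) -> kfold f t = kfold g t.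
Proof. exact: eq_tfold. Qed.

Lemma kfold_raddf (G G' : zmodType) (g : {additive G -> G'}) (f : M -> N -> G) t :
  g (kfold f t) = kfold (fun m n => g (f m n)) t.
Proof. exact: raddf_sum. Qed.

Lemma kfoldD (G : zmodType) (f g : M -> N -> G) t :
  kfold (fun m n => f m n + g m n) t = kfold f t + kfold g t.
Proof. exact: tfold_add. Qed.

Section Target.
Variable P : lmodType k.
Implicit Types f g h : M -> N -> P.

Lemma kfoldZ f c t : kfold (fun m n => c *: f m n) t = c *: kfold f t.
Proof. by rewrite /kfold /tfold /fsum scaler_sumr. Qed.

Lemma kfoldZr (u : M -> N -> k) (p : P) t :
  kfold (fun m n => u m n *: p) t = kfold u t *: p.
Proof. by rewrite /kfold /tfold /fsum scaler_suml. Qed.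

Lemma kfold_lin f g h c t :
  (forall m n, f m n = c *: g m n + h m n) ->
  kfold f t = c *: kfold g t + kfold h t.
Proof. by move=> e; rewrite (eq_kfold _ e) kfoldD kfoldZ. Qed.

Lemma kfold_linear (Q : lmodType k) (g : {linear P -> Q}) f t :
  g (kfold f t) = kfold (fun m n => g (f m n)) t.
Proof. exact: raddf_sum. Qed.

Definition kbilinear f : Prop :=
  (forall c m m' n, f (c *: m + m') n = c *: f m n + f m' n) /\
  (forall c m n n', f m (c *: n + n') = c *: f m n + f m n').

Lemma kbilinear0 f : kbilinear f -> (forall n, f 0 n = 0) /\ (forall m, f m 0 = 0).
Proof.
case=> fl fr; split=> x.
  by have /esym/eqP := fl 1 0 0 x; rewrite !scale1r addr0 -subr_eq0 addrK => /eqP.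
by have /esym/eqP := fr 1 x 0 0; rewrite !scale1r addr0 -subr_eq0 addrK => /eqP.
Qed.

Lemma kbilinear_balanced f : kbilinear f ->
  balanced (fun (c : k) (m : M) => c *: m) (fun (c : k) (n : N) => c *: n) f.
Proof.
move=> fb; have [f0l f0r] := kbilinear0 fb; case: fb => fl fr.
split=> [m m' n|m n n'|c m n].
- by have := fl 1 m m' n; rewrite !scale1r.
- by have := fr 1 m n n'; rewrite !scale1r.
- by rewrite -[c *: m]addr0 fl f0l -[c *: n]addr0 fr f0r.
Qed.

Lemma kfold_tens f m n : kbilinear f -> kfold f (m ⊗ n) = f m n.
Proof. by move/kbilinear_balanced => fb; exact: tfold_pure. Qed.

Lemma kfold0 f : kbilinear f -> kfold f 0 = 0.
Proof. by move/kbilinear_balanced => fb; exact: tfold0. Qed.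

Lemma kfold_addr f s t : kbilinear f -> kfold f (s + t) = kfold f s + kfold f t.
Proof. by move/kbilinear_balanced => fb; exact: tfoldD. Qed.

Lemma kfoldP f c s t :
  kbilinear f -> kfold f (c *: s + t) = c *: kfold f s + kfold f t.
Proof.
move=> fb; rewrite kfold_addr //; congr (_ + _).
elim/ktensor_ind: s => [m n|s u IHs IHu|]; last by rewrite scaler0 kfold0 // scaler0.
  rewrite -ktensZl !kfold_tens //; have [f0 _] := kbilinear0 fb.
  by case: fb => fl _; rewrite -[c *: m]addr0 fl f0 addr0.
by rewrite scalerDr !kfold_addr // IHs IHu scalerDr.
Qed.

End Target.
End KTensor.

Section KTensor2.
Variables (k : fieldType) (M N M' N' : lmodType k).

Lemma kfold_exchange (G : zmodType) (F : M -> N -> M' -> N' -> G) t t' :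
  \Sw_(m, n <- t) \Sw_(m', n' <- t') F m n m' n' =
  \Sw_(m', n' <- t') \Sw_(m, n <- t) F m n m' n'.
Proof. exact: exchange_big. Qed.

Lemma kfold_kfold (P : lmodType k) (f : M -> N -> P)
    (F : M' -> N' -> (M ⊗ N)%type) t : kbilinear f ->
  kfold f (kfold F t) = kfold (fun m' n' => kfold f (F m' n')) t.
Proof. by move/kbilinear_balanced => fb; exact: tfold_sum. Qed.

End KTensor2.

Record coalgebra (k : fieldType) := Coalgebra {
  coalg_sort :> lmodType k;
  comul : {linear coalg_sort -> (coalg_sort ⊗ coalg_sort)%type};
  counit : {scalar coalg_sort};
  comulA : forall h,
    \Sw_(h1, r <- comul h) \Sw_(h2, h3 <- comul r) (h1 ⊗ h2 ⊗ h3) =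
    \Sw_(l, h3 <- comul h) \Sw_(h1, h2 <- comul l) (h1 ⊗ h2 ⊗ h3);
  counit_l : forall h, \Sw_(h1, h2 <- comul h) (counit h1 *: h2) = h;
  counit_r : forall h, \Sw_(h1, h2 <- comul h) (counit h2 *: h1) = h
}.
Arguments comul {k _}.
Arguments counit {k _}.

(* [omegaV] is the convolution inverse of [omega]. *)
Record coquasi_bialgebra (k : fieldType) := CoquasiBialgebra {
  cqb_coalg :> coalgebra k;
  hmul : {linear (cqb_coalg ⊗ cqb_coalg)%type -> cqb_coalg};
  hone : cqb_coalg;
  omega : {scalar (cqb_coalg ⊗ cqb_coalg ⊗ cqb_coalg)%type};
  omegaV : {scalar (cqb_coalg ⊗ cqb_coalg ⊗ cqb_coalg)%type};
  comul_mul : forall h g, comul (hmul (h ⊗ g)) =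
    \Sw_(h1, h2 <- comul h) \Sw_(g1, g2 <- comul g)
      (hmul (h1 ⊗ g1) ⊗ hmul (h2 ⊗ g2));
  counit_mul : forall h g, counit (hmul (h ⊗ g)) = counit h * counit g;
  comul_one : comul hone = hone ⊗ hone;
  counit_one : counit hone = 1;
  omegaK : forall h g x,
    \Sw_(h1, h2 <- comul h) \Sw_(g1, g2 <- comul g) \Sw_(x1, x2 <- comul x)
      (omega (h1 ⊗ g1 ⊗ x1) * omegaV (h2 ⊗ g2 ⊗ x2)) =
    counit h * counit g * counit x;
  omegaVK : forall h g x,
    \Sw_(h1, h2 <- comul h) \Sw_(g1, g2 <- comul g) \Sw_(x1, x2 <- comul x)
      (omegaV (h1 ⊗ g1 ⊗ x1) * omega (h2 ⊗ g2 ⊗ x2)) =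
    counit h * counit g * counit x;
  hmulA : forall h g x,
    \Sw_(h1, h2 <- comul h) \Sw_(g1, g2 <- comul g) \Sw_(x1, x2 <- comul x)
      (omega (h2 ⊗ g2 ⊗ x2) *: hmul (h1 ⊗ hmul (g1 ⊗ x1))) =
    \Sw_(h1, h2 <- comul h) \Sw_(g1, g2 <- comul g) \Sw_(x1, x2 <- comul x)
      (omega (h1 ⊗ g1 ⊗ x1) *: hmul (hmul (h2 ⊗ g2) ⊗ x2));
  hmul1l : forall h, hmul (hone ⊗ h) = h;
  hmul1r : forall h, hmul (h ⊗ hone) = h;
  omega_cocycle : forall h g x y,
    \Sw_(h1, h2 <- comul h) \Sw_(g1, g2 <- comul g)
    \Sw_(x1, x2 <- comul x) \Sw_(y1, y2 <- comul y)
      (omega (h1 ⊗ g1 ⊗ hmul (x1 ⊗ y1)) * omega (hmul (h2 ⊗ g2) ⊗ x2 ⊗ y2)) =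
    \Sw_(h1, h2 <- comul h)
    \Sw_(g1, g' <- comul g) \Sw_(g2, g3 <- comul g')
    \Sw_(x1, x' <- comul x) \Sw_(x2, x3 <- comul x')
    \Sw_(y1, y2 <- comul y)
      (omega (g1 ⊗ x1 ⊗ y1) * omega (h1 ⊗ hmul (g2 ⊗ x2) ⊗ y2) *
       omega (h2 ⊗ g3 ⊗ x3));
  omega_normal : forall h g, omega (h ⊗ hone ⊗ g) = counit h * counit g
}.
Arguments hmul {k _}.
Arguments hone {k _}.
Arguments omega {k _}.
Arguments omegaV {k _}.

Record coquasi_hopf (k : fieldType) := CoquasiHopf {
  cqh_bialg :> coquasi_bialgebra k;
  antipode : {linear cqh_bialg -> cqh_bialg};
  halpha : {scalar cqh_bialg};
  hbeta : {scalar cqh_bialg};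
  comul_antipode : forall h, comul (antipode h) =
    \Sw_(h1, h2 <- comul h) (antipode h2 ⊗ antipode h1);
  counit_antipode : forall h, counit (antipode h) = counit h;
  antipode_alpha : forall h,
    \Sw_(h1, r <- comul h) \Sw_(h2, h3 <- comul r)
      hmul ((halpha h2 *: antipode h1) ⊗ h3) = halpha h *: hone;
  antipode_beta : forall h,
    \Sw_(h1, r <- comul h) \Sw_(h2, h3 <- comul r)
      hmul ((hbeta h2 *: h1) ⊗ antipode h3) = hbeta h *: hone;
  omega_antipode : forall h,
    \Sw_(h1, r1 <- comul h) \Sw_(h2, r2 <- comul r1)
    \Sw_(h3, r3 <- comul r2) \Sw_(h4, h5 <- comul r3)
      omega ((hbeta h2 *: h1) ⊗ antipode h3 ⊗ (halpha h4 *: h5)) = counit h;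
  omegaV_antipode : forall h,
    \Sw_(h1, r1 <- comul h) \Sw_(h2, r2 <- comul r1)
    \Sw_(h3, r3 <- comul r2) \Sw_(h4, h5 <- comul r3)
      omegaV (antipode h1 ⊗ (halpha h2 *: (hbeta h4 *: h3)) ⊗ antipode h5) =
    counit h;
  halpha_one : halpha hone = 1;
  hbeta_one : hbeta hone = 1
}.
Arguments antipode {k _}.
Arguments halpha {k _}.
Arguments hbeta {k _}.

Record comodule (k : fieldType) (C : coalgebra k) := Comodule {
  comod_sort :> lmodType k;
  rho : {linear comod_sort -> (comod_sort ⊗ C)%type};
  rhoA : forall m,
    \Sw_(m0, m' <- rho m) \Sw_(m1, m2 <- comul m') (m0 ⊗ m1 ⊗ m2) =
    \Sw_(m', m2 <- rho m) \Sw_(m0, m1 <- rho m') (m0 ⊗ m1 ⊗ m2);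
  rho_counit : forall m, \Sw_(m0, m1 <- rho m) (counit m1 *: m0) = m
}.
Arguments rho {k C _}.

Definition colinear (k : fieldType) (C : coalgebra k) (M N : comodule C) (f : M -> N) : Prop :=
  forall m, rho (f m) = \Sw_(m0, m1 <- rho m) (f m0 ⊗ m1).

Definition regular_comodule (k : fieldType) (C : coalgebra k) : comodule C :=
  @Comodule k C C comul (@comulA k C) (@counit_r k C).

Record comodule_algebra (k : fieldType) (H : coquasi_bialgebra k) := ComoduleAlgebra {
  ca_comod :> comodule H;
  amul : {linear (ca_comod ⊗ ca_comod)%type -> ca_comod};
  aone : ca_comod;
  rho_amul : forall a b, rho (amul (a ⊗ b)) =
    \Sw_(a0, a1 <- rho a) \Sw_(b0, b1 <- rho b)
      (amul (a0 ⊗ b0) ⊗ hmul (a1 ⊗ b1));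
  rho_aone : rho aone = aone ⊗ hone;
  amul1l : forall a, amul (aone ⊗ a) = a;
  amul1r : forall a, amul (a ⊗ aone) = a;
  amulA : forall a b c, amul (amul (a ⊗ b) ⊗ c) =
    \Sw_(a0, a1 <- rho a) \Sw_(b0, b1 <- rho b) \Sw_(c0, c1 <- rho c)
      (omega (a1 ⊗ b1 ⊗ c1) *: amul (a0 ⊗ amul (b0 ⊗ c0)))
}.
Arguments amul {k H _}.
Arguments aone {k H _}.

Record right_hopf_module (k : fieldType) (H : coquasi_bialgebra k)
    (A : comodule_algebra H) := RightHopfModule {
  rhm_comod :> comodule H;
  ract : {linear (rhm_comod ⊗ A)%type -> rhm_comod};
  rho_ract : forall m a, rho (ract (m ⊗ a)) =
    \Sw_(m0, m1 <- rho m) \Sw_(a0, a1 <- rho a)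
      (ract (m0 ⊗ a0) ⊗ hmul (m1 ⊗ a1));
  ract1 : forall m, ract (m ⊗ aone) = m;
  ractA : forall m a b, ract (ract (m ⊗ a) ⊗ b) =
    \Sw_(m0, m1 <- rho m) \Sw_(a0, a1 <- rho a) \Sw_(b0, b1 <- rho b)
      (omega (m1 ⊗ a1 ⊗ b1) *: ract (m0 ⊗ amul (a0 ⊗ b0)))
}.
Arguments ract {k H A _}.

Record left_hopf_module (k : fieldType) (H : coquasi_bialgebra k)
    (A : comodule_algebra H) := LeftHopfModule {
  lhm_comod :> comodule H;
  lact : {linear (A ⊗ lhm_comod)%type -> lhm_comod};
  rho_lact : forall a m, rho (lact (a ⊗ m)) =
    \Sw_(a0, a1 <- rho a) \Sw_(m0, m1 <- rho m)
      (lact (a0 ⊗ m0) ⊗ hmul (a1 ⊗ m1));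
  lact1 : forall m, lact (aone ⊗ m) = m;
  lactA : forall a b m, lact (amul (a ⊗ b) ⊗ m) =
    \Sw_(a0, a1 <- rho a) \Sw_(b0, b1 <- rho b) \Sw_(m0, m1 <- rho m)
      (omega (a1 ⊗ b1 ⊗ m1) *: lact (a0 ⊗ lact (b0 ⊗ m0)))
}.
Arguments lact {k H A _}.

Record right_hopf_hom (k : fieldType) (H : coquasi_bialgebra k)
    (A : comodule_algebra H)
    (M N : right_hopf_module A) := RightHopfHom {
  rhh_fun :> {linear M -> N};
  rhh_colinear : colinear rhh_fun;
  rhh_act : forall m a, rhh_fun (ract (m ⊗ a)) = ract (rhh_fun m ⊗ a)
}.

Record left_hopf_hom (k : fieldType) (H : coquasi_bialgebra k)
    (A : comodule_algebra H)
    (M N : left_hopf_module A) := LeftHopfHom {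
  lhh_fun :> {linear M -> N};
  lhh_colinear : colinear lhh_fun;
  lhh_act : forall a m, lhh_fun (lact (a ⊗ m)) = lact (a ⊗ lhh_fun m)
}.
Section LinearSteps.
Variables (k : fieldType) (M N : lmodType k) (c : k).

Lemma lin_tensl (m m1 m2 : M) (n : N) :
  m = c *: m1 + m2 -> m ⊗ n = c *: (m1 ⊗ n) + m2 ⊗ n.
Proof. by move=> ->; rewrite ktensPl. Qed.

Lemma lin_tensr (m : M) (n n1 n2 : N) :
  n = c *: n1 + n2 -> m ⊗ n = c *: (m ⊗ n1) + m ⊗ n2.
Proof. by move=> ->; rewrite ktensPr. Qed.

Lemma lin_app (f : {linear M -> N}) (m m1 m2 : M) :
  m = c *: m1 + m2 -> f m = c *: f m1 + f m2.
Proof. by move=> ->; rewrite linearP. Qed.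

Lemma lin_scalar (f : {scalar M}) (m m1 m2 : M) :
  m = c *: m1 + m2 -> f m = c * f m1 + f m2.
Proof. by move=> ->; rewrite linearP. Qed.

Lemma lin_scalel (a a1 a2 : k) (m : M) :
  a = c * a1 + a2 -> a *: m = c *: (a1 *: m) + a2 *: m.
Proof. by move=> ->; rewrite scalerDl scalerA. Qed.

Lemma lin_scaler (a : k) (m m1 m2 : M) :
  m = c *: m1 + m2 -> a *: m = c *: (a *: m1) + a *: m2.
Proof. by move=> ->; rewrite scalerDr !scalerA mulrC. Qed.

Lemma lin_mull (a a1 a2 b : k) :
  a = c * a1 + a2 -> a * b = c * (a1 * b) + a2 * b.
Proof. by move=> ->; ring. Qed.

Lemma lin_mulr (a b b1 b2 : k) :
  b = c * b1 + b2 -> a * b = c * (a * b1) + a * b2.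
Proof. by move=> ->; ring. Qed.

Lemma lin_regular (a a1 a2 : k) :
  a = c * a1 + a2 -> (a : k^o) = c *: (a1 : k^o) + (a2 : k^o).
Proof. by []. Qed.
End LinearSteps.

Lemma regular_scaleE (k : fieldType) (a b : k) : a *: (b : k^o) = a * b.
Proof. by []. Qed.

(* [klin] solves goals E(c *: x + y) = c *: E(x) + E(y), where E is built from  *)
(* iterated Sweedler sums, pure tensors, linear maps and products of scalars;    *)
(* [kbil] and [ktril] prove bilinearity and trilinearity of such expressions.    *)
Ltac klin :=
  lazymatch goal with
  | |- kfold _ ?t = _ *: kfold _ ?t + _ => apply: kfold_lin => ? ?; klin
  | |- kfold _ _ = _ *: kfold _ _ + _ =>
      rewrite linearP; apply: kfoldP; split=> ? ? ? ?; klin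
  | |- ?x = _ => klin_term
  end
with klin_term :=
  lazymatch goal with
  | |- _ *: _ + _ = _ *: _ + _ => reflexivity
  | |- ktens _ ?n = _ *: ktens _ ?n + _ => refine (lin_tensl _ _); klin_term
  | |- ktens ?m _ = _ *: ktens ?m _ + _ => refine (lin_tensr _ _); klin_term
  | |- _ *: ?m = _ *: (_ *: ?m) + _ => refine (lin_scalel _ _); klin_term
  | |- ?a *: _ = _ *: (?a *: _) + _ => refine (lin_scaler _ _); klin_term
  | |- _ * ?b = _ * (_ * ?b) + _ => refine (lin_mull _ _); klin_term
  | |- ?a * _ = _ * (?a * _) + _ => refine (lin_mulr _ _); klin_term
  | |- _ * ?b = _ *: (_ * ?b) + _ => refine (lin_mull _ _); klin_term
  | |- ?a * _ = _ *: (?a * _) + _ => refine (lin_mulr _ _); klin_term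
  | |- _ = _ *: _ + _ =>
      first [refine (lin_app _ _); klin_term | refine (lin_scalar _ _); klin_term]
  | |- _ = _ * _ + _ => refine (lin_scalar _ _); klin_term
  end.
Ltac kbil := split=> ? ? ? ?; klin.

Definition ktrilinear (k : fieldType) (M N P Q : lmodType k)
    (F : M -> N -> P -> Q) : Prop :=
  [/\ forall c m m' n p, F (c *: m + m') n p = c *: F m n p + F m' n p,
      forall c m n n' p, F m (c *: n + n') p = c *: F m n p + F m n' p
    & forall c m n p p', F m n (c *: p + p') = c *: F m n p + F m n p'].
Ltac ktril := split=> ? ? ? ? ?; klin.

Lemma kfold3 (k : fieldType) (M N P Q M' N' : lmodType k) (F : M -> N -> P -> Q)
  t (G : M' -> N' -> (M ⊗ N ⊗ P)%type) : ktrilinear F ->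
  \Sw_(l, p <- kfold G t) \Sw_(m, n <- l) F m n p =
  \Sw_(x, y <- t) \Sw_(l, p <- G x y) \Sw_(m, n <- l) F m n p.
Proof.
case=> F1 F2 F3; apply: kfold_kfold; split=> [c l l' p|c l p p'].
  by apply: kfoldP; split=> *.
by apply: kfold_lin.
Qed.

Lemma kfold3_tens (k : fieldType) (M N P Q : lmodType k) (F : M -> N -> P -> Q)
  m n p : ktrilinear F ->
  \Sw_(l, p <- m ⊗ n ⊗ p) \Sw_(m, n <- l) F m n p = F m n p.
Proof.
case=> F1 F2 F3; rewrite kfold_tens; last first.
  split=> [c l l' q|c l q q']; first by apply: kfoldP; split=> *.
  by apply: kfold_lin.
by rewrite kfold_tens //; split=> *.
Qed.

Lemma comulA_sw (k : fieldType) (C : coalgebra k) (Q : lmodType k)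
    (F : C -> C -> C -> Q) h : ktrilinear F ->
  \Sw_(h1, r <- comul h) \Sw_(h2, h3 <- comul r) F h1 h2 h3 =
  \Sw_(l, h3 <- comul h) \Sw_(h1, h2 <- comul l) F h1 h2 h3.
Proof.
move=> Ft; have := congr1 (fun t => \Sw_(l, c <- t) \Sw_(a, b <- l) F a b c)
  (comulA h).
rewrite !kfold3 // => e; etransitivity; [|etransitivity; [exact: e|]];
  apply: eq_kfold => a b; rewrite kfold3 //; apply: eq_kfold => x y;
  by rewrite kfold3_tens.
Qed.

Lemma rhoA_sw (k : fieldType) (C : coalgebra k) (M : comodule C) (Q : lmodType k)
    (F : M -> C -> C -> Q) m : ktrilinear F ->
  \Sw_(m0, m' <- rho m) \Sw_(m1, m2 <- comul m') F m0 m1 m2 =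
  \Sw_(m', m2 <- rho m) \Sw_(m0, m1 <- rho m') F m0 m1 m2.
Proof.
move=> Ft; have := congr1 (fun t => \Sw_(l, c <- t) \Sw_(a, b <- l) F a b c)
  (rhoA m).
rewrite !kfold3 // => e; etransitivity; [|etransitivity; [exact: e|]];
  apply: eq_kfold => a b; rewrite kfold3 //; apply: eq_kfold => x y;
  by rewrite kfold3_tens.
Qed.

Section OmegaUnits.
Variables (k : fieldType) (H : coquasi_bialgebra k).
Implicit Types h g x y : H.

Lemma comul_one_sw (Q : lmodType k) (F : H -> H -> Q) : kbilinear F ->
  kfold F (comul hone) = F hone hone.
Proof. by move=> Fb; rewrite comul_one kfold_tens. Qed.

Lemma counit_l_sw (Q : lmodType k) (f : H -> Q) h : linear f ->
  \Sw_(h1, h2 <- comul h) (counit h1 *: f h2) = f h.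
Proof.
move=> fl; pose f' := GRing.isLinear.Build k H Q _ f fl.
pose g : {linear H -> Q} := HB.pack f f'.
rewrite -[in RHS](counit_l h) -[f _]/(g _) kfold_linear; apply: eq_kfold => a b.
by rewrite linearZ.
Qed.

Lemma counit_r_sw (Q : lmodType k) (f : H -> Q) h : linear f ->
  \Sw_(h1, h2 <- comul h) (counit h2 *: f h1) = f h.
Proof.
move=> fl; pose f' := GRing.isLinear.Build k H Q _ f fl.
pose g : {linear H -> Q} := HB.pack f f'.
rewrite -[in RHS](counit_r h) -[f _]/(g _) kfold_linear; apply: eq_kfold => a b.
by rewrite linearZ.
Qed.

Let conv_ok (u : H -> H -> k) := kbilinear (P := k^o) u.
Let conv (u v : H -> H -> k) g x :=
  \Sw_(g1, g2 <- comul g) \Sw_(x1, x2 <- comul x) (u g1 x1 * v g2 x2).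
Let e g x := counit g * counit x.

Let convA u v w g x : conv_ok u -> conv_ok v -> conv_ok w ->
  conv u (conv v w) g x = conv (conv u v) w g x.
Proof.
move=> [ul ur] [vl vr] [wl wr]; rewrite /conv.
transitivity (\Sw_(g1, g' <- comul g) \Sw_(g2, g3 <- comul g')
   \Sw_(x1, x' <- comul x) \Sw_(x2, x3 <- comul x') (u g1 x1 * v g2 x2 * w g3 x3)).
  apply: eq_kfold => g1 g'.
  under eq_kfold => x1 x'.
    rewrite -[u g1 x1 * _]/(u g1 x1 *: (_ : k^o)) -kfoldZ.
    under eq_kfold => a b do rewrite -kfoldZ; over.
  rewrite kfold_exchange; apply: eq_kfold => a b; apply: eq_kfold => c d.
  by apply: eq_kfold => i j; rewrite -mulrA.
rewrite (comulA_sw (Q := k^o)); last first.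
  split=> c *; apply: kfold_lin => ? ?; apply: kfold_lin => ? ?;
   by rewrite ?(ul, vl, wl) !regular_scaleE; ring.
apply: eq_kfold => g' g3; rewrite kfold_exchange.
under eq_kfold => a b do rewrite kfold_exchange.
transitivity (\Sw_(x1, x' <- comul x) \Sw_(x2, x3 <- comul x')
   \Sw_(g1, g2 <- comul g') (u g1 x1 * v g2 x2 * w g3 x3)); first by [].
rewrite (comulA_sw (Q := k^o)); last first.
  split=> c *; apply: kfold_lin => ? ?;
   by rewrite ?(ur, vr, wr) !regular_scaleE; ring.
apply: eq_kfold => x' x3; rewrite kfold_exchange.
rewrite mulrC -[_ * _]/(w g3 x3 *: (_ : k^o)) -kfoldZ; apply: eq_kfold => a b.
by rewrite -kfoldZ; apply: eq_kfold => c d; rewrite regular_scaleE mulrC.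
Qed.

Let conv1 u g x : conv_ok u -> conv u e g x = u g x.
Proof.
move=> [ul ur]; rewrite /conv /e.
transitivity (\Sw_(g1, g2 <- comul g) (counit g2 *: (u g1 x : k^o))).
  apply: eq_kfold => g1 g2.
  rewrite -[in RHS](counit_r_sw (f := u g1 : H -> k^o)) -?kfoldZ.
    by apply: eq_kfold => a b; rewrite !regular_scaleE; ring.
  by move=> c a b; rewrite ur.
by apply: (counit_r_sw (f := (u^~ x) : H -> k^o)) => c a b; rewrite ul.
Qed.

Let conv1l u g x : conv_ok u -> conv e u g x = u g x.
Proof.
move=> [ul ur]; rewrite /conv /e.
transitivity (\Sw_(g1, g2 <- comul g) (counit g1 *: (u g2 x : k^o))).
  apply: eq_kfold => g1 g2.
  rewrite -[in RHS](counit_l_sw (f := u g2 : H -> k^o)) -?kfoldZ.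
    by apply: eq_kfold => a b; rewrite !regular_scaleE; ring.
  by move=> c a b; rewrite ur.
by apply: (counit_l_sw (f := (u^~ x) : H -> k^o)) => c a b; rewrite ul.
Qed.

Let omega_11 x : omega (hone ⊗ hone ⊗ x) = counit x.
Proof. by rewrite omega_normal counit_one mul1r. Qed.

(* A convolution idempotent with a right convolution inverse is trivial. *)
Let conv_idem u v g x : conv_ok u -> conv_ok v ->
  (forall g x, conv u u g x = u g x) -> (forall g x, conv u v g x = e g x) ->
  u g x = e g x.
Proof.
move=> uok vok uu uv; rewrite -uv -[LHS]conv1 //.
transitivity (conv u (conv u v) g x).
  by apply: eq_kfold => a b; apply: eq_kfold => c d; rewrite uv.
by rewrite convA //; apply: eq_kfold => a b; apply: eq_kfold => c d; rewrite uu.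
Qed.

Lemma omega_1l g x : omega (hone ⊗ g ⊗ x) = counit g * counit x.
Proof.
pose u (g x : H) : k := omega (hone ⊗ g ⊗ x).
pose v (g x : H) : k := omegaV (hone ⊗ g ⊗ x).
have uok : conv_ok u by rewrite /u; kbil.
apply: (@conv_idem u v) => // [|{}g {}x|{}g {}x]; first by rewrite /v; kbil.
  have := omega_cocycle hone hone g x.
  rewrite !(comul_one_sw (Q := k^o)); try by kbil.
  rewrite hmul1l => e1; transitivity (conv e u g x); last exact: conv1l.
  transitivity (\Sw_(x1, x2 <- comul g) \Sw_(y1, y2 <- comul x)
    (omega (hone ⊗ hone ⊗ hmul (x1 ⊗ y1)) * omega (hone ⊗ x2 ⊗ y2))).
    rewrite e1; apply: eq_kfold => x1 x'.
    rewrite kfold_exchange; apply: eq_kfold => y1 y2.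
    rewrite -(counit_r_sw (f := (fun x' => u x1 y1 * u x' y2) : H -> k^o)).
      apply: eq_kfold => x2 x3.
      by rewrite hmul1l omega_11 regular_scaleE mulrC.
    by move=> c a b; rewrite /u; klin.
  apply: eq_kfold => x1 x2; apply: eq_kfold => y1 y2.
  by rewrite omega_11 counit_mul.
have := omegaK hone g x; rewrite (comul_one_sw (Q := k^o)); last by kbil.
by rewrite counit_one mul1r.
Qed.

Lemma omega_1r h g : omega (h ⊗ g ⊗ hone) = counit h * counit g.
Proof.
pose u (h g : H) : k := omega (h ⊗ g ⊗ hone).
pose v (h g : H) : k := omegaV (h ⊗ g ⊗ hone).
have uok : conv_ok u by rewrite /u; kbil.
apply: (@conv_idem u v) => // [|{}h {}g|{}h {}g]; first by rewrite /v; kbil.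
  transitivity (\Sw_(h1, h2 <- comul h) \Sw_(g1, g2 <- comul g)
    (omega (h1 ⊗ g1 ⊗ hone) * omega (hmul (h2 ⊗ g2) ⊗ hone ⊗ hone))).
    transitivity (\Sw_(h1, h2 <- comul h)
      \Sw_(g1, g' <- comul g) \Sw_(g2, g3 <- comul g')
      (omega (g1 ⊗ hone ⊗ hone) * omega (h1 ⊗ g2 ⊗ hone) *
       omega (h2 ⊗ g3 ⊗ hone))).
      apply: eq_kfold => h1 h2.
      rewrite -(counit_l_sw (f := (fun g => \Sw_(g1, g2 <- comul g) (u h1 g1 * u h2 g2)) : H -> k^o)).
        apply: eq_kfold => g1 g'; rewrite -kfoldZ; apply: eq_kfold => g2 g3.
        by rewrite omega_normal counit_one mulr1 regular_scaleE mulrA.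
      by move=> c a b; rewrite /u; klin.
    have := omega_cocycle h g hone hone.
    under eq_kfold => h1 h2.
      under eq_kfold => g1 g2.
        rewrite !(comul_one_sw (Q := k^o)); [|by kbil|by kbil].
        rewrite hmul1l; over.
      over.
    move=> ->.
    apply: eq_kfold => h1 h2; apply: eq_kfold => g1 g'; apply: eq_kfold => g2 g3.
    rewrite !(comul_one_sw (Q := k^o)); try by kbil.
    by rewrite hmul1r.
  transitivity (conv u e h g); last exact: conv1.
  apply: eq_kfold => h1 h2; apply: eq_kfold => g1 g2.
  by rewrite omega_normal counit_one mulr1 counit_mul.
have := omegaK h g hone.
rewrite counit_one mulr1 /e => <-.
apply: eq_kfold => h1 h2; apply: eq_kfold => g1 g2.
by rewrite (comul_one_sw (Q := k^o)) //; kbil.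
Qed.

End OmegaUnits.

Section Coinvariants.
Variables (k : fieldType) (H : coquasi_bialgebra k) (M : comodule H).

Definition coinvariants : {pred M} := fun m => rho m == m ⊗ hone.

Lemma coinvariantP m : reflect (rho m = m ⊗ hone) (m \in coinvariants).
Proof. exact: eqP. Qed.

Lemma coinvariants_zmod : zmod_closed coinvariants.
Proof.
split=> [|x y /coinvariantP rx /coinvariantP ry]; apply/coinvariantP.
  by rewrite linear0 ktens0l.
by rewrite linearB /= rx ry ktensBl.
Qed.
HB.instance Definition _ := GRing.isZmodClosed.Build M coinvariants coinvariants_zmod.

Definition coinv_sub := {m : M | m \in coinvariants}.
HB.instance Definition _ := SubChoice.on coinv_sub.
HB.instance Definition _ := [SubChoice_isSubZmodule of coinv_sub by <:].

Lemma rho_coinv_sw (Q : lmodType k) (F : M -> H -> Q) m :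
  kbilinear F -> m \in coinvariants -> kfold F (rho m) = F m hone.
Proof. by move=> Fb /coinvariantP ->; rewrite kfold_tens. Qed.

Lemma rho_counit_sw (Q : lmodType k) (f : M -> Q) m : linear f ->
  \Sw_(m0, m1 <- rho m) (counit m1 *: f m0) = f m.
Proof.
move=> fl; pose f' := GRing.isLinear.Build k M Q _ f fl.
pose g : {linear M -> Q} := HB.pack f f'.
rewrite -[in RHS](rho_counit m) -[f _]/(g _) kfold_linear; apply: eq_kfold => a b.
by rewrite linearZ.
Qed.

End Coinvariants.
Arguments coinvariants {k H} M.

Section CoinvariantAlgebra.
Variables (k : fieldType) (H : coquasi_bialgebra k) (A : comodule_algebra H).
Implicit Types a b c : A.

Lemma amulA_l b a c : b \in coinvariants A ->
  amul (amul (b ⊗ a) ⊗ c) = amul (b ⊗ amul (a ⊗ c)).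
Proof.
move=> bB; rewrite amulA rho_coinv_sw //; last by kbil.
rewrite -(rho_counit_sw (f := fun a => amul (b ⊗ amul (a ⊗ c)))); last first.
  by move=> ? ? ?; klin.
apply: eq_kfold => a0 a1.
rewrite -(rho_counit_sw (f := fun c => amul (b ⊗ amul (a0 ⊗ c)))); last first.
  by move=> ? ? ?; klin.
by rewrite -kfoldZ; apply: eq_kfold => c0 c1; rewrite omega_1l scalerA.
Qed.

Lemma amulA_m b a c : b \in coinvariants A ->
  amul (amul (a ⊗ b) ⊗ c) = amul (a ⊗ amul (b ⊗ c)).
Proof.
move=> bB; rewrite amulA.
rewrite -(rho_counit_sw (f := fun a => amul (a ⊗ amul (b ⊗ c)))); last first.
  by move=> ? ? ?; klin.
apply: eq_kfold => a0 a1; rewrite rho_coinv_sw //; last by kbil.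
rewrite -(rho_counit_sw (f := fun c => amul (a0 ⊗ amul (b ⊗ c)))); last first.
  by move=> ? ? ?; klin.
by rewrite -kfoldZ; apply: eq_kfold => c0 c1; rewrite omega_normal scalerA.
Qed.

Lemma amulA_r b a c : b \in coinvariants A ->
  amul (amul (a ⊗ c) ⊗ b) = amul (a ⊗ amul (c ⊗ b)).
Proof.
move=> bB; rewrite amulA.
rewrite -(rho_counit_sw (f := fun a => amul (a ⊗ amul (c ⊗ b)))); last first.
  by move=> ? ? ?; klin.
apply: eq_kfold => a0 a1.
rewrite -(rho_counit_sw (f := fun c => amul (a0 ⊗ amul (c ⊗ b)))); last first.
  by move=> ? ? ?; klin.
rewrite -kfoldZ; apply: eq_kfold => c0 c1.
by rewrite rho_coinv_sw ?omega_1r ?scalerA //; kbil.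
Qed.

Lemma coinvariants_aone : aone \in coinvariants A.
Proof. by apply/coinvariantP; rewrite rho_aone. Qed.

Lemma coinvariants_amul b b' : b \in coinvariants A -> b' \in coinvariants A ->
  amul (b ⊗ b') \in coinvariants A.
Proof.
move=> bB b'B; apply/coinvariantP; rewrite rho_amul.
rewrite rho_coinv_sw //; last by kbil.
by rewrite rho_coinv_sw ?hmul1l //; kbil.
Qed.

Definition coinv_type : Type := coinv_sub A.
HB.instance Definition _ := GRing.Zmodule.on coinv_type.

Let one : coinv_type := exist _ aone coinvariants_aone.
Let mul (b b' : coinv_type) : coinv_type :=
  exist _ (amul (val b ⊗ val b')) (coinvariants_amul (valP b) (valP b')).

Let mulA : associative mul.
Proof. by move=> x y z; apply/val_inj; rewrite /= amulA_l //; exact: valP. Qed.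
Let mul1 : left_id one mul.
Proof. by move=> x; apply/val_inj; rewrite /= amul1l. Qed.
Let mulr1 : right_id one mul.
Proof. by move=> x; apply/val_inj; rewrite /= amul1r. Qed.
Let mulDl : left_distributive mul +%R.
Proof. by move=> x y z; apply/val_inj; rewrite /= ktensDl linearD. Qed.
Let mulDr : right_distributive mul +%R.
Proof. by move=> x y z; apply/val_inj; rewrite /= ktensDr linearD. Qed.
HB.instance Definition _ := GRing.Zmodule_isPzRing.Build coinv_type
  mulA mul1 mulr1 mulDl mulDr.

Definition coinv_algebra : pzRingType := GRing.PzRing.clone coinv_type _.

Definition coinv_val (b : coinv_algebra) : A := val (b : coinv_sub A).

Lemma coinv_valP x : coinv_val x \in coinvariants A.
Proof. exact: valP. Qed.
Lemma coinv_val1 : coinv_val 1 = aone. Proof. by []. Qed.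
Lemma coinv_valM x y : coinv_val (x * y) = amul (coinv_val x ⊗ coinv_val y).
Proof. by []. Qed.
Lemma coinv_valD x y : coinv_val (x + y) = coinv_val x + coinv_val y.
Proof. by []. Qed.

End CoinvariantAlgebra.

(* Right modules over a ring R are left modules over the converse ring R^c: the  *)
(* product of n by r on the right is (r : R^c) *: n. Modules over the k-algebra  *)
(* of coinvariants are modules over the underlying ring; they are k-linear       *)
(* through the unit k -> A^{coH}, and so are the maps between them.              *)

Section CoinvariantModules.
Variables (k : fieldType) (H : coquasi_bialgebra k) (A : comodule_algebra H).
Local Notation B := (coinv_algebra A).

Section Right.
Variable M : right_hopf_module A.

Lemma ractA_l m a c : m \in coinvariants M ->
  ract (ract (m ⊗ a) ⊗ c) = ract (m ⊗ amul (a ⊗ c)).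
Proof.
move=> mM; rewrite ractA rho_coinv_sw //; last by kbil.
rewrite -(rho_counit_sw (f := fun a => ract (m ⊗ amul (a ⊗ c)))); last first.
  by move=> ? ? ?; klin.
apply: eq_kfold => a0 a1.
rewrite -(rho_counit_sw (f := fun c => ract (m ⊗ amul (a0 ⊗ c)))); last first.
  by move=> ? ? ?; klin.
by rewrite -kfoldZ; apply: eq_kfold => c0 c1; rewrite omega_1l scalerA.
Qed.

Lemma coinvariants_ract m (b : B) : m \in coinvariants M ->
  ract (m ⊗ coinv_val b) \in coinvariants M.
Proof.
move=> mM; apply/coinvariantP; rewrite rho_ract.
rewrite rho_coinv_sw //; last by kbil.
by rewrite rho_coinv_sw ?hmul1l ?coinv_valP //; kbil.
Qed.

Definition coinv_right_type : Type := coinv_sub M.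
HB.instance Definition _ := GRing.Zmodule.on coinv_right_type.

Let scale (b : B^c) (m : coinv_right_type) : coinv_right_type :=
  exist _ (ract (val m ⊗ coinv_val b)) (coinvariants_ract b (valP m)).

Let scaleA b c m : scale b (scale c m) = scale (b * c) m.
Proof. by apply/val_inj; rewrite /= ractA_l //; exact: valP. Qed.
Let scale1 : left_id 1 scale.
Proof. by move=> m; apply/val_inj; rewrite /= ract1. Qed.
Let scaleDr : right_distributive scale +%R.
Proof. by move=> b m n; apply/val_inj; rewrite /= ktensDl linearD. Qed.
Let scaleDl m : {morph scale^~ m : b c / b + c}.
Proof. by move=> b c; apply/val_inj; rewrite /= coinv_valD ktensDr linearD. Qed.
HB.instance Definition _ := GRing.Zmodule_isLmodule.Build B^c coinv_right_type
  scaleA scale1 scaleDr scaleDl.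

Definition coinv_right : lmodType B^c := GRing.Lmodule.clone B^c coinv_right_type _.

End Right.

Section Left.
Variable M : left_hopf_module A.

Lemma lactA_r a c m : m \in coinvariants M ->
  lact (amul (a ⊗ c) ⊗ m) = lact (a ⊗ lact (c ⊗ m)).
Proof.
move=> mM; rewrite lactA.
rewrite -(rho_counit_sw (f := fun a => lact (a ⊗ lact (c ⊗ m)))); last first.
  by move=> ? ? ?; klin.
apply: eq_kfold => a0 a1.
rewrite -(rho_counit_sw (f := fun c => lact (a0 ⊗ lact (c ⊗ m)))); last first.
  by move=> ? ? ?; klin.
rewrite -kfoldZ; apply: eq_kfold => c0 c1.
by rewrite rho_coinv_sw ?omega_1r ?scalerA //; kbil.
Qed.

Lemma coinvariants_lact m (b : B) : m \in coinvariants M ->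
  lact (coinv_val b ⊗ m) \in coinvariants M.
Proof.
move=> mM; apply/coinvariantP; rewrite rho_lact.
rewrite rho_coinv_sw ?coinv_valP //; last by kbil.
by rewrite rho_coinv_sw ?hmul1l //; kbil.
Qed.

Definition coinv_left_type : Type := coinv_sub M.
HB.instance Definition _ := GRing.Zmodule.on coinv_left_type.

Let scale (b : B) (m : coinv_left_type) : coinv_left_type :=
  exist _ (lact (coinv_val b ⊗ val m)) (coinvariants_lact b (valP m)).

Let scaleA b c m : scale b (scale c m) = scale (b * c) m.
Proof. by apply/val_inj; rewrite /= coinv_valM lactA_r //; exact: valP. Qed.
Let scale1 : left_id 1 scale.
Proof. by move=> m; apply/val_inj; rewrite /= lact1. Qed.
Let scaleDr : right_distributive scale +%R.
Proof. by move=> b m n; apply/val_inj; rewrite /= ktensDr linearD. Qed.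
Let scaleDl m : {morph scale^~ m : b c / b + c}.
Proof. by move=> b c; apply/val_inj; rewrite /= coinv_valD ktensDl linearD. Qed.
HB.instance Definition _ := GRing.Zmodule_isLmodule.Build B coinv_left_type
  scaleA scale1 scaleDr scaleDl.

Definition coinv_left : lmodType B := GRing.Lmodule.clone B coinv_left_type _.

End Left.

(* A as a left and as a right B-module, by multiplication. *)
Definition left_regular_type : Type := A.
HB.instance Definition _ := GRing.Zmodule.on left_regular_type.

Let lscale (b : B) (a : left_regular_type) : left_regular_type :=
  amul (coinv_val b ⊗ (a : A)).
Let lscaleA b c a : lscale b (lscale c a) = lscale (b * c) a.
Proof. by rewrite /lscale coinv_valM amulA_l // coinv_valP. Qed.
Let lscale1 : left_id 1 lscale.
Proof. exact: amul1l. Qed.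
Let lscaleDr : right_distributive lscale +%R.
Proof. by move=> b m n; rewrite /lscale ktensDr linearD. Qed.
Let lscaleDl a : {morph lscale^~ a : b c / b + c}.
Proof. by move=> b c; rewrite /lscale coinv_valD ktensDl linearD. Qed.
HB.instance Definition _ := GRing.Zmodule_isLmodule.Build B left_regular_type
  lscaleA lscale1 lscaleDr lscaleDl.
Definition left_regular : lmodType B := GRing.Lmodule.clone B left_regular_type _.

Definition right_regular_type : Type := A.
HB.instance Definition _ := GRing.Zmodule.on right_regular_type.

Let rscale (b : B^c) (a : right_regular_type) : right_regular_type :=
  amul ((a : A) ⊗ coinv_val b).
Let rscaleA b c a : rscale b (rscale c a) = rscale (b * c) a.
Proof.
rewrite /rscale [coinv_val (b * c)]/(amul (coinv_val c ⊗ coinv_val b)).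
by rewrite amulA_r // coinv_valP.
Qed.
Let rscale1 : left_id 1 rscale.
Proof. exact: amul1r. Qed.
Let rscaleDr : right_distributive rscale +%R.
Proof. by move=> b m n; rewrite /rscale ktensDl linearD. Qed.
Let rscaleDl a : {morph rscale^~ a : b c / b + c}.
Proof. by move=> b c; rewrite /rscale coinv_valD ktensDr linearD. Qed.
HB.instance Definition _ := GRing.Zmodule_isLmodule.Build B^c right_regular_type
  rscaleA rscale1 rscaleDr rscaleDl.
Definition right_regular : lmodType B^c := GRing.Lmodule.clone B^c right_regular_type _.

End CoinvariantModules.

Section BTensor.
Variable R : pzRingType.

Definition btensor (N : lmodType R^c) (M : lmodType R) : zmodType :=
  tensor (fun (r : R) (n : N) => (r : R^c) *: n) (fun (r : R) (m : M) => r *: m).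

Definition btens (N : lmodType R^c) (M : lmodType R) (n : N) (m : M) :
  btensor N M := pure _ _ n m.

Definition bfold (N : lmodType R^c) (M : lmodType R) (G : zmodType)
  (f : N -> M -> G) (t : btensor N M) : G := tfold f t.

Section Theory.
Variables (N : lmodType R^c) (M : lmodType R).

Definition rbalanced (G : zmodType) (f : N -> M -> G) : Prop :=
  balanced (fun (r : R) (n : N) => (r : R^c) *: n) (fun (r : R) (m : M) => r *: m) f.

Lemma btens_balanced : rbalanced (@btens N M).
Proof. exact: pure_balanced. Qed.

Lemma btensor_ind (P : btensor N M -> Prop) :
  (forall n m, P (btens n m)) -> (forall s t, P s -> P t -> P (s + t)) ->
  P 0 -> forall t, P t.
Proof. exact: tensor_ind. Qed.

Lemma btensor_eq (G : zmodType) (f g : btensor N M -> G) :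
  {morph f : x y / x + y} -> {morph g : x y / x + y} ->
  (forall n m, f (btens n m) = g (btens n m)) -> f =1 g.
Proof.
move=> fD gD e; elim/btensor_ind => [n m|s t IHs IHt|]; first exact: e.
  by rewrite fD gD IHs IHt.
have z (h : btensor N M -> G) : {morph h : x y / x + y} -> h 0 = 0.
  by move=> hD; apply: (addrI (h 0)); rewrite -hD !addr0.
by rewrite !z.
Qed.

Lemma bfold_btens (G : zmodType) (f : N -> M -> G) n m :
  rbalanced f -> bfold f (btens n m) = f n m.
Proof. exact: tfold_pure. Qed.

Lemma bfoldD (G : zmodType) (f : N -> M -> G) : rbalanced f ->
  {morph bfold f : s t / s + t}.
Proof. by move=> fb s t; exact: tfoldD. Qed.

End Theory.

Definition btensor_map (N N' : lmodType R^c) (M M' : lmodType R)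
  (f : N -> N') (g : M -> M') (t : btensor N M) : btensor N' M' :=
  bfold (fun n m => btens (f n) (g m)) t.

Lemma btensor_map_balanced (N N' : lmodType R^c) (M M' : lmodType R)
  (f : {linear N -> N'}) (g : {linear M -> M'}) :
  rbalanced (fun n m => btens (f n) (g m)).
Proof.
have [bl br bs] := @btens_balanced N' M'.
by split=> *; rewrite ?linearD ?linearZ /= ?bl ?br // bs.
Qed.

Definition exact_at (X Y Z : zmodType) (f : X -> Y) (g : Y -> Z) : Prop :=
  forall y, g y = 0 <-> exists x, f x = y.

(* Faithful flatness: tensoring with the module preserves and reflects exact    *)
(* sequences X -> Y -> Z.                                                        *)
Definition faithfully_flat_left (M : lmodType R) : Prop :=
  forall (X Y Z : lmodType R^c) (f : {linear X -> Y}) (g : {linear Y -> Z}),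
    exact_at f g <->
    exact_at (btensor_map (N := X) f (@id M)) (btensor_map (N := Y) g (@id M)).

Definition faithfully_flat_right (N : lmodType R^c) : Prop :=
  forall (X Y Z : lmodType R) (f : {linear X -> Y}) (g : {linear Y -> Z}),
    exact_at f g <->
    exact_at (btensor_map (M := X) (@id N) f) (btensor_map (M := Y) (@id N) g).

End BTensor.

Section RightInduction.
Variables (k : fieldType) (H : coquasi_bialgebra k) (A : comodule_algebra H).
Local Notation B := (coinv_algebra A).
Variable N : lmodType B^c.

(* The k-structure, the coaction and the action on N ⊗_B A are those of A.      *)
Definition ind_right_type : Type := btensor N (left_regular A).
HB.instance Definition _ := GRing.Zmodule.on ind_right_type.

Let tens (n : N) (a : A) : ind_right_type := btens n (a : left_regular A).

Let tens_balanced : rbalanced (M := left_regular A) tens.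
Proof. exact: btens_balanced. Qed.

Let scale (c : k) (t : ind_right_type) : ind_right_type :=
  bfold (M := left_regular A) (fun n (a : A) => tens n (c *: a)) t.

Let scale_balanced c : rbalanced (M := left_regular A) (fun n (a : A) => tens n (c *: a)).
Proof.
have [bl br bs] := tens_balanced; split=> [*|n a a'|b n a].
- exact: bl.
- by rewrite -br; congr tens; exact: scalerDr.
- rewrite bs; congr tens.
  by rewrite -[b *: a]/(amul (coinv_val b ⊗ (a : A))) -linearZ /= -ktensZr.
Qed.

Let scaleE c n a : scale c (tens n a) = tens n (c *: a).
Proof. by apply: bfold_btens; exact: scale_balanced. Qed.

Let scaleDr : right_distributive scale +%R.
Proof. by move=> c; apply: bfoldD; exact: scale_balanced. Qed.

Let scaleA c d t : scale c (scale d t) = scale (c * d) t.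
Proof.
move: t; apply: (btensor_eq (N := N) (M := left_regular A)) => [x y|x y|n a].
- by rewrite !scaleDr.
- by rewrite scaleDr.
- by rewrite !scaleE scalerA.
Qed.

Let scale1 : left_id 1 scale.
Proof.
apply: (btensor_eq (N := N) (M := left_regular A)) => [x y|//|n a].
- by rewrite !scaleDr.
- by rewrite scaleE scale1r.
Qed.

Let scaleDl t : {morph scale^~ t : c d / c + d}.
Proof.
move=> c d; move: t.
apply: (btensor_eq (N := N) (M := left_regular A)) => [x y|x y|n a].
- by rewrite !scaleDr.
- by rewrite !scaleDr addrACA.
- by rewrite !scaleE scalerDl; have [_ br _] := tens_balanced; exact: br.
Qed.

HB.instance Definition _ := GRing.Zmodule_isLmodule.Build k ind_right_type
  scaleA scale1 scaleDr scaleDl.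
Definition ind_right_space : lmodType k := GRing.Lmodule.clone k ind_right_type _.

Definition ind_right_tens (n : N) (a : A) : ind_right_space := tens n a.

Lemma ind_right_tens_linear n : linear (ind_right_tens n).
Proof.
move=> c x y; rewrite -[c *: ind_right_tens n x]/(scale c (tens n x)) scaleE.
by have [_ br _] := tens_balanced; exact: br.
Qed.
HB.instance Definition _ n :=
  GRing.isLinear.Build k A ind_right_space _ (ind_right_tens n) (ind_right_tens_linear n).

Lemma ind_right_tensDl n n' a :
  ind_right_tens (n + n') a = ind_right_tens n a + ind_right_tens n' a.
Proof. by have [bl _ _] := tens_balanced; exact: bl. Qed.

Lemma ind_right_tensB (b : B) n a :
  ind_right_tens ((b : B^c) *: n) a = ind_right_tens n (amul (coinv_val b ⊗ a)).
Proof. by have [_ _ bs] := tens_balanced; exact: bs. Qed.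

Lemma ind_right_ind (P : ind_right_space -> Prop) :
  (forall n a, P (ind_right_tens n a)) -> (forall s t, P s -> P t -> P (s + t)) ->
  P 0 -> forall t, P t.
Proof. exact: (btensor_ind (N := N) (M := left_regular A)). Qed.

Lemma ind_right_eq (G : zmodType) (f g : ind_right_space -> G) :
  {morph f : x y / x + y} -> {morph g : x y / x + y} ->
  (forall n a, f (ind_right_tens n a) = g (ind_right_tens n a)) -> f =1 g.
Proof. exact: (btensor_eq (N := N) (M := left_regular A)). Qed.

(* The linear map on N ⊗_B A induced by a balanced map linear in A. *)
Definition ind_right_lift_ok (Q : lmodType k) (f : N -> A -> Q) : Prop :=
  [/\ forall n n' a, f (n + n') a = f n a + f n' a,
      forall n, linear (f n)
    & forall (b : B) n a, f ((b : B^c) *: n) a = f n (amul (coinv_val b ⊗ a))].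

Definition ind_right_fold (Q : lmodType k) (f : N -> A -> Q)
  (t : ind_right_space) : Q := bfold (N := N) (M := left_regular A) f t.

Section Lift.
Variables (Q : lmodType k) (f : N -> A -> Q) (fok : ind_right_lift_ok f).

Let f_balanced : rbalanced (M := left_regular A) f.
Proof.
case: fok => fl fr fb; split=> //.
by move=> n a a'; have := fr n 1 a a'; rewrite !scale1r.
Qed.

Lemma ind_right_foldE n a : ind_right_fold f (ind_right_tens n a) = f n a.
Proof. by apply: bfold_btens. Qed.

Lemma ind_right_fold_linear : linear (ind_right_fold f).
Proof.
move=> c s t; rewrite [LHS]bfoldD //; congr (_ + _).
move: s; apply: ind_right_eq => [x y|x y|n a].
- by rewrite scalerDr [LHS]bfoldD.
- by rewrite -scalerDr; congr (_ *: _); exact: bfoldD.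
rewrite -linearZ /= -!/(ind_right_fold f _) !ind_right_foldE.
case: fok => _ fr _; have f0 : f n 0 = 0.
  by have /esym/eqP := fr n 1 0 0; rewrite !scale1r addr0 -subr_eq0 addrK => /eqP.
by rewrite -[c *: a]addr0 fr f0 addr0.
Qed.
End Lift.

Definition ind_right_rho (t : ind_right_space) : (ind_right_space ⊗ H)%type :=
  ind_right_fold (fun n a => \Sw_(a0, a1 <- rho a) (ind_right_tens n a0 ⊗ a1)) t.

Lemma amul_coinv_rho_sw (Q : lmodType k) (F : A -> H -> Q) (b : B) a :
  kbilinear F ->
  kfold F (rho (amul (coinv_val b ⊗ a))) =
  \Sw_(a0, a1 <- rho a) F (amul (coinv_val b ⊗ a0)) a1.
Proof.
move=> [Fl Fr]; rewrite rho_amul rho_coinv_sw ?coinv_valP //; last by kbil.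
rewrite kfold_kfold //; apply: eq_kfold => a0 a1.
by rewrite kfold_tens // hmul1l.
Qed.

Let rho_ok : ind_right_lift_ok
  (fun n a => \Sw_(a0, a1 <- rho a) (ind_right_tens n a0 ⊗ a1)).
Proof.
split=> [n n' a|n c a a'|b n a].
- rewrite -kfoldD; apply: eq_kfold => a0 a1.
  by rewrite ind_right_tensDl ktensDl.
- by klin.
- rewrite amul_coinv_rho_sw; last by kbil.
  by apply: eq_kfold => a0 a1; rewrite ind_right_tensB.
Qed.

Lemma ind_right_rhoE n a : ind_right_rho (ind_right_tens n a) =
  \Sw_(a0, a1 <- rho a) (ind_right_tens n a0 ⊗ a1).
Proof. exact: ind_right_foldE rho_ok _ _. Qed.

HB.instance Definition _ := GRing.isLinear.Build k ind_right_space
  (ind_right_space ⊗ H)%type _ ind_right_rho (ind_right_fold_linear rho_ok).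

Let rhoA_ t :
  \Sw_(m0, m' <- ind_right_rho t) \Sw_(m1, m2 <- comul m') (m0 ⊗ m1 ⊗ m2) =
  \Sw_(m', m2 <- ind_right_rho t) \Sw_(m0, m1 <- ind_right_rho m') (m0 ⊗ m1 ⊗ m2).
Proof.
move: t; apply: ind_right_eq => [x y|x y|n a].
- by rewrite linearD kfold_addr //; kbil.
- by rewrite linearD kfold_addr //; kbil.
rewrite ind_right_rhoE !kfold_kfold; [|by kbil|by kbil].
transitivity (\Sw_(a0, a' <- rho a) \Sw_(a1, a2 <- comul a')
   (ind_right_tens n a0 ⊗ a1 ⊗ a2)).
  by apply: eq_kfold => a0 a1; rewrite kfold_tens //; kbil.
rewrite rhoA_sw; last by ktril.
apply: eq_kfold => a0 a1; rewrite kfold_tens; last by kbil.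
rewrite ind_right_rhoE kfold_kfold; last by kbil.
by apply: eq_kfold => a00 a01; rewrite kfold_tens //; kbil.
Qed.

Let rho_counit_ t : \Sw_(m0, m1 <- ind_right_rho t) (counit m1 *: m0) = t.
Proof.
move: t; apply: ind_right_eq => [x y|//|n a].
  by rewrite linearD kfold_addr //; kbil.
rewrite ind_right_rhoE kfold_kfold; last by kbil.
rewrite -[RHS](rho_counit_sw (f := ind_right_tens n)); last exact: ind_right_tens_linear.
by apply: eq_kfold => a0 a1; rewrite kfold_tens //; kbil.
Qed.

Definition ind_right_comodule : comodule H :=
  @Comodule k H ind_right_space ind_right_rho rhoA_ rho_counit_.

Definition ind_right_act1 (x : A) (t : ind_right_space) : ind_right_space :=
  ind_right_fold (fun n a => ind_right_tens n (amul (a ⊗ x))) t.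

Definition ind_right_act (u : (ind_right_space ⊗ A)%type) : ind_right_space :=
  \Sw_(t, x <- u) ind_right_act1 x t.

Let act1_ok x : ind_right_lift_ok (fun n a => ind_right_tens n (amul (a ⊗ x))).
Proof.
split=> [n n' a|n c a a'|b n a].
- exact: ind_right_tensDl.
- by klin.
- by rewrite ind_right_tensB amulA_l // coinv_valP.
Qed.

HB.instance Definition _ x := GRing.isLinear.Build k ind_right_space ind_right_space _
  (ind_right_act1 x) (ind_right_fold_linear (act1_ok x)).

Let act1E x n a : ind_right_act1 x (ind_right_tens n a) = ind_right_tens n (amul (a ⊗ x)).
Proof. exact: ind_right_foldE (act1_ok x) _ _. Qed.

Let act1_bilinear : kbilinear (fun t x => ind_right_act1 x t).
Proof.
split=> [c t t' x|c t x x']; first by rewrite linearP.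
move: t; apply: ind_right_eq => [s t|s t|n a]; try by rewrite ?linearD ?scalerDr // addrACA.
by rewrite !act1E; klin.
Qed.

HB.instance Definition _ := GRing.isLinear.Build k (ind_right_space ⊗ A)%type
  ind_right_space _ ind_right_act (fun c s t => kfoldP c s t act1_bilinear).

Lemma ind_right_actE n a x :
  ind_right_act (ind_right_tens n a ⊗ x) = ind_right_tens n (amul (a ⊗ x)).
Proof. by rewrite /ind_right_act kfold_tens // act1E. Qed.

Let rho_act_ t x : ind_right_rho (ind_right_act (t ⊗ x)) =
  \Sw_(m0, m1 <- ind_right_rho t) \Sw_(x0, x1 <- rho x)
    (ind_right_act (m0 ⊗ x0) ⊗ hmul (m1 ⊗ x1)).
Proof.
move: t; apply: ind_right_eq => [s t|s t|n a].
- by rewrite ktensDl !linearD.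
- by rewrite linearD kfold_addr //; kbil.
rewrite ind_right_actE !ind_right_rhoE rho_amul !kfold_kfold; [|by kbil|by kbil].
apply: eq_kfold => a0 a1; rewrite kfold_kfold; last by kbil.
rewrite kfold_tens; last by kbil.
apply: eq_kfold => x0 x1; rewrite ind_right_actE kfold_tens //; kbil.
Qed.

Let act1_ t : ind_right_act (t ⊗ aone) = t.
Proof.
move: t; apply: ind_right_eq => [s t|//|n a].
  by rewrite ktensDl linearD.
by rewrite ind_right_actE amul1r.
Qed.

Let actA_ t x y : ind_right_act (ind_right_act (t ⊗ x) ⊗ y) =
  \Sw_(m0, m1 <- ind_right_rho t) \Sw_(x0, x1 <- rho x) \Sw_(y0, y1 <- rho y)
    (omega (m1 ⊗ x1 ⊗ y1) *: ind_right_act (m0 ⊗ amul (x0 ⊗ y0))).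
Proof.
move: t; apply: ind_right_eq => [s t|s t|n a].
- by rewrite ktensDl linearD ktensDl linearD.
- by rewrite linearD kfold_addr //; kbil.
rewrite !ind_right_actE amulA ind_right_rhoE kfold_kfold; last by kbil.
rewrite kfold_linear; apply: eq_kfold => a0 a1.
rewrite kfold_tens; last by kbil.
rewrite kfold_linear; apply: eq_kfold => x0 x1.
rewrite kfold_linear; apply: eq_kfold => y0 y1.
by rewrite linearZ ind_right_actE.
Qed.

Definition ind_right : right_hopf_module A :=
  @RightHopfModule k H A ind_right_comodule ind_right_act rho_act_ act1_ actA_.

Lemma rho_ind_right n a : @rho k H ind_right (ind_right_tens n a) =
  \Sw_(a0, a1 <- rho a) ((ind_right_tens n a0 : ind_right) ⊗ a1).
Proof. exact: ind_right_rhoE. Qed.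

Lemma act_ind_right n a x :
  @ract k H A ind_right (ind_right_tens n a ⊗ x) = ind_right_tens n (amul (a ⊗ x)).
Proof. exact: ind_right_actE. Qed.

End RightInduction.

Section LeftInduction.
Variables (k : fieldType) (H : coquasi_bialgebra k) (A : comodule_algebra H).
Local Notation B := (coinv_algebra A).
Variable N : lmodType B.

Definition ind_left_type : Type := btensor (right_regular A) N.
HB.instance Definition _ := GRing.Zmodule.on ind_left_type.

Let tens (a : A) (n : N) : ind_left_type := btens (a : right_regular A) n.

Let tens_balanced : rbalanced (N := right_regular A) tens.
Proof. exact: btens_balanced. Qed.

Let scale (c : k) (t : ind_left_type) : ind_left_type :=
  bfold (N := right_regular A) (fun (a : A) n => tens (c *: a) n) t.

Let scale_balanced c : rbalanced (N := right_regular A) (fun (a : A) n => tens (c *: a) n).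
Proof.
have [bl br bs] := tens_balanced; split=> [a a' n|*|b a n].
- by rewrite -bl; congr tens; exact: scalerDr.
- exact: br.
- rewrite -bs; congr tens.
  by rewrite -[(b : B^c) *: a]/(amul ((a : A) ⊗ coinv_val b)) -linearZ /= -ktensZl.
Qed.

Let scaleE c a n : scale c (tens a n) = tens (c *: a) n.
Proof. by apply: bfold_btens; exact: scale_balanced. Qed.

Let scaleDr : right_distributive scale +%R.
Proof. by move=> c; apply: bfoldD; exact: scale_balanced. Qed.

Let scaleA c d t : scale c (scale d t) = scale (c * d) t.
Proof.
move: t; apply: (btensor_eq (N := right_regular A) (M := N)) => [x y|x y|a n].
- by rewrite !scaleDr.
- by rewrite scaleDr.
- by rewrite !scaleE scalerA.
Qed.

Let scale1 : left_id 1 scale.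
Proof.
apply: (btensor_eq (N := right_regular A) (M := N)) => [x y|//|a n].
- by rewrite !scaleDr.
- by rewrite scaleE scale1r.
Qed.

Let scaleDl t : {morph scale^~ t : c d / c + d}.
Proof.
move=> c d; move: t.
apply: (btensor_eq (N := right_regular A) (M := N)) => [x y|x y|a n].
- by rewrite !scaleDr.
- by rewrite !scaleDr addrACA.
- by rewrite !scaleE scalerDl; have [bl _ _] := tens_balanced; exact: bl.
Qed.

HB.instance Definition _ := GRing.Zmodule_isLmodule.Build k ind_left_type
  scaleA scale1 scaleDr scaleDl.
Definition ind_left_space : lmodType k := GRing.Lmodule.clone k ind_left_type _.

(* [ind_left_tens n a] is the pure tensor of a and n in A ⊗_B N. *)
Definition ind_left_tens (n : N) (a : A) : ind_left_space := tens a n.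

Lemma ind_left_tens_linear n : linear (ind_left_tens n).
Proof.
move=> c x y; rewrite -[c *: ind_left_tens n x]/(scale c (tens x n)) scaleE.
by have [bl _ _] := tens_balanced; exact: bl.
Qed.
HB.instance Definition _ n :=
  GRing.isLinear.Build k A ind_left_space _ (ind_left_tens n) (ind_left_tens_linear n).

Lemma ind_left_tensDl n n' a :
  ind_left_tens (n + n') a = ind_left_tens n a + ind_left_tens n' a.
Proof. by have [_ br _] := tens_balanced; exact: br. Qed.

Lemma ind_left_tensB (b : B) n a :
  ind_left_tens (b *: n) a = ind_left_tens n (amul (a ⊗ coinv_val b)).
Proof. by have [_ _ bs] := tens_balanced; exact/esym/bs. Qed.

Lemma ind_left_ind (P : ind_left_space -> Prop) :
  (forall n a, P (ind_left_tens n a)) -> (forall s t, P s -> P t -> P (s + t)) ->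
  P 0 -> forall t, P t.
Proof.
by move=> Pt; apply: (btensor_ind (N := right_regular A) (M := N)) => a n; exact: Pt.
Qed.

Lemma ind_left_eq (G : zmodType) (f g : ind_left_space -> G) :
  {morph f : x y / x + y} -> {morph g : x y / x + y} ->
  (forall n a, f (ind_left_tens n a) = g (ind_left_tens n a)) -> f =1 g.
Proof.
move=> fD gD e; apply: (btensor_eq (N := right_regular A) (M := N) fD gD) => a n.
exact: e.
Qed.

Definition ind_left_lift_ok (Q : lmodType k) (f : N -> A -> Q) : Prop :=
  [/\ forall n n' a, f (n + n') a = f n a + f n' a,
      forall n, linear (f n)
    & forall (b : B) n a, f (b *: n) a = f n (amul (a ⊗ coinv_val b))].

Definition ind_left_fold (Q : lmodType k) (f : N -> A -> Q)
  (t : ind_left_space) : Q :=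
  bfold (N := right_regular A) (M := N) (fun a n => f n a) t.

Section Lift.
Variables (Q : lmodType k) (f : N -> A -> Q) (fok : ind_left_lift_ok f).

Let f_balanced : rbalanced (N := right_regular A) (fun a n => f n a).
Proof.
case: fok => fl fr fb; split=> // a a' n.
by have := fr n 1 a a'; rewrite !scale1r.
Qed.

Lemma ind_left_foldE n a : ind_left_fold f (ind_left_tens n a) = f n a.
Proof. exact: (bfold_btens _ _ f_balanced). Qed.

Lemma ind_left_fold_linear : linear (ind_left_fold f).
Proof.
move=> c s t; rewrite [LHS]bfoldD //; congr (_ + _).
move: s; apply: ind_left_eq => [x y|x y|n a].
- by rewrite scalerDr [LHS]bfoldD.
- by rewrite -scalerDr; congr (_ *: _); exact: bfoldD.
rewrite -linearZ /= -!/(ind_left_fold f _) !ind_left_foldE.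
case: fok => _ fr _; have f0 : f n 0 = 0.
  by have /esym/eqP := fr n 1 0 0; rewrite !scale1r addr0 -subr_eq0 addrK => /eqP.
by rewrite -[c *: a]addr0 fr f0 addr0.
Qed.
End Lift.

Definition ind_left_rho (t : ind_left_space) : (ind_left_space ⊗ H)%type :=
  ind_left_fold (fun n a => \Sw_(a0, a1 <- rho a) (ind_left_tens n a0 ⊗ a1)) t.

Lemma amul_rho_coinv_sw (Q : lmodType k) (F : A -> H -> Q) (b : B) a :
  kbilinear F ->
  kfold F (rho (amul (a ⊗ coinv_val b))) =
  \Sw_(a0, a1 <- rho a) F (amul (a0 ⊗ coinv_val b)) a1.
Proof.
move=> [Fl Fr]; rewrite rho_amul kfold_kfold //; apply: eq_kfold => a0 a1.
rewrite rho_coinv_sw ?coinv_valP //; last by kbil.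
by rewrite kfold_tens // hmul1r.
Qed.

Let rho_ok : ind_left_lift_ok
  (fun n a => \Sw_(a0, a1 <- rho a) (ind_left_tens n a0 ⊗ a1)).
Proof.
split=> [n n' a|n c a a'|b n a].
- rewrite -kfoldD; apply: eq_kfold => a0 a1.
  by rewrite ind_left_tensDl ktensDl.
- by klin.
- rewrite amul_rho_coinv_sw; last by kbil.
  by apply: eq_kfold => a0 a1; rewrite ind_left_tensB.
Qed.

Lemma ind_left_rhoE n a : ind_left_rho (ind_left_tens n a) =
  \Sw_(a0, a1 <- rho a) (ind_left_tens n a0 ⊗ a1).
Proof. exact: ind_left_foldE rho_ok _ _. Qed.

HB.instance Definition _ := GRing.isLinear.Build k ind_left_space
  (ind_left_space ⊗ H)%type _ ind_left_rho (ind_left_fold_linear rho_ok).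

Let rhoA_ t :
  \Sw_(m0, m' <- ind_left_rho t) \Sw_(m1, m2 <- comul m') (m0 ⊗ m1 ⊗ m2) =
  \Sw_(m', m2 <- ind_left_rho t) \Sw_(m0, m1 <- ind_left_rho m') (m0 ⊗ m1 ⊗ m2).
Proof.
move: t; apply: ind_left_eq => [x y|x y|n a].
- by rewrite linearD kfold_addr //; kbil.
- by rewrite linearD kfold_addr //; kbil.
rewrite ind_left_rhoE !kfold_kfold; [|by kbil|by kbil].
transitivity (\Sw_(a0, a' <- rho a) \Sw_(a1, a2 <- comul a')
   (ind_left_tens n a0 ⊗ a1 ⊗ a2)).
  by apply: eq_kfold => a0 a1; rewrite kfold_tens //; kbil.
rewrite rhoA_sw; last by ktril.
apply: eq_kfold => a0 a1; rewrite kfold_tens; last by kbil.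
rewrite ind_left_rhoE kfold_kfold; last by kbil.
by apply: eq_kfold => a00 a01; rewrite kfold_tens //; kbil.
Qed.

Let rho_counit_ t : \Sw_(m0, m1 <- ind_left_rho t) (counit m1 *: m0) = t.
Proof.
move: t; apply: ind_left_eq => [x y|//|n a].
  by rewrite linearD kfold_addr //; kbil.
rewrite ind_left_rhoE kfold_kfold; last by kbil.
rewrite -[RHS](rho_counit_sw (f := ind_left_tens n)); last exact: ind_left_tens_linear.
by apply: eq_kfold => a0 a1; rewrite kfold_tens //; kbil.
Qed.

Definition ind_left_comodule : comodule H :=
  @Comodule k H ind_left_space ind_left_rho rhoA_ rho_counit_.

Definition ind_left_act1 (x : A) (t : ind_left_space) : ind_left_space :=
  ind_left_fold (fun n a => ind_left_tens n (amul (x ⊗ a))) t.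

Definition ind_left_act (u : (A ⊗ ind_left_space)%type) : ind_left_space :=
  \Sw_(x, t <- u) ind_left_act1 x t.

Let act1_ok x : ind_left_lift_ok (fun n a => ind_left_tens n (amul (x ⊗ a))).
Proof.
split=> [n n' a|n c a a'|b n a].
- exact: ind_left_tensDl.
- by klin.
- by rewrite ind_left_tensB amulA_r // coinv_valP.
Qed.

HB.instance Definition _ x := GRing.isLinear.Build k ind_left_space ind_left_space _
  (ind_left_act1 x) (ind_left_fold_linear (act1_ok x)).

Let act1E x n a : ind_left_act1 x (ind_left_tens n a) = ind_left_tens n (amul (x ⊗ a)).
Proof. exact: ind_left_foldE (act1_ok x) _ _. Qed.

Let act1_bilinear : kbilinear (fun x t => ind_left_act1 x t).
Proof.
split=> [c x x' t|c x t t']; last by rewrite linearP.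
move: t; apply: ind_left_eq => [s t|s t|n a]; try by rewrite ?linearD ?scalerDr // addrACA.
by rewrite !act1E; klin.
Qed.

HB.instance Definition _ := GRing.isLinear.Build k (A ⊗ ind_left_space)%type
  ind_left_space _ ind_left_act (fun c s t => kfoldP c s t act1_bilinear).

Lemma ind_left_actE n a x :
  ind_left_act (x ⊗ ind_left_tens n a) = ind_left_tens n (amul (x ⊗ a)).
Proof. by rewrite /ind_left_act kfold_tens // act1E. Qed.

Let rho_act_ x t : ind_left_rho (ind_left_act (x ⊗ t)) =
  \Sw_(x0, x1 <- rho x) \Sw_(m0, m1 <- ind_left_rho t)
    (ind_left_act (x0 ⊗ m0) ⊗ hmul (x1 ⊗ m1)).
Proof.
move: t; apply: ind_left_eq => [s t|s t|n a].
- by rewrite ktensDr !linearD.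
- by rewrite -kfoldD; apply: eq_kfold => x0 x1; rewrite linearD kfold_addr //; kbil.
rewrite ind_left_actE !ind_left_rhoE rho_amul kfold_kfold; last by kbil.
apply: eq_kfold => x0 x1; rewrite !kfold_kfold; [|by kbil|by kbil].
apply: eq_kfold => a0 a1; rewrite !kfold_tens; [|by kbil|by kbil].
by rewrite ind_left_actE.
Qed.

Let act1_ t : ind_left_act (aone ⊗ t) = t.
Proof.
move: t; apply: ind_left_eq => [s t|//|n a].
  by rewrite ktensDr linearD.
by rewrite ind_left_actE amul1l.
Qed.

Let actA_ x y t : ind_left_act (amul (x ⊗ y) ⊗ t) =
  \Sw_(x0, x1 <- rho x) \Sw_(y0, y1 <- rho y) \Sw_(m0, m1 <- ind_left_rho t)
    (omega (x1 ⊗ y1 ⊗ m1) *: ind_left_act (x0 ⊗ ind_left_act (y0 ⊗ m0))).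
Proof.
move: t; apply: ind_left_eq => [s t|s t|n a].
- by rewrite ktensDr linearD.
- rewrite -kfoldD; apply: eq_kfold => x0 x1.
  rewrite -kfoldD; apply: eq_kfold => y0 y1.
  by rewrite linearD kfold_addr //; kbil.
rewrite !ind_left_actE amulA ind_left_rhoE kfold_linear.
apply: eq_kfold => x0 x1; rewrite kfold_linear.
apply: eq_kfold => y0 y1; rewrite kfold_linear kfold_kfold; last by kbil.
apply: eq_kfold => a0 a1; rewrite kfold_tens; last by kbil.
by rewrite linearZ !ind_left_actE.
Qed.

Definition ind_left : left_hopf_module A :=
  @LeftHopfModule k H A ind_left_comodule ind_left_act rho_act_ act1_ actA_.

Lemma rho_ind_left n a : @rho k H ind_left (ind_left_tens n a) =
  \Sw_(a0, a1 <- rho a) ((ind_left_tens n a0 : ind_left) ⊗ a1).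
Proof. exact: ind_left_rhoE. Qed.

Lemma act_ind_left n a x :
  @lact k H A ind_left (x ⊗ ind_left_tens n a) = ind_left_tens n (amul (x ⊗ a)).
Proof. exact: ind_left_actE. Qed.

End LeftInduction.

Record category := Category {
  obj :> Type;
  hom : obj -> obj -> Type;
  idm : forall x, hom x x;
  comp : forall x y z, hom y z -> hom x y -> hom x z;
  compA : forall x y z t (h : hom z t) (g : hom y z) (f : hom x y),
    comp h (comp g f) = comp (comp h g) f;
  comp1m : forall x y (f : hom x y), comp (idm y) f = f;
  compm1 : forall x y (f : hom x y), comp f (idm x) = f
}.
Arguments hom {c} x y.
Arguments idm {c} x.
Arguments comp {c x y z} g f.

Record functor (C D : category) := Functor {
  fobj :> C -> D;
  fmap : forall x y, hom x y -> hom (fobj x) (fobj y);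
  fmap1 : forall x, fmap (idm x) = idm (fobj x);
  fmap_comp : forall x y z (g : hom y z) (f : hom x y),
    fmap (comp g f) = comp (fmap g) (fmap f)
}.
Arguments fmap {C D} f0 {x y} f : rename.

Definition functor_id (C : category) : functor C C :=
  @Functor C C (fun x => x) (fun x y f => f) (fun x => erefl)
    (fun x y z g f => erefl).

Section FunctorComp.
Variables (C D E : category) (G : functor D E) (F : functor C D).

Let fmap1_ (x : C) : fmap G (fmap F (idm x)) = idm (G (F x)).
Proof. by rewrite !fmap1. Qed.
Let fmap_comp_ (x y z : C) (g : hom y z) (f : hom x y) :
  fmap G (fmap F (comp g f)) = comp (fmap G (fmap F g)) (fmap G (fmap F f)).
Proof. by rewrite !fmap_comp. Qed.

Definition functor_comp : functor C E :=
  @Functor C E (fun x => G (F x)) (fun x y f => fmap G (fmap F f)) fmap1_ fmap_comp_.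
End FunctorComp.

Definition is_iso (C : category) (x y : C) (f : hom x y) : Prop :=
  exists g : hom y x, comp g f = idm x /\ comp f g = idm y.

Definition naturally_isomorphic (C D : category) (F G : functor C D) : Prop :=
  exists eta : forall x : C, hom (F x) (G x),
    (forall (x y : C) (f : hom x y), comp (eta y) (fmap F f) = comp (fmap G f) (eta x))
    /\ (forall x, is_iso (eta x)).

Definition inverse_equivalences (C D : category) (F : functor C D) (G : functor D C) :
  Prop :=
  naturally_isomorphic (functor_comp G F) (functor_id C) /\
  naturally_isomorphic (functor_comp F G) (functor_id D).

Lemma linear_eq (R : pzRingType) (U V : lmodType R) (f g : {linear U -> V}) :
  f =1 g -> f = g.
Proof.
case: f g => [f cf] [g cg] /= /funext e; rewrite {f}e in cf *.
congr GRing.Linear.Pack; case: cf cg => [[a] [b]] [[c] [d]].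
by congr GRing.Linear.Class; congr (_ _); exact: Prop_irrelevance.
Qed.

Section LmodCategory.
Variable R : pzRingType.
Definition lmod_hom (U V : lmodType R) : Type := {linear U -> V}.
Definition lmod_comp (U V W : lmodType R) (g : lmod_hom V W) (f : lmod_hom U V) :
  lmod_hom U W := GRing.Linear.clone R U W _ (g \o f) _.
Definition lmod_id (U : lmodType R) : lmod_hom U U :=
  GRing.Linear.clone R U U _ idfun _.

Let lmod_compA (x y z t : lmodType R) (h : lmod_hom z t) (g : lmod_hom y z)
  (f : lmod_hom x y) : lmod_comp h (lmod_comp g f) = lmod_comp (lmod_comp h g) f.
Proof. exact: linear_eq. Qed.
Let lmod_comp1m (x y : lmodType R) (f : lmod_hom x y) : lmod_comp (lmod_id y) f = f.
Proof. exact: linear_eq. Qed.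
Let lmod_compm1 (x y : lmodType R) (f : lmod_hom x y) : lmod_comp f (lmod_id x) = f.
Proof. exact: linear_eq. Qed.

Definition lmod_category : category :=
  @Category (lmodType R) lmod_hom lmod_id lmod_comp
    lmod_compA lmod_comp1m lmod_compm1.
End LmodCategory.

Section HopfCategories.
Variables (k : fieldType) (H : coquasi_bialgebra k) (A : comodule_algebra H).
Local Notation B := (coinv_algebra A).

Lemma right_hopf_hom_eq (M N : right_hopf_module A) (f g : right_hopf_hom M N) :
  f =1 g -> f = g.
Proof.
case: f g => [f f1 f2] [g g1 g2] /= /linear_eq e; rewrite {f}e in f1 f2 *.
by congr RightHopfHom; exact: Prop_irrelevance.
Qed.

Lemma left_hopf_hom_eq (M N : left_hopf_module A) (f g : left_hopf_hom M N) :
  f =1 g -> f = g.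
Proof.
case: f g => [f f1 f2] [g g1 g2] /= /linear_eq e; rewrite {f}e in f1 f2 *.
by congr LeftHopfHom; exact: Prop_irrelevance.
Qed.

Lemma colinear_id (M : comodule H) : colinear (@idfun M).
Proof. by move=> m; rewrite kfold_id. Qed.

Lemma colinear_comp (M N P : comodule H) (g : {linear N -> P}) (f : {linear M -> N}) :
  colinear g -> colinear f -> colinear (g \o f).
Proof.
move=> gc fc m; rewrite /= gc fc kfold_kfold; last by kbil.
by apply: eq_kfold => m0 m1; rewrite kfold_tens //; kbil.
Qed.

Definition right_hopf_id (M : right_hopf_module A) : right_hopf_hom M M :=
  @RightHopfHom k H A M M (lmod_id M) (@colinear_id M) (fun _ _ => erefl).

Let right_comp_act (M N P : right_hopf_module A) (g : right_hopf_hom N P)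
  (f : right_hopf_hom M N) m a :
  lmod_comp g f (ract (m ⊗ a)) = ract (lmod_comp g f m ⊗ a).
Proof. by rewrite /= !rhh_act. Qed.

Definition right_hopf_comp (M N P : right_hopf_module A) (g : right_hopf_hom N P)
  (f : right_hopf_hom M N) : right_hopf_hom M P :=
  @RightHopfHom k H A M P (lmod_comp g f)
    (colinear_comp (rhh_colinear g) (rhh_colinear f)) (right_comp_act g f).

Let right_hopf_compA (x y z t : right_hopf_module A) (h : right_hopf_hom z t) (g : right_hopf_hom y z)
  (f : right_hopf_hom x y) : right_hopf_comp h (right_hopf_comp g f) = right_hopf_comp (right_hopf_comp h g) f.
Proof. exact: right_hopf_hom_eq. Qed.
Let right_hopf_comp1m (x y : right_hopf_module A) (f : right_hopf_hom x y) : right_hopf_comp (right_hopf_id y) f = f.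
Proof. exact: right_hopf_hom_eq. Qed.
Let right_hopf_compm1 (x y : right_hopf_module A) (f : right_hopf_hom x y) : right_hopf_comp f (right_hopf_id x) = f.
Proof. exact: right_hopf_hom_eq. Qed.

Definition right_hopf_category : category :=
  @Category (right_hopf_module A) (@right_hopf_hom k H A) right_hopf_id right_hopf_comp
    right_hopf_compA right_hopf_comp1m right_hopf_compm1.

Definition left_hopf_id (M : left_hopf_module A) : left_hopf_hom M M :=
  @LeftHopfHom k H A M M (lmod_id M) (@colinear_id M) (fun _ _ => erefl).

Let left_comp_act (M N P : left_hopf_module A) (g : left_hopf_hom N P)
  (f : left_hopf_hom M N) a m :
  lmod_comp g f (lact (a ⊗ m)) = lact (a ⊗ lmod_comp g f m).
Proof. by rewrite /= !lhh_act. Qed.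

Definition left_hopf_comp (M N P : left_hopf_module A) (g : left_hopf_hom N P)
  (f : left_hopf_hom M N) : left_hopf_hom M P :=
  @LeftHopfHom k H A M P (lmod_comp g f)
    (colinear_comp (lhh_colinear g) (lhh_colinear f)) (left_comp_act g f).

Let left_hopf_compA (x y z t : left_hopf_module A) (h : left_hopf_hom z t) (g : left_hopf_hom y z)
  (f : left_hopf_hom x y) : left_hopf_comp h (left_hopf_comp g f) = left_hopf_comp (left_hopf_comp h g) f.
Proof. exact: left_hopf_hom_eq. Qed.
Let left_hopf_comp1m (x y : left_hopf_module A) (f : left_hopf_hom x y) : left_hopf_comp (left_hopf_id y) f = f.
Proof. exact: left_hopf_hom_eq. Qed.
Let left_hopf_compm1 (x y : left_hopf_module A) (f : left_hopf_hom x y) : left_hopf_comp f (left_hopf_id x) = f.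
Proof. exact: left_hopf_hom_eq. Qed.

Definition left_hopf_category : category :=
  @Category (left_hopf_module A) (@left_hopf_hom k H A) left_hopf_id left_hopf_comp
    left_hopf_compA left_hopf_comp1m left_hopf_compm1.

Lemma coinvariants_colinear (M N : comodule H) (f : {linear M -> N}) m :
  colinear f -> m \in coinvariants M -> f m \in coinvariants N.
Proof.
move=> fc mM; apply/coinvariantP; rewrite fc.
by rewrite rho_coinv_sw //; kbil.
Qed.

Section RightMaps.
Variables (M N : right_hopf_module A) (f : right_hopf_hom M N).
Definition coinv_right_map (m : coinv_right M) : coinv_right N :=
  exist _ (f (val m)) (coinvariants_colinear (rhh_colinear f) (valP m)).
Lemma coinv_right_map_linear : linear coinv_right_map.
Proof.
move=> b m n; apply: val_inj; rewrite /= linearD; congr (_ + _).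
exact: rhh_act.
Qed.
HB.instance Definition _ := GRing.isLinear.Build B^c (coinv_right M) (coinv_right N) _
  coinv_right_map coinv_right_map_linear.
End RightMaps.

Section LeftMaps.
Variables (M N : left_hopf_module A) (f : left_hopf_hom M N).
Definition coinv_left_map (m : coinv_left M) : coinv_left N :=
  exist _ (f (val m)) (coinvariants_colinear (lhh_colinear f) (valP m)).
Lemma coinv_left_map_linear : linear coinv_left_map.
Proof.
move=> b m n; apply: val_inj; rewrite /= linearD; congr (_ + _).
exact: lhh_act.
Qed.
HB.instance Definition _ := GRing.isLinear.Build B (coinv_left M) (coinv_left N) _
  coinv_left_map coinv_left_map_linear.
End LeftMaps.

Let coinv_right_hom (M N : right_hopf_module A) (f : right_hopf_hom M N) :
  lmod_hom (coinv_right M) (coinv_right N) :=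
  GRing.Linear.clone B^c (coinv_right M) (coinv_right N) _ (coinv_right_map f) _.

Let coinv_left_hom (M N : left_hopf_module A) (f : left_hopf_hom M N) :
  lmod_hom (coinv_left M) (coinv_left N) :=
  GRing.Linear.clone B (coinv_left M) (coinv_left N) _ (coinv_left_map f) _.

Let coinv_right_fmap1 (M : right_hopf_module A) :
  coinv_right_hom (right_hopf_id M) = lmod_id (coinv_right M).
Proof. by apply: linear_eq => m; apply: val_inj. Qed.
Let coinv_right_fmap_comp (M N P : right_hopf_module A) (g : right_hopf_hom N P)
  (f : right_hopf_hom M N) : coinv_right_hom (right_hopf_comp g f) =
  lmod_comp (coinv_right_hom g) (coinv_right_hom f).
Proof. by apply: linear_eq => m; apply: val_inj. Qed.

Definition coinv_right_functor : functor right_hopf_category (lmod_category B^c) :=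
  @Functor right_hopf_category (lmod_category B^c) (@coinv_right k H A) coinv_right_hom
    coinv_right_fmap1 coinv_right_fmap_comp.

Let coinv_left_fmap1 (M : left_hopf_module A) :
  coinv_left_hom (left_hopf_id M) = lmod_id (coinv_left M).
Proof. by apply: linear_eq => m; apply: val_inj. Qed.
Let coinv_left_fmap_comp (M N P : left_hopf_module A) (g : left_hopf_hom N P)
  (f : left_hopf_hom M N) : coinv_left_hom (left_hopf_comp g f) =
  lmod_comp (coinv_left_hom g) (coinv_left_hom f).
Proof. by apply: linear_eq => m; apply: val_inj. Qed.

Definition coinv_left_functor : functor left_hopf_category (lmod_category B) :=
  @Functor left_hopf_category (lmod_category B) (@coinv_left k H A) coinv_left_hom
    coinv_left_fmap1 coinv_left_fmap_comp.

End HopfCategories.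

Section RightInductionFunctor.
Variables (k : fieldType) (H : coquasi_bialgebra k) (A : comodule_algebra H).
Local Notation B := (coinv_algebra A).

Section Map.
Variables (N N' : lmodType B^c) (f : {linear N -> N'}).

Definition ind_right_map (t : ind_right N) : ind_right N' :=
  ind_right_fold (fun n a => ind_right_tens (f n) a) t.

Let map_ok : ind_right_lift_ok (fun n a => ind_right_tens (f n) a).
Proof.
split=> [n n' a|n|b n a].
- by rewrite (linearD f) ind_right_tensDl.
- exact: ind_right_tens_linear.
- by rewrite (linearZZ f) ind_right_tensB.
Qed.

Lemma ind_right_mapE n a : ind_right_map (ind_right_tens n a) = ind_right_tens (f n) a.
Proof. exact: ind_right_foldE map_ok _ _. Qed.

HB.instance Definition _ := GRing.isLinear.Build k (ind_right N) (ind_right N') _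
  ind_right_map (ind_right_fold_linear map_ok).

Let map_colinear : colinear ind_right_map.
Proof.
apply: ind_right_eq => [s t|s t|n a]; first by rewrite !linearD.
  by rewrite linearD kfold_addr //; kbil.
rewrite ind_right_mapE !rho_ind_right kfold_kfold; last by kbil.
apply: eq_kfold => a0 a1; rewrite kfold_tens; last by kbil.
by rewrite ind_right_mapE.
Qed.

Let map_act t a : ind_right_map (ract (t ⊗ a)) = ract (ind_right_map t ⊗ a).
Proof.
move: t; apply: ind_right_eq => [s t|s t|n x].
- by rewrite ktensDl [ract _]linearD [LHS]linearD.
- by rewrite [ind_right_map _]linearD ktensDl [LHS]linearD.
by rewrite ind_right_mapE !act_ind_right ind_right_mapE.
Qed.

Definition ind_right_hom : right_hopf_hom (ind_right N) (ind_right N') :=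
  @RightHopfHom k H A (ind_right N) (ind_right N')
    (GRing.Linear.clone k (ind_right N) (ind_right N') _ ind_right_map _)
    map_colinear map_act.
End Map.

Let fmap1_ (N : lmodType B^c) : ind_right_hom (lmod_id N) = right_hopf_id (ind_right N).
Proof.
apply: right_hopf_hom_eq; apply: ind_right_eq => [s t|s t|n a].
- exact: linearD.
- exact: linearD.
- exact: ind_right_mapE.
Qed.

Let fmap_comp_ (N N' N'' : lmodType B^c) (g : lmod_hom N' N'') (f : lmod_hom N N') :
  ind_right_hom (lmod_comp g f) = right_hopf_comp (ind_right_hom g) (ind_right_hom f).
Proof.
apply: right_hopf_hom_eq; apply: ind_right_eq => [s t|s t|n a].
- exact: linearD.
- exact: linearD.
- by rewrite [LHS]ind_right_mapE /= !ind_right_mapE.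
Qed.

Definition ind_right_functor : functor (lmod_category B^c) (right_hopf_category A) :=
  @Functor (lmod_category B^c) (right_hopf_category A) (@ind_right k H A) ind_right_hom
    fmap1_ fmap_comp_.
End RightInductionFunctor.

Section LeftInductionFunctor.
Variables (k : fieldType) (H : coquasi_bialgebra k) (A : comodule_algebra H).
Local Notation B := (coinv_algebra A).

Section Map.
Variables (N N' : lmodType B) (f : {linear N -> N'}).

Definition ind_left_map (t : ind_left N) : ind_left N' :=
  ind_left_fold (fun n a => ind_left_tens (f n) a) t.

Let map_ok : ind_left_lift_ok (fun n a => ind_left_tens (f n) a).
Proof.
split=> [n n' a|n|b n a].
- by rewrite (linearD f) ind_left_tensDl.
- exact: ind_left_tens_linear.
- by rewrite (linearZZ f) ind_left_tensB.
Qed.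

Lemma ind_left_mapE n a : ind_left_map (ind_left_tens n a) = ind_left_tens (f n) a.
Proof. exact: ind_left_foldE map_ok _ _. Qed.

HB.instance Definition _ := GRing.isLinear.Build k (ind_left N) (ind_left N') _
  ind_left_map (ind_left_fold_linear map_ok).

Let map_colinear : colinear ind_left_map.
Proof.
apply: ind_left_eq => [s t|s t|n a]; first by rewrite !linearD.
  by rewrite linearD kfold_addr //; kbil.
rewrite ind_left_mapE !rho_ind_left kfold_kfold; last by kbil.
apply: eq_kfold => a0 a1; rewrite kfold_tens; last by kbil.
by rewrite ind_left_mapE.
Qed.

Let map_act a t : ind_left_map (lact (a ⊗ t)) = lact (a ⊗ ind_left_map t).
Proof.
move: t; apply: ind_left_eq => [s t|s t|n x].
- by rewrite ktensDr [lact _]linearD [LHS]linearD.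
- by rewrite [ind_left_map _]linearD ktensDr [LHS]linearD.
by rewrite ind_left_mapE !act_ind_left ind_left_mapE.
Qed.

Definition ind_left_hom : left_hopf_hom (ind_left N) (ind_left N') :=
  @LeftHopfHom k H A (ind_left N) (ind_left N')
    (GRing.Linear.clone k (ind_left N) (ind_left N') _ ind_left_map _)
    map_colinear map_act.
End Map.

Let fmap1_ (N : lmodType B) : ind_left_hom (lmod_id N) = left_hopf_id (ind_left N).
Proof.
apply: left_hopf_hom_eq; apply: ind_left_eq => [s t|s t|n a].
- exact: linearD.
- exact: linearD.
- exact: ind_left_mapE.
Qed.

Let fmap_comp_ (N N' N'' : lmodType B) (g : lmod_hom N' N'') (f : lmod_hom N N') :
  ind_left_hom (lmod_comp g f) = left_hopf_comp (ind_left_hom g) (ind_left_hom f).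
Proof.
apply: left_hopf_hom_eq; apply: ind_left_eq => [s t|s t|n a].
- exact: linearD.
- exact: linearD.
- by rewrite [LHS]ind_left_mapE /= !ind_left_mapE.
Qed.

Definition ind_left_functor : functor (lmod_category B) (left_hopf_category A) :=
  @Functor (lmod_category B) (left_hopf_category A) (@ind_left k H A) ind_left_hom
    fmap1_ fmap_comp_.
End LeftInductionFunctor.

Section Galois.
Variables (k : fieldType) (H : coquasi_hopf k) (A : comodule_algebra H).
Local Notation B := (coinv_algebra A).

Definition can_tens (a b : A) : (A ⊗ H)%type :=
  \Sw_(a0, a1 <- rho a)
  \Sw_(b0, r1 <- rho b) \Sw_(b1, r2 <- comul r1)
  \Sw_(b2, r3 <- comul r2) \Sw_(b3, b4 <- comul r3)
    (omegaV (a1 ⊗ (hbeta b2 *: b1) ⊗ antipode b3) *: (amul (a0 ⊗ b0) ⊗ b4)).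

Definition can : btensor (right_regular A) (left_regular A) -> (A ⊗ H)%type :=
  bfold (N := right_regular A) (M := left_regular A) can_tens.

Lemma can_tens_balanced :
  rbalanced (N := right_regular A) (M := left_regular A) can_tens.
Proof.
have cE a b : can_tens a b = \Sw_(a0, a1 <- rho a)
  \Sw_(b0, r1 <- rho b) \Sw_(b1, r2 <- comul r1)
  \Sw_(b2, r3 <- comul r2) \Sw_(b3, b4 <- comul r3)
    ((hbeta b2 * omegaV (a1 ⊗ b1 ⊗ antipode b3)) *: (amul (a0 ⊗ b0) ⊗ b4)).
  apply: eq_kfold => a0 a1; apply: eq_kfold => b0 r1; apply: eq_kfold => b1 r2.
  apply: eq_kfold => b2 r3; apply: eq_kfold => b3 b4.
  by rewrite ktensZr ktensZl linearZ.
have cb : kbilinear can_tens by split=> *; rewrite !cE; klin.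
have [cl cr _] := kbilinear_balanced cb.
split=> [//|//|b x y].
rewrite -[LHS]/(can_tens (amul ((x : A) ⊗ coinv_val b)) y).
rewrite -[RHS]/(can_tens x (amul (coinv_val b ⊗ (y : A)))) !cE.
rewrite amul_rho_coinv_sw; last by kbil.
apply: eq_kfold => a0 a1.
rewrite amul_coinv_rho_sw; last by kbil.
apply: eq_kfold => b0 r1; apply: eq_kfold => b1 r2.
apply: eq_kfold => b2 r3; apply: eq_kfold => b3 b4.
by rewrite amulA_m // coinv_valP.
Qed.

Lemma canE (a b : A) :
  can (btens (a : right_regular A) (b : left_regular A)) = can_tens a b.
Proof. exact: bfold_btens can_tens_balanced. Qed.

Definition galois_extension : Prop := bijective can.

Definition total_integral (gamma : {linear H -> A}) : Prop :=
  colinear (M := regular_comodule H) gamma /\ gamma hone = aone.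

End Galois.
Arguments can {k H} A t.

(* Main.v *)
(* A total integral gamma yields the projection m |-> m_0 β(m_1) γ(S(m_2)) of a      *)
(* Hopf module onto its coinvariants, whence coinvariants are exact and the units of *)
(* both adjunctions are bijective.  If moreover can is surjective, averaging a linear *)
(* section of it gives a colinear translation map h |-> l(h) ⊗ r(h) with              *)
(* l(h) r(h)_0 ⊗ r(h)_1 = α(h_1) 1 ⊗ h_2; since m = (m_0 β(m_1) l(m_2)) r(m_2) with   *)
(* coinvariant first factors, every Hopf module is generated by its coinvariants, and *)
(* applying this to kernels gives the equivalences.                                   *)
(*   Conversely, can(a ⊗ b) = a . (b_0 ⊗ β(b_1) b_2) in the free left Hopf module     *)
(* A ⊗ H, whose coinvariants are the cotensor product A □ H = A; so can is onto as    *)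
(* soon as left Hopf modules are generated by their coinvariants.  Lifting of         *)
(* coinvariants along surjections makes A □ (-) right exact on finite-dimensional     *)
(* comodules, hence colinear maps into A extend, and Zorn's lemma produces gamma.     *)
(*   Left and right are exchanged by passing to the opposite multiplications, with    *)
(* antipode S^-1.  In the flat case the inverse of can provides the translation map,  *)
(* and l and r solve the descent problem for the kernel M^coH of m |-> ρ(m) - m ⊗ 1.  *)

Require Import Defs.
From HB Require Import structures.
From mathcomp Require Import all_boot all_order all_algebra.
From mathcomp Require Import boolp classical_sets ring.

Set Implicit Arguments.
Unset Strict Implicit.
Unset Printing Implicit Defensive.

Import GRing.Theory.
Local Open Scope quotient_scope.
Local Open Scope ring_scope.

(** * Sweedler calculus *)

(** Everything is tied to two elementary properties of Hopf modules on either side: each module is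
    generated over A by its coinvariants ([gen_right], [gen_left]), and coinvariants lift along
    surjections ([lift_right], [lift_left]). A total integral together with surjectivity of can
    implies all four ([total_conditions]); conversely the two properties on one side give back the
    total integral and the surjectivity of can ([left_conditions_total], [right_conditions_total]).

    Let γ be a total integral. The trace m ↦ m_0 β(m_1) γ(S(m_2)) is a natural projection onto
    coinvariants; it gives lifting and the bijectivity of the units of both adjunctions. Moreover γ
    yields a colinear retraction of the coaction of every Hopf module ([retr_rho]), with which
    linear lifts are averaged to colinear ones ([colinear_lift]). Averaging a linear section of can
    produces a translation map h ↦ l(h) ⊗ r(h) ([total_translation]). Then m_0 β(m_1) l(m_2) ⊗
    r(m_2) has coinvariant left factor ([tau_coinv]) and multiplies back to m ([tau_generates]), so
    right Hopf modules are generated by coinvariants; for left ones see [total_gen_left]. Applied to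
    kernels, generation gives bijective counits and faithful flatness.

    The associator enters these computations through the functional κ(a, h) = ω(a, S(h_1), α(h_2)
    h_3), which β cancels ([kappa_beta]). By means of κ and β the cotensor product V □ X is
    identified with the coinvariants of V ⊗ X' ([cot_kappaK], [cot_betaK]). For X = H this reads (A
    ⊗ H)^coH = A, and can becomes the counit of the left adjunction at A ⊗ H ([can_counit]):
    generation makes can surjective, bijective counits make it bijective. For finite-dimensional X,
    lifting of coinvariants says that colinear maps into A extend from a subcomodule, and Zorn's
    lemma gives γ ([lift_left_total]).

    An equivalence of categories gives generation because every module is isomorphic to an induced
    one, and lifting because induction reflects surjections ([equivalence_surj]). If A is Galois and
    faithfully flat on the left, the inverse of can is a translation map with values in A ⊗_B A
    ([galois_translation]), and the same element solves the descent problem for M^coH inside M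
    ([descent_adjoint_right]). The other side is reached by reversing all products, with the inverse
    of ω and the antipode S^-1. *)

Lemma kfold_linarg (k : fieldType) (M N P : lmodType k) (f : M -> N -> P) c t s u :
  kbilinear f -> t = c *: s + u -> kfold f t = c *: kfold f s + kfold f u.
Proof. by move=> fb ->; exact: kfoldP. Qed.

Lemma lin_sum (k : fieldType) (P : lmodType k) (I : Type) (r : seq I) (F G E : I -> P) c :
  (forall i, F i = c *: G i + E i) ->
  \sum_(i <- r) F i = c *: \sum_(i <- r) G i + \sum_(i <- r) E i.
Proof.
by move=> e; rewrite scaler_sumr -big_split; apply: eq_bigr => i _; exact: e.
Qed.

Section ScalarLinear.
Variables (k : fieldType) (M N : lmodType k) (c : k).

Lemma kfold_lin_k (f g h : M -> N -> k) t :
  (forall m n, f m n = c * g m n + h m n) -> kfold f t = c * kfold g t + kfold h t.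
Proof. exact: (kfold_lin (P := k^o)). Qed.

Lemma kfold_linarg_k (f : M -> N -> k) t s u :
  kbilinear (P := k^o) f -> t = c *: s + u -> kfold f t = c * kfold f s + kfold f u.
Proof. exact: kfold_linarg. Qed.

Lemma lin_sum_k (I : Type) (r : seq I) (F G E : I -> k) :
  (forall i, F i = c * G i + E i) ->
  \sum_(i <- r) F i = c * \sum_(i <- r) G i + \sum_(i <- r) E i.
Proof. exact: (lin_sum (P := k^o)). Qed.
End ScalarLinear.

(** The redefinition also passes through finite sums, scalar-valued folds and folds nested inside
    terms. *)
Ltac klin ::=
  cbv beta;
  lazymatch goal with
  | |- kfold _ ?t = _ *: kfold _ ?t + _ => apply: kfold_lin => ? ?; klin
  | |- kfold _ _ = _ *: kfold _ _ + _ =>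
      apply: kfold_linarg; [split=> ? ? ? ?; klin|klin_term]
  | |- kfold _ ?t = _ * kfold _ ?t + _ => apply: kfold_lin_k => ? ?; klin
  | |- kfold _ _ = _ * kfold _ _ + _ =>
      apply: kfold_linarg_k; [split=> ? ? ? ?; klin|klin_term]
  | |- bigop _ _ _ = _ *: _ + _ => apply: lin_sum => ?; klin
  | |- bigop _ _ _ = _ * _ + _ => apply: lin_sum_k => ?; klin
  | |- ?x = _ => klin_term
  end.
Ltac klin_term ::=
  lazymatch goal with
  | |- _ *: _ + _ = _ *: _ + _ => reflexivity
  | |- kfold _ _ = _ => klin
  | |- bigop _ _ _ = _ => klin
  | |- ktens _ ?n = _ *: ktens _ ?n + _ => refine (lin_tensl _ _); klin_term
  | |- ktens ?m _ = _ *: ktens ?m _ + _ => refine (lin_tensr _ _); klin_term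
  | |- _ *: ?m = _ *: (_ *: ?m) + _ => refine (lin_scalel _ _); klin_term
  | |- ?a *: _ = _ *: (?a *: _) + _ => refine (lin_scaler _ _); klin_term
  | |- _ * ?b = _ * (_ * ?b) + _ => refine (lin_mull _ _); klin_term
  | |- ?a * _ = _ * (?a * _) + _ => refine (lin_mulr _ _); klin_term
  | |- _ * ?b = _ *: (_ * ?b) + _ => refine (lin_mull _ _); klin_term
  | |- ?a * _ = _ *: (?a * _) + _ => refine (lin_mulr _ _); klin_term
  | |- _ = _ *: _ + _ =>
      first [refine (lin_app _ _); klin_term | refine (lin_scalar _ _); klin_term]
  | |- _ = _ * _ + _ => refine (lin_scalar _ _); klin_term
  end.

Definition linof (k : fieldType) (M P : lmodType k) (f : M -> P) (fl : linear f) :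
  {linear M -> P} := HB.pack f (GRing.isLinear.Build k M P _ f fl).

Section Lift.
Variables (k : fieldType) (M N P : lmodType k).

(* Opaque, since otherwise [kliftE] unifies with the scaling of tensors. *)
Lemma klift_sig (f : M -> N -> P) : kbilinear f ->
  {g : {linear (M ⊗ N)%type -> P} | forall m n, g (m ⊗ n) = f m n}.
Proof.
move=> fb; exists (linof (fun c s t => kfoldP c s t fb)) => m n.
exact: kfold_tens.
Qed.

Definition klift f (fb : kbilinear f) : {linear (M ⊗ N)%type -> P} :=
  sval (klift_sig fb).

Lemma kliftE f (fb : kbilinear f) m n : klift fb (m ⊗ n) = f m n.
Proof. exact: (svalP (klift_sig fb)). Qed.

Lemma klinear_eq (f g : (M ⊗ N)%type -> P) : linear f -> linear g ->
  (forall m n, f (m ⊗ n) = g (m ⊗ n)) -> f =1 g.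
Proof.
move=> fl gl e; elim/ktensor_ind => [//|s t IHs IHt|].
  by have := fl 1 s t; have := gl 1 s t; rewrite !scale1r IHs IHt => -> ->.
have z (h : (M ⊗ N)%type -> P) : linear h -> h 0 = 0.
  move=> hl; have /esym/eqP := hl 1 0 0.
  by rewrite !scale1r addr0 -subr_eq0 addrK => /eqP.
by rewrite !z.
Qed.
End Lift.

Section TensorFold.
Variables (k : fieldType) (M N P Q : lmodType k).

Lemma ktens_kfoldr (x : P) (f : M -> N -> Q) t :
  x ⊗ kfold f t = kfold (fun m n => x ⊗ f m n) t.
Proof. exact: (kfold_linear (linof (fun c y z => ktensPr c x y z))). Qed.

Lemma ktens_kfoldl (f : M -> N -> P) (y : Q) t :
  kfold f t ⊗ y = kfold (fun m n => f m n ⊗ y) t.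
Proof. exact: (kfold_linear (linof (fun c x z => ktensPl c x z y))). Qed.
End TensorFold.

Section CounitSweedler.
Variables (k : fieldType) (C : coalgebra k) (Q : lmodType k) (f : C -> Q).
Hypothesis fl : linear f.

Lemma counitl_sw c : \Sw_(c1, c2 <- comul c) (counit c1 *: f c2) = f c.
Proof.
rewrite -[in RHS](counit_l c) -[f _]/(linof fl _) kfold_linear.
by apply: eq_kfold => a b; rewrite linearZ.
Qed.

Lemma counitr_sw c : \Sw_(c1, c2 <- comul c) (counit c2 *: f c1) = f c.
Proof.
rewrite -[in RHS](counit_r c) -[f _]/(linof fl _) kfold_linear.
by apply: eq_kfold => a b; rewrite linearZ.
Qed.
End CounitSweedler.

Section TensorCoalgebra.
Variables (k : fieldType) (C D : coalgebra k).

Definition tcomul_fun (c : C) (d : D) : ((C ⊗ D) ⊗ (C ⊗ D))%type :=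
  \Sw_(c1, c2 <- comul c) \Sw_(d1, d2 <- comul d) ((c1 ⊗ d1) ⊗ (c2 ⊗ d2)).
Lemma tcomul_bil : kbilinear tcomul_fun.
Proof. rewrite /tcomul_fun; kbil. Qed.
Definition tcomul := klift tcomul_bil.
Lemma tcounit_bil : kbilinear (P := k^o) (fun (c : C) (d : D) => counit c * counit d).
Proof. kbil. Qed.
Definition tcounit : {scalar (C ⊗ D)%type} := klift tcounit_bil.

Lemma tcomul_sw (Q : lmodType k) (F : (C ⊗ D)%type -> (C ⊗ D)%type -> Q) c d :
  kbilinear F ->
  kfold F (tcomul (c ⊗ d)) =
  \Sw_(c1, c2 <- comul c) \Sw_(d1, d2 <- comul d) F (c1 ⊗ d1) (c2 ⊗ d2).
Proof.
move=> Fb; rewrite kliftE kfold_kfold //; apply: eq_kfold => c1 c2.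
by rewrite kfold_kfold //; apply: eq_kfold => d1 d2; rewrite kfold_tens.
Qed.

Lemma tcomulA x :
  \Sw_(h1, r <- tcomul x) \Sw_(h2, h3 <- tcomul r) (h1 ⊗ h2 ⊗ h3) =
  \Sw_(l, h3 <- tcomul x) \Sw_(h1, h2 <- tcomul l) (h1 ⊗ h2 ⊗ h3).
Proof.
move: x; apply: klinear_eq => [? ? ?|? ? ?|c d]; [by klin|by klin|].
rewrite !tcomul_sw; [|by kbil|by kbil].
under eq_kfold => c1 c2 do under eq_kfold => d1 d2 do
  (rewrite tcomul_sw; last by kbil).
under [RHS]eq_kfold => c1 c2 do under eq_kfold => d1 d2 do
  (rewrite tcomul_sw; last by kbil).
under eq_kfold => c1 c2 do rewrite kfold_exchange.
under [RHS]eq_kfold => c1 c2 do rewrite kfold_exchange.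
rewrite comulA_sw; last by ktril.
apply: eq_kfold => l c3; apply: eq_kfold => c1 c2.
by rewrite comulA_sw //; ktril.
Qed.

Lemma tcounit_l x : \Sw_(h1, h2 <- tcomul x) (tcounit h1 *: h2) = x.
Proof.
move: x; apply: klinear_eq => [? ? ?|? ? ?|c d]; [by klin|by []|].
rewrite tcomul_sw; last by kbil.
rewrite -[RHS](@counitl_sw _ _ _ (fun c => c ⊗ d) _ c); last by move=> ? ? ?; klin.
apply: eq_kfold => c1 c2.
rewrite -(@counitl_sw _ _ _ (fun d => c2 ⊗ d) _ d); last by move=> ? ? ?; klin.
by rewrite -kfoldZ; apply: eq_kfold => d1 d2; rewrite kliftE scalerA.
Qed.

Lemma tcounit_r x : \Sw_(h1, h2 <- tcomul x) (tcounit h2 *: h1) = x.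
Proof.
move: x; apply: klinear_eq => [? ? ?|? ? ?|c d]; [by klin|by []|].
rewrite tcomul_sw; last by kbil.
rewrite -[RHS](@counitr_sw _ _ _ (fun c => c ⊗ d) _ c); last by move=> ? ? ?; klin.
apply: eq_kfold => c1 c2.
rewrite -(@counitr_sw _ _ _ (fun d => c1 ⊗ d) _ d); last by move=> ? ? ?; klin.
by rewrite -kfoldZ; apply: eq_kfold => d1 d2; rewrite kliftE scalerA.
Qed.

Definition tcoalg : coalgebra k := Coalgebra tcomulA tcounit_l tcounit_r.
End TensorCoalgebra.

(* Scalar-valued Sweedler sums live in [k] itself, not in [k^o]: the following *)
(* are instances of the corresponding general lemmas that rewrite there.        *)
Section ScalarFold.
Variables (k : fieldType) (M N : lmodType k).
Implicit Types (f : M -> N -> k) (a : k).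

Lemma kfoldMl a f t : a * kfold f t = kfold (fun m n => a * f m n) t.
Proof. exact: mulr_sumr. Qed.

Lemma kfoldMr a f t : kfold f t * a = kfold (fun m n => f m n * a) t.
Proof. exact: mulr_suml. Qed.

Lemma kfold_tens_k f m n : kbilinear (P := k^o) f -> kfold f (m ⊗ n) = f m n.
Proof. exact: kfold_tens. Qed.

Lemma kfold_kfold_k (M' N' : lmodType k) f (F : M' -> N' -> (M ⊗ N)%type) t :
  kbilinear (P := k^o) f -> kfold f (kfold F t) = kfold (fun m' n' => kfold f (F m' n')) t.
Proof. exact: kfold_kfold. Qed.

Lemma scalar_eq (u v : {scalar M}) : u =1 v -> u = v.
Proof. exact: (@linear_eq k M k^o). Qed.

Definition scalof (f : M -> k) (fl : linear (f : M -> k^o)) : {scalar M} := linof fl.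
End ScalarFold.

Section ScalarCoalgebra.
Variables (k : fieldType) (C : coalgebra k).

Lemma comulA_k (F : C -> C -> C -> k) h : ktrilinear (Q := k^o) F ->
  \Sw_(h1, r <- comul h) \Sw_(h2, h3 <- comul r) F h1 h2 h3 =
  \Sw_(l, h3 <- comul h) \Sw_(h1, h2 <- comul l) F h1 h2 h3.
Proof. exact: comulA_sw. Qed.

Lemma counitl_k (f : C -> k) c : linear (f : C -> k^o) ->
  \Sw_(c1, c2 <- comul c) (counit c1 * f c2) = f c.
Proof. by move=> fl; exact: (@counitl_sw k C k^o f fl). Qed.

Lemma counitr_k (f : C -> k) c : linear (f : C -> k^o) ->
  \Sw_(c1, c2 <- comul c) (counit c2 * f c1) = f c.
Proof. by move=> fl; exact: (@counitr_sw k C k^o f fl). Qed.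
End ScalarCoalgebra.

(** * Convolution of functionals with functionals and with vector-valued maps *)

Section Convolution.
Variables (k : fieldType) (C : coalgebra k).
Implicit Types u v w : {scalar C}.

Lemma conv_linear u v :
  linear ((fun c => \Sw_(c1, c2 <- comul c) (u c1 * v c2)) : C -> k^o).
Proof. by move=> a x y; klin. Qed.
Definition conv u v : {scalar C} := scalof (conv_linear u v).
Lemma convE u v c : conv u v c = \Sw_(c1, c2 <- comul c) (u c1 * v c2).
Proof. by []. Qed.

Lemma convA u v w : conv u (conv v w) = conv (conv u v) w.
Proof.
apply: scalar_eq => c; rewrite convE.
under eq_kfold => c1 c2 do rewrite kfoldMl.
rewrite comulA_k; last by ktril.
apply: eq_kfold => l c3; rewrite kfoldMr; apply: eq_kfold => c1 c2.
by rewrite mulrA.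
Qed.

Lemma conv1l u : conv counit u = u.
Proof. by apply: scalar_eq => c; apply: counitl_k => ? ? ?; klin. Qed.

Lemma conv1r u : conv u counit = u.
Proof.
apply: scalar_eq => c; rewrite -[RHS](@counitr_k _ _ u) ?convE.
  by apply: eq_kfold => a b; rewrite mulrC.
by move=> ? ? ?; klin.
Qed.
End Convolution.

Section VectorConvolution.
Variables (k : fieldType) (C : coalgebra k) (Q : lmodType k).
Implicit Types (u v : {scalar C}) (f : {linear C -> Q}).

Lemma lconv_linear u f : linear (fun c => \Sw_(c1, c2 <- comul c) (u c1 *: f c2)).
Proof. by move=> a x y; klin. Qed.
Lemma rconv_linear f u : linear (fun c => \Sw_(c1, c2 <- comul c) (u c2 *: f c1)).
Proof. by move=> a x y; klin. Qed.
Definition lconv u f : {linear C -> Q} := linof (lconv_linear u f).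
Definition rconv f u : {linear C -> Q} := linof (rconv_linear f u).

Lemma lconvA u v f : lconv u (lconv v f) = lconv (conv u v) f.
Proof.
apply: linear_eq => c; rewrite /lconv /=.
under eq_kfold => c1 c2 do rewrite -kfoldZ.
rewrite comulA_sw; last by ktril.
apply: eq_kfold => l c3; rewrite -kfoldZr; apply: eq_kfold => c1 c2.
by rewrite scalerA.
Qed.

Lemma rconvA f u v : rconv (rconv f u) v = rconv f (conv u v).
Proof.
apply: linear_eq => c; rewrite /rconv /=.
under eq_kfold => l c3 do rewrite -kfoldZ.
rewrite -comulA_sw; last by ktril.
apply: eq_kfold => c1 r; rewrite -kfoldZr; apply: eq_kfold => c2 c3.
by rewrite scalerA mulrC.
Qed.

Lemma lrconvA u f v : lconv u (rconv f v) = rconv (lconv u f) v.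
Proof.
apply: linear_eq => c; rewrite /rconv /lconv /=.
under eq_kfold => c1 r do rewrite -kfoldZ.
rewrite comulA_sw; last by ktril.
apply: eq_kfold => l c3; rewrite -kfoldZ; apply: eq_kfold => c2 c1.
by rewrite !scalerA mulrC.
Qed.

Lemma lconv1 f : lconv counit f = f.
Proof. by apply: linear_eq => c; apply: counitl_sw => a x y; rewrite linearP. Qed.

Lemma rconv1 f : rconv f counit = f.
Proof. by apply: linear_eq => c; apply: counitr_sw => a x y; rewrite linearP. Qed.

(** Multiplying f * u = u * g by the inverse v on both sides gives g * v = v * f. This converts
    associativity up to [omega] into associativity up to [omegaV]. *)
Lemma conv_intertwine u v (f g : {linear C -> Q}) :
  conv u v = counit -> conv v u = counit -> rconv f u = lconv u g ->
  rconv g v = lconv v f.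
Proof.
by move=> uv vu e; rewrite -[f]rconv1 -uv -rconvA e -lrconvA lconvA vu lconv1.
Qed.
End VectorConvolution.
Section QuadriLinear.
Variables (k : fieldType) (M N O P Q : lmodType k).

Definition kquadrilinear (f : M -> N -> O -> P -> Q) : Prop :=
  [/\ forall c m m' n o p, f (c *: m + m') n o p = c *: f m n o p + f m' n o p,
      forall c m n n' o p, f m (c *: n + n') o p = c *: f m n o p + f m n' o p,
      forall c m n o o' p, f m n (c *: o + o') p = c *: f m n o p + f m n o' p
    & forall c m n o p p', f m n o (c *: p + p') = c *: f m n o p + f m n o p'].

Lemma klift4_sig f : kquadrilinear f ->
  {g : {linear (M ⊗ N ⊗ O ⊗ P)%type -> Q} |
    forall m n o p, g (m ⊗ n ⊗ o ⊗ p) = f m n o p}.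
Proof.
case=> f1 f2 f3 f4.
have b1 p o : kbilinear (fun m n => f m n o p) by split=> *.
have b2 p : kbilinear (fun s o => \Sw_(m, n <- s) f m n o p).
  by split=> *; [exact: kfoldP|exact: kfold_lin].
have b3 : kbilinear (fun r p => \Sw_(s, o <- r) \Sw_(m, n <- s) f m n o p).
  by split=> *; [exact: kfoldP|apply: kfold_lin => *; exact: kfold_lin].
by exists (klift b3) => m n o p; rewrite kliftE !kfold_tens.
Qed.
Definition klift4 f (fq : kquadrilinear f) := sval (klift4_sig fq).
Lemma klift4E f (fq : kquadrilinear f) m n o p :
  klift4 fq (m ⊗ n ⊗ o ⊗ p) = f m n o p.
Proof. exact: (svalP (klift4_sig fq)). Qed.

Lemma klinear3_eq (f g : {linear (M ⊗ N ⊗ O)%type -> Q}) :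
  (forall m n o, f (m ⊗ n ⊗ o) = g (m ⊗ n ⊗ o)) -> f =1 g.
Proof.
move=> e; apply: klinear_eq => [? ? ?|? ? ?|t o]; try exact: linearP.
by move: t; apply: klinear_eq => [? ? ?|? ? ?|m n]; [klin|klin|].
Qed.
Lemma klinear4_eq (f g : {linear (M ⊗ N ⊗ O ⊗ P)%type -> Q}) :
  (forall m n o p, f (m ⊗ n ⊗ o ⊗ p) = g (m ⊗ n ⊗ o ⊗ p)) -> f =1 g.
Proof.
move=> e; apply: klinear_eq => [? ? ?|? ? ?|t p]; try exact: linearP.
move: t; apply: klinear_eq => [? ? ?|? ? ?|t o]; [klin|klin|].
by move: t; apply: klinear_eq => [? ? ?|? ? ?|m n]; [klin|klin|].
Qed.
End QuadriLinear.
Definition kscal4 (k : fieldType) (M N O P : lmodType k) (f : M -> N -> O -> P -> k)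
  (fq : kquadrilinear (Q := k^o) f) : {scalar (M ⊗ N ⊗ O ⊗ P)%type} := klift4 fq.
Lemma kscal4E (k : fieldType) (M N O P : lmodType k) (f : M -> N -> O -> P -> k)
  (fq : kquadrilinear (Q := k^o) f) m n o p : kscal4 fq (m ⊗ n ⊗ o ⊗ p) = f m n o p.
Proof. exact: (@klift4E k M N O P k^o f fq). Qed.
Lemma scalar4_eq (k : fieldType) (M N O P : lmodType k)
  (f g : {scalar (M ⊗ N ⊗ O ⊗ P)%type}) :
  (forall m n o p, f (m ⊗ n ⊗ o ⊗ p) = g (m ⊗ n ⊗ o ⊗ p)) -> f = g.
Proof. by move=> e; apply: scalar_eq; exact: (klinear4_eq (Q := k^o)). Qed.
Ltac kquad := split=> ? ? ? ? ? ?; klin.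

(** * The pentagon as an equation between convolution products *)

Section Cocycle.
Variables (k : fieldType) (H : coquasi_bialgebra k).
Implicit Types h g x y : H.

Definition H3 : coalgebra k := tcoalg (tcoalg H H) H.
Definition H4 : coalgebra k := tcoalg H3 H.

Lemma conv4E (u v : {scalar H4}) h g x y :
  conv u v (h ⊗ g ⊗ x ⊗ y) =
  \Sw_(h1, h2 <- comul h) \Sw_(g1, g2 <- comul g) \Sw_(x1, x2 <- comul x)
  \Sw_(y1, y2 <- comul y)
    (u (h1 ⊗ g1 ⊗ x1 ⊗ y1) * v (h2 ⊗ g2 ⊗ x2 ⊗ y2)).
Proof.
rewrite convE [LHS](tcomul_sw (Q := k^o)); last by kbil.
rewrite [LHS](tcomul_sw (Q := k^o)); last by kbil.
by rewrite [LHS](tcomul_sw (Q := k^o)) //; kbil.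
Qed.

Section Pieces.
Variable w : {scalar (H ⊗ H ⊗ H)%type}.
Lemma piece_hg_x_y_quad : kquadrilinear (Q := k^o)
  (fun h g x y => w (hmul (h ⊗ g) ⊗ x ⊗ y)).
Proof. kquad. Qed.
Lemma piece_h_g_xy_quad : kquadrilinear (Q := k^o)
  (fun h g x y => w (h ⊗ g ⊗ hmul (x ⊗ y))).
Proof. kquad. Qed.
Lemma piece_g_x_y_quad : kquadrilinear (Q := k^o)
  (fun h g x y => counit h * w (g ⊗ x ⊗ y)).
Proof. kquad. Qed.
Lemma piece_h_gx_y_quad : kquadrilinear (Q := k^o)
  (fun h g x y => w (h ⊗ hmul (g ⊗ x) ⊗ y)).
Proof. kquad. Qed.
Lemma piece_h_g_x_quad : kquadrilinear (Q := k^o)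
  (fun h g x y => w (h ⊗ g ⊗ x) * counit y).
Proof. kquad. Qed.
(** The five faces of the pentagon: the name shows how the four arguments are bracketed, and an
    argument that is missing from the name is absorbed by the counit. *)
Definition w_hg_x_y : {scalar H4} := kscal4 piece_hg_x_y_quad.
Definition w_h_g_xy : {scalar H4} := kscal4 piece_h_g_xy_quad.
Definition w_g_x_y : {scalar H4} := kscal4 piece_g_x_y_quad.
Definition w_h_gx_y : {scalar H4} := kscal4 piece_h_gx_y_quad.
Definition w_h_g_x : {scalar H4} := kscal4 piece_h_g_x_quad.
End Pieces.

Definition convo_inverse (w v : {scalar (H ⊗ H ⊗ H)%type}) : Prop :=
  forall h g x,
    \Sw_(h1, h2 <- comul h) \Sw_(g1, g2 <- comul g) \Sw_(x1, x2 <- comul x)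
      (w (h1 ⊗ g1 ⊗ x1) * v (h2 ⊗ g2 ⊗ x2)) = counit h * counit g * counit x.

Lemma counit4E h g x y : counit (c := H4) (h ⊗ g ⊗ x ⊗ y) =
  counit h * counit g * counit x * counit y.
Proof. by rewrite /= /tcounit !kliftE. Qed.

Section Inverse.
Variables (w v : {scalar (H ⊗ H ⊗ H)%type}) (wv : convo_inverse w v).

Lemma conv_hg_x_y : conv (w_hg_x_y w) (w_hg_x_y v) = counit.
Proof.
apply: scalar4_eq => h g x y; rewrite conv4E counit4E.
rewrite -counit_mul -wv comul_mul kfold_kfold_k; last by kbil.
apply: eq_kfold => h1 h2; rewrite kfold_kfold_k; last by kbil.
apply: eq_kfold => g1 g2; rewrite kfold_tens_k; last by kbil.
by apply: eq_kfold => x1 x2; apply: eq_kfold => y1 y2; rewrite !kscal4E.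
Qed.

Lemma conv_h_g_xy : conv (w_h_g_xy w) (w_h_g_xy v) = counit.
Proof.
apply: scalar4_eq => h g x y; rewrite conv4E counit4E.
rewrite -mulrA -(counit_mul x y) -wv.
apply: eq_kfold => h1 h2; apply: eq_kfold => g1 g2.
rewrite comul_mul kfold_kfold_k; last by kbil.
apply: eq_kfold => x1 x2; rewrite kfold_kfold_k; last by kbil.
apply: eq_kfold => y1 y2; rewrite kfold_tens_k; last by kbil.
by rewrite !kscal4E.
Qed.

Lemma conv_h_gx_y : conv (w_h_gx_y w) (w_h_gx_y v) = counit.
Proof.
apply: scalar4_eq => h g x y; rewrite conv4E counit4E.
rewrite -[counit h * _ * _]mulrA -(counit_mul g x) -wv.
apply: eq_kfold => h1 h2; rewrite comul_mul kfold_kfold_k; last by kbil.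
apply: eq_kfold => g1 g2; rewrite kfold_kfold_k; last by kbil.
apply: eq_kfold => x1 x2; rewrite kfold_tens_k; last by kbil.
by apply: eq_kfold => y1 y2; rewrite !kscal4E.
Qed.

Lemma conv_g_x_y : conv (w_g_x_y w) (w_g_x_y v) = counit.
Proof.
apply: scalar4_eq => h g x y; rewrite conv4E counit4E.
transitivity (\Sw_(h1, h2 <- comul h)
    (counit h1 * (counit h2 * (counit g * counit x * counit y)))).
  apply: eq_kfold => h1 h2; rewrite -wv !kfoldMl.
  apply: eq_kfold => g1 g2; rewrite !kfoldMl; apply: eq_kfold => x1 x2.
  rewrite !kfoldMl; apply: eq_kfold => y1 y2; rewrite !kscal4E; ring.
rewrite (@counitl_k _ _ (fun h => counit h * _)) ?mulrA //.
by move=> ? ? ?; klin.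
Qed.

Lemma conv_h_g_x : conv (w_h_g_x w) (w_h_g_x v) = counit.
Proof.
apply: scalar4_eq => h g x y; rewrite conv4E counit4E.
rewrite -wv kfoldMr; apply: eq_kfold => h1 h2; rewrite kfoldMr.
apply: eq_kfold => g1 g2; rewrite kfoldMr; apply: eq_kfold => x1 x2.
rewrite -(@counitl_k _ _ counit y) ?kfoldMl.
  by apply: eq_kfold => y1 y2; rewrite !kscal4E; ring.
by move=> ? ? ?; klin.
Qed.
End Inverse.

(** In this form faces can be cancelled one at a time, which is how all variants of the pentagon
    below are obtained. *)
Lemma cocycle_conv : conv (w_h_g_xy omega) (w_hg_x_y omega) =
  conv (w_g_x_y omega) (conv (w_h_gx_y omega) (w_h_g_x omega)) :> {scalar H4}.
Proof.
apply: scalar4_eq => h g x y; rewrite !conv4E.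
transitivity (\Sw_(h1, h2 <- comul h) \Sw_(g1, g2 <- comul g)
    \Sw_(x1, x2 <- comul x) \Sw_(y1, y2 <- comul y)
      (omega (h1 ⊗ g1 ⊗ hmul (x1 ⊗ y1)) * omega (hmul (h2 ⊗ g2) ⊗ x2 ⊗ y2))).
  by do 4!apply: eq_kfold => ? ?; rewrite !kscal4E.
rewrite omega_cocycle.
(* The face without h contributes only a counit of h; it is inserted here to match the iterated
   comultiplication on the other side. *)
transitivity (\Sw_(h1, h2 <- comul h) (counit h1 * (\Sw_(h1, h2 <- comul h2)
   \Sw_(g1, g' <- comul g) \Sw_(g2, g3 <- comul g')
    \Sw_(x1, x' <- comul x) \Sw_(x2, x3 <- comul x')
    \Sw_(y1, y2 <- comul y)
      (omega (g1 ⊗ x1 ⊗ y1) * omega (h1 ⊗ hmul (g2 ⊗ x2) ⊗ y2) *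
       omega (h2 ⊗ g3 ⊗ x3))))).
  by rewrite counitl_k // => ? ? ?; klin.
apply: eq_kfold => h1 h2; rewrite !kfoldMl.
under [RHS]eq_kfold => g1 g' do under eq_kfold => x1 x' do under eq_kfold => y1 y' do
  rewrite kscal4E conv4E kfoldMl.
under [RHS]eq_kfold => g1 g' do under eq_kfold => x1 x' do rewrite kfold_exchange.
under [RHS]eq_kfold => g1 g' do rewrite kfold_exchange.
rewrite [RHS]kfold_exchange; apply: eq_kfold => m n; rewrite kfoldMl.
apply: eq_kfold => g1 g'; rewrite kfoldMl.
under [RHS]eq_kfold => x1 x' do under eq_kfold => y1 y' do rewrite kfoldMl.
under [RHS]eq_kfold => x1 x' do rewrite kfold_exchange.
rewrite [RHS]kfold_exchange; apply: eq_kfold => g2 g3; rewrite kfoldMl.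
apply: eq_kfold => x1 x'; rewrite kfoldMl.
under [RHS]eq_kfold => y1 y' do rewrite kfoldMl.
rewrite [RHS]kfold_exchange; apply: eq_kfold => x2 x3; rewrite kfoldMl.
apply: eq_kfold => y1 y'; rewrite kfoldMl.
rewrite -(@counitr_k _ _ (fun y' => omega (m ⊗ hmul (g2 ⊗ x2) ⊗ y')) y');
  last by move=> ? ? ?; klin.
rewrite kfoldMl kfoldMr kfoldMl; apply: eq_kfold => y2 y3.
by rewrite !kscal4E; ring.
Qed.

Section WithCounit.
Variables (w : {scalar (H ⊗ H ⊗ H)%type}) (v : {scalar H4}).

Lemma conv_g_x_yl h g x y : conv (w_g_x_y w) v (h ⊗ g ⊗ x ⊗ y) =
  \Sw_(g1, g2 <- comul g) \Sw_(x1, x2 <- comul x) \Sw_(y1, y2 <- comul y)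
    (w (g1 ⊗ x1 ⊗ y1) * v (h ⊗ g2 ⊗ x2 ⊗ y2)).
Proof.
rewrite conv4E -[RHS](@counitl_k _ _ (fun h => \Sw_(g1, g2 <- comul g)
  \Sw_(x1, x2 <- comul x) \Sw_(y1, y2 <- comul y)
    (w (g1 ⊗ x1 ⊗ y1) * v (h ⊗ g2 ⊗ x2 ⊗ y2)))); last by move=> ? ? ?; klin.
apply: eq_kfold => h1 h2; rewrite kfoldMl; apply: eq_kfold => g1 g2.
rewrite kfoldMl; apply: eq_kfold => x1 x2.
by rewrite kfoldMl; apply: eq_kfold => y1 y2; rewrite kscal4E mulrA.
Qed.

Lemma conv_g_x_yr h g x y : conv v (w_g_x_y w) (h ⊗ g ⊗ x ⊗ y) =
  \Sw_(g1, g2 <- comul g) \Sw_(x1, x2 <- comul x) \Sw_(y1, y2 <- comul y)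
    (v (h ⊗ g1 ⊗ x1 ⊗ y1) * w (g2 ⊗ x2 ⊗ y2)).
Proof.
rewrite conv4E -[RHS](@counitr_k _ _ (fun h => \Sw_(g1, g2 <- comul g)
  \Sw_(x1, x2 <- comul x) \Sw_(y1, y2 <- comul y)
    (v (h ⊗ g1 ⊗ x1 ⊗ y1) * w (g2 ⊗ x2 ⊗ y2)))); last by move=> ? ? ?; klin.
apply: eq_kfold => h1 h2; rewrite kfoldMl; apply: eq_kfold => g1 g2.
rewrite kfoldMl; apply: eq_kfold => x1 x2.
by rewrite kfoldMl; apply: eq_kfold => y1 y2; rewrite kscal4E; ring.
Qed.

Lemma conv_h_g_xl h g x y : conv (w_h_g_x w) v (h ⊗ g ⊗ x ⊗ y) =
  \Sw_(h1, h2 <- comul h) \Sw_(g1, g2 <- comul g) \Sw_(x1, x2 <- comul x)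
    (w (h1 ⊗ g1 ⊗ x1) * v (h2 ⊗ g2 ⊗ x2 ⊗ y)).
Proof.
rewrite conv4E; apply: eq_kfold => h1 h2; apply: eq_kfold => g1 g2.
apply: eq_kfold => x1 x2; rewrite -[in RHS](@counitl_k _ _ (fun y => v (h2 ⊗ g2 ⊗ x2 ⊗ y)) y);
  last by move=> ? ? ?; klin.
by rewrite kfoldMl; apply: eq_kfold => y1 y2; rewrite kscal4E mulrA.
Qed.

Lemma conv_h_g_xr h g x y : conv v (w_h_g_x w) (h ⊗ g ⊗ x ⊗ y) =
  \Sw_(h1, h2 <- comul h) \Sw_(g1, g2 <- comul g) \Sw_(x1, x2 <- comul x)
    (v (h1 ⊗ g1 ⊗ x1 ⊗ y) * w (h2 ⊗ g2 ⊗ x2)).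
Proof.
rewrite conv4E; apply: eq_kfold => h1 h2; apply: eq_kfold => g1 g2.
apply: eq_kfold => x1 x2; rewrite -[in RHS](@counitr_k _ _ (fun y => v (h1 ⊗ g1 ⊗ x1 ⊗ y)) y);
  last by move=> ? ? ?; klin.
by rewrite kfoldMr; apply: eq_kfold => y1 y2; rewrite kscal4E; ring.
Qed.
End WithCounit.

Let wK := @omegaK k H.
Let wVK := @omegaVK k H.

(** The pentagon with [w_g_x_y] and [w_h_gx_y] cancelled on the left of one side and [w_hg_x_y] on
    the right of the other. This mixed form yields the associativity of free left Hopf modules. *)
Lemma cocycle_hg_x_yV h g x y :
  \Sw_(h1, h2 <- comul h) \Sw_(g1, g2 <- comul g) \Sw_(x1, x2 <- comul x)
    (omega (h1 ⊗ g1 ⊗ x1) * omegaV (hmul (h2 ⊗ g2) ⊗ x2 ⊗ y)) =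
  \Sw_(h1, h2 <- comul h) \Sw_(g1, g' <- comul g) \Sw_(x1, x' <- comul x)
  \Sw_(y1, y' <- comul y) (omegaV (h1 ⊗ hmul (g1 ⊗ x1) ⊗ y1) *
    \Sw_(g2, g3 <- comul g') \Sw_(x2, x3 <- comul x') \Sw_(y2, y3 <- comul y')
      (omegaV (g2 ⊗ x2 ⊗ y2) * omega (h2 ⊗ g3 ⊗ hmul (x3 ⊗ y3)))).
Proof.
have: conv (w_h_g_x omega) (w_hg_x_y omegaV) =
    conv (w_h_gx_y omegaV) (conv (w_g_x_y omegaV) (w_h_g_xy omega)).
  rewrite -[w_h_g_xy _]conv1r -(conv_hg_x_y wK) [conv (w_h_g_xy _) _]convA.
  rewrite cocycle_conv -!convA [conv (w_g_x_y omegaV) _]convA (conv_g_x_y wVK) conv1l.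
  by rewrite [conv (w_h_gx_y omegaV) _]convA (conv_h_gx_y wVK) conv1l.
move/(congr1 (fun u : {scalar H4} => u (h ⊗ g ⊗ x ⊗ y))).
rewrite conv_h_g_xl conv4E => e; etransitivity; [|etransitivity; first exact: e].
  by do 3!apply: eq_kfold => ? ?; rewrite kscal4E.
do 4!apply: eq_kfold => ? ?; rewrite kscal4E conv_g_x_yl; congr (_ * _).
by do 3!apply: eq_kfold => ? ?; rewrite kscal4E.
Qed.

(** The pentagon with [w_h_g_xy] cancelled on the left and [w_h_g_x] on the right; it is needed for
    [kappa_cocycle]. *)
Lemma cocycle_h_g_xV h g x y :
  \Sw_(h1, h2 <- comul h) \Sw_(g1, g2 <- comul g) \Sw_(x1, x2 <- comul x)
    (omega (hmul (h1 ⊗ g1) ⊗ x1 ⊗ y) * omegaV (h2 ⊗ g2 ⊗ x2)) =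
  \Sw_(h1, h2 <- comul h) \Sw_(g1, g' <- comul g) \Sw_(x1, x' <- comul x)
  \Sw_(y1, y' <- comul y) (omegaV (h1 ⊗ g1 ⊗ hmul (x1 ⊗ y1)) *
    \Sw_(g2, g3 <- comul g') \Sw_(x2, x3 <- comul x') \Sw_(y2, y3 <- comul y')
      (omega (g2 ⊗ x2 ⊗ y2) * omega (h2 ⊗ hmul (g3 ⊗ x3) ⊗ y3))).
Proof.
have: conv (w_hg_x_y omega) (w_h_g_x omegaV) =
    conv (w_h_g_xy omegaV) (conv (w_g_x_y omega) (w_h_gx_y omega)).
  rewrite -[w_h_gx_y _]conv1r -(conv_h_g_x wK) [conv (w_h_gx_y _) _]convA.
  rewrite [conv (w_g_x_y omega) _]convA -cocycle_conv -!convA.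
  by rewrite [conv (w_h_g_xy omegaV) _]convA (conv_h_g_xy wVK) conv1l.
move/(congr1 (fun u : {scalar H4} => u (h ⊗ g ⊗ x ⊗ y))).
rewrite conv_h_g_xr conv4E => e; etransitivity; [|etransitivity; first exact: e].
  by do 3!apply: eq_kfold => ? ?; rewrite kscal4E.
do 4!apply: eq_kfold => ? ?; rewrite kscal4E conv_g_x_yl; congr (_ * _).
by do 3!apply: eq_kfold => ? ?; rewrite kscal4E.
Qed.

(** Both sides of the pentagon inverted. With all arguments reversed this is the pentagon for
    [omega_op]. *)
Lemma cocycleV h g x y :
  \Sw_(h1, h2 <- comul h) \Sw_(g1, g2 <- comul g) \Sw_(x1, x2 <- comul x)
  \Sw_(y1, y2 <- comul y)
    (omegaV (hmul (h1 ⊗ g1) ⊗ x1 ⊗ y1) * omegaV (h2 ⊗ g2 ⊗ hmul (x2 ⊗ y2))) =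
  \Sw_(h1, h2 <- comul h) \Sw_(g1, g' <- comul g) \Sw_(x1, x' <- comul x)
    (omegaV (h1 ⊗ g1 ⊗ x1) *
    \Sw_(g2, g3 <- comul g') \Sw_(x2, x3 <- comul x') \Sw_(y1, y2 <- comul y)
      (omegaV (h2 ⊗ hmul (g2 ⊗ x2) ⊗ y1) * omegaV (g3 ⊗ x3 ⊗ y2))).
Proof.
have: conv (w_hg_x_y omegaV) (w_h_g_xy omegaV) =
    conv (w_h_g_x omegaV) (conv (w_h_gx_y omegaV) (w_g_x_y omegaV)).
  rewrite -[LHS]conv1l -(conv_h_g_x wVK) -convA; congr conv.
  rewrite -[RHS]conv1r -(conv_h_g_xy wK) -convA.
  rewrite -[w_h_g_xy omega as X in conv X _]conv1r.
  rewrite -(conv_hg_x_y wK) [conv (w_h_g_xy _) _]convA cocycle_conv.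
  rewrite -!convA [conv (w_g_x_y omegaV) _]convA (conv_g_x_y wVK) conv1l.
  by rewrite [conv (w_h_gx_y omegaV) _]convA (conv_h_gx_y wVK) conv1l.
move/(congr1 (fun u : {scalar H4} => u (h ⊗ g ⊗ x ⊗ y))).
rewrite conv_h_g_xl conv4E => e; etransitivity; [|etransitivity; first exact: e].
  by do 4!apply: eq_kfold => ? ?; rewrite !kscal4E.
do 3!apply: eq_kfold => ? ?; rewrite conv_g_x_yr; congr (_ * _).
by do 3!apply: eq_kfold => ? ?; rewrite kscal4E.
Qed.

Lemma comul3_sw (Q : lmodType k) (G : H3 -> H3 -> Q) h g x : kbilinear G ->
  kfold G (comul (c := H3) (h ⊗ g ⊗ x)) =
  \Sw_(h1, h2 <- comul h) \Sw_(g1, g2 <- comul g) \Sw_(x1, x2 <- comul x)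
    G (h1 ⊗ g1 ⊗ x1) (h2 ⊗ g2 ⊗ x2).
Proof.
move=> [Gl Gr]; rewrite [LHS]tcomul_sw // [LHS]tcomul_sw //.
by split=> *; apply: kfold_lin => *; rewrite ?ktensPl; [exact: Gl|exact: Gr].
Qed.

Lemma conv_inverse3 (w v : {scalar (H ⊗ H ⊗ H)%type}) : convo_inverse w v ->
  conv (w : {scalar H3}) (v : {scalar H3}) = counit.
Proof.
move=> wv; apply: scalar_eq; apply: (klinear3_eq (Q := k^o)) => h g x.
rewrite [LHS](comul3_sw (Q := k^o)); last by kbil.
by rewrite [LHS]wv /= /tcounit !kliftE.
Qed.

(** Associativity says that [omega] intertwines the two triple products; [conv_intertwine] reverses
    the direction. *)
Lemma hmulA_V h g x :
  \Sw_(h1, h2 <- comul h) \Sw_(g1, g2 <- comul g) \Sw_(x1, x2 <- comul x)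
    (omegaV (h2 ⊗ g2 ⊗ x2) *: hmul (hmul (h1 ⊗ g1) ⊗ x1)) =
  \Sw_(h1, h2 <- comul h) \Sw_(g1, g2 <- comul g) \Sw_(x1, x2 <- comul x)
    (omegaV (h1 ⊗ g1 ⊗ x1) *: hmul (h2 ⊗ hmul (g2 ⊗ x2))).
Proof.
have b1 : kbilinear (fun (p : (H ⊗ H)%type) (x : H) =>
  \Sw_(h, g <- p) hmul (h ⊗ hmul (g ⊗ x))) by kbil.
have b2 : kbilinear (fun (p : (H ⊗ H)%type) (x : H) => hmul (hmul p ⊗ x)) by kbil.
pose f : {linear H3 -> H} := klift b1; pose f' : {linear H3 -> H} := klift b2.
have fE h' g' x' : f (h' ⊗ g' ⊗ x') = hmul (h' ⊗ hmul (g' ⊗ x')).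
  by rewrite /f kliftE kfold_tens //; kbil.
have f'E h' g' x' : f' (h' ⊗ g' ⊗ x') = hmul (hmul (h' ⊗ g') ⊗ x').
  by rewrite /f' kliftE.
have: rconv f' (omegaV : {scalar H3}) = lconv (omegaV : {scalar H3}) f.
  apply: (conv_intertwine (conv_inverse3 wK) (conv_inverse3 wVK)).
  apply: linear_eq; apply: klinear3_eq => h' g' x'.
  rewrite /rconv /lconv /= !comul3_sw; [|by kbil|by kbil].
  under eq_kfold => ? ? do under eq_kfold => ? ? do under eq_kfold => ? ? do rewrite fE.
  by rewrite hmulA; do 3!apply: eq_kfold => ? ?; rewrite f'E.
move/(congr1 (fun u : {linear H3 -> H} => u (h ⊗ g ⊗ x))).
rewrite /rconv /lconv /= !comul3_sw; [|by kbil|by kbil] => e.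
etransitivity; [|etransitivity; first exact: e].
  by do 3!apply: eq_kfold => ? ?; rewrite f'E.
by do 3!apply: eq_kfold => ? ?; rewrite fE.
Qed.
End Cocycle.
(** * The opposite Hopf algebra and the opposite comodule algebra *)

(* [swx n] exchanges the [n]th and the [n.+1]st Sweedler sums of the left-hand *)
(* side, counting from 0.                                                       *)
Tactic Notation "swx" int_or_var(n) := etransitivity;
  [do n (apply: eq_kfold => ? ?); refine (kfold_exchange _ _ _)|].

Section TriLift.
Variables (k : fieldType) (M N O : lmodType k).

Lemma kscal3_sig (f : M -> N -> O -> k) : ktrilinear (Q := k^o) f ->
  {g : {scalar (M ⊗ N ⊗ O)%type} | forall m n o, g (m ⊗ n ⊗ o) = f m n o}.
Proof.
case=> f1 f2 f3.
have b1 o : kbilinear (P := k^o) (fun m n => f m n o) by split=> *.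
have b2 : kbilinear (P := k^o) (fun s o => \Sw_(m, n <- s) f m n o).
  by split=> *; [exact: kfoldP|exact: kfold_lin].
exists (klift b2 : {scalar _}) => m n o.
rewrite -[RHS](kfold_tens_k m n (b1 o)); exact: (kliftE b2).
Qed.
Definition kscal3 f (ft : ktrilinear (Q := k^o) f) : {scalar (M ⊗ N ⊗ O)%type} :=
  sval (kscal3_sig ft).
Lemma kscal3E f (ft : ktrilinear (Q := k^o) f) m n o : kscal3 ft (m ⊗ n ⊗ o) = f m n o.
Proof. exact: (svalP (kscal3_sig ft)). Qed.
End TriLift.

Section OmegaVUnits.
Variables (k : fieldType) (H : coquasi_bialgebra k).
Implicit Types h g x : H.

(** With 1 in one place [omega] is the unit for convolution, so convolving with it leaves [omegaV]
    unchanged, while the product is the counit. The other two places are treated alike. *)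
Lemma omegaV_1r h g : omegaV (h ⊗ g ⊗ hone) = counit h * counit g.
Proof.
have := omegaK h g hone; rewrite counit_one mulr1 => <-.
rewrite -[LHS](@counitl_k _ _ (fun h => omegaV (h ⊗ g ⊗ hone)));
  last by move=> ? ? ?; klin.
apply: eq_kfold => h1 h2.
rewrite -(@counitl_k _ _ (fun g => omegaV (h2 ⊗ g ⊗ hone)) g);
  last by move=> ? ? ?; klin.
rewrite kfoldMl; apply: eq_kfold => g1 g2.
by rewrite (comul_one_sw (Q := k^o)) ?omega_1r ?mulrA //; kbil.
Qed.

Lemma omegaV_1m h g : omegaV (h ⊗ hone ⊗ g) = counit h * counit g.
Proof.
have := omegaK h hone g; rewrite counit_one mulr1 => <-.
rewrite -[LHS](@counitl_k _ _ (fun h => omegaV (h ⊗ hone ⊗ g)));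
  last by move=> ? ? ?; klin.
apply: eq_kfold => h1 h2; rewrite (comul_one_sw (Q := k^o)); last by kbil.
rewrite -(@counitl_k _ _ (fun g => omegaV (h2 ⊗ hone ⊗ g)) g);
  last by move=> ? ? ?; klin.
by rewrite kfoldMl; apply: eq_kfold => g1 g2; rewrite omega_normal mulrA.
Qed.

Lemma omegaV_1l h g : omegaV (hone ⊗ h ⊗ g) = counit h * counit g.
Proof.
have := omegaK hone h g; rewrite counit_one mul1r => <-.
rewrite (comul_one_sw (Q := k^o)); last by kbil.
rewrite -[LHS](@counitl_k _ _ (fun h => omegaV (hone ⊗ h ⊗ g)));
  last by move=> ? ? ?; klin.
apply: eq_kfold => h1 h2.
rewrite -(@counitl_k _ _ (fun g => omegaV (hone ⊗ h2 ⊗ g)) g);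
  last by move=> ? ? ?; klin.
by rewrite kfoldMl; apply: eq_kfold => g1 g2; rewrite omega_1l mulrA.
Qed.
End OmegaVUnits.

Section OppositeBialgebra.
Variables (k : fieldType) (H : coquasi_bialgebra k).
Implicit Types h g x y : H.

Lemma hmul_op_bil : kbilinear (fun h g : H => hmul (g ⊗ h)). Proof. kbil. Qed.
Definition hmul_op := klift hmul_op_bil.
Lemma hmul_opE h g : hmul_op (h ⊗ g) = hmul (g ⊗ h). Proof. exact: kliftE. Qed.

Lemma omega_op_tril : ktrilinear (Q := k^o) (fun h g x : H => omegaV (x ⊗ g ⊗ h)).
Proof. ktril. Qed.
(** Reversing products reverses the direction of reassociation too, hence the inverse functional
    together with the reversed arguments. *)
Definition omega_op := kscal3 omega_op_tril.
Lemma omega_opE h g x : omega_op (h ⊗ g ⊗ x) = omegaV (x ⊗ g ⊗ h).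
Proof. exact: kscal3E. Qed.
Lemma omegaV_op_tril : ktrilinear (Q := k^o) (fun h g x : H => omega (x ⊗ g ⊗ h)).
Proof. ktril. Qed.
Definition omegaV_op := kscal3 omegaV_op_tril.
Lemma omegaV_opE h g x : omegaV_op (h ⊗ g ⊗ x) = omega (x ⊗ g ⊗ h).
Proof. exact: kscal3E. Qed.

Let comul_mul_op h g : comul (hmul_op (h ⊗ g)) =
  \Sw_(h1, h2 <- comul h) \Sw_(g1, g2 <- comul g) (hmul_op (h1 ⊗ g1) ⊗ hmul_op (h2 ⊗ g2)).
Proof.
rewrite hmul_opE comul_mul kfold_exchange.
by do 2!apply: eq_kfold => ? ?; rewrite !hmul_opE.
Qed.

Let counit_mul_op h g : counit (hmul_op (h ⊗ g)) = counit h * counit g.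
Proof. by rewrite hmul_opE counit_mul mulrC. Qed.

Let omegaK_op h g x :
  \Sw_(h1, h2 <- comul h) \Sw_(g1, g2 <- comul g) \Sw_(x1, x2 <- comul x)
    (omega_op (h1 ⊗ g1 ⊗ x1) * omegaV_op (h2 ⊗ g2 ⊗ x2)) =
  counit h * counit g * counit x.
Proof.
rewrite (_ : _ * _ = counit x * counit g * counit h); last by ring.
rewrite -omegaVK.
swx 0; swx 1; swx 0; do 3!apply: eq_kfold => ? ?.
by rewrite omega_opE omegaV_opE.
Qed.

Let omegaVK_op h g x :
  \Sw_(h1, h2 <- comul h) \Sw_(g1, g2 <- comul g) \Sw_(x1, x2 <- comul x)
    (omegaV_op (h1 ⊗ g1 ⊗ x1) * omega_op (h2 ⊗ g2 ⊗ x2)) =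
  counit h * counit g * counit x.
Proof.
rewrite (_ : _ * _ = counit x * counit g * counit h); last by ring.
rewrite -omegaK.
swx 0; swx 1; swx 0; do 3!apply: eq_kfold => ? ?.
by rewrite omega_opE omegaV_opE.
Qed.

Let hmulA_op h g x :
  \Sw_(h1, h2 <- comul h) \Sw_(g1, g2 <- comul g) \Sw_(x1, x2 <- comul x)
    (omega_op (h2 ⊗ g2 ⊗ x2) *: hmul_op (h1 ⊗ hmul_op (g1 ⊗ x1))) =
  \Sw_(h1, h2 <- comul h) \Sw_(g1, g2 <- comul g) \Sw_(x1, x2 <- comul x)
    (omega_op (h1 ⊗ g1 ⊗ x1) *: hmul_op (hmul_op (h2 ⊗ g2) ⊗ x2)).
Proof.
swx 0; swx 1; swx 0; symmetry; swx 0; swx 1; swx 0.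
transitivity (\Sw_(x1, x2 <- comul x) \Sw_(g1, g2 <- comul g) \Sw_(h1, h2 <- comul h)
  (omegaV (x1 ⊗ g1 ⊗ h1) *: hmul (x2 ⊗ hmul (g2 ⊗ h2)))).
  by do 3!apply: eq_kfold => ? ?; rewrite omega_opE !hmul_opE.
by rewrite -hmulA_V; do 3!apply: eq_kfold => ? ?; rewrite omega_opE !hmul_opE.
Qed.

Let omega_cocycle_op h g x y :
  \Sw_(h1, h2 <- comul h) \Sw_(g1, g2 <- comul g)
  \Sw_(x1, x2 <- comul x) \Sw_(y1, y2 <- comul y)
    (omega_op (h1 ⊗ g1 ⊗ hmul_op (x1 ⊗ y1)) * omega_op (hmul_op (h2 ⊗ g2) ⊗ x2 ⊗ y2)) =
  \Sw_(h1, h2 <- comul h)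
  \Sw_(g1, g' <- comul g) \Sw_(g2, g3 <- comul g')
  \Sw_(x1, x' <- comul x) \Sw_(x2, x3 <- comul x')
  \Sw_(y1, y2 <- comul y)
    (omega_op (g1 ⊗ x1 ⊗ y1) * omega_op (h1 ⊗ hmul_op (g2 ⊗ x2) ⊗ y2) *
     omega_op (h2 ⊗ g3 ⊗ x3)).
Proof.
swx 0; swx 1; swx 2; swx 0; swx 1; swx 0.
transitivity (\Sw_(y1, y2 <- comul y) \Sw_(x1, x2 <- comul x) \Sw_(g1, g2 <- comul g)
  \Sw_(h1, h2 <- comul h)
    (omegaV (hmul (y1 ⊗ x1) ⊗ g1 ⊗ h1) * omegaV (y2 ⊗ x2 ⊗ hmul (g2 ⊗ h2)))).
  by do 4!apply: eq_kfold => ? ?; rewrite !omega_opE !hmul_opE.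
rewrite cocycleV; symmetry.
swx 4; swx 3; swx 2; swx 1; swx 0; swx 3; swx 2; swx 1; swx 2; swx 4; swx 3; swx 4.
do 3!apply: eq_kfold => ? ?; rewrite kfoldMl; apply: eq_kfold => ? ?.
rewrite kfoldMl; apply: eq_kfold => ? ?; rewrite kfoldMl; apply: eq_kfold => ? ?.
by rewrite !omega_opE !hmul_opE mulrA.
Qed.

Let omega_normal_op h g : omega_op (h ⊗ hone ⊗ g) = counit h * counit g.
Proof. by rewrite omega_opE omegaV_1m mulrC. Qed.

Let hmul1l_op h : hmul_op (hone ⊗ h) = h.
Proof. by rewrite hmul_opE hmul1r. Qed.
Let hmul1r_op h : hmul_op (h ⊗ hone) = h.
Proof. by rewrite hmul_opE hmul1l. Qed.

Definition coquasi_bialgebra_op : coquasi_bialgebra k :=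
  CoquasiBialgebra comul_mul_op counit_mul_op (comul_one H) (counit_one H)
    omegaK_op omegaVK_op hmulA_op hmul1l_op hmul1r_op omega_cocycle_op omega_normal_op.
End OppositeBialgebra.

Section OppositeHopf.
Variables (k : fieldType) (H : coquasi_hopf k) (T : {linear H -> H}).
Hypotheses (ST : cancel (@antipode k H) T) (TS : cancel T (@antipode k H)).
Implicit Types h g x y : H.

Lemma comul_antipode_sw (Q : lmodType k) (F : H -> H -> Q) h : kbilinear F ->
  kfold F (comul (antipode h)) = \Sw_(h1, h2 <- comul h) F (antipode h2) (antipode h1).
Proof.
move=> Fb; rewrite comul_antipode kfold_kfold //.
by apply: eq_kfold => a b; rewrite kfold_tens.
Qed.

Lemma comul_antipode_k (F : H -> H -> k) h : kbilinear (P := k^o) F ->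
  kfold F (comul (antipode h)) = \Sw_(h1, h2 <- comul h) F (antipode h2) (antipode h1).
Proof. exact: comul_antipode_sw. Qed.

Lemma antipode_one : antipode hone = hone :> H.
Proof.
have := antipode_alpha (hone : H).
rewrite comul_one_sw; last by kbil.
rewrite comul_one_sw; last by kbil.
by rewrite halpha_one !scale1r hmul1r.
Qed.

Lemma antipodeV_one : T hone = hone.
Proof. by rewrite -[in LHS]antipode_one ST. Qed.

Let comul_T h : comul (T h) = \Sw_(h1, h2 <- comul h) (T h2 ⊗ T h1).
Proof.
rewrite -[in RHS](TS h) comul_antipode_sw; last by kbil.
by rewrite -[LHS]kfold_id; apply: eq_kfold => a b; rewrite !ST.
Qed.

Let counit_T h : counit (T h) = counit h.
Proof. by rewrite -[in RHS](TS h) counit_antipode. Qed.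

Lemma halphaV_lin : linear ((fun h => halpha (T h)) : H -> k^o).
Proof. by move=> ? ? ?; klin. Qed.
Lemma hbetaV_lin : linear ((fun h => hbeta (T h)) : H -> k^o).
Proof. by move=> ? ? ?; klin. Qed.

Let Hop := coquasi_bialgebra_op H.

(** For h = S(g) the anti-comultiplicativity of S reverses the three legs, and the identity becomes
    the axiom for α at g. *)
Let antipode_alpha_op h :
  \Sw_(h1, r <- comul h) \Sw_(h2, h3 <- comul r)
    @hmul k Hop ((scalof halphaV_lin h2 *: T h1) ⊗ h3) = scalof halphaV_lin h *: hone.
Proof.
rewrite -[h]TS; move: (T h) => g.
transitivity (\Sw_(h1, r <- comul (antipode g)) \Sw_(h2, h3 <- comul r)
    hmul (h3 ⊗ (halpha (T h2) *: T h1))).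
  by do 2!apply: eq_kfold => ? ?; rewrite hmul_opE.
rewrite comul_antipode_sw; last by kbil.
transitivity (\Sw_(l, g3 <- comul g) \Sw_(g1, g2 <- comul l)
    hmul ((halpha g2 *: antipode g1) ⊗ g3)).
  apply: eq_kfold => l g3; rewrite comul_antipode_sw; last by kbil.
  by apply: eq_kfold => g1 g2; rewrite !ST ktensZr ktensZl.
rewrite -comulA_sw; last by ktril.
by rewrite antipode_alpha /= ST.
Qed.

Let antipode_beta_op h :
  \Sw_(h1, r <- comul h) \Sw_(h2, h3 <- comul r)
    @hmul k Hop ((scalof hbetaV_lin h2 *: h1) ⊗ T h3) = scalof hbetaV_lin h *: hone.
Proof.
rewrite -[h]TS; move: (T h) => g.
transitivity (\Sw_(h1, r <- comul (antipode g)) \Sw_(h2, h3 <- comul r)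
    hmul (T h3 ⊗ (hbeta (T h2) *: h1))).
  by do 2!apply: eq_kfold => ? ?; rewrite hmul_opE.
rewrite comul_antipode_sw; last by kbil.
transitivity (\Sw_(l, g3 <- comul g) \Sw_(g1, g2 <- comul l)
    hmul ((hbeta g2 *: g1) ⊗ antipode g3)).
  apply: eq_kfold => l g3; rewrite comul_antipode_sw; last by kbil.
  by apply: eq_kfold => g1 g2; rewrite !ST ktensZr ktensZl.
rewrite -comulA_sw; last by ktril.
by rewrite antipode_beta /= ST.
Qed.

(** Under h = S(g) this is the axiom [omegaV_antipode]: passing to the opposite exchanges the two
    normalizations. *)
Let omega_antipode_op h :
  \Sw_(h1, r1 <- comul h) \Sw_(h2, r2 <- comul r1)
  \Sw_(h3, r3 <- comul r2) \Sw_(h4, h5 <- comul r3)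
    @omega k Hop ((scalof hbetaV_lin h2 *: h1) ⊗ T h3 ⊗ (scalof halphaV_lin h4 *: h5)) =
  counit h.
Proof.
rewrite -[h]TS; move: (T h) => g; rewrite counit_antipode -omegaV_antipode.
transitivity (\Sw_(h1, r1 <- comul (antipode g)) \Sw_(h2, r2 <- comul r1)
  \Sw_(h3, r3 <- comul r2) \Sw_(h4, h5 <- comul r3)
    omegaV ((halpha (T h4) *: h5) ⊗ T h3 ⊗ (hbeta (T h2) *: h1))).
  by do 4!apply: eq_kfold => ? ?; rewrite [LHS]omega_opE.
rewrite comul_antipode_k; last by kbil.
under eq_kfold => l h1 do (rewrite comul_antipode_k; last by kbil).
under eq_kfold => l h1 do under eq_kfold => l2 h2 do
  (rewrite comul_antipode_k; last by kbil).
under eq_kfold => l h1 do under eq_kfold => l2 h2 do under eq_kfold => l3 h3 do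
  (rewrite comul_antipode_k; last by kbil).
rewrite -comulA_k; last by ktril.
under eq_kfold => l r do rewrite kfold_exchange.
rewrite -comulA_k; last by ktril.
under eq_kfold => l r do under eq_kfold => h3 r' do rewrite kfold_exchange.
under eq_kfold => l r do rewrite kfold_exchange.
rewrite -comulA_k; last by ktril.
do 4!apply: eq_kfold => ? ?.
by rewrite !ST !(ktensZl, ktensZr) !linearZ /=; ring.
Qed.

Let omegaV_antipode_op h :
  \Sw_(h1, r1 <- comul h) \Sw_(h2, r2 <- comul r1)
  \Sw_(h3, r3 <- comul r2) \Sw_(h4, h5 <- comul r3)
    @omegaV k Hop (T h1 ⊗ (scalof halphaV_lin h2 *: (scalof hbetaV_lin h4 *: h3)) ⊗ T h5) =
  counit h.
Proof.
rewrite -[h]TS; move: (T h) => g; rewrite counit_antipode -omega_antipode.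
transitivity (\Sw_(h1, r1 <- comul (antipode g)) \Sw_(h2, r2 <- comul r1)
  \Sw_(h3, r3 <- comul r2) \Sw_(h4, h5 <- comul r3)
    omega (T h5 ⊗ (halpha (T h2) *: (hbeta (T h4) *: h3)) ⊗ T h1)).
  by do 4!apply: eq_kfold => ? ?; rewrite [LHS]omegaV_opE.
rewrite comul_antipode_k; last by kbil.
under eq_kfold => l h1 do (rewrite comul_antipode_k; last by kbil).
under eq_kfold => l h1 do under eq_kfold => l2 h2 do
  (rewrite comul_antipode_k; last by kbil).
under eq_kfold => l h1 do under eq_kfold => l2 h2 do under eq_kfold => l3 h3 do
  (rewrite comul_antipode_k; last by kbil).
rewrite -comulA_k; last by ktril.
under eq_kfold => l r do rewrite kfold_exchange.
rewrite -comulA_k; last by ktril.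
under eq_kfold => l r do under eq_kfold => h3 r' do rewrite kfold_exchange.
under eq_kfold => l r do rewrite kfold_exchange.
rewrite -comulA_k; last by ktril.
do 4!apply: eq_kfold => ? ?.
by rewrite !ST !(ktensZl, ktensZr) !linearZ /=; ring.
Qed.

Let halpha_one_op : scalof halphaV_lin hone = 1.
Proof. by rewrite /= antipodeV_one halpha_one. Qed.
Let hbeta_one_op : scalof hbetaV_lin hone = 1.
Proof. by rewrite /= antipodeV_one hbeta_one. Qed.

Definition coquasi_hopf_op : coquasi_hopf k :=
  @CoquasiHopf k Hop T (scalof halphaV_lin) (scalof hbetaV_lin) comul_T counit_T
    antipode_alpha_op antipode_beta_op omega_antipode_op omegaV_antipode_op
    halpha_one_op hbeta_one_op.
End OppositeHopf.
Section TriLiftVector.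
Variables (k : fieldType) (M N O Q : lmodType k).

Lemma klift3_sig (f : M -> N -> O -> Q) : ktrilinear f ->
  {g : {linear (M ⊗ N ⊗ O)%type -> Q} | forall m n o, g (m ⊗ n ⊗ o) = f m n o}.
Proof.
case=> f1 f2 f3.
have b1 o : kbilinear (fun m n => f m n o) by split=> *.
have b2 : kbilinear (fun s o => \Sw_(m, n <- s) f m n o).
  by split=> *; [exact: kfoldP|exact: kfold_lin].
by exists (klift b2) => m n o; rewrite kliftE kfold_tens.
Qed.
Definition klift3 f (ft : ktrilinear f) := sval (klift3_sig ft).
Lemma klift3E f (ft : ktrilinear f) m n o : klift3 ft (m ⊗ n ⊗ o) = f m n o.
Proof. exact: (svalP (klift3_sig ft)). Qed.
End TriLiftVector.

Section TwistInverse.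
Variables (k : fieldType) (H : coquasi_bialgebra k) (U V W : comodule H).
Variables (Q : lmodType k) (w v : {scalar (H ⊗ H ⊗ H)%type}).
Hypothesis wv : convo_inverse w v.

(** Coassociativity collects the two twists into the convolution product of w and v, evaluated on
    one leg of each vector, and [wv] makes it the counit. It inverts associativity laws, in both
    directions between [omega] and [omegaV]. *)
Lemma twist_inverse (F G : U -> V -> W -> Q) : ktrilinear G ->
  (forall x y z, F x y z = \Sw_(x0, x1 <- rho x) \Sw_(y0, y1 <- rho y)
    \Sw_(z0, z1 <- rho z) (w (x1 ⊗ y1 ⊗ z1) *: G x0 y0 z0)) ->
  forall x y z, \Sw_(x0, x1 <- rho x) \Sw_(y0, y1 <- rho y)
    \Sw_(z0, z1 <- rho z) (v (x1 ⊗ y1 ⊗ z1) *: F x0 y0 z0) = G x y z.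
Proof.
move=> Gt FG x y z; pose g := klift3 Gt.
have gE a b c : G a b c = g (a ⊗ b ⊗ c) by rewrite klift3E.
under eq_kfold => x0 x1 do under eq_kfold => y0 y1 do under eq_kfold => z0 z1 do
  (rewrite FG -kfoldZ; under eq_kfold => a b do
    (rewrite -kfoldZ; under eq_kfold => c d do
      (rewrite -kfoldZ; under eq_kfold => e f do rewrite gE))).
swx 2; swx 1; rewrite -rhoA_sw; last by ktril.
swx 3.
under eq_kfold => x0 x' do under eq_kfold => x1 x2 do
  (rewrite -rhoA_sw; last by ktril).
under eq_kfold => x0 x' do under eq_kfold => x1 x2 do under eq_kfold => y0 y' do
  under eq_kfold => y1 y2 do (rewrite -rhoA_sw; last by ktril).
swx 1; swx 3; swx 2.
rewrite gE -[RHS](rho_counit_sw (f := fun x => g (x ⊗ y ⊗ z))); last first.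
  by move=> ? ? ?; klin.
apply: eq_kfold => x0 x'.
rewrite -[in RHS](rho_counit_sw (f := fun y => g (x0 ⊗ y ⊗ z))); last first.
  by move=> ? ? ?; klin.
rewrite -kfoldZ; apply: eq_kfold => y0 y'.
rewrite -[in RHS](rho_counit_sw (f := fun z => g (x0 ⊗ y0 ⊗ z))); last first.
  by move=> ? ? ?; klin.
rewrite -kfoldZ -kfoldZ; apply: eq_kfold => z0 z'.
rewrite !scalerA -wv -kfoldZr; apply: eq_kfold => a b.
rewrite -kfoldZr; apply: eq_kfold => c d.
by rewrite -kfoldZr; apply: eq_kfold => e f; rewrite scalerA mulrC.
Qed.
End TwistInverse.

Section InverseAssociativity.
Variables (k : fieldType) (H : coquasi_bialgebra k) (A : comodule_algebra H).

Lemma amulA_V (a b c : A) : amul (a ⊗ amul (b ⊗ c)) =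
  \Sw_(a0, a1 <- rho a) \Sw_(b0, b1 <- rho b) \Sw_(c0, c1 <- rho c)
    (omegaV (a1 ⊗ b1 ⊗ c1) *: amul (amul (a0 ⊗ b0) ⊗ c0)).
Proof.
symmetry; move: a b c.
apply: (@twist_inverse k H A A A A omega omegaV (@omegaK k H)
  (fun a b c => amul (amul (a ⊗ b) ⊗ c)) (fun a b c => amul (a ⊗ amul (b ⊗ c)))).
  by ktril.
exact: amulA.
Qed.

Lemma lactA_V (M : left_hopf_module A) (a b : A) (m : M) : lact (a ⊗ lact (b ⊗ m)) =
  \Sw_(a0, a1 <- rho a) \Sw_(b0, b1 <- rho b) \Sw_(c0, c1 <- rho m)
    (omegaV (a1 ⊗ b1 ⊗ c1) *: lact (amul (a0 ⊗ b0) ⊗ c0)).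
Proof.
symmetry; move: a b m.
apply: (@twist_inverse k H A A M M omega omegaV (@omegaK k H)
  (fun a b c => lact (amul (a ⊗ b) ⊗ c)) (fun a b c => lact (a ⊗ lact (b ⊗ c)))).
  by ktril.
exact: lactA.
Qed.
End InverseAssociativity.

Section OppositeAlgebra.
Variables (k : fieldType) (H : coquasi_bialgebra k) (A : comodule_algebra H).
Let Hop := coquasi_bialgebra_op H.

Lemma amul_op_bil : kbilinear (fun a b : A => amul (b ⊗ a)). Proof. kbil. Qed.
Definition amul_op := klift amul_op_bil.
Lemma amul_opE a b : amul_op (a ⊗ b) = amul (b ⊗ a). Proof. exact: kliftE. Qed.

Let rho_amul_op a b : rho (amul_op (a ⊗ b)) =
  \Sw_(a0, a1 <- rho a) \Sw_(b0, b1 <- rho b) (amul_op (a0 ⊗ b0) ⊗ @hmul k Hop (a1 ⊗ b1)).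
Proof.
rewrite amul_opE rho_amul kfold_exchange.
by do 2!apply: eq_kfold => ? ?; rewrite amul_opE [in RHS]hmul_opE.
Qed.

Let amul1l_op a : amul_op (aone ⊗ a) = a.
Proof. by rewrite amul_opE amul1r. Qed.
Let amul1r_op a : amul_op (a ⊗ aone) = a.
Proof. by rewrite amul_opE amul1l. Qed.

Let amulA_op a b c : amul_op (amul_op (a ⊗ b) ⊗ c) =
  \Sw_(a0, a1 <- rho a) \Sw_(b0, b1 <- rho b) \Sw_(c0, c1 <- rho c)
    (@omega k Hop (a1 ⊗ b1 ⊗ c1) *: amul_op (a0 ⊗ amul_op (b0 ⊗ c0))).
Proof.
rewrite !amul_opE amulA_V; swx 0; swx 1; swx 0.
by do 3!apply: eq_kfold => ? ?; rewrite [in RHS]omega_opE !amul_opE.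
Qed.

Definition comodule_algebra_op : comodule_algebra Hop :=
  @ComoduleAlgebra k Hop (ca_comod A) amul_op aone rho_amul_op (rho_aone A)
    amul1l_op amul1r_op amulA_op.

Section RightOfLeft.
Variable M : left_hopf_module A.
Lemma ract_op_bil : kbilinear (fun (m : M) (a : A) => lact (a ⊗ m)). Proof. kbil. Qed.
Definition ract_op := klift ract_op_bil.
Lemma ract_opE m a : ract_op (m ⊗ a) = lact (a ⊗ m). Proof. exact: kliftE. Qed.

Let rho_ract_op m a : rho (ract_op (m ⊗ a)) =
  \Sw_(m0, m1 <- rho m) \Sw_(a0, a1 <- rho a) (ract_op (m0 ⊗ a0) ⊗ @hmul k Hop (m1 ⊗ a1)).
Proof.
rewrite ract_opE rho_lact kfold_exchange.
by do 2!apply: eq_kfold => ? ?; rewrite ract_opE [in RHS]hmul_opE.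
Qed.

Let ract1_op m : ract_op (m ⊗ aone) = m.
Proof. by rewrite ract_opE lact1. Qed.

Let ractA_op m a b : ract_op (ract_op (m ⊗ a) ⊗ b) =
  \Sw_(m0, m1 <- rho m) \Sw_(a0, a1 <- rho a) \Sw_(b0, b1 <- rho b)
    (@omega k Hop (m1 ⊗ a1 ⊗ b1) *: ract_op (m0 ⊗ amul_op (a0 ⊗ b0))).
Proof.
rewrite !ract_opE lactA_V; swx 0; swx 1; swx 0.
by do 3!apply: eq_kfold => ? ?; rewrite [in RHS]omega_opE ract_opE amul_opE.
Qed.

(** The underlying comodule is kept as it is, so that coinvariants and colinear maps on the two
    sides agree by conversion. *)
Definition right_of_left : right_hopf_module comodule_algebra_op :=
  @RightHopfModule k Hop comodule_algebra_op (lhm_comod M) ract_op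
    rho_ract_op ract1_op ractA_op.
End RightOfLeft.

Section RightOfLeftOp.
Variable M : left_hopf_module comodule_algebra_op.

Lemma ract_unop_bil : kbilinear (fun (m : M) (a : A) => @lact k Hop comodule_algebra_op M (a ⊗ m)).
Proof. kbil. Qed.
Definition ract_unop : {linear (lhm_comod M ⊗ A)%type -> lhm_comod M} := klift ract_unop_bil.
Lemma ract_unopE m a : ract_unop (m ⊗ a) = @lact k Hop comodule_algebra_op M (a ⊗ m).
Proof. exact: kliftE. Qed.

Let rho_ract_unop m a : rho (ract_unop (m ⊗ a)) =
  \Sw_(m0, m1 <- rho m) \Sw_(a0, a1 <- rho a) (ract_unop (m0 ⊗ a0) ⊗ @hmul k H (m1 ⊗ a1)).
Proof.
rewrite ract_unopE rho_lact kfold_exchange.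
by do 2!apply: eq_kfold => ? ?; rewrite ract_unopE [in LHS]hmul_opE.
Qed.

Let ract1_unop m : ract_unop (m ⊗ aone) = m.
Proof. by rewrite ract_unopE; exact: (@lact1 k Hop comodule_algebra_op M). Qed.

Let ractA_unop m a b : ract_unop (ract_unop (m ⊗ a) ⊗ b) =
  \Sw_(m0, m1 <- @rho k H (lhm_comod M) m) \Sw_(a0, a1 <- rho a) \Sw_(b0, b1 <- rho b)
    (@omega k H (m1 ⊗ a1 ⊗ b1) *: ract_unop (m0 ⊗ amul (a0 ⊗ b0))).
Proof.
symmetry; move: m a b.
have t : ktrilinear (fun (m : lhm_comod M) (a b : A) => ract_unop (ract_unop (m ⊗ a) ⊗ b)).
  by ktril.
apply: (twist_inverse (F := fun m a b => ract_unop (m ⊗ amul (a ⊗ b)))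
  (@omegaVK k H) t) => m a b.
rewrite !ract_unopE -[amul _](amul_opE b a) [LHS](@lactA k Hop comodule_algebra_op M).
swx 0; swx 1; swx 0.
by do 3!apply: eq_kfold => ? ?; rewrite [in LHS]omega_opE !ract_unopE.
Qed.

Definition right_of_left_op : right_hopf_module A :=
  @RightHopfModule k H A (lhm_comod M) ract_unop rho_ract_unop ract1_unop ractA_unop.
End RightOfLeftOp.
End OppositeAlgebra.
(** * Tensor products of comodules and the retraction of a total integral *)

Section Contractions.
Variables (k : fieldType) (H : coquasi_hopf k) (Q : lmodType k).
Implicit Types h : H.

Lemma contract_alpha (f : {linear H -> Q}) h :
  \Sw_(h1, r <- comul h) \Sw_(h2, h3 <- comul r)
    (halpha h2 *: f (hmul (antipode h1 ⊗ h3))) = halpha h *: f hone.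
Proof.
rewrite -[RHS]linearZ -antipode_alpha !kfold_linear; apply: eq_kfold => h1 r.
by rewrite kfold_linear; apply: eq_kfold => h2 h3; rewrite -linearZ -linearZ ktensZl.
Qed.

Lemma contract_beta (f : {linear H -> Q}) h :
  \Sw_(h1, r <- comul h) \Sw_(h2, h3 <- comul r)
    (hbeta h2 *: f (hmul (h1 ⊗ antipode h3))) = hbeta h *: f hone.
Proof.
rewrite -[RHS]linearZ -antipode_beta !kfold_linear; apply: eq_kfold => h1 r.
by rewrite kfold_linear; apply: eq_kfold => h2 h3; rewrite -linearZ -linearZ ktensZl.
Qed.

Variable F : {linear (H ⊗ H ⊗ H)%type -> Q}.

(** Since S reverses the comultiplication, the two legs multiplied together are the neighbours of
    the leg inside α; these three legs contract to 1 by the axiom for α. [contract_beta_mul] is the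
    mirror image. *)
Lemma contract_alpha_mul h :
  \Sw_(h1, r <- comul h) \Sw_(h2, h3 <- comul r) (halpha h2 *:
    \Sw_(g1, g2 <- comul (antipode h1)) \Sw_(x1, x2 <- comul h3)
      F (hmul (g1 ⊗ x1) ⊗ g2 ⊗ x2)) =
  \Sw_(h1, r <- comul h) \Sw_(h2, h3 <- comul r)
    (halpha h2 *: F (hone ⊗ antipode h1 ⊗ h3)).
Proof.
under eq_kfold => h1 r do under eq_kfold => h2 h3 do
  (rewrite comul_antipode_sw -?kfoldZ; last by kbil).
under eq_kfold => h1 r do under eq_kfold => h2 h3 do under eq_kfold => a b do
  rewrite -kfoldZ.
swx 1; rewrite -comulA_sw; last by ktril.
apply: eq_kfold => a r0.
under eq_kfold => b r do (rewrite comulA_sw; last by ktril).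
rewrite comulA_sw; last by ktril.
apply: eq_kfold => l x2.
have fl : linear (fun z : H => F (z ⊗ antipode a ⊗ x2)) by move=> ? ? ?; klin.
exact: (contract_alpha (linof fl)).
Qed.

Lemma contract_beta_mul h :
  \Sw_(h1, r <- comul h) \Sw_(h2, h3 <- comul r) (hbeta h2 *:
    \Sw_(x1, x2 <- comul h1) \Sw_(y1, y2 <- comul (antipode h3))
      F (x1 ⊗ y1 ⊗ hmul (x2 ⊗ y2))) =
  \Sw_(h1, r <- comul h) \Sw_(h2, h3 <- comul r)
    (hbeta h2 *: F (h1 ⊗ antipode h3 ⊗ hone)).
Proof.
under eq_kfold => h1 r do under eq_kfold => h2 h3 do rewrite -kfoldZ.
under eq_kfold => h1 r do under eq_kfold => h2 h3 do under eq_kfold => x1 x2 do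
  (rewrite comul_antipode_sw -?kfoldZ; last by kbil).
swx 1; rewrite -comulA_sw; last by ktril.
apply: eq_kfold => x1 r0.
under eq_kfold => x2 r do (rewrite comulA_sw; last by ktril).
rewrite comulA_sw; last by ktril.
apply: eq_kfold => l y1.
have fl : linear (fun z : H => F (x1 ⊗ antipode y1 ⊗ z)) by move=> ? ? ?; klin.
exact: (contract_beta (linof fl)).
Qed.

(** This functional is the price of nonassociativity in (m l(h)) r(h), see [tau_kappa]. *)
Definition kappa (a h : H) : k := \Sw_(h1, r <- comul h) \Sw_(h2, h3 <- comul r)
  (halpha h2 * omega (a ⊗ antipode h1 ⊗ h3)).

(** The axiom [omega_antipode] with its legs grouped around β. *)
Lemma kappa_beta h : \Sw_(h1, r <- comul h) \Sw_(h2, h3 <- comul r)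
  (hbeta h2 * kappa h1 h3) = counit h.
Proof.
rewrite -omega_antipode; apply: eq_kfold => h1 r; apply: eq_kfold => h2 h3.
rewrite /kappa kfoldMl; apply: eq_kfold => h4 r'.
rewrite kfoldMl; apply: eq_kfold => h5 h6.
by rewrite !(ktensZl, ktensZr) !linearZ /=; ring.
Qed.
End Contractions.

(** Three vectors that each coact twice are rewritten with one coaction each, followed by three
    comultiplications, so that identities in H apply under the sums over the vectors. *)
Ltac regroup3 :=
  swx 2; swx 1; (rewrite -[LHS]rhoA_sw; last by ktril); swx 3;
  (etransitivity; [do 2!(apply: eq_kfold => ? ?);
     (rewrite -[LHS]rhoA_sw; [reflexivity|by ktril])|]);
  (etransitivity; [do 4!(apply: eq_kfold => ? ?);
     (rewrite -[LHS]rhoA_sw; [reflexivity|by ktril])|]);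
  swx 1; swx 3; swx 2.

Section TensorComodule.
Variables (k : fieldType) (H : coquasi_bialgebra k) (V W : comodule H).

Lemma rho_tens_bil : kbilinear (fun (v : V) (w : W) => \Sw_(v0, v1 <- rho v)
  \Sw_(w0, w1 <- rho w) (v0 ⊗ w0 ⊗ hmul (v1 ⊗ w1))).
Proof. kbil. Qed.
Definition rho_tens : {linear (V ⊗ W)%type -> (V ⊗ W ⊗ H)%type} := klift rho_tens_bil.

Lemma rho_tens_sw (Q : lmodType k) (F : (V ⊗ W)%type -> H -> Q) v w : kbilinear F ->
  kfold F (rho_tens (v ⊗ w)) =
  \Sw_(v0, v1 <- rho v) \Sw_(w0, w1 <- rho w) F (v0 ⊗ w0) (hmul (v1 ⊗ w1)).
Proof.
move=> Fb; rewrite kliftE kfold_kfold //; apply: eq_kfold => v0 v1.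
by rewrite kfold_kfold //; apply: eq_kfold => w0 w1; rewrite kfold_tens.
Qed.

Let rho_tensA t :
  \Sw_(m0, m' <- rho_tens t) \Sw_(m1, m2 <- comul m') (m0 ⊗ m1 ⊗ m2) =
  \Sw_(m', m2 <- rho_tens t) \Sw_(m0, m1 <- rho_tens m') (m0 ⊗ m1 ⊗ m2).
Proof.
move: t; apply: klinear_eq => [? ? ?|? ? ?|v w]; [by klin|by klin|].
rewrite !rho_tens_sw; [|by kbil|by kbil].
under [RHS]eq_kfold => ? ? do under eq_kfold => ? ? do
  (rewrite rho_tens_sw; last by kbil).
symmetry; swx 1; rewrite -rhoA_sw; last by ktril.
under eq_kfold => v0 v' do under eq_kfold => v1 v2 do
  (rewrite -rhoA_sw; last by ktril).
swx 1; do 2!apply: eq_kfold => ? ?; rewrite comul_mul.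
rewrite kfold_kfold; last by kbil.
apply: eq_kfold => ? ?; rewrite kfold_kfold; last by kbil.
by apply: eq_kfold => ? ?; rewrite kfold_tens //; kbil.
Qed.

Let rho_tens_counit t : \Sw_(m0, m1 <- rho_tens t) (counit m1 *: m0) = t.
Proof.
move: t; apply: klinear_eq => [? ? ?|//|v w]; first by klin.
rewrite rho_tens_sw; last by kbil.
rewrite -[RHS](rho_counit_sw (f := fun v => v ⊗ w) v); last by move=> ? ? ?; klin.
apply: eq_kfold => v0 v1.
rewrite -(rho_counit_sw (f := fun w => v0 ⊗ w) w); last by move=> ? ? ?; klin.
by rewrite -kfoldZ; apply: eq_kfold => ? ?; rewrite counit_mul scalerA.
Qed.

Definition tens_comodule : comodule H := Comodule rho_tensA rho_tens_counit.
End TensorComodule.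

Section Associator.
Variables (k : fieldType) (H : coquasi_bialgebra k) (U V W : comodule H).

Definition assoc_fun (u : U) (v : V) (w : W) : (U ⊗ (V ⊗ W))%type :=
  \Sw_(u0, u1 <- rho u) \Sw_(v0, v1 <- rho v) \Sw_(w0, w1 <- rho w)
    (omega (u1 ⊗ v1 ⊗ w1) *: (u0 ⊗ (v0 ⊗ w0))).

Lemma rho_tens3 u v w :
  @rho k H (tens_comodule U (tens_comodule V W)) (u ⊗ (v ⊗ w)) =
  \Sw_(u0, u1 <- rho u) \Sw_(v0, v1 <- rho v) \Sw_(w0, w1 <- rho w)
    ((u0 ⊗ (v0 ⊗ w0) : tens_comodule U (tens_comodule V W)) ⊗
      hmul (u1 ⊗ hmul (v1 ⊗ w1))).
Proof.
rewrite [LHS]kliftE; apply: eq_kfold => u0 u1.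
by rewrite rho_tens_sw //; kbil.
Qed.

(** After regrouping, the colinearity of the associator of comodules is [hmulA] on the legs in H. *)
Lemma rho_assoc u v w :
  @rho k H (tens_comodule U (tens_comodule V W)) (assoc_fun u v w) =
  \Sw_(u0, u1 <- rho u) \Sw_(v0, v1 <- rho v) \Sw_(w0, w1 <- rho w)
    ((assoc_fun u0 v0 w0 : tens_comodule U (tens_comodule V W)) ⊗
      hmul (hmul (u1 ⊗ v1) ⊗ w1)).
Proof.
transitivity (\Sw_(u0, u1 <- rho u) \Sw_(v0, v1 <- rho v) \Sw_(w0, w1 <- rho w)
  \Sw_(u00, u2 <- rho u0) \Sw_(v00, v2 <- rho v0) \Sw_(w00, w2 <- rho w0)
    (omega (u1 ⊗ v1 ⊗ w1) *: ((u00 ⊗ (v00 ⊗ w00) : tens_comodule U (tens_comodule V W))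
       ⊗ hmul (u2 ⊗ hmul (v2 ⊗ w2))))).
  rewrite kfold_linear; apply: eq_kfold => ? ?; rewrite kfold_linear.
  apply: eq_kfold => ? ?; rewrite kfold_linear; apply: eq_kfold => ? ?.
  rewrite linearZ /= rho_tens3 -kfoldZ; apply: eq_kfold => ? ?.
  by rewrite -kfoldZ; apply: eq_kfold => ? ?; rewrite -kfoldZ.
regroup3.
transitivity (\Sw_(u0, u' <- rho u) \Sw_(v0, v' <- rho v) \Sw_(w0, w' <- rho w)
  ((u0 ⊗ (v0 ⊗ w0) : tens_comodule U (tens_comodule V W)) ⊗
  \Sw_(u1, u2 <- comul u') \Sw_(v1, v2 <- comul v') \Sw_(w1, w2 <- comul w')
     (omega (u1 ⊗ v1 ⊗ w1) *: hmul (hmul (u2 ⊗ v2) ⊗ w2)))).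
  do 3!apply: eq_kfold => ? ?; rewrite -hmulA.
  rewrite ktens_kfoldr; apply: eq_kfold => ? ?.
  rewrite ktens_kfoldr; apply: eq_kfold => ? ?.
  by rewrite ktens_kfoldr; apply: eq_kfold => ? ?; rewrite ktensZr.
symmetry.
transitivity (\Sw_(u0, u1 <- rho u) \Sw_(v0, v1 <- rho v) \Sw_(w0, w1 <- rho w)
  \Sw_(u00, u2 <- rho u0) \Sw_(v00, v2 <- rho v0) \Sw_(w00, w2 <- rho w0)
    (omega (u2 ⊗ v2 ⊗ w2) *: ((u00 ⊗ (v00 ⊗ w00) : tens_comodule U (tens_comodule V W))
       ⊗ hmul (hmul (u1 ⊗ v1) ⊗ w1)))).
  do 3!apply: eq_kfold => ? ?; rewrite ktens_kfoldl; apply: eq_kfold => ? ?.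
  rewrite ktens_kfoldl; apply: eq_kfold => ? ?.
  by rewrite ktens_kfoldl; apply: eq_kfold => ? ?; rewrite ktensZl.
regroup3; do 3!apply: eq_kfold => ? ?.
rewrite ktens_kfoldr; apply: eq_kfold => ? ?.
rewrite ktens_kfoldr; apply: eq_kfold => ? ?.
by rewrite ktens_kfoldr; apply: eq_kfold => ? ?; rewrite ktensZr.
Qed.
End Associator.

Section ContractBetaComodule.
Variables (k : fieldType) (H : coquasi_hopf k) (V : comodule H) (Q : lmodType k).

(** Coassociativity brings together the legs v_1 β(v_2) S(v_3), which contract to β(v_1) 1. *)
Lemma contract_beta_comodule (K : V -> H -> H -> Q) v : ktrilinear K ->
  \Sw_(v', g <- rho v) \Sw_(g1, g2 <- comul g) \Sw_(v0, b <- rho v')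
  \Sw_(c, d <- comul g2) (hbeta g1 *: K v0 (hmul (b ⊗ antipode c)) d) =
  \Sw_(v0, g <- rho v) \Sw_(g1, g2 <- comul g) (hbeta g1 *: K v0 hone g2).
Proof.
move=> Kt; pose K' := klift3 Kt.
have KE x y z : K x y z = K' (x ⊗ y ⊗ z) by rewrite klift3E.
under eq_kfold => ? ? do under eq_kfold => ? ? do under eq_kfold => ? ? do
  under eq_kfold => ? ? do rewrite KE.
swx 1; rewrite -[LHS]rhoA_sw; last by ktril.
apply: eq_kfold => v0 g.
under eq_kfold => b g' do (rewrite comulA_sw; last by ktril).
rewrite comulA_sw; last by ktril.
apply: eq_kfold => l d; rewrite KE.
have fl : linear (fun z : H => K' (v0 ⊗ z ⊗ d)) by move=> ? ? ?; klin.
exact: (contract_beta (linof fl)).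
Qed.
End ContractBetaComodule.

Section CoinvariantBeta.
Variables (k : fieldType) (H : coquasi_hopf k) (V W Z : comodule H).
Variables (P : {linear (V ⊗ W)%type -> Z}) (psi : {linear H -> W}).
Hypothesis Pc : forall v w, rho (P (v ⊗ w)) =
  \Sw_(v0, v1 <- rho v) \Sw_(w0, w1 <- rho w) (P (v0 ⊗ w0) ⊗ hmul (v1 ⊗ w1)).
Hypothesis psic : forall h, rho (psi h) =
  \Sw_(h1, h2 <- comul h) (psi h2 ⊗ antipode h1).

(* For P the tensor product itself and psi the identity of H with the coaction *)
(* h |-> h_2 ⊗ S(h_1), this is the map v |-> v_0 β(v_1) ⊗ v_2.                 *)
Definition twist_beta (v : V) : Z := \Sw_(v0, g <- rho v)
  \Sw_(g1, g2 <- comul g) (hbeta g1 *: P (v0 ⊗ psi g2)).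

Lemma twist_beta_linear : linear twist_beta.
Proof. by rewrite /twist_beta => ? ? ?; klin. Qed.

(** The coaction contributes exactly the product v_1 β(v_2) S(v_3), which the axiom for β reduces to
    a multiple of 1. *)
Lemma twist_beta_coinv v : twist_beta v \in coinvariants Z.
Proof.
apply/coinvariantP; rewrite /twist_beta kfold_linear.
transitivity (\Sw_(v', g <- rho v) \Sw_(g1, g2 <- comul g) \Sw_(v0, b <- rho v')
  \Sw_(c, d <- comul g2) (hbeta g1 *: (P (v0 ⊗ psi d) ⊗ hmul (b ⊗ antipode c)))).
  apply: eq_kfold => v' g; rewrite kfold_linear; apply: eq_kfold => g1 g2.
  rewrite linearZ /= Pc -kfoldZ; apply: eq_kfold => v0 b.
  rewrite psic kfold_kfold -?kfoldZ; last by kbil.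
  by apply: eq_kfold => c d; rewrite kfold_tens //; kbil.
rewrite (contract_beta_comodule (K := fun v0 z d => P (v0 ⊗ psi d) ⊗ z)); last by ktril.
rewrite ktens_kfoldl; apply: eq_kfold => v0 g.
by rewrite ktens_kfoldl; apply: eq_kfold => l d; rewrite ktensZl.
Qed.
End CoinvariantBeta.

Section KappaCancel.
Variables (k : fieldType) (H : coquasi_hopf k) (V : comodule H) (Q : lmodType k).

(** The scalar in front of f(v_0) is κ(v_1, v_3) β(v_2), which is a counit by [kappa_beta]. *)
Lemma kappa_cancel (f : {linear V -> Q}) (v : V) :
  \Sw_(v0, g <- rho v) \Sw_(g1, g2 <- comul g)
    (hbeta g1 *: \Sw_(v00, v1 <- rho v0) (kappa v1 g2 *: f v00)) = f v.
Proof.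
under eq_kfold => v0 g do under eq_kfold => g1 g2 do rewrite -kfoldZ.
swx 1; rewrite -[LHS]rhoA_sw; last by rewrite /kappa; ktril.
rewrite -[RHS](rho_counit_sw (f := f)); last by move=> ? ? ?; klin.
apply: eq_kfold => v0 g; rewrite -kappa_beta -kfoldZr; apply: eq_kfold => v1 r.
by rewrite -kfoldZr; apply: eq_kfold => g1 g2; rewrite scalerA.
Qed.
End KappaCancel.

(** * The retraction and the trace attached to a colinear map from H to A *)

Section Retraction.
Variables (k : fieldType) (H : coquasi_hopf k) (A : comodule_algebra H).
Variables (gamma : {linear H -> A}).
Hypothesis gammac : colinear (M := regular_comodule H) gamma.
Variable M : right_hopf_module A.
Let HH := regular_comodule H.

Lemma retr_core_tril : ktrilinear (fun (m : M) (y h : H) =>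
  \Sw_(m0, m1 <- rho m) \Sw_(y0, y1 <- comul y) \Sw_(h0, h1 <- comul h)
    (omega (m1 ⊗ y1 ⊗ h1) *: ract (m0 ⊗ gamma (hmul (y0 ⊗ h0))))).
Proof. ktril. Qed.
Definition retr_core := klift3 retr_core_tril.

Lemma act_gamma_bil : kbilinear (fun (m : M) (p : (H ⊗ H)%type) => ract (m ⊗ gamma (hmul p))).
Proof. kbil. Qed.
Definition act_gamma := klift act_gamma_bil.

Lemma retr_coreE m y h : retr_core (m ⊗ y ⊗ h) = act_gamma (@assoc_fun k H M HH HH m y h).
Proof.
rewrite klift3E /assoc_fun kfold_linear; apply: eq_kfold => ? ?.
rewrite kfold_linear; apply: eq_kfold => ? ?; rewrite kfold_linear.
by apply: eq_kfold => ? ?; rewrite linearZ /= kliftE.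
Qed.

Lemma act_gamma_colinear t :
  rho (act_gamma t) = \Sw_(t0, t1 <- @rho k H (tens_comodule M (tens_comodule HH HH)) t)
    (act_gamma t0 ⊗ t1).
Proof.
move: t; apply: klinear_eq => [? ? ?|? ? ?|m p]; [by klin|by klin|].
move: p; apply: klinear_eq => [? ? ?|? ? ?|y h]; [by klin|by klin|].
rewrite (@rho_tens3 k H M HH HH) kfold_kfold; last by kbil.
rewrite kliftE rho_ract; apply: eq_kfold => m0 m1.
rewrite kfold_kfold; last by kbil.
rewrite gammac kfold_kfold; last by kbil.
rewrite comul_mul kfold_kfold; last by kbil.
apply: eq_kfold => y0 y1; rewrite !kfold_kfold; [|by kbil|by kbil].
apply: eq_kfold => h0 h1; rewrite kfold_tens; last by kbil.
rewrite kfold_tens; last by kbil.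
by rewrite kfold_tens ?kliftE //; kbil.
Qed.

Lemma antipode_anticolinear h : @rho k H HH (antipode h) =
  \Sw_(h1, h2 <- comul h) ((antipode h2 : HH) ⊗ antipode h1).
Proof. exact: comul_antipode. Qed.

Definition tens_id (V W : comodule H) : {linear (V ⊗ W)%type -> tens_comodule V W} := idfun.

Lemma tens_id_colinear (V W : comodule H) v w : rho (tens_id V W (v ⊗ w)) =
  \Sw_(v0, v1 <- rho v) \Sw_(w0, w1 <- rho w) (tens_id V W (v0 ⊗ w0) ⊗ hmul (v1 ⊗ w1)).
Proof. exact: kliftE. Qed.

Definition retr_theta (m : M) : tens_comodule M HH := twist_beta (tens_id M HH) antipode m.

(** For an ordinary Hopf algebra this is m ⊗ h ↦ m_0 γ(S(m_1) h); the functional β and the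
    associator are the corrections required here. *)
Definition retr (m : M) (h : H) : M :=
  \Sw_(x, y <- retr_theta m) retr_core (x ⊗ y ⊗ h).

Lemma retr_bil : kbilinear retr.
Proof. rewrite /retr /retr_theta /twist_beta /=; kbil. Qed.

Lemma retrE m h : retr m h = \Sw_(m0, g <- rho m) \Sw_(g1, g2 <- comul g)
  (hbeta g1 *: retr_core (m0 ⊗ antipode g2 ⊗ h)).
Proof.
rewrite /retr /retr_theta /twist_beta kfold_kfold; last by kbil.
apply: eq_kfold => m00 b; rewrite kfold_kfold; last by kbil.
apply: eq_kfold => b1 b2; rewrite -ktensZl kfold_tens; last by kbil.
by rewrite !ktensZl linearZ.
Qed.

(** Reassociation and the action are both colinear, and [retr_theta m] is coinvariant, so the
    coaction of the result comes from h alone. *)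
Lemma retr_colinear m h : rho (retr m h) = \Sw_(h1, h2 <- comul h) (retr m h1 ⊗ h2).
Proof.
pose G (t : tens_comodule M HH) (z : H) := \Sw_(h0, h1 <- comul h)
  \Sw_(x, y <- (t : (M ⊗ H)%type)) (retr_core (x ⊗ y ⊗ h0) ⊗ hmul (z ⊗ h1)).
have Gb : kbilinear G by rewrite /G; kbil.
transitivity (kfold G (rho (retr_theta m))).
  rewrite /retr; move: (retr_theta m); apply: klinear_eq => [? ? ?|? ? ?|x y].
  - by klin.
  - by apply: (kfold_linarg Gb); rewrite linearP.
  rewrite kfold_tens; last by kbil.
  rewrite retr_coreE act_gamma_colinear rho_assoc kfold_kfold; last by kbil.
  symmetry; etransitivity; first exact: (rho_tens_sw (V := M) (W := HH) x y Gb).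
  symmetry; apply: eq_kfold => x0 x1; rewrite kfold_kfold; last by kbil.
  apply: eq_kfold => y0 y1; rewrite kfold_kfold; last by kbil.
  apply: eq_kfold => h0 h1; rewrite !kfold_tens; [|by kbil|by kbil].
  by rewrite retr_coreE.
rewrite (rho_coinv_sw Gb); last first.
  apply: twist_beta_coinv; [exact: tens_id_colinear|exact: antipode_anticolinear].
apply: eq_kfold => h1 h2; rewrite /retr ktens_kfoldl.
by apply: eq_kfold => x y; rewrite hmul1l.
Qed.

(** The argument of γ contracts by the axiom for α to 1, where γ is 1; the remaining associator is
    κ, which β cancels. Thus [retr] splits the coaction twisted by α. *)
Lemma retr_rho (gamma1 : gamma hone = aone) m :
  \Sw_(m0, g <- rho m) \Sw_(g1, g2 <- comul g) (halpha g1 *: retr m0 g2) = m.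
Proof.
transitivity (\Sw_(m0, g <- rho m) \Sw_(g1, g2 <- comul g) \Sw_(m00, b <- rho m0)
  \Sw_(b1, b2 <- comul b) (halpha g1 *: (hbeta b1 *: retr_core (m00 ⊗ antipode b2 ⊗ g2)))).
  apply: eq_kfold => m0 g; apply: eq_kfold => g1 g2.
  rewrite retrE -kfoldZ; apply: eq_kfold => m00 b.
  by rewrite -kfoldZ.
swx 1; rewrite -[LHS]rhoA_sw; last by ktril.
swx 2; under eq_kfold => m0 g do (rewrite -comulA_sw; last by ktril).
(* Writing m itself by means of κ and β leaves a comparison of single values of κ. *)
rewrite -[RHS](kappa_cancel idfun m); apply: eq_kfold => m0 g.
apply: eq_kfold => b1 r.
have Ft : ktrilinear (fun z y h : H => \Sw_(m00, m1 <- rho m0)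
  (omega (m1 ⊗ y ⊗ h) *: ract (m00 ⊗ gamma z))) by ktril.
transitivity (hbeta b1 *: \Sw_(h1, r <- comul r) \Sw_(h2, h3 <- comul r) (halpha h2 *:
    \Sw_(g1, g2 <- comul (antipode h1)) \Sw_(x1, x2 <- comul h3)
      klift3 Ft (hmul (g1 ⊗ x1) ⊗ g2 ⊗ x2))).
  rewrite -kfoldZ; apply: eq_kfold => h1 r'; rewrite -kfoldZ.
  apply: eq_kfold => h2 h3; rewrite scalerA mulrC -scalerA; congr (_ *: (_ *: _)).
  rewrite klift3E; swx 0; swx 1; do 2!apply: eq_kfold => ? ?.
  by rewrite klift3E.
congr (_ *: _); rewrite contract_alpha_mul.
transitivity (\Sw_(h1, r <- comul r) \Sw_(h2, h3 <- comul r) \Sw_(m00, m1 <- rho m0)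
    ((halpha h2 * omega (m1 ⊗ antipode h1 ⊗ h3)) *: m00)).
  do 2!apply: eq_kfold => ? ?; rewrite klift3E -kfoldZ; apply: eq_kfold => ? ?.
  by rewrite gamma1 ract1 scalerA.
swx 1; swx 0; apply: eq_kfold => m00 m1; rewrite -kfoldZr.
by apply: eq_kfold => ? ?; rewrite -kfoldZr.
Qed.
End Retraction.

Section RetractionNatural.
Variables (k : fieldType) (H : coquasi_hopf k) (A : comodule_algebra H).
Variables (gamma : {linear H -> A}) (M N : right_hopf_module A) (f : right_hopf_hom M N).

Lemma retr_natural m h : f (retr gamma m h) = retr gamma (f m) h.
Proof.
rewrite !retrE (rhh_colinear f) kfold_linear kfold_kfold; last by kbil.
apply: eq_kfold => m0 g; rewrite kfold_tens; last by kbil.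
rewrite kfold_linear; apply: eq_kfold => g1 g2; rewrite linearZ /=; congr (_ *: _).
rewrite !klift3E (rhh_colinear f) kfold_linear kfold_kfold; last by kbil.
apply: eq_kfold => ? ?; rewrite kfold_tens; last by kbil.
rewrite kfold_linear; apply: eq_kfold => ? ?; rewrite kfold_linear.
by apply: eq_kfold => ? ?; rewrite linearZ /= rhh_act.
Qed.
End RetractionNatural.

Section Trace.
Variables (k : fieldType) (H : coquasi_hopf k) (A : comodule_algebra H).
Variables (gamma : {linear H -> A}).
Hypothesis gammac : colinear (M := regular_comodule H) gamma.

Definition antipode_int : {linear H -> A} := gamma \o antipode.

Lemma antipode_int_anticolinear h : rho (antipode_int h) =
  \Sw_(h1, h2 <- comul h) (antipode_int h2 ⊗ antipode h1).
Proof.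
rewrite /= gammac [LHS]comul_antipode_sw //; kbil.
Qed.

(** For an ordinary Hopf algebra this is the projection m ↦ m_0 γ(S(m_1)) onto coinvariants. *)
Definition trace (M : right_hopf_module A) (m : M) : M :=
  twist_beta (@ract k H A M) antipode_int m.

Lemma trace_coinv (M : right_hopf_module A) (m : M) : trace m \in coinvariants M.
Proof.
by apply: twist_beta_coinv; [exact: rho_ract|exact: antipode_int_anticolinear].
Qed.

Lemma trace_id (gamma1 : gamma hone = aone) (M : right_hopf_module A) (m : M) :
  m \in coinvariants M -> trace m = m.
Proof.
move=> mM; rewrite /trace /twist_beta rho_coinv_sw //; last by kbil.
rewrite comul_one_sw; last by kbil.
by rewrite /= antipode_one gamma1 ract1 hbeta_one scale1r.
Qed.

Lemma trace_natural (M N : right_hopf_module A) (f : right_hopf_hom M N) m :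
  f (trace m) = trace (f m).
Proof.
rewrite /trace /twist_beta (rhh_colinear f) kfold_linear kfold_kfold; last by kbil.
apply: eq_kfold => m0 g; rewrite kfold_tens; last by kbil.
by rewrite kfold_linear; apply: eq_kfold => ? ?; rewrite linearZ /= rhh_act.
Qed.
End Trace.
(** * Translation maps *)

Section TranslationData.
Variables (k : fieldType) (H : coquasi_hopf k) (A : comodule_algebra H).

Definition coinv_balanced (Q : lmodType k) (F : A -> H -> A -> Q) : Prop :=
  forall b, b \in coinvariants A ->
  forall l h r, F (amul (l ⊗ b)) h r = F l h (amul (b ⊗ r)).

(* [tau h] is a formal sum of pairs (l, r), standing for l(h) ⊗ r(h) in A ⊗ A or *)
(* in A ⊗_B A; [adm] tells which maps are defined on this tensor product.        *)
Record translation (adm : forall Q : lmodType k, (A -> H -> A -> Q) -> Prop)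
    (tau : H -> seq (A * A)) : Prop := Translation {
  tau_linear : forall (Q : lmodType k) (F : A -> H -> A -> Q) x,
    ktrilinear F -> @adm _ F ->
    linear (fun h => \sum_(p <- tau h) F p.1 x p.2);
  tau_coact : forall (Q : lmodType k) (F : A -> H -> A -> Q),
    ktrilinear F -> @adm _ F -> forall h,
    \sum_(p <- tau h) \Sw_(l0, l1 <- rho p.1) F l0 l1 p.2 =
    \Sw_(h1, h2 <- comul h) \sum_(p <- tau h2) F p.1 (antipode h1) p.2;
  tau_mul : forall h,
    \sum_(p <- tau h) \Sw_(r0, r1 <- rho p.2) (amul (p.1 ⊗ r0) ⊗ r1) =
    \Sw_(h1, h2 <- comul h) (halpha h1 *: (aone ⊗ h2))
}.

Variables (adm : forall Q : lmodType k, (A -> H -> A -> Q) -> Prop).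
Hypothesis adm_balanced : forall (Q : lmodType k) (F : A -> H -> A -> Q), coinv_balanced F -> @adm _ F.
Variables (tau : H -> seq (A * A)) (tauP : translation adm tau).
Variable M : right_hopf_module A.

Lemma amul_coinv_rho (Q : lmodType k) (F : A -> H -> Q) b a : b \in coinvariants A ->
  kbilinear F ->
  kfold F (rho (amul (b ⊗ a))) = \Sw_(a0, a1 <- rho a) F (amul (b ⊗ a0)) a1.
Proof. by move=> bB Fb; exact: (amul_coinv_rho_sw (exist _ b bB) a Fb). Qed.

(** Reassociating (m l) r introduces ω(m_1, l_1, r_1). By [tau_coact] the leg l_1 becomes S(h_1),
    and then [tau_mul] evaluates l r_0 ⊗ r_1, leaving the definition of κ. *)
Lemma tau_kappa (m : M) h :
  \sum_(p <- tau h) ract (ract (m ⊗ p.1) ⊗ p.2) =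
  \Sw_(m0, m1 <- rho m) (kappa m1 h *: m0).
Proof.
pose F (l : A) (z : H) (r : A) := \Sw_(m0, m1 <- rho m) \Sw_(r0, r1 <- rho r)
  (omega (m1 ⊗ z ⊗ r1) *: ract (m0 ⊗ amul (l ⊗ r0))).
have Ft : ktrilinear F by rewrite /F; ktril.
have Fbal : coinv_balanced F.
  move=> b bB l z r; apply: eq_kfold => m0 m1; rewrite amul_coinv_rho //; last by kbil.
  by apply: eq_kfold => r0 r1; rewrite amulA_m.
transitivity (\sum_(p <- tau h) \Sw_(l0, l1 <- rho p.1) F l0 l1 p.2).
  by apply: eq_bigr => p _; rewrite ractA kfold_exchange.
rewrite (tau_coact tauP Ft (adm_balanced Fbal)).
have Lb c : kbilinear (fun (a : A) (z : H) => \Sw_(m0, m1 <- rho m)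
  (omega (m1 ⊗ antipode c ⊗ z) *: ract (m0 ⊗ a))) by kbil.
transitivity (\Sw_(h1, h2 <- comul h) \Sw_(x1, x2 <- comul h2) (halpha x1 *:
   \Sw_(m0, m1 <- rho m) (omega (m1 ⊗ antipode h1 ⊗ x2) *: m0))).
  apply: eq_kfold => h1 h2.
  have := congr1 (klift (Lb h1)) (tau_mul tauP h2); rewrite linear_sum kfold_linear.
  move=> e; etransitivity; [|etransitivity; first exact: e].
    apply: eq_bigr => p _; rewrite kfold_linear /F kfold_exchange.
    by apply: eq_kfold => r0 r1; rewrite kliftE.
  apply: eq_kfold => x1 x2; rewrite linearZ /= kliftE; congr (_ *: _).
  by apply: eq_kfold => ? ?; rewrite ract1.
symmetry; transitivity (\Sw_(m0, m1 <- rho m) \Sw_(h1, h2 <- comul h)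
    \Sw_(x1, x2 <- comul h2) ((halpha x1 * omega (m1 ⊗ antipode h1 ⊗ x2)) *: m0)).
  apply: eq_kfold => m0 m1; rewrite -kfoldZr; apply: eq_kfold => h1 h2.
  by rewrite -kfoldZr.
swx 0; apply: eq_kfold => h1 h2; rewrite kfold_exchange; apply: eq_kfold => x1 x2.
by rewrite -kfoldZ; apply: eq_kfold => ? ?; rewrite scalerA.
Qed.

(** β cancels the κ of [tau_kappa]. With [tau_coinv] this writes m by coinvariants. *)
Lemma tau_generates (m : M) :
  \Sw_(m0, g <- rho m) \Sw_(g1, g2 <- comul g)
    (hbeta g1 *: \sum_(p <- tau g2) ract (ract (m0 ⊗ p.1) ⊗ p.2)) = m.
Proof.
rewrite -[RHS](kappa_cancel idfun m); apply: eq_kfold => ? ?; apply: eq_kfold => ? ?.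
by rewrite tau_kappa.
Qed.

(** By [tau_coact] the left factor of the translation map coacts through S, so the contraction
    behind [twist_beta_coinv] works again. Testing on maps F lets one proof serve both A ⊗ A and A
    ⊗_B A. *)
Lemma tau_coinv (Q : lmodType k) (F : {linear (M ⊗ H ⊗ A)%type -> Q}) m :
  (forall m0 : M, @adm _ (fun l z r => F (ract (m0 ⊗ l) ⊗ z ⊗ r))) ->
  (forall m : M, @adm _ (fun l z r => \Sw_(m0, m1 <- rho m)
     F (ract (m0 ⊗ l) ⊗ hmul (m1 ⊗ z) ⊗ r))) ->
  \Sw_(m0, g <- rho m) \Sw_(g1, g2 <- comul g) (hbeta g1 *:
    \sum_(p <- tau g2) \Sw_(x0, x1 <- rho (ract (m0 ⊗ p.1))) F (x0 ⊗ x1 ⊗ p.2)) =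
  \Sw_(m0, g <- rho m) \Sw_(g1, g2 <- comul g) (hbeta g1 *:
    \sum_(p <- tau g2) F (ract (m0 ⊗ p.1) ⊗ hone ⊗ p.2)).
Proof.
move=> adm1 adm2.
transitivity (\Sw_(m', g <- rho m) \Sw_(g1, g2 <- comul g) \Sw_(m0, m1 <- rho m')
  \Sw_(h1, h2 <- comul g2) (hbeta g1 *:
     \sum_(p <- tau h2) F (ract (m0 ⊗ p.1) ⊗ hmul (m1 ⊗ antipode h1) ⊗ p.2))).
  apply: eq_kfold => m' g; apply: eq_kfold => g1 g2.
  rewrite (eq_bigr (fun p => \Sw_(l0, l1 <- rho p.1) \Sw_(m0, m1 <- rho m')
    F (ract (m0 ⊗ l0) ⊗ hmul (m1 ⊗ l1) ⊗ p.2))); last first.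
    move=> p _; rewrite rho_ract kfold_kfold; last by kbil.
    rewrite [RHS]kfold_exchange; apply: eq_kfold => m0 m1.
    rewrite kfold_kfold; last by kbil.
    by apply: eq_kfold => ? ?; rewrite kfold_tens //; kbil.
  rewrite (tau_coact tauP _ (adm2 m')); last by ktril.
  rewrite kfold_exchange -kfoldZ; apply: eq_kfold => h1 h2.
  rewrite kfoldZ; congr (_ *: _).
  by rewrite [RHS]exchange_big.
rewrite (contract_beta_comodule (K := fun v z d =>
  \sum_(p <- tau d) F (ract (v ⊗ p.1) ⊗ z ⊗ p.2))) //.
split=> [c v v' z d|c v z z' d|c v z d d'].
- by klin.
- by klin.
by apply: (tau_linear tauP (F := fun l z r => F (ract (v ⊗ l) ⊗ z ⊗ r))); [ktril|].
Qed.
End TranslationData.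
(** * Linear extensions and kernels *)

Section LinearExtension.
Variables (k : fieldType) (U V : lmodType k).
Implicit Types G L : U * V -> Prop.

Definition lin_graph G : Prop :=
  [/\ G (0, 0), forall c u v u' v', G (u, v) -> G (u', v') -> G (c *: u + u', c *: v + v')
    & forall v, G (0, v) -> v = 0].

Lemma lin_graph_fun G u v v' : lin_graph G -> G (u, v) -> G (u, v') -> v = v'.
Proof.
case=> _ GD G0 g g'; have := GD (-1) _ _ _ _ g' g; rewrite !scaleN1r addNr.
by move/G0/eqP; rewrite addrC subr_eq0 => /eqP.
Qed.

(** Zorn's lemma for graphs of partial linear maps subject to a local condition: monotonicity in the
    graph carries the condition over to unions of chains. *)
Lemma zorn_lin_graph (L : (U * V -> Prop) -> U * V -> Prop) G0 :
  (forall G G' p, (forall q, G q -> G' q) -> L G p -> L G' p) ->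
  lin_graph G0 -> (forall p, G0 p -> L G0 p) ->
  exists G, [/\ lin_graph G, forall p, G0 p -> G p, forall p, G p -> L G p
    & forall G', lin_graph G' -> (forall p, G p -> G' p) ->
        (forall p, G' p -> L G' p) -> forall p, G' p -> G p].
Proof.
move=> Lmono G0l G0L.
(* Adjoining [G0] to every set makes the union of the empty chain admissible. *)
pose u (X : U * V -> Prop) p := G0 p \/ X p.
pose P (X : set (U * V)) := lin_graph (u X) /\ forall p, u X p -> L (u X) p.
have [F FP Ftot|X [[Xl XL] Xmax]] := @Zorn_bigcup (U * V)%type P.
  have FU X p : F X -> u X p -> u (\bigcup_(Y in F) Y)%classic p.
    by move=> FX [?|Xp]; [left|right; exists X].
  have inv p : u (\bigcup_(Y in F) Y)%classic p -> G0 p \/ exists2 X, F X & u X p.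
    by case=> [|[X FX Xp]]; [left|right; exists X => //; right].
  have join p q : u (\bigcup_(Y in F) Y)%classic p -> u (\bigcup_(Y in F) Y)%classic q ->
      (G0 p /\ G0 q) \/ exists2 X, F X & u X p /\ u X q.
    move=> /inv [p0|[X FX Xp]] /inv [q0|[Y FY Yq]]; first by left.
    - by right; exists Y => //; split=> //; left.
    - by right; exists X => //; split=> //; left.
    have [XY|YX] := Ftot _ _ FX FY; right; [exists Y|exists X] => //; split=> //.
      by case: Xp => [?|/XY ?]; [left|right].
    by case: Yq => [?|/YX ?]; [left|right].
  split; first split.
  - by left; case: G0l.
  - move=> c x y x' y' p q; have [[p0 q0]|[X FX [Xp Xq]]] := join _ _ p q.
      by left; case: G0l => _ GD _; exact: GD.
    by apply: (FU X) => //; have [[_ XD _] _] := FP X FX; exact: XD.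
  - move=> v /inv [p0|[X FX Xp]]; first by case: G0l => _ _; exact.
    by have [[_ _ X0] _] := FP X FX; exact: X0.
  move=> p /inv [p0|[X FX Xp]]; first by apply: Lmono (G0L _ p0) => q; left.
  have [_ XL] := FP X FX; apply: Lmono (XL _ Xp) => q; exact: FU.
exists (u X); split=> // [p|G' G'l GG' G'L p G'p]; first by left.
apply: contrapT => nXp; apply: (Xmax G') => //.
  split; first by move=> q Xq; apply: GG'; right.
  by move=> G'X; apply: nXp; right; exact: G'X.
have E : u G' = G'.
  apply/funext => q; apply/propext; split=> [[?|//]|]; last by right.
  by apply: GG'; left.
by split; rewrite E.
Qed.

(* With [D] the full relation this extends a linear map defined on a subspace; *)
(* with [D] the converse graph of a surjection it gives a linear section.      *)
Lemma linear_extension (D G0 : U * V -> Prop) :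
  (forall c u v u' v', D (u, v) -> D (u', v') -> D (c *: u + u', c *: v + v')) ->
  (forall u, exists v, D (u, v)) -> lin_graph G0 -> (forall p, G0 p -> D p) ->
  exists2 f : {linear U -> V}, (forall p, G0 p -> f p.1 = p.2) & forall u, D (u, f u).
Proof.
move=> DD Dtot G0l G0D.
have [//|//|//|G [Gl G0G GD Gmax]] := @zorn_lin_graph (fun _ => D) G0.
(* A maximal graph is total: otherwise a pair (u, w) in D can be adjoined. *)
have Gtot u : exists v, G (u, v).
  apply: contrapT => nG; have [w Dw] := Dtot u.
  pose G' (p : U * V) := exists c x y, G (x, y) /\ p = (c *: u + x, c *: w + y).
  have {}nG v : ~ G (u, v) by move=> g; apply: nG; exists v.
  have [G00 GL Gf] := Gl.
  apply: (nG w); apply: (Gmax G'); last first.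
  - by exists 1, 0, 0; rewrite !scale1r !addr0.
  - move=> _ [c [x [y [g ->]]]]; apply: DD => //; exact: GD.
  - by move=> [x y] g; exists 0, x, y; rewrite !scale0r !add0r.
  split.
  - by exists 0, 0, 0; rewrite !scale0r !addr0.
  - move=> c _ _ _ _ [d [x [y [g [-> ->]]]]] [e [x' [y' [g' [-> ->]]]]].
    exists (c * d + e), (c *: x + x'), (c *: y + y'); split; first exact: GL.
    by rewrite !scalerDl !scalerDr !scalerA !addrA;
      congr (_, _); rewrite -!addrA; congr (_ + _); rewrite addrCA.
  move=> v [c [x [y [g [e ->]]]]].
  have [c0|c0] := eqVneq c 0.
    move: e; rewrite c0 !scale0r !add0r => /esym x0; rewrite x0 in g.
    exact: Gf.
  (* For nonzero c the relation c u + x = 0 puts u into the domain of G, a contradiction. *)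
  case: (nG (- c^-1 *: y)).
  have := GL (- c^-1) x y 0 0 g G00; rewrite !addr0.
  suff -> : - c^-1 *: x = u by [].
  move: e; rewrite addrC => /esym/eqP; rewrite addr_eq0 => /eqP ->.
  by rewrite scalerN scaleNr opprK scalerA mulVf // scale1r.
pose f u := sval (cid (Gtot u)).
have fG u : G (u, f u) by exact: (svalP (cid (Gtot u))).
have fl : linear f.
  move=> c x y; apply: (lin_graph_fun Gl (fG _)).
  by case: Gl => _ GL _; exact: GL.
exists (linof fl) => [[u v] g|u] /=; last exact: GD.
exact: (lin_graph_fun Gl (fG u) (G0G _ g)).
Qed.
End LinearExtension.

Lemma linear_section (k : fieldType) (X Y : lmodType k) (p : {linear X -> Y}) :
  (forall y, exists x, p x = y) -> exists s : {linear Y -> X}, cancel s p.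
Proof.
move=> psurj.
have [|//|||s _ sP] := @linear_extension k Y X (fun q => p q.2 = q.1) (fun q => q = (0, 0)).
- by move=> c u v u' v' /= <- <-; rewrite linearP.
- split=> // [c u v u' v' [-> ->] [-> ->]|v [->//]].
  by rewrite !scaler0 !addr0.
- by move=> _ -> /=; rewrite linear0.
by exists s => y; exact: sP.
Qed.

Section FreeFamilies.
Variables (k : fieldType) (M N : lmodType k).

Definition kfree n (e : 'I_n -> N) : Prop :=
  forall c : 'I_n -> k, \sum_i c i *: e i = 0 -> forall i, c i = 0.

(** The coordinate forms are defined on the span of e and then extended to N. *)
Lemma kfree_dual n (e : 'I_n -> N) : kfree e ->
  exists f : 'I_n -> {scalar N}, forall i j, f i (e j) = (i == j)%:R.
Proof.
move=> ef.
have fP i : exists f : {scalar N}, forall j, f (e j) = (i == j)%:R.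
  have [//|||//|f fE _] := @linear_extension k N k^o (fun _ => True)
    (fun p => exists c : 'I_n -> k, p = (\sum_j c j *: e j, c i)).
  - by move=> u; exists 0.
  - split=> [|c _ _ _ _ [a [-> ->]] [b [-> ->]]|v [c [/esym/ef -> ->//]]].
      exists (fun _ => 0); congr (_, _).
      by rewrite big1 // => j _; rewrite scale0r.
    exists (fun j => c * a j + b j); congr (_, _).
    rewrite scaler_sumr -big_split; apply: eq_bigr => j _.
    by rewrite scalerDl scalerA.
  exists f => j; have := fE (e j, (i == j)%:R); apply.
  exists (fun l => (l == j)%:R); congr (_, _).
  rewrite (bigD1 j) //= eqxx scale1r big1 ?addr0 // => l /negPf ->.
  by rewrite scale0r.
by exists (fun i => sval (cid (fP i))) => i j; exact: (svalP (cid (fP i))).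
Qed.

Lemma ktens_free n (e : 'I_n -> N) (m : 'I_n -> M) : kfree e ->
  \sum_i (m i ⊗ e i) = 0 -> forall i, m i = 0.
Proof.
move=> /kfree_dual [f fE] s0 i.
have b : kbilinear (fun (m : M) (x : N) => f i x *: m) by kbil.
have := congr1 (klift b) s0; rewrite linear_sum linear0 => <-.
rewrite (bigD1 i) //= kliftE fE eqxx scale1r big1 ?addr0 // => j ji.
by rewrite kliftE fE eq_sym (negPf ji) scale0r.
Qed.

(** As long as the right factors are dependent, one of them can be eliminated and the representation
    becomes shorter. *)
Lemma ktens_free_repr (t : (M ⊗ N)%type) :
  exists n (m : 'I_n -> M) (e : 'I_n -> N), kfree e /\ t = \sum_i (m i ⊗ e i).
Proof.
have [n [m [e ->]]] : exists n (m : 'I_n -> M) (e : 'I_n -> N), t = \sum_i (m i ⊗ e i).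
  rewrite -[t]kfold_id /kfold /tfold /fsum; move: (repr _) => s.
  exists (size s), (fun i => (nth (0, 0) s i).1), (fun i => (nth (0, 0) s i).2).
  by rewrite (big_nth (0, 0)) big_mkord.
elim: n m e => [|n IHn] m e; first by exists 0%N, m, e; split=> // c _ [].
have [ef|] := pselect (kfree e); first by exists n.+1, m, e.
move=> /existsNP [c] /not_implyP [ce] /existsNP [i /eqP ci].
have [n' [m' [e' [e'f E]]]] := IHn (fun j => m (lift i j) - (c (lift i j) / c i) *: m i)
  (fun j => e (lift i j)).
exists n', m', e'; split=> //; rewrite -E (bigD1_ord i) //=.
have ei : e i = - \sum_(j < n) (c (lift i j) / c i) *: e (lift i j).
  apply: (scalerI ci); rewrite scalerN scaler_sumr; apply/eqP.
  rewrite -addr_eq0; apply/eqP; rewrite -[RHS]ce [RHS](bigD1_ord i) //=; congr (_ + _).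
  by apply: eq_bigr => j _; rewrite scalerA mulrC divfK.
rewrite {1}ei -sumrN.
have -> (x : M) (F : 'I_n -> N) : x ⊗ (\sum_j F j) = \sum_j (x ⊗ F j).
  exact: (linear_sum (linof (fun c y z => ktensPr c x y z))).
rewrite -big_split; apply: eq_bigr => j _ /=.
by rewrite ktensBl ktensZl -[- (_ *: e _)]scaleNr ktensZr scaleNr addrC.
Qed.
End FreeFamilies.

Section TensorMap.
Variables (k : fieldType) (M N P : lmodType k) (f : {linear M -> P}).

Lemma tens_map_bil : kbilinear (fun (m : M) (n : N) => f m ⊗ n). Proof. kbil. Qed.
Definition tens_map : {linear (M ⊗ N)%type -> (P ⊗ N)%type} := klift tens_map_bil.
Lemma tens_mapE m n : tens_map (m ⊗ n) = f m ⊗ n. Proof. exact: kliftE. Qed.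

Lemma tens_map_kfold (Q : lmodType k) (F : P -> N -> Q) t : kbilinear F ->
  kfold F (tens_map t) = \Sw_(m, n <- t) F (f m) n.
Proof.
move=> Fb; pose F' := klift Fb; rewrite -[t in LHS]kfold_id kfold_linear kfold_kfold //.
by apply: eq_kfold => m n; rewrite tens_mapE kfold_tens.
Qed.

Lemma tens_map_fold t : tens_map t = \Sw_(m, n <- t) (f m ⊗ n).
Proof. by rewrite -[LHS]kfold_id tens_map_kfold //; kbil. Qed.

(** Flatness over a field: in a representation with independent right factors, f must kill every
    left factor. *)
Lemma tens_map_ker t : tens_map t = 0 ->
  exists n (m : 'I_n -> M) (e : 'I_n -> N),
    (forall i, f (m i) = 0) /\ t = \sum_i (m i ⊗ e i).
Proof.
have [n [m [e [ef ->]]]] := ktens_free_repr t; rewrite linear_sum => t0.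
exists n, m, e; split=> // i; apply: (ktens_free ef (m := f \o m)).
by rewrite -[RHS]t0; apply: eq_bigr => j _; rewrite tens_mapE.
Qed.

Lemma tens_map_inj : injective f -> injective tens_map.
Proof.
move=> fi s t /eqP; rewrite -subr_eq0 -linearB => /eqP /tens_map_ker.
move=> [n [m [e [m0 E]]]]; apply/eqP; rewrite -subr_eq0 E big1 // => i _.
have -> : m i = 0 by apply: fi; rewrite m0 linear0.
by rewrite ktens0l.
Qed.
End TensorMap.

(** * Kernels of colinear maps and of Hopf module morphisms *)

Section KernelComodule.
Variables (k : fieldType) (C : coalgebra k) (M N : comodule C) (f : {linear M -> N}).
Hypothesis fc : colinear f.

Definition kerp : {pred M} := fun m => f m == 0.
Lemma kerpP m : reflect (f m = 0) (m \in kerp). Proof. exact: eqP. Qed.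
Lemma kerp_submod : submod_closed kerp.
Proof.
split; first by apply/kerpP; rewrite linear0.
by move=> c x y /kerpP x0 /kerpP y0; apply/kerpP; rewrite linearP x0 y0 scaler0 addr0.
Qed.
HB.instance Definition _ := GRing.isSubmodClosed.Build k M kerp kerp_submod.
Definition ker_type := {m : M | m \in kerp}.
HB.instance Definition _ := SubChoice.on ker_type.
HB.instance Definition _ := [SubChoice_isSubLmodule of ker_type by <:].
Definition ker_space : lmodType k := GRing.Lmodule.clone k ker_type _.
Lemma ker_val_linear : linear (fun x : ker_space => \val (x : ker_type) : M).
Proof. by []. Qed.
Definition ker_val := linof ker_val_linear.

Definition ker_mk m (m0 : f m = 0) : ker_space :=
  (exist (fun m => m \in kerp) m (introT (kerpP m) m0) : ker_type).
Lemma ker_val_inj : injective ker_val. Proof. exact: val_inj. Qed.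
Lemma ker_valP x : f (ker_val x) = 0. Proof. exact/kerpP/valP. Qed.

(** By colinearity the coaction of an element of the kernel is killed by f ⊗ C, whose kernel is ker
    f ⊗ C by [tens_map_ker]. *)
Lemma rho_ker_sig (x : ker_space) : {t : (ker_space ⊗ C)%type | tens_map C ker_val t = rho (ker_val x)}.
Proof.
apply: cid.
have : tens_map C f (rho (ker_val x)) = 0.
  by rewrite tens_map_fold -fc ker_valP linear0.
move=> /tens_map_ker [n [m [e [m0 ->]]]].
exists (\sum_i (ker_mk (m0 i) ⊗ e i)).
by rewrite linear_sum; apply: eq_bigr => i _; rewrite tens_mapE.
Qed.

Lemma rho_ker_linear : linear (fun x => sval (rho_ker_sig x)).
Proof.
move=> c x y; apply: (tens_map_inj ker_val_inj).
by rewrite (svalP (rho_ker_sig _)) !linearP /= !(svalP (rho_ker_sig _)).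
Qed.
Definition rho_ker := linof rho_ker_linear.
Lemma rho_kerE x : tens_map C ker_val (rho_ker x) = rho (ker_val x).
Proof. exact: (svalP (rho_ker_sig x)). Qed.
Lemma rho_ker_sw (Q : lmodType k) (F : M -> C -> Q) x : kbilinear F ->
  kfold F (rho (ker_val x)) = \Sw_(x0, x1 <- rho_ker x) F (ker_val x0) x1.
Proof. by move=> Fb; rewrite -rho_kerE tens_map_kfold. Qed.

Let rho_kerA x :
  \Sw_(m0, m' <- rho_ker x) \Sw_(m1, m2 <- comul m') (m0 ⊗ m1 ⊗ m2) =
  \Sw_(m', m2 <- rho_ker x) \Sw_(m0, m1 <- rho_ker m') (m0 ⊗ m1 ⊗ m2).
Proof.
apply: (tens_map_inj (f := tens_map C ker_val)); first exact/tens_map_inj/ker_val_inj.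
have := rhoA (ker_val x); rewrite !rho_ker_sw; [|by kbil|by kbil] => e.
rewrite [LHS]kfold_linear [RHS]kfold_linear.
etransitivity; [|etransitivity; first exact: e]; apply: eq_kfold => a b.
  by rewrite kfold_linear; apply: eq_kfold => ? ?; rewrite !tens_mapE.
rewrite rho_ker_sw; last by kbil.
by rewrite kfold_linear; apply: eq_kfold => ? ?; rewrite !tens_mapE.
Qed.

Let rho_ker_counit x : \Sw_(m0, m1 <- rho_ker x) (counit m1 *: m0) = x.
Proof.
apply: ker_val_inj; rewrite -[RHS]rho_counit rho_ker_sw; last by kbil.
by rewrite kfold_linear; apply: eq_kfold => ? ?; rewrite linearZ.
Qed.

Definition ker_comodule : comodule C := Comodule rho_kerA rho_ker_counit.

Lemma ker_val_colinear : colinear (M := ker_comodule) ker_val.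
Proof. by move=> x; rewrite -rho_kerE tens_map_fold. Qed.
End KernelComodule.
Section KernelHopf.
Variables (k : fieldType) (H : coquasi_bialgebra k) (A : comodule_algebra H).

Section Right.
Variables (M N : right_hopf_module A) (f : right_hopf_hom M N).
Let K := ker_comodule (rhh_colinear f).

Lemma ker_ract_sig (x : K) (a : A) : {y : K | ker_val f y = ract (ker_val f x ⊗ a)}.
Proof.
have yK : f (ract (ker_val f x ⊗ a)) = 0 by rewrite rhh_act ker_valP ktens0l linear0.
by exists (ker_mk yK).
Qed.
Definition ker_ract_fun (x : K) (a : A) : K := sval (ker_ract_sig x a).
Lemma ker_ract_funE (x : K) (a : A) : ker_val f (ker_ract_fun x a) = ract (ker_val f x ⊗ a).
Proof. exact: (svalP (ker_ract_sig x a)). Qed.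
Lemma ker_ract_bil : kbilinear ker_ract_fun.
Proof.
by split=> c x y a; apply: (@ker_val_inj _ _ M N f);
  rewrite linearP !ker_ract_funE; klin.
Qed.
Definition ker_ract := klift ker_ract_bil.
Lemma ker_ractE x a : ker_val f (ker_ract (x ⊗ a)) = ract (ker_val f x ⊗ a).
Proof. by rewrite kliftE ker_ract_funE. Qed.

Let tinj := tens_map_inj (N := H) (@ker_val_inj _ _ M N f).

Let rho_ker_ract m a : rho (ker_ract (m ⊗ a)) =
  \Sw_(m0, m1 <- rho m) \Sw_(a0, a1 <- rho a) (ker_ract (m0 ⊗ a0) ⊗ hmul (m1 ⊗ a1)).
Proof.
apply: tinj; rewrite (rho_kerE (rhh_colinear f)) ker_ractE rho_ract.
rewrite (rho_ker_sw (rhh_colinear f)); last by kbil.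
rewrite kfold_linear; apply: eq_kfold => m0 m1; rewrite kfold_linear.
by apply: eq_kfold => a0 a1; rewrite tens_mapE ker_ractE.
Qed.
Let ker_ract1 m : ker_ract (m ⊗ aone) = m.
Proof. by apply: (@ker_val_inj _ _ M N f); rewrite ker_ractE ract1. Qed.
Let ker_ractA m a b : ker_ract (ker_ract (m ⊗ a) ⊗ b) =
  \Sw_(m0, m1 <- rho m) \Sw_(a0, a1 <- rho a) \Sw_(b0, b1 <- rho b)
    (omega (m1 ⊗ a1 ⊗ b1) *: ker_ract (m0 ⊗ amul (a0 ⊗ b0))).
Proof.
apply: (@ker_val_inj _ _ M N f); rewrite !ker_ractE ractA.
rewrite (rho_ker_sw (rhh_colinear f)); last by kbil.
rewrite kfold_linear; apply: eq_kfold => ? ?; rewrite kfold_linear.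
apply: eq_kfold => ? ?; rewrite kfold_linear.
by apply: eq_kfold => ? ?; rewrite linearZ ker_ractE.
Qed.
Definition ker_right : right_hopf_module A :=
  @RightHopfModule k H A K ker_ract rho_ker_ract ker_ract1 ker_ractA.
End Right.

Section Left.
Variables (M N : left_hopf_module A) (f : left_hopf_hom M N).
Let K := ker_comodule (lhh_colinear f).

Lemma ker_lact_sig (a : A) (x : K) : {y : K | ker_val f y = lact (a ⊗ ker_val f x)}.
Proof.
have yK : f (lact (a ⊗ ker_val f x)) = 0 by rewrite lhh_act ker_valP ktens0r linear0.
by exists (ker_mk yK).
Qed.
Definition ker_lact_fun (a : A) (x : K) : K := sval (ker_lact_sig a x).
Lemma ker_lact_funE (a : A) (x : K) : ker_val f (ker_lact_fun a x) = lact (a ⊗ ker_val f x).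
Proof. exact: (svalP (ker_lact_sig a x)). Qed.
Lemma ker_lact_bil : kbilinear ker_lact_fun.
Proof.
by split=> c x y a; apply: (@ker_val_inj _ _ M N f);
  rewrite linearP !ker_lact_funE; klin.
Qed.
Definition ker_lact := klift ker_lact_bil.
Lemma ker_lactE a x : ker_val f (ker_lact (a ⊗ x)) = lact (a ⊗ ker_val f x).
Proof. by rewrite kliftE ker_lact_funE. Qed.

Let tinj := tens_map_inj (N := H) (@ker_val_inj _ _ M N f).

Let rho_ker_lact a m : rho (ker_lact (a ⊗ m)) =
  \Sw_(a0, a1 <- rho a) \Sw_(m0, m1 <- rho m) (ker_lact (a0 ⊗ m0) ⊗ hmul (a1 ⊗ m1)).
Proof.
apply: tinj; rewrite (rho_kerE (lhh_colinear f)) ker_lactE rho_lact.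
rewrite kfold_linear; apply: eq_kfold => a0 a1.
rewrite (rho_ker_sw (lhh_colinear f)) ?kfold_linear; last by kbil.
apply: eq_kfold => m0 m1; rewrite tens_mapE.
by congr (_ ⊗ _); exact/esym/ker_lactE.
Qed.
Let ker_lact1 m : ker_lact (aone ⊗ m) = m.
Proof. by apply: (@ker_val_inj _ _ M N f); rewrite ker_lactE lact1. Qed.
Let ker_lactA a b m : ker_lact (amul (a ⊗ b) ⊗ m) =
  \Sw_(a0, a1 <- rho a) \Sw_(b0, b1 <- rho b) \Sw_(m0, m1 <- rho m)
    (omega (a1 ⊗ b1 ⊗ m1) *: ker_lact (a0 ⊗ ker_lact (b0 ⊗ m0))).
Proof.
apply: (@ker_val_inj _ _ M N f); rewrite !ker_lactE lactA.
rewrite kfold_linear; apply: eq_kfold => ? ?; rewrite kfold_linear.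
apply: eq_kfold => ? ?; rewrite (rho_ker_sw (lhh_colinear f)); last by kbil.
rewrite kfold_linear.
apply: eq_kfold => ? ?; rewrite linearZ; congr (_ *: _).
etransitivity; last exact/esym/ker_lactE.
by congr (lact (_ ⊗ _)); exact/esym/ker_lactE.
Qed.
Definition ker_left : left_hopf_module A :=
  @LeftHopfModule k H A K ker_lact rho_ker_lact ker_lact1 ker_lactA.
End Left.
End KernelHopf.

(** * Generation by coinvariants and lifting of coinvariants *)

Section ElementaryConditions.
Variables (k : fieldType) (H : coquasi_bialgebra k) (A : comodule_algebra H).

Definition gen_right : Prop := forall (M : right_hopf_module A) (m : M),
  exists2 s : seq (M * A), {in s, forall p, p.1 \in coinvariants M} &
    m = \sum_(p <- s) ract (p.1 ⊗ p.2).

Definition gen_left : Prop := forall (M : left_hopf_module A) (m : M),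
  exists2 s : seq (M * A), {in s, forall p, p.1 \in coinvariants M} &
    m = \sum_(p <- s) lact (p.2 ⊗ p.1).

(** Generation and lifting are the only features of an equivalence of categories from which the
    total integral and the surjectivity of can are recovered. *)
Definition lift_right : Prop :=
  forall (M N : right_hopf_module A) (f : right_hopf_hom M N),
  (forall n, exists m, f m = n) ->
  forall n, n \in coinvariants N -> exists2 m, m \in coinvariants M & f m = n.

Definition lift_left : Prop :=
  forall (M N : left_hopf_module A) (f : left_hopf_hom M N),
  (forall n, exists m, f m = n) ->
  forall n, n \in coinvariants N -> exists2 m, m \in coinvariants M & f m = n.

Lemma ker_val_coinv (C : comodule H) (N : comodule H) (f : {linear C -> N})
  (fc : colinear f) (x : ker_comodule fc) :
  x \in coinvariants (ker_comodule fc) -> ker_val f x \in coinvariants C.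
Proof. by apply: coinvariants_colinear; exact: ker_val_colinear. Qed.

(** The kernel of a morphism is itself a Hopf module, so generation applies to it. *)
Lemma gen_right_ker : gen_right ->
  forall (M N : right_hopf_module A) (f : right_hopf_hom M N) (x : M), f x = 0 ->
  exists2 s : seq (M * A), {in s, forall p, p.1 \in coinvariants M /\ f p.1 = 0} &
    x = \sum_(p <- s) ract (p.1 ⊗ p.2).
Proof.
move=> gen M N f x fx.
have [s sK sE] := gen (ker_right f) (ker_mk fx).
exists [seq (ker_val f p.1, p.2) | p <- s].
  move=> _ /mapP [p ps ->] /=; split; last exact: ker_valP.
  exact: (@ker_val_coinv _ _ _ (rhh_colinear f) _ (sK _ ps)).
rewrite big_map -[x]/(ker_val f (ker_mk fx)) {1}sE linear_sum.
by apply: eq_bigr => p _; exact: ker_ractE.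
Qed.

Lemma gen_left_ker : gen_left ->
  forall (M N : left_hopf_module A) (f : left_hopf_hom M N) (x : M), f x = 0 ->
  exists2 s : seq (M * A), {in s, forall p, p.1 \in coinvariants M /\ f p.1 = 0} &
    x = \sum_(p <- s) lact (p.2 ⊗ p.1).
Proof.
move=> gen M N f x fx.
have [s sK sE] := gen (ker_left f) (ker_mk fx).
exists [seq (ker_val f p.1, p.2) | p <- s].
  move=> _ /mapP [p ps ->] /=; split; last exact: ker_valP.
  exact: (@ker_val_coinv _ _ _ (lhh_colinear f) _ (sK _ ps)).
rewrite big_map -[x]/(ker_val f (ker_mk fx)) {1}sE linear_sum.
by apply: eq_bigr => p _; exact: ker_lactE.
Qed.
End ElementaryConditions.

(** * Free left Hopf modules *)

Ltac regroup4 :=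
  swx 3; swx 2; swx 1; swx 4; swx 3; swx 5;
  (rewrite -[LHS]rhoA_sw; last by ktril);
  (etransitivity; [do 2!(apply: eq_kfold => ? ?);
     (rewrite -[LHS]rhoA_sw; [reflexivity|by ktril])|]);
  (etransitivity; [do 4!(apply: eq_kfold => ? ?);
     (rewrite -[LHS]rhoA_sw; [reflexivity|by ktril])|]);
  (etransitivity; [do 6!(apply: eq_kfold => ? ?);
     (rewrite -[LHS]rhoA_sw; [reflexivity|by ktril])|]);
  swx 1; swx 3; swx 2; swx 5; swx 4; swx 3.

Section FreeLeftHopf.
Variables (k : fieldType) (H : coquasi_bialgebra k) (A : comodule_algebra H).
Variable V : comodule H.
Let AV := tens_comodule A V.

Lemma free_act_tril : ktrilinear (fun (a b : A) (v : V) =>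
  \Sw_(a0, a1 <- rho a) \Sw_(b0, b1 <- rho b) \Sw_(v0, v1 <- rho v)
    (omegaV (a1 ⊗ b1 ⊗ v1) *: (amul (a0 ⊗ b0) ⊗ v0))).
Proof. ktril. Qed.
(** Multiplication on the first factor, after a ⊗ (b ⊗ v) has been moved to (a ⊗ b) ⊗ v by the
    inverse associator. *)
Definition free_act := klift3 free_act_tril.
Lemma free_lact_bil : kbilinear (fun (a : A) (t : (A ⊗ V)%type) =>
  \Sw_(b, v <- t) free_act (a ⊗ b ⊗ v)).
Proof. kbil. Qed.
Definition free_lact : {linear (A ⊗ AV)%type -> AV} := klift free_lact_bil.

Lemma free_lactE a b v : free_lact (a ⊗ (b ⊗ v)) =
  \Sw_(a0, a1 <- rho a) \Sw_(b0, b1 <- rho b) \Sw_(v0, v1 <- rho v)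
    (omegaV (a1 ⊗ b1 ⊗ v1) *: (amul (a0 ⊗ b0) ⊗ v0)).
Proof. by rewrite kliftE kfold_tens ?klift3E //; kbil. Qed.

Let rho_AVE a v : @rho k H AV (a ⊗ v) = \Sw_(a0, a1 <- rho a)
  \Sw_(v0, v1 <- rho v) ((a0 ⊗ v0 : AV) ⊗ hmul (a1 ⊗ v1)).
Proof. exact: kliftE. Qed.

Let rho_free_lact a t : rho (free_lact (a ⊗ t)) =
  \Sw_(a0, a1 <- rho a) \Sw_(t0, t1 <- @rho k H AV t) (free_lact (a0 ⊗ t0) ⊗ hmul (a1 ⊗ t1)).
Proof.
move: t; apply: klinear_eq => [? ? ?|? ? ?|b v]; [by klin|by klin|].
transitivity (\Sw_(a0, a1 <- rho a) \Sw_(b0, b1 <- rho b) \Sw_(v0, v1 <- rho v)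
  \Sw_(a00, a2 <- rho a0) \Sw_(b00, b2 <- rho b0) \Sw_(v00, v2 <- rho v0)
    (omegaV (a1 ⊗ b1 ⊗ v1) *: ((amul (a00 ⊗ b00) ⊗ v00 : AV)
       ⊗ hmul (hmul (a2 ⊗ b2) ⊗ v2)))).
  rewrite free_lactE kfold_linear; apply: eq_kfold => ? ?; rewrite kfold_linear.
  apply: eq_kfold => ? ?; rewrite kfold_linear; apply: eq_kfold => ? ?.
  rewrite linearZ /= rho_AVE rho_amul kfold_kfold; last by kbil.
  rewrite -kfoldZ; apply: eq_kfold => ? ?; rewrite kfold_kfold; last by kbil.
  rewrite -kfoldZ; apply: eq_kfold => ? ?; rewrite kfold_tens; last by kbil.
  by rewrite -kfoldZ.
regroup3.
transitivity (\Sw_(a0, a' <- rho a) \Sw_(b0, b' <- rho b) \Sw_(v0, v' <- rho v)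
  ((amul (a0 ⊗ b0) ⊗ v0 : AV) ⊗
  \Sw_(a1, a2 <- comul a') \Sw_(b1, b2 <- comul b') \Sw_(v1, v2 <- comul v')
     (omegaV (a1 ⊗ b1 ⊗ v1) *: hmul (a2 ⊗ hmul (b2 ⊗ v2))))).
  do 3!apply: eq_kfold => ? ?; rewrite -hmulA_V.
  rewrite ktens_kfoldr; apply: eq_kfold => ? ?.
  rewrite ktens_kfoldr; apply: eq_kfold => ? ?.
  by rewrite ktens_kfoldr; apply: eq_kfold => ? ?; rewrite ktensZr.
symmetry.
transitivity (\Sw_(u0, u1 <- rho a) \Sw_(v0, v1 <- rho b) \Sw_(w0, w1 <- rho v)
  \Sw_(u00, u2 <- rho u0) \Sw_(v00, v2 <- rho v0) \Sw_(w00, w2 <- rho w0)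
    (omegaV (u2 ⊗ v2 ⊗ w2) *: ((amul (u00 ⊗ v00) ⊗ w00 : AV)
       ⊗ hmul (u1 ⊗ hmul (v1 ⊗ w1))))).
  apply: eq_kfold => ? ?; rewrite rho_AVE kfold_kfold; last by kbil.
  apply: eq_kfold => ? ?; rewrite kfold_kfold; last by kbil.
  apply: eq_kfold => ? ?; rewrite kfold_tens; last by kbil.
  rewrite free_lactE ktens_kfoldl; apply: eq_kfold => ? ?.
  rewrite ktens_kfoldl; apply: eq_kfold => ? ?.
  by rewrite ktens_kfoldl; apply: eq_kfold => ? ?; rewrite ktensZl.
regroup3; do 3!apply: eq_kfold => ? ?.
rewrite ktens_kfoldr; apply: eq_kfold => ? ?.
rewrite ktens_kfoldr; apply: eq_kfold => ? ?.
by rewrite ktens_kfoldr; apply: eq_kfold => ? ?; rewrite ktensZr.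
Qed.

Let free_lact1 t : free_lact (aone ⊗ t) = t.
Proof.
move: t; apply: klinear_eq => [? ? ?|//|b v]; first by klin.
rewrite free_lactE rho_coinv_sw ?coinvariants_aone //; last by kbil.
rewrite -[RHS](rho_counit_sw (f := fun b => b ⊗ v) b); last by move=> ? ? ?; klin.
apply: eq_kfold => b0 b1.
rewrite -(rho_counit_sw (f := fun v => b0 ⊗ v) v); last by move=> ? ? ?; klin.
by rewrite -kfoldZ; apply: eq_kfold => ? ?; rewrite omegaV_1l amul1l scalerA.
Qed.

(** Once all coactions are collected, the two sides are one element of A ⊗ V weighted by the two
    sides of [cocycle_hg_x_yV]. *)
Let free_lactA a b t : free_lact (amul (a ⊗ b) ⊗ t) =
  \Sw_(a0, a1 <- rho a) \Sw_(b0, b1 <- rho b) \Sw_(t0, t1 <- @rho k H AV t)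
    (omega (a1 ⊗ b1 ⊗ t1) *: free_lact (a0 ⊗ free_lact (b0 ⊗ t0))).
Proof.
move: t; apply: klinear_eq => [? ? ?|? ? ?|c v]; [by klin|by klin|].
transitivity (\Sw_(a0, a1 <- rho a) \Sw_(b0, b1 <- rho b) \Sw_(c0, c1 <- rho c)
  \Sw_(v0, v1 <- rho v) ((\Sw_(a1, a2 <- comul a1) \Sw_(b1, b2 <- comul b1)
   \Sw_(c1, c2 <- comul c1)
    (omega (a1 ⊗ b1 ⊗ c1) * omegaV (hmul (a2 ⊗ b2) ⊗ c2 ⊗ v1))) *:
    (amul (a0 ⊗ amul (b0 ⊗ c0)) ⊗ v0))).
  rewrite free_lactE rho_amul kfold_kfold; last by kbil.
  transitivity (\Sw_(v0, v1 <- rho v)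
    \Sw_(a0, a1 <- rho a) \Sw_(b0, b1 <- rho b) \Sw_(c0, c1 <- rho c)
    \Sw_(a00, a2 <- rho a0) \Sw_(b00, b2 <- rho b0) \Sw_(c00, c2 <- rho c0)
    ((omega (a2 ⊗ b2 ⊗ c2) * omegaV (hmul (a1 ⊗ b1) ⊗ c1 ⊗ v1)) *:
      (amul (a00 ⊗ amul (b00 ⊗ c00)) ⊗ v0))).
    symmetry; swx 0; apply: eq_kfold => ? ?.
    rewrite kfold_kfold; last by kbil.
    swx 0; apply: eq_kfold => ? ?; rewrite kfold_tens; last by kbil.
    swx 0; apply: eq_kfold => ? ?; apply: eq_kfold => ? ?.
    rewrite amulA ktens_kfoldl -kfoldZ; apply: eq_kfold => ? ?.
    rewrite ktens_kfoldl -kfoldZ; apply: eq_kfold => ? ?.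
    rewrite ktens_kfoldl -kfoldZ; apply: eq_kfold => ? ?.
    by rewrite ktensZl scalerA mulrC.
  symmetry; swx 2; swx 1; swx 0; apply: eq_kfold => v0 v1; symmetry; regroup3.
  do 3!apply: eq_kfold => ? ?; rewrite -kfoldZr; apply: eq_kfold => ? ?.
  by rewrite -kfoldZr; apply: eq_kfold => ? ?; rewrite -kfoldZr.
(* The outer action is kept as an opaque linear map until the legs of the inner one have been
   regrouped. *)
have G2b : kquadrilinear (fun (a b c : A) (v : V) => free_lact (a ⊗ (amul (b ⊗ c) ⊗ v))).
  by kquad.
pose G2 := klift4 G2b.
have G2E x y z w : free_lact (x ⊗ (amul (y ⊗ z) ⊗ w)) = G2 (x ⊗ y ⊗ z ⊗ w).
  by rewrite klift4E.
transitivity (\Sw_(a0, a1 <- rho a) \Sw_(b0, b1 <- rho b) \Sw_(c0, c1 <- rho c)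
  \Sw_(v0, v1 <- rho v) ((\Sw_(b1, b2 <- comul b1)
   \Sw_(c1, c2 <- comul c1) \Sw_(v1, v2 <- comul v1)
    (omegaV (b1 ⊗ c1 ⊗ v1) * omega (a1 ⊗ b2 ⊗ hmul (c2 ⊗ v2)))) *:
    G2 (a0 ⊗ b0 ⊗ c0 ⊗ v0))); last first.
  apply: eq_kfold => a0 a1; symmetry.
  transitivity (\Sw_(b0, b1 <- rho b) \Sw_(c0, c1 <- rho c) \Sw_(v0, v1 <- rho v)
    \Sw_(b00, b2 <- rho b0) \Sw_(c00, c2 <- rho c0) \Sw_(v00, v2 <- rho v0)
    ((omegaV (b2 ⊗ c2 ⊗ v2) * omega (a1 ⊗ b1 ⊗ hmul (c1 ⊗ v1))) *:
      G2 (a0 ⊗ b00 ⊗ c00 ⊗ v00))).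
    apply: eq_kfold => ? ?; rewrite rho_AVE kfold_kfold; last by kbil.
    apply: eq_kfold => ? ?; rewrite kfold_kfold; last by kbil.
    apply: eq_kfold => ? ?; rewrite kfold_tens; last by kbil.
    rewrite free_lactE ktens_kfoldr kfold_linear -kfoldZ; apply: eq_kfold => ? ?.
    rewrite ktens_kfoldr kfold_linear -kfoldZ; apply: eq_kfold => ? ?.
    rewrite ktens_kfoldr kfold_linear -kfoldZ; apply: eq_kfold => ? ?.
    by rewrite ktensZr linearZ /= G2E scalerA mulrC.
  regroup3; do 3!apply: eq_kfold => ? ?; rewrite -kfoldZr; apply: eq_kfold => ? ?.
  by rewrite -kfoldZr; apply: eq_kfold => ? ?; rewrite -kfoldZr.
symmetry.
have Tq : kquadrilinear (Q := k^o) (fun a1 b1 c1 v1 : H => \Sw_(b1, b2 <- comul b1)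
   \Sw_(c1, c2 <- comul c1) \Sw_(v1, v2 <- comul v1)
    (omegaV (b1 ⊗ c1 ⊗ v1) * omega (a1 ⊗ b2 ⊗ hmul (c2 ⊗ v2)))) by kquad.
pose T := kscal4 Tq.
transitivity (\Sw_(a0, a1 <- rho a) \Sw_(b0, b1 <- rho b) \Sw_(c0, c1 <- rho c)
  \Sw_(v0, v1 <- rho v)
  \Sw_(a00, a2 <- rho a0) \Sw_(b00, b2 <- rho b0) \Sw_(c00, c2 <- rho c0)
  \Sw_(v00, v2 <- rho v0) (T (a1 ⊗ b1 ⊗ c1 ⊗ v1) *:
   (omegaV (a2 ⊗ hmul (b2 ⊗ c2) ⊗ v2) *: (amul (a00 ⊗ amul (b00 ⊗ c00)) ⊗ v00)))).
  do 4!apply: eq_kfold => ? ?; rewrite kscal4E -G2E free_lactE -kfoldZ.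
  apply: eq_kfold => ? ?; rewrite rho_amul kfold_kfold; last by kbil.
  rewrite -kfoldZ; apply: eq_kfold => ? ?.
  rewrite kfold_kfold; last by kbil.
  rewrite -kfoldZ; apply: eq_kfold => ? ?.
  rewrite kfold_tens; last by kbil.
  by rewrite -kfoldZ.
regroup4; do 4!apply: eq_kfold => ? ?; rewrite cocycle_hg_x_yV.
rewrite -kfoldZr; apply: eq_kfold => ? ?; rewrite -kfoldZr; apply: eq_kfold => ? ?.
rewrite -kfoldZr; apply: eq_kfold => ? ?; rewrite -kfoldZr; apply: eq_kfold => ? ?.
by rewrite kscal4E scalerA mulrC.
Qed.

Definition free_left : left_hopf_module A :=
  @LeftHopfModule k H A AV free_lact rho_free_lact free_lact1 free_lactA.
End FreeLeftHopf.
(** * Cotensor products and the canonical map *)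

Record lcomodule (k : fieldType) (C : coalgebra k) := LComodule {
  lcomod_sort :> lmodType k;
  lrho : {linear lcomod_sort -> (C ⊗ lcomod_sort)%type};
  lrhoA : forall x,
    \Sw_(h, x0 <- lrho x) \Sw_(h1, h2 <- comul h) (h1 ⊗ h2 ⊗ x0) =
    \Sw_(h1, x' <- lrho x) \Sw_(h2, x0 <- lrho x') (h1 ⊗ h2 ⊗ x0);
  lrho_counit : forall x, \Sw_(h, x0 <- lrho x) (counit h *: x0) = x
}.
Arguments lrho {k C _}.

Lemma lrhoA_sw (k : fieldType) (C : coalgebra k) (X : lcomodule C) (Q : lmodType k)
    (F : C -> C -> X -> Q) x : ktrilinear F ->
  \Sw_(h, x0 <- lrho x) \Sw_(h1, h2 <- comul h) F h1 h2 x0 =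
  \Sw_(h1, x' <- lrho x) \Sw_(h2, x0 <- lrho x') F h1 h2 x0.
Proof.
move=> Ft; pose F' := klift3 Ft; have := congr1 F' (lrhoA x); rewrite !kfold_linear => e.
etransitivity; [|etransitivity; first exact: e]; apply: eq_kfold => a b;
  by rewrite kfold_linear; apply: eq_kfold => ? ?; rewrite klift3E.
Qed.

Lemma lrho_counit_sw (k : fieldType) (C : coalgebra k) (X : lcomodule C) (Q : lmodType k)
    (f : {linear X -> Q}) x : \Sw_(h, x0 <- lrho x) (counit h *: f x0) = f x.
Proof.
rewrite -[in RHS](lrho_counit x) kfold_linear.
by apply: eq_kfold => ? ?; rewrite linearZ.
Qed.

Section DualComodule.
Variables (k : fieldType) (H : coquasi_hopf k) (X : lcomodule H).

Lemma rho_dual_lin : linear (fun x : X => \Sw_(h, x0 <- lrho x) (x0 ⊗ antipode h)).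
Proof. by move=> ? ? ?; klin. Qed.
Definition rho_dual : {linear X -> (X ⊗ H)%type} := linof rho_dual_lin.

Lemma rho_dual_sw (Q : lmodType k) (F : X -> H -> Q) x : kbilinear F ->
  kfold F (rho_dual x) = \Sw_(h, x0 <- lrho x) F x0 (antipode h).
Proof.
by move=> Fb; rewrite kfold_kfold //; apply: eq_kfold => ? ?; rewrite kfold_tens.
Qed.

Let rho_dualA x :
  \Sw_(m0, m' <- rho_dual x) \Sw_(m1, m2 <- comul m') (m0 ⊗ m1 ⊗ m2) =
  \Sw_(m', m2 <- rho_dual x) \Sw_(m0, m1 <- rho_dual m') (m0 ⊗ m1 ⊗ m2).
Proof.
rewrite !rho_dual_sw; [|by kbil|by kbil].
under eq_kfold => ? ? do (rewrite comul_antipode_sw; last by kbil).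
under [RHS]eq_kfold => ? ? do (rewrite rho_dual_sw; last by kbil).
by rewrite lrhoA_sw //; ktril.
Qed.

Let rho_dual_counit x : \Sw_(m0, m1 <- rho_dual x) (counit m1 *: m0) = x.
Proof.
rewrite rho_dual_sw; last by kbil.
by rewrite -[RHS]lrho_counit; apply: eq_kfold => ? ?; rewrite counit_antipode.
Qed.

Definition dual_comodule : comodule H := Comodule rho_dualA rho_dual_counit.
End DualComodule.

(** * Identities for κ and β behind the cotensor isomorphism *)

Section KappaIdentities.
Variables (k : fieldType) (H : coquasi_hopf k).
Implicit Types a h : H.

(** Write a_1 as a_1 1, expand 1 backwards by the contraction for α, and reassociate with
    [hmulA]. *)
Lemma kappa_mul a h : \Sw_(a1, a2 <- comul a) (kappa a2 h *: a1) =
  \Sw_(a1, a2 <- comul a) \Sw_(h1, r <- comul h) \Sw_(h2, h3 <- comul r)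
    (kappa a1 h2 *: hmul (hmul (a2 ⊗ antipode h1) ⊗ h3)).
Proof.
have Ft : ktrilinear (fun z g x : H => \Sw_(a1, a2 <- comul a)
  (omega (a2 ⊗ g ⊗ x) *: hmul (a1 ⊗ z))) by ktril.
transitivity (\Sw_(h1, r <- comul h) \Sw_(h2, h3 <- comul r)
    (halpha h2 *: klift3 Ft (hone ⊗ antipode h1 ⊗ h3))).
  transitivity (\Sw_(a1, a2 <- comul a) \Sw_(h1, r <- comul h) \Sw_(h2, h3 <- comul r)
      ((halpha h2 * omega (a2 ⊗ antipode h1 ⊗ h3)) *: a1)).
    apply: eq_kfold => ? ?; rewrite -kfoldZr; apply: eq_kfold => ? ?.
    by rewrite -kfoldZr.
  swx 0; apply: eq_kfold => ? ?; swx 0; apply: eq_kfold => ? ?.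
  rewrite klift3E -kfoldZ; apply: eq_kfold => ? ?.
  by rewrite hmul1r scalerA.
rewrite -contract_alpha_mul.
transitivity (\Sw_(h1, r <- comul h) \Sw_(h2, h3 <- comul r)
  \Sw_(a1, a2 <- comul a) \Sw_(g1, g2 <- comul (antipode h1)) \Sw_(x1, x2 <- comul h3)
  (halpha h2 *: (omega (a1 ⊗ g1 ⊗ x1) *: hmul (hmul (a2 ⊗ g2) ⊗ x2)))).
  do 2!apply: eq_kfold => ? ?.
  under [RHS]eq_kfold => ? ? do under eq_kfold => ? ? do rewrite kfoldZ.
  under [RHS]eq_kfold => ? ? do rewrite kfoldZ.
  rewrite kfoldZ -hmulA; congr (_ *: _); symmetry; swx 0; swx 1.
  by do 2!apply: eq_kfold => ? ?; rewrite klift3E.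
swx 1; swx 0; apply: eq_kfold => a1 a2.
under eq_kfold => h1 r do under eq_kfold => h2 h3 do
  (rewrite comul_antipode_sw; last by kbil).
swx 1; rewrite -comulA_sw; last by ktril.
apply: eq_kfold => h1 r.
transitivity (\Sw_(g1, r <- comul r) \Sw_(h2, h3 <- comul r) \Sw_(x1, x2 <- comul h3)
  ((halpha h2 * omega (a1 ⊗ antipode g1 ⊗ x1)) *: hmul (hmul (a2 ⊗ antipode h1) ⊗ x2))).
  by do 3!apply: eq_kfold => ? ?; rewrite scalerA.
under eq_kfold => ? ? do (rewrite comulA_sw; last by ktril).
rewrite comulA_sw; last by ktril.
apply: eq_kfold => h2 h3; rewrite -kfoldZr; apply: eq_kfold => ? ?.
by rewrite -kfoldZr.
Qed.

(* The functional [nu] degenerates to [kappa * beta] when its second argument is *)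
(* 1, which is what a_2 S(h_1) becomes on coinvariants.                          *)
Definition nu (a z h : H) : k :=
  \Sw_(h1, r1 <- comul h) \Sw_(h2, r2 <- comul r1) \Sw_(h3, r3 <- comul r2)
  \Sw_(h4, h5 <- comul r3) \Sw_(x1, x2 <- comul h3)
    (halpha h2 * hbeta h4 * (omega (a ⊗ antipode h1 ⊗ x1) * omegaV (z ⊗ x2 ⊗ antipode h5))).

Lemma nu_tril : ktrilinear (Q := k^o) nu. Proof. rewrite /nu; ktril. Qed.

Lemma nu_one a h : nu a hone h = \Sw_(h1, h2 <- comul h) (kappa a h1 * hbeta h2).
Proof.
transitivity (\Sw_(h1, r1 <- comul h) \Sw_(h2, r2 <- comul r1) \Sw_(h3, h4 <- comul r2)
    (halpha h2 * hbeta h4 * omega (a ⊗ antipode h1 ⊗ h3))).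
  apply: eq_kfold => h1 r1; apply: eq_kfold => h2 r2; apply: eq_kfold => h3 r3.
  rewrite -[hbeta r3](@counitr_k _ _ (hbeta (k := k) (c := H))); last by move=> ? ? ?; klin.
  rewrite kfoldMl kfoldMr; apply: eq_kfold => h4 h5.
  rewrite -(@counitr_k _ _ (fun x => omega (a ⊗ antipode h1 ⊗ x)) h3);
    last by move=> ? ? ?; klin.
  rewrite kfoldMl; apply: eq_kfold => ? ?.
  by rewrite omegaV_1l counit_antipode; ring.
under eq_kfold => h1 r1 do (rewrite comulA_k; last by ktril).
rewrite comulA_k; last by ktril.
apply: eq_kfold => l h4; rewrite /kappa kfoldMr; apply: eq_kfold => ? ?.
by rewrite kfoldMr; apply: eq_kfold => ? ?; ring.
Qed.

Let Jlhs a g x y := \Sw_(h1, h2 <- comul a) \Sw_(g1, g2 <- comul g) \Sw_(x1, x2 <- comul x)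
    (omega (h1 ⊗ g1 ⊗ x1) * omegaV (hmul (h2 ⊗ g2) ⊗ x2 ⊗ y)).

(** In the form given by [cocycle_hg_x_yV] the last ω contains the product of a leg of h_3 with a
    leg of S(h_5). β contracts it to 1, where ω is trivial. *)
Let Jlhs_beta a g h :
  \Sw_(h3, r3 <- comul h) \Sw_(h4, h5 <- comul r3) (hbeta h4 * Jlhs a g h3 (antipode h5)) =
  \Sw_(h3, r3 <- comul h) \Sw_(h4, h5 <- comul r3) (hbeta h4 *
    \Sw_(g1, g2 <- comul g) \Sw_(x1, x2 <- comul h3) \Sw_(y1, y2 <- comul (antipode h5))
     (omegaV (a ⊗ hmul (g1 ⊗ x1) ⊗ y1) * omegaV (g2 ⊗ x2 ⊗ y2))).
Proof.
have Ft : ktrilinear (Q := k^o) (fun x y z : H => \Sw_(a1, a2 <- comul a)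
  \Sw_(g1, g' <- comul g) \Sw_(g2, g3 <- comul g')
  \Sw_(x1, x2 <- comul x) \Sw_(y1, y2 <- comul y)
  (omegaV (a1 ⊗ hmul (g1 ⊗ x1) ⊗ y1) * omegaV (g2 ⊗ x2 ⊗ y2) * omega (a2 ⊗ g3 ⊗ z))).
  by ktril.
transitivity (\Sw_(h3, r3 <- comul h) \Sw_(h4, h5 <- comul r3) (hbeta h4 *
  \Sw_(x1, x2 <- comul h3) \Sw_(y1, y2 <- comul (antipode h5))
    kscal3 Ft (x1 ⊗ y1 ⊗ hmul (x2 ⊗ y2)))).
  apply: eq_kfold => h3 r3; apply: eq_kfold => h4 h5; congr (_ * _).
  rewrite /Jlhs cocycle_hg_x_yV; move: (antipode h5) => y {h4 h5}.
  transitivity (\Sw_(x', x3 <- comul h3) \Sw_(y', y3 <- comul y) \Sw_(a1, a2 <- comul a)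
    \Sw_(g1, g' <- comul g) \Sw_(g2, g3 <- comul g') \Sw_(x1, x2 <- comul x')
    \Sw_(y1, y2 <- comul y') (omegaV (a1 ⊗ hmul (g1 ⊗ x1) ⊗ y1) *
      omegaV (g2 ⊗ x2 ⊗ y2) * omega (a2 ⊗ g3 ⊗ hmul (x3 ⊗ y3)))); last first.
    by do 2!apply: eq_kfold => ? ?; rewrite kscal3E.
  symmetry; swx 1; swx 0; apply: eq_kfold => a1 a2.
  swx 1; swx 0; apply: eq_kfold => g1 g'.
  swx 1; swx 0; swx 2; symmetry.
  transitivity (\Sw_(x1, x' <- comul h3) \Sw_(y1, y' <- comul y)
    \Sw_(g2, g3 <- comul g') \Sw_(x2, x3 <- comul x') \Sw_(y2, y3 <- comul y')
    (omegaV (a1 ⊗ hmul (g1 ⊗ x1) ⊗ y1) * omegaV (g2 ⊗ x2 ⊗ y2) *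
     omega (a2 ⊗ g3 ⊗ hmul (x3 ⊗ y3)))).
    do 2!apply: eq_kfold => ? ?; rewrite kfoldMl; apply: eq_kfold => ? ?.
    rewrite kfoldMl; apply: eq_kfold => ? ?.
    by rewrite kfoldMl; apply: eq_kfold => ? ?; rewrite mulrA.
  swx 1; swx 0; apply: eq_kfold => g2 g3; swx 1.
  rewrite comulA_k; last by ktril.
  do 2!apply: eq_kfold => ? ?.
  by rewrite comulA_k //; ktril.
have e := contract_beta_mul (Q := k^o) (kscal3 Ft) h.
etransitivity; first exact: e.
apply: eq_kfold => h3 r3; apply: eq_kfold => h4 h5; congr (_ * _).
rewrite kscal3E; move: (antipode h5) => y {h4 h5 e}.
rewrite -[RHS](@counitr_k _ _ (fun a => \Sw_(g1, g2 <- comul g) \Sw_(x1, x2 <- comul h3)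
  \Sw_(y1, y2 <- comul y) (omegaV (a ⊗ hmul (g1 ⊗ x1) ⊗ y1) * omegaV (g2 ⊗ x2 ⊗ y2))));
  last by move=> ? ? ?; klin.
apply: eq_kfold => a1 a2; rewrite kfoldMl; apply: eq_kfold => g1 g'.
rewrite -(@counitr_k _ _ (fun g' => \Sw_(x1, x2 <- comul h3)
  \Sw_(y1, y2 <- comul y) (omegaV (a1 ⊗ hmul (g1 ⊗ x1) ⊗ y1) * omegaV (g' ⊗ x2 ⊗ y2))) g');
  last by move=> ? ? ?; klin.
rewrite kfoldMl; apply: eq_kfold => g2 g3; rewrite !kfoldMl; apply: eq_kfold => x1 x2.
rewrite !kfoldMl; apply: eq_kfold => y1 y2; rewrite omega_1r; ring.
Qed.

(** β is contracted by [Jlhs_beta], then α contracts the product of S(h_1) and h_3 to 1, and what is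
    left is [omegaV_antipode]. *)
Lemma nu_total a h :
  \Sw_(a1, a2 <- comul a) \Sw_(h1, r <- comul h) nu a1 (hmul (a2 ⊗ antipode h1)) r =
  counit a * counit h.
Proof.
transitivity (\Sw_(h1, r1 <- comul h) \Sw_(h2, r2 <- comul r1) (halpha h2 *
  (\Sw_(h3, r3 <- comul r2) \Sw_(h4, h5 <- comul r3)
    (hbeta h4 * Jlhs a (antipode h1) h3 (antipode h5))))).
  transitivity (\Sw_(h1, r0 <- comul h) \Sw_(d, r1 <- comul r0)
    \Sw_(h2, r2 <- comul r1) \Sw_(h3, r3 <- comul r2)
    \Sw_(h4, h5 <- comul r3) \Sw_(a1, a2 <- comul a) \Sw_(x1, x2 <- comul h3)
    (halpha h2 * hbeta h4 * (omega (a1 ⊗ antipode d ⊗ x1) *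
       omegaV (hmul (a2 ⊗ antipode h1) ⊗ x2 ⊗ antipode h5)))).
    swx 0; apply: eq_kfold => h1 r0; rewrite /nu.
    swx 0; apply: eq_kfold => ? ?; swx 0; apply: eq_kfold => ? ?.
    swx 0; apply: eq_kfold => ? ?; swx 0; apply: eq_kfold => ? ?.
    by apply: eq_kfold => ? ?.
  rewrite comulA_k; last by ktril.
  apply: eq_kfold => l r1; rewrite kfold_exchange; apply: eq_kfold => h2 r2.
  rewrite kfoldMl kfold_exchange; apply: eq_kfold => h3 r3.
  rewrite kfoldMl kfold_exchange; apply: eq_kfold => h4 h5.
  rewrite kfold_exchange /Jlhs [hbeta h4 * _]kfoldMl [RHS]kfoldMl.
  apply: eq_kfold => a1 a2.
  rewrite comul_antipode_k; last by kbil.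
  rewrite !kfoldMl; apply: eq_kfold => c d; rewrite !kfoldMl.
  by apply: eq_kfold => x1 x2; ring.
under eq_kfold => h1 r1 do under eq_kfold => h2 r2 do rewrite Jlhs_beta.
transitivity (\Sw_(h1, r1 <- comul h) \Sw_(h2, r2 <- comul r1) \Sw_(h3, r3 <- comul r2)
  (halpha h2 * \Sw_(h4, h5 <- comul r3) (hbeta h4 *
    \Sw_(g1, g2 <- comul (antipode h1)) \Sw_(x1, x2 <- comul h3)
    \Sw_(y1, y2 <- comul (antipode h5))
     (omegaV (a ⊗ hmul (g1 ⊗ x1) ⊗ y1) * omegaV (g2 ⊗ x2 ⊗ y2))))).
  by do 2!apply: eq_kfold => ? ?; rewrite kfoldMl.
under eq_kfold => h1 r1 do (rewrite comulA_k; last by ktril).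
rewrite comulA_k; last by ktril.
have Ft r3 : ktrilinear (Q := k^o) (fun z g x : H => \Sw_(h4, h5 <- comul r3) (hbeta h4 *
  \Sw_(y1, y2 <- comul (antipode h5)) (omegaV (a ⊗ z ⊗ y1) * omegaV (g ⊗ x ⊗ y2)))).
  by ktril.
transitivity (\Sw_(l, r3 <- comul h) \Sw_(h1, r <- comul l) \Sw_(h2, h3 <- comul r)
    (halpha h2 * \Sw_(h4, h5 <- comul r3) (hbeta h4 * \Sw_(y1, y2 <- comul (antipode h5))
       (omegaV (a ⊗ hone ⊗ y1) * omegaV (antipode h1 ⊗ h3 ⊗ y2))))).
  apply: eq_kfold => l r3; have e := contract_alpha_mul (Q := k^o) (kscal3 (Ft r3)) l.
  etransitivity; [|etransitivity; first exact: e]; last first.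
    by do 2!apply: eq_kfold => ? ?; congr (_ * _); exact: kscal3E.
  do 2!apply: eq_kfold => ? ?; congr (_ * _).
  under eq_kfold => h4 h5 do rewrite kfoldMl.
  swx 0; apply: eq_kfold => g1 g2; under eq_kfold => h4 h5 do rewrite kfoldMl.
  by swx 0; apply: eq_kfold => x1 x2; rewrite kscal3E.
rewrite mulrC -omegaV_antipode kfoldMr.
rewrite -comulA_k; last by ktril.
apply: eq_kfold => h1 r1; rewrite -comulA_k; last by ktril.
rewrite kfoldMr.
apply: eq_kfold => h2 r2; rewrite kfoldMr; apply: eq_kfold => h3 r3.
rewrite kfoldMl kfoldMr; apply: eq_kfold => h4 h5.
rewrite -(@counitl_k _ _ (fun y => omegaV (antipode h1 ⊗ (halpha h2 *: (hbeta h4 *: h3)) ⊗ y))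
  (antipode h5)); last by move=> ? ? ?; klin.
rewrite kfoldMr !kfoldMl; apply: eq_kfold => y1 y2.
by rewrite omegaV_1m !(ktensZl, ktensZr) !linearZ /=; ring.
Qed.
End KappaIdentities.
(* V □ X, the vectors with v_0 ⊗ v_1 ⊗ x = v ⊗ x_{-1} ⊗ x_0, is identified with the *)
(* coinvariants of V ⊗ X', where X' is X with the coaction x |-> x_0 ⊗ S(x_{-1}).    *)
Section Cotensor.
Variables (k : fieldType) (H : coquasi_hopf k) (V : comodule H) (X : lcomodule H).
Let VX := tens_comodule V (dual_comodule X).

Definition cotensor (u : (V ⊗ X)%type) : Prop :=
  \Sw_(v, x <- u) \Sw_(v0, v1 <- rho v) (v0 ⊗ v1 ⊗ x) =
  \Sw_(v, x <- u) \Sw_(h, x0 <- lrho x) (v ⊗ h ⊗ x0).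

Lemma cotensor_sw (Q : lmodType k) (F : {linear (V ⊗ H ⊗ X)%type -> Q}) u : cotensor u ->
  \Sw_(v, x <- u) \Sw_(v0, v1 <- rho v) F (v0 ⊗ v1 ⊗ x) =
  \Sw_(v, x <- u) \Sw_(h, x0 <- lrho x) F (v ⊗ h ⊗ x0).
Proof.
move/(congr1 F); rewrite !kfold_linear => e.
etransitivity; [|etransitivity; first exact: e]; apply: eq_kfold => ? ?;
  by rewrite kfold_linear.
Qed.

Lemma rho_tens_dual v x : @rho k H VX (v ⊗ x) = \Sw_(v0, v1 <- rho v)
  \Sw_(h, x0 <- lrho x) ((v0 ⊗ x0 : VX) ⊗ hmul (v1 ⊗ antipode h)).
Proof.
rewrite [LHS]kliftE; apply: eq_kfold => v0 v1.
by rewrite [LHS]rho_dual_sw //; kbil.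
Qed.

Lemma coinv_dual_sw (Q : lmodType k) (F : {linear (V ⊗ H ⊗ X)%type -> Q}) (u : VX) :
  u \in coinvariants VX ->
  \Sw_(v, x <- (u : (V ⊗ X)%type)) \Sw_(v0, v1 <- rho v) \Sw_(h, x0 <- lrho x)
     F (v0 ⊗ hmul (v1 ⊗ antipode h) ⊗ x0) =
  \Sw_(v, x <- (u : (V ⊗ X)%type)) F (v ⊗ hone ⊗ x).
Proof.
move=> uc; pose G (t : VX) (z : H) := \Sw_(v, x <- (t : (V ⊗ X)%type)) F (v ⊗ z ⊗ x).
have Gb : kbilinear G by rewrite /G; kbil.
rewrite -[RHS](rho_coinv_sw Gb uc); move: (u : (V ⊗ X)%type) => {uc}.
apply: klinear_eq => [? ? ?|? ? ?|v x]; first by klin.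
  by apply: (kfold_linarg Gb); rewrite linearP.
rewrite kfold_tens; last by kbil.
symmetry; etransitivity; first exact: (rho_tens_sw (V := V) (W := dual_comodule X) v x Gb).
apply: eq_kfold => v0 v1; rewrite [LHS]rho_dual_sw; last by rewrite /G; kbil.
by apply: eq_kfold => ? ?; rewrite /G kfold_tens //; kbil.
Qed.

Lemma cot_beta_bil : kbilinear (fun (v : V) (x : X) =>
  \Sw_(h, x0 <- lrho x) (hbeta h *: (v ⊗ x0))).
Proof. kbil. Qed.
Definition cot_beta : {linear (V ⊗ X)%type -> (V ⊗ X)%type} := klift cot_beta_bil.
Lemma cot_kappa_bil : kbilinear (fun (v : V) (x : X) => \Sw_(v0, v1 <- rho v)
  \Sw_(h, x0 <- lrho x) (kappa v1 h *: (v0 ⊗ x0))).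
Proof. rewrite /kappa; kbil. Qed.
Definition cot_kappa : {linear (V ⊗ X)%type -> (V ⊗ X)%type} := klift cot_kappa_bil.

Lemma cot_betaE (Q : lmodType k) (F : {linear (V ⊗ X)%type -> Q}) u :
  F (cot_beta u) = \Sw_(v, x <- u) \Sw_(h, x0 <- lrho x) (hbeta h *: F (v ⊗ x0)).
Proof.
move: u; apply: klinear_eq => [? ? ?|? ? ?|v x]; [by klin|by klin|].
rewrite kliftE kfold_tens; last by kbil.
by rewrite kfold_linear; apply: eq_kfold => ? ?; rewrite linearZ.
Qed.

Lemma cot_kappaE (Q : lmodType k) (F : {linear (V ⊗ X)%type -> Q}) u :
  F (cot_kappa u) = \Sw_(v, x <- u) \Sw_(v0, v1 <- rho v)
    \Sw_(h, x0 <- lrho x) (kappa v1 h *: F (v0 ⊗ x0)).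
Proof.
move: u; apply: klinear_eq => [? ? ?|? ? ?|v x]; [by klin|by rewrite /kappa; klin|].
rewrite kliftE kfold_tens; last by rewrite /kappa; kbil.
rewrite kfold_linear; apply: eq_kfold => ? ?.
by rewrite kfold_linear; apply: eq_kfold => ? ?; rewrite linearZ.
Qed.

(** The cotensor relation trades the leg of v in the coaction for a leg of x, which then meets β and
    the antipode and contracts to 1. *)
Lemma cot_beta_coinv u : cotensor u -> (cot_beta u : VX) \in coinvariants VX.
Proof.
move=> uc; apply/coinvariantP.
have -> (z : H) : (cot_beta u : VX) ⊗ z = linof (fun c x y => ktensPl c x y z) (cot_beta u : VX).
  by [].
rewrite (cot_betaE (linof (fun c x y => ktensPl c x y hone))).
rewrite (cot_betaE (@rho k H VX)).
have Ft : ktrilinear (fun (v : V) (z : H) (x : X) => \Sw_(h, x' <- lrho x)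
   \Sw_(h', x0 <- lrho x') (hbeta h *: ((v ⊗ x0 : VX) ⊗ hmul (z ⊗ antipode h')))).
  by ktril.
transitivity (\Sw_(v, x <- u) \Sw_(v0, v1 <- rho v) klift3 Ft (v0 ⊗ v1 ⊗ x)).
  apply: eq_kfold => v x.
  transitivity (\Sw_(h, x' <- lrho x) \Sw_(v0, v1 <- rho v) \Sw_(h', x0 <- lrho x')
     (hbeta h *: ((v0 ⊗ x0 : VX) ⊗ hmul (v1 ⊗ antipode h')))).
    by apply: eq_kfold => h x'; rewrite rho_tens_dual -kfoldZ; apply: eq_kfold => v0 v1;
      rewrite -kfoldZ.
  by swx 0; apply: eq_kfold => ? ?; rewrite klift3E.
rewrite cotensor_sw //; apply: eq_kfold => v x.
under eq_kfold => ? ? do rewrite klift3E.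
rewrite -lrhoA_sw; last by ktril.
swx 1; rewrite -lrhoA_sw; last by ktril.
apply: eq_kfold => L x0; rewrite -comulA_sw; last by ktril.
have fl : linear (fun z : H => (v ⊗ x0 : VX) ⊗ z) by move=> ? ? ?; klin.
exact: (contract_beta (linof fl)).
Qed.

(** [kappa_mul] produces a factor v_2 S(h_1), and on coinvariants this factor may be replaced by 1
    ([coinv_dual_sw]). *)
Lemma cot_kappa_cotensor (u : VX) : u \in coinvariants VX -> cotensor (cot_kappa u).
Proof.
move=> uc; rewrite /cotensor.
have b1 : kbilinear (fun (v : V) (x : X) => \Sw_(v0, v1 <- rho v) (v0 ⊗ v1 ⊗ x)) by kbil.
have b2 : kbilinear (fun (v : V) (x : X) => \Sw_(h, x0 <- lrho x) (v ⊗ h ⊗ x0)) by kbil.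
have e1 (t : (V ⊗ X)%type) : \Sw_(v, x <- t) \Sw_(v0, v1 <- rho v) (v0 ⊗ v1 ⊗ x) = klift b1 t.
  by rewrite -[t in RHS]kfold_id kfold_linear; apply: eq_kfold => ? ?; rewrite kliftE.
have e2 (t : (V ⊗ X)%type) : \Sw_(v, x <- t) \Sw_(h, x0 <- lrho x) (v ⊗ h ⊗ x0) = klift b2 t.
  by rewrite -[t in RHS]kfold_id kfold_linear; apply: eq_kfold => ? ?; rewrite kliftE.
rewrite e1 e2 !cot_kappaE {e1 e2}.
have Ft : ktrilinear (fun (v : V) (z : H) (x : X) => \Sw_(v0, v1 <- rho v)
  \Sw_(h, x0 <- lrho x) \Sw_(h2, h3 <- comul h)
  (kappa v1 h2 *: (v0 ⊗ hmul (z ⊗ h3) ⊗ x0))) by rewrite /kappa; ktril.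
transitivity (\Sw_(v, x <- (u : (V ⊗ X)%type)) klift3 Ft (v ⊗ hone ⊗ x)); last first.
  apply: eq_kfold => v x; rewrite klift3E; apply: eq_kfold => v0 v1.
  rewrite lrhoA_sw; last by rewrite /kappa; ktril.
  apply: eq_kfold => h2 x'; rewrite kliftE -kfoldZ; apply: eq_kfold => h3 x0.
  by rewrite hmul1l.
rewrite -coinv_dual_sw //; apply: eq_kfold => v x.
transitivity (\Sw_(v0, v' <- rho v) \Sw_(h, x0 <- lrho x)
  (v0 ⊗ (\Sw_(v1, v2 <- comul v') (kappa v2 h *: v1)) ⊗ x0)).
  transitivity (\Sw_(v', v2 <- rho v) \Sw_(v0, v1 <- rho v') \Sw_(h, x0 <- lrho x)
     (kappa v2 h *: (v0 ⊗ v1 ⊗ x0))).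
    apply: eq_kfold => ? ?; under eq_kfold => ? ? do rewrite kliftE -kfoldZ.
    by swx 0.
  rewrite -rhoA_sw; last by rewrite /kappa; ktril.
  apply: eq_kfold => ? ?; swx 0; apply: eq_kfold => ? ?.
  rewrite ktens_kfoldr ktens_kfoldl; apply: eq_kfold => ? ?.
  by rewrite ktensZr ktensZl.
symmetry.
transitivity (\Sw_(v', v2 <- rho v) \Sw_(v0, v1 <- rho v') \Sw_(h1, x' <- lrho x)
  \Sw_(h, x0 <- lrho x') \Sw_(h2, h3 <- comul h)
  (kappa v1 h2 *: (v0 ⊗ hmul (hmul (v2 ⊗ antipode h1) ⊗ h3) ⊗ x0))).
  apply: eq_kfold => ? ?; under eq_kfold => ? ? do rewrite klift3E.
  by swx 0.
rewrite -rhoA_sw; last by rewrite /kappa; ktril.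
apply: eq_kfold => v0 v'; symmetry.
transitivity (\Sw_(h, x0 <- lrho x) (v0 ⊗ (
  \Sw_(a1, a2 <- comul v') \Sw_(h1, r <- comul h) \Sw_(h2, h3 <- comul r)
    (kappa a1 h2 *: hmul (hmul (a2 ⊗ antipode h1) ⊗ h3))) ⊗ x0)).
  by apply: eq_kfold => h x0; rewrite kappa_mul.
transitivity (\Sw_(v1, v2 <- comul v') \Sw_(h, x0 <- lrho x)
  \Sw_(h1, r <- comul h) \Sw_(h2, h3 <- comul r)
  (kappa v1 h2 *: (v0 ⊗ hmul (hmul (v2 ⊗ antipode h1) ⊗ h3) ⊗ x0))).
  symmetry; swx 0; apply: eq_kfold => h x0; symmetry.
  rewrite ktens_kfoldr ktens_kfoldl; apply: eq_kfold => ? ?.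
  rewrite ktens_kfoldr ktens_kfoldl; apply: eq_kfold => ? ?.
  rewrite ktens_kfoldr ktens_kfoldl; apply: eq_kfold => ? ?.
  by rewrite ktensZr ktensZl.
apply: eq_kfold => v1 v2; rewrite lrhoA_sw //; by rewrite /kappa; ktril.
Qed.

(** After the cotensor relation all legs in κ and β come from x, and [kappa_beta] applies. *)
Lemma cot_kappaK u : cotensor u -> cot_kappa (cot_beta u) = u.
Proof.
move=> uc; rewrite (cot_betaE cot_kappa).
have Ft : ktrilinear (fun (v : V) (z : H) (x : X) => \Sw_(h, x' <- lrho x)
   \Sw_(h', x0 <- lrho x') ((hbeta h * kappa z h') *: (v ⊗ x0))).
  by rewrite /kappa; ktril.
transitivity (\Sw_(v, x <- u) \Sw_(v0, v1 <- rho v) klift3 Ft (v0 ⊗ v1 ⊗ x)).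
  apply: eq_kfold => v x.
  transitivity (\Sw_(h, x' <- lrho x) \Sw_(v0, v1 <- rho v) \Sw_(h', x0 <- lrho x')
     ((hbeta h * kappa v1 h') *: (v0 ⊗ x0))).
    apply: eq_kfold => h x'; rewrite kliftE -kfoldZ; apply: eq_kfold => v0 v1.
    by rewrite -kfoldZ; apply: eq_kfold => ? ?; rewrite scalerA.
  by swx 0; apply: eq_kfold => ? ?; rewrite klift3E.
rewrite cotensor_sw // -[RHS]kfold_id; apply: eq_kfold => v x.
under eq_kfold => ? ? do rewrite klift3E.
rewrite -lrhoA_sw; last by rewrite /kappa; ktril.
swx 1; rewrite -lrhoA_sw; last by rewrite /kappa; ktril.
have fl : linear (fun x : X => v ⊗ x) by move=> ? ? ?; klin.
rewrite -[RHS](lrho_counit_sw (linof fl) x).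
apply: eq_kfold => L x0; rewrite -comulA_sw; last by rewrite /kappa; ktril.
rewrite -kappa_beta -kfoldZr; apply: eq_kfold => ? ?.
by rewrite -kfoldZr.
Qed.

(** The composite is given by the values of [nu] at 1. On a coinvariant this 1 may be replaced by
    v_2 S(h_1), and [nu_total] finishes. *)
Lemma cot_betaK (u : VX) : u \in coinvariants VX -> cot_beta (cot_kappa u) = u.
Proof.
move=> uc; rewrite (cot_kappaE cot_beta).
have [n1 n2 n3] := nu_tril H.
have Ft : ktrilinear (fun (v : V) (z : H) (x : X) => \Sw_(v0, v1 <- rho v)
  \Sw_(h, x0 <- lrho x) (nu v1 z h *: (v0 ⊗ x0))) by rewrite /nu; ktril.
transitivity (\Sw_(v, x <- (u : (V ⊗ X)%type)) klift3 Ft (v ⊗ hone ⊗ x)).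
  apply: eq_kfold => v x; rewrite klift3E; apply: eq_kfold => v0 v1.
  transitivity (\Sw_(h1, x' <- lrho x) \Sw_(h2, x0 <- lrho x')
    ((kappa v1 h1 * hbeta h2) *: (v0 ⊗ x0))).
    apply: eq_kfold => ? ?; rewrite kliftE -kfoldZ; apply: eq_kfold => ? ?.
    by rewrite scalerA.
  rewrite -lrhoA_sw; last by rewrite /kappa; ktril.
  by apply: eq_kfold => ? ?; rewrite nu_one -kfoldZr.
rewrite -coinv_dual_sw // -[RHS]kfold_id; apply: eq_kfold => v x.
transitivity (\Sw_(v', v2 <- rho v) \Sw_(v0, v1 <- rho v') \Sw_(h1, x' <- lrho x)
  \Sw_(h, x0 <- lrho x') (nu v1 (hmul (v2 ⊗ antipode h1)) h *: (v0 ⊗ x0))).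
  apply: eq_kfold => ? ?; under eq_kfold => ? ? do rewrite klift3E.
  by swx 0.
rewrite -rhoA_sw; last by rewrite /nu; ktril.
rewrite -[RHS](rho_counit_sw (f := fun v => v ⊗ x)); last by move=> ? ? ?; klin.
apply: eq_kfold => v0 v'.
have fl : linear (fun x : X => v0 ⊗ x) by move=> ? ? ?; klin.
transitivity (\Sw_(v1, v2 <- comul v') \Sw_(h, x0 <- lrho x) \Sw_(h1, r <- comul h)
   (nu v1 (hmul (v2 ⊗ antipode h1)) r *: (v0 ⊗ x0))).
  apply: eq_kfold => ? ?; rewrite lrhoA_sw //; by rewrite /nu; ktril.
swx 0; rewrite -[v0 ⊗ x](lrho_counit_sw (linof fl) x) -kfoldZ.
apply: eq_kfold => h x0; rewrite scalerA -nu_total -kfoldZr.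
by apply: eq_kfold => ? ?; rewrite -kfoldZr.
Qed.
End Cotensor.
Section KappaCocycle.
Variables (k : fieldType) (H : coquasi_hopf k).
Implicit Types l b h : H.

Lemma kappa_one h : kappa hone h = halpha h.
Proof.
rewrite /kappa; transitivity (\Sw_(h1, r <- comul h) (counit h1 * halpha r)).
  apply: eq_kfold => h1 r; rewrite -[halpha r](@counitr_k _ _ (halpha (k := k) (c := H)));
    last by move=> ? ? ?; klin.
  rewrite kfoldMl; apply: eq_kfold => h2 h3.
  by rewrite omega_1l counit_antipode; ring.
by apply: counitl_k => ? ? ?; klin.
Qed.

(** Expanding κ, [cocycle_h_g_xV] creates a product of legs of S(h_1) and h_3 inside [omegaV]; α
    contracts it to 1, where [omegaV] is trivial. The identity governs left multiplication in
    [cot_kappa_lact]. *)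
Lemma kappa_cocycle l b h :
  \Sw_(l1, l2 <- comul l) \Sw_(b1, b2 <- comul b) \Sw_(h1, h2 <- comul h)
    (kappa (hmul (l1 ⊗ b1)) h2 * omegaV (l2 ⊗ b2 ⊗ antipode h1)) =
  \Sw_(b1, b2 <- comul b) \Sw_(h1, r <- comul h) \Sw_(h2, h3 <- comul r)
    (kappa b1 h2 * omega (l ⊗ hmul (b2 ⊗ antipode h1) ⊗ h3)).
Proof.
have Ft : ktrilinear (Q := k^o) (fun z x y : H => \Sw_(l1, l2 <- comul l)
  \Sw_(b1, b' <- comul b) (omegaV (l1 ⊗ b1 ⊗ z) *
   \Sw_(b2, b3 <- comul b') \Sw_(x2, x3 <- comul x) \Sw_(y2, y3 <- comul y)
   (omega (b2 ⊗ x2 ⊗ y2) * omega (l2 ⊗ hmul (b3 ⊗ x3) ⊗ y3)))) by ktril.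
transitivity (\Sw_(h1, r <- comul h) \Sw_(h2, h3 <- comul r) (halpha h2 *
  \Sw_(l1, l2 <- comul l) \Sw_(b1, b2 <- comul b) \Sw_(x1, x2 <- comul (antipode h1))
    (omega (hmul (l1 ⊗ b1) ⊗ x1 ⊗ h3) * omegaV (l2 ⊗ b2 ⊗ x2)))).
  swx 1; swx 0; symmetry.
  transitivity (\Sw_(h1, r <- comul h) \Sw_(h2, h3 <- comul r) \Sw_(l1, l2 <- comul l)
   \Sw_(b1, b2 <- comul b) \Sw_(c, d <- comul h1)
     (halpha h2 * (omega (hmul (l1 ⊗ b1) ⊗ antipode d ⊗ h3) * omegaV (l2 ⊗ b2 ⊗ antipode c)))).
    do 2!apply: eq_kfold => ? ?; rewrite kfoldMl; apply: eq_kfold => ? ?.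
    rewrite kfoldMl; apply: eq_kfold => ? ?.
    rewrite comul_antipode_k; last by kbil.
    by rewrite kfoldMl.
  swx 3; swx 2; swx 1; rewrite -comulA_k; last by ktril.
  apply: eq_kfold => c r'; symmetry.
  transitivity (\Sw_(l1, l2 <- comul l) \Sw_(b1, b2 <- comul b)
    \Sw_(d, r <- comul r') \Sw_(h2, h3 <- comul r)
     (halpha h2 * (omega (hmul (l1 ⊗ b1) ⊗ antipode d ⊗ h3) * omegaV (l2 ⊗ b2 ⊗ antipode c)))).
    do 2!apply: eq_kfold => ? ?; rewrite /kappa kfoldMr; apply: eq_kfold => ? ?.
    by rewrite kfoldMr; apply: eq_kfold => ? ?; rewrite mulrA.
  by swx 1; swx 0; swx 2; swx 1.
transitivity (\Sw_(h1, r <- comul h) \Sw_(h2, h3 <- comul r) (halpha h2 *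
    \Sw_(g1, g2 <- comul (antipode h1)) \Sw_(x1, x2 <- comul h3)
      kscal3 Ft (hmul (g1 ⊗ x1) ⊗ g2 ⊗ x2))).
  do 2!apply: eq_kfold => ? ?; congr (_ * _).
  rewrite cocycle_h_g_xV; symmetry.
  under eq_kfold => ? ? do under eq_kfold => ? ? do rewrite kscal3E.
  by swx 1; swx 0; swx 2; swx 1.
etransitivity; first exact: (contract_alpha_mul (Q := k^o) (kscal3 Ft)).
transitivity (\Sw_(h1, r <- comul h) \Sw_(h2, h3 <- comul r) (halpha h2 *
  \Sw_(b2, b3 <- comul b) \Sw_(x2, x3 <- comul (antipode h1)) \Sw_(y2, y3 <- comul h3)
   (omega (b2 ⊗ x2 ⊗ y2) * omega (l ⊗ hmul (b3 ⊗ x3) ⊗ y3)))).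
  apply: eq_kfold => h1 r; apply: eq_kfold => h2 h3; congr (_ * _); rewrite kscal3E.
  rewrite -[RHS](@counitl_k _ _ (fun l => \Sw_(b2, b3 <- comul b)
    \Sw_(x2, x3 <- comul (antipode h1)) \Sw_(y2, y3 <- comul h3)
    (omega (b2 ⊗ x2 ⊗ y2) * omega (l ⊗ hmul (b3 ⊗ x3) ⊗ y3))));
    last by move=> ? ? ?; klin.
  apply: eq_kfold => l1 l2.
  rewrite -[in RHS](@counitl_k _ _ (fun b => \Sw_(b2, b3 <- comul b)
    \Sw_(x2, x3 <- comul (antipode h1)) \Sw_(y2, y3 <- comul h3)
    (omega (b2 ⊗ x2 ⊗ y2) * omega (l2 ⊗ hmul (b3 ⊗ x3) ⊗ y3))));
    last by move=> ? ? ?; klin.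
  by rewrite kfoldMl; apply: eq_kfold => ? ?; rewrite omegaV_1r mulrA.
symmetry; transitivity (\Sw_(b1, b2 <- comul b) \Sw_(h1, r <- comul h)
  \Sw_(r', h3 <- comul r) \Sw_(x1, s <- comul r') \Sw_(y1, y2 <- comul s)
    (halpha y1 * (omega (b1 ⊗ antipode x1 ⊗ y2) * omega (l ⊗ hmul (b2 ⊗ antipode h1) ⊗ h3)))).
  do 3!apply: eq_kfold => ? ?; rewrite /kappa kfoldMr; apply: eq_kfold => ? ?.
  by rewrite kfoldMr; apply: eq_kfold => ? ?; rewrite mulrA.
under eq_kfold => b1 b2 do under eq_kfold => h1 r do
  (rewrite -comulA_k; last by ktril).
under eq_kfold => b1 b2 do (rewrite comulA_k; last by ktril).
under eq_kfold => b1 b2 do under eq_kfold => l' s do under eq_kfold => h1 x1 do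
  (rewrite -comulA_k; last by ktril).
swx 0; symmetry.
transitivity (\Sw_(h1, r <- comul h) \Sw_(h2, h3 <- comul r)
  \Sw_(b2, b3 <- comul b) \Sw_(c, d <- comul h1) \Sw_(y2, y3 <- comul h3)
   (halpha h2 * (omega (b2 ⊗ antipode d ⊗ y2) * omega (l ⊗ hmul (b3 ⊗ antipode c) ⊗ y3)))).
  do 2!apply: eq_kfold => ? ?; rewrite kfoldMl; apply: eq_kfold => ? ?.
  rewrite comul_antipode_k; last by kbil.
  by rewrite kfoldMl; apply: eq_kfold => ? ?; rewrite kfoldMl.
apply: eq_kfold => l' s; swx 0; apply: eq_kfold => b1 b2; swx 0.
by do 2!apply: eq_kfold => ? ?.
Qed.
End KappaCocycle.

(** * The canonical map and the coinvariants of A ⊗ H *)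

Definition regular_lcomodule (k : fieldType) (C : coalgebra k) : lcomodule C :=
  @LComodule k C C comul (fun h => esym (comulA h)) (@counit_l k C).

Section Canonical.
Variables (k : fieldType) (H : coquasi_hopf k) (A : comodule_algebra H).
Let HL := regular_lcomodule H.
Let HD := dual_comodule HL.
Let AH : left_hopf_module A := free_left A HD.

Lemma can_tens_bil : kbilinear (@can_tens k H A).
Proof. rewrite /can_tens; kbil. Qed.

Lemma rho_cotensor (b : A) : @cotensor k H A HL (rho b).
Proof. by rewrite /cotensor /= rhoA. Qed.

Definition coinv_of (b : A) : AH := @cot_beta k H A HL (rho b).

Lemma coinv_of_coinv b : coinv_of b \in coinvariants AH.
Proof. exact: cot_beta_coinv (rho_cotensor b). Qed.

Lemma free_lact_regular a b h : @lact k H A AH (a ⊗ (b ⊗ h : AH)) =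
  \Sw_(a0, a1 <- rho a) \Sw_(b0, b1 <- rho b) \Sw_(c, d <- comul h)
    (omegaV (a1 ⊗ b1 ⊗ antipode c) *: (amul (a0 ⊗ b0) ⊗ d : (A ⊗ H)%type)).
Proof.
etransitivity; first exact: free_lactE.
by do 2!apply: eq_kfold => ? ?; rewrite [LHS]rho_dual_sw //; kbil.
Qed.

(** The legs of b in the formula for can are those created by the free action on b_0 ⊗ β(b_1) b_2;
    coassociativity matches them. *)
Lemma can_tensE a b : can_tens a b = lact (a ⊗ coinv_of b).
Proof.
have fl : linear (fun t : (A ⊗ H)%type => @lact k H A AH (a ⊗ (t : AH))).
  by move=> c s t; rewrite ktensPr linearP.
rewrite [RHS](@cot_betaE k H A HL _ (linof fl)) /=.
rewrite /can_tens; swx 0; symmetry.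
transitivity (\Sw_(b', g <- rho b) \Sw_(g1, g2 <- comul g) \Sw_(a0, a1 <- rho a)
  \Sw_(b0, b1 <- rho b') \Sw_(c, d <- comul g2) (hbeta g1 *:
    (omegaV (a1 ⊗ b1 ⊗ antipode c) *: (amul (a0 ⊗ b0) ⊗ d : (A ⊗ H)%type)))).
  apply: eq_kfold => b' g; apply: eq_kfold => g1 g2.
  transitivity (hbeta g1 *: \Sw_(a0, a1 <- rho a) \Sw_(b0, b1 <- rho b')
    \Sw_(c, d <- comul g2)
    (omegaV (a1 ⊗ b1 ⊗ antipode c) *: (amul (a0 ⊗ b0) ⊗ d : (A ⊗ H)%type))).
    by congr (_ *: _); exact: free_lact_regular.
  rewrite -kfoldZ; apply: eq_kfold => a0 a1.
  by rewrite -kfoldZ; apply: eq_kfold => b0 b1; rewrite -kfoldZ.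
swx 2; swx 1; rewrite -[LHS]rhoA_sw; last by ktril.
apply: eq_kfold => b0 r; symmetry; swx 0; apply: eq_kfold => b1 g.
swx 0; apply: eq_kfold => g1 g2; apply: eq_kfold => a0 a1.
apply: eq_kfold => c d.
by rewrite ktensZr ktensZl linearZ /= -scalerA.
Qed.

(** The identification A □ H = A: the counit on the second factor inverts the coaction. *)
Lemma cotensor_rho (u : (A ⊗ H)%type) : @cotensor k H A HL u ->
  u = rho (\Sw_(v, h <- u) (counit h *: v)).
Proof.
have Ft : ktrilinear (fun (v : A) (g h : H) => counit h *: (v ⊗ g)) by ktril.
move=> uc; have := @cotensor_sw k H A HL _ (klift3 Ft) u uc.
rewrite kfold_linear => e.
etransitivity; [|etransitivity; first exact/esym/e].
  rewrite -[LHS]kfold_id; apply: eq_kfold => v h.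
  rewrite -[v ⊗ h](counitr_sw (f := fun h => v ⊗ h)); last by move=> ? ? ?; klin.
  by apply: eq_kfold => ? ?; rewrite klift3E.
apply: eq_kfold => v h; rewrite linearZ /= -[in RHS](kfold_id (rho v)) -kfoldZ.
by apply: eq_kfold => ? ?; rewrite klift3E.
Qed.

Lemma coinv_ofP (w : AH) : w \in coinvariants AH -> exists b, w = coinv_of b.
Proof.
move=> wc; exists (\Sw_(v, h <- cot_kappa A HL w) (counit h *: v)).
rewrite /coinv_of -(cotensor_rho (cot_kappa_cotensor wc)).
by rewrite [RHS](cot_betaK wc).
Qed.

Definition lmulH (l : A) (t : (A ⊗ H)%type) : (A ⊗ H)%type :=
  \Sw_(b, h <- t) (amul (l ⊗ b) ⊗ h).

Lemma lmulH_bil : kbilinear lmulH. Proof. rewrite /lmulH; kbil. Qed.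

(** In cotensor coordinates the twisted action becomes plain left multiplication: the associators of
    the action are absorbed by [kappa_cocycle]. *)
Lemma cot_kappa_lact (l : A) (w : AH) : w \in coinvariants AH ->
  cot_kappa A HL (lact (l ⊗ w)) = lmulH l (cot_kappa A HL w).
Proof.
move=> wc; have lm : linear (lmulH l) by case: lmulH_bil => _ e ? ? ?; exact: e.
symmetry; etransitivity; first exact: (@cot_kappaE k H A HL _ (linof lm) w).
rewrite /=; symmetry.
have Ft : ktrilinear (fun (b : A) (z : H) (h : H) => \Sw_(l0, l1 <- rho l)
  \Sw_(b0, b1 <- rho b) \Sw_(h2, h' <- comul h) \Sw_(h3, h4 <- comul h')
   ((kappa b1 h2 * omega (l1 ⊗ z ⊗ h3)) *: (amul (l0 ⊗ b0) ⊗ h4))).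
  by rewrite /kappa; ktril.
(* A trivial factor ω(l_1, 1, h_3) is inserted; coinvariance of w then replaces its middle 1 by b_2
   S(h_1), as [kappa_cocycle] requires. *)
transitivity (\Sw_(b, h <- (w : (A ⊗ H)%type)) klift3 Ft (b ⊗ hone ⊗ h)); last first.
  apply: eq_kfold => b h; rewrite klift3E kfold_exchange; apply: eq_kfold => b0 b1.
  rewrite -(rho_counit_sw (f := fun l => \Sw_(h0, x0 <- comul h)
     (kappa b1 h0 *: lmulH l (b0 ⊗ x0))) l); last first.
    by move=> ? ? ?; rewrite /lmulH; klin.
  apply: eq_kfold => l0 l1; rewrite -kfoldZ; apply: eq_kfold => h2 h'.
  rewrite /lmulH kfold_tens; last by kbil.
  rewrite -(@counitl_sw _ _ (A ⊗ H)%type (fun h' => amul (l0 ⊗ b0) ⊗ h') _ h');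
    last by move=> ? ? ?; klin.
  rewrite -[kappa b1 h2 *: kfold _ _]kfoldZ -[counit l1 *: kfold _ _]kfoldZ.
  apply: eq_kfold => h3 h4.
  by rewrite omega_normal !scalerA; congr (_ *: _); ring.
rewrite -[RHS](@coinv_dual_sw k H A HL _ (klift3 Ft) w wc).
have fl : linear (fun t : (A ⊗ H)%type =>
    cot_kappa A HL (@lact k H A AH (l ⊗ (t : AH)) : (A ⊗ H)%type)).
  by move=> c s t; rewrite ktensPr linearP /= linearP.
rewrite -[LHS]/(linof fl (w : (A ⊗ H)%type)) -[in LHS](kfold_id (w : (A ⊗ H)%type)).
rewrite kfold_linear; apply: eq_kfold => b h.
transitivity (cot_kappa A HL (\Sw_(l0, l1 <- rho l) \Sw_(b0, b1 <- rho b) \Sw_(c, d <- comul h)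
    (omegaV (l1 ⊗ b1 ⊗ antipode c) *: (amul (l0 ⊗ b0) ⊗ d)))).
  exact: (congr1 (cot_kappa A HL) (free_lact_regular l b h)).
transitivity (\Sw_(l', l2 <- rho l) \Sw_(b', b2 <- rho b) \Sw_(c, d <- comul h)
  \Sw_(l0, l1 <- rho l') \Sw_(b0, b1 <- rho b') \Sw_(h2, h3 <- comul d)
    ((kappa (hmul (l1 ⊗ b1)) h2 * omegaV (l2 ⊗ b2 ⊗ antipode c)) *: (amul (l0 ⊗ b0) ⊗ h3))).
  rewrite kfold_linear; apply: eq_kfold => l' l2; rewrite kfold_linear.
  apply: eq_kfold => b' b2; rewrite kfold_linear; apply: eq_kfold => c d.
  rewrite linearZ /= kliftE rho_amul kfold_kfold; last by rewrite /kappa; kbil.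
  rewrite -kfoldZ; apply: eq_kfold => ? ?.
  rewrite kfold_kfold; last by rewrite /kappa; kbil.
  rewrite -kfoldZ; apply: eq_kfold => ? ?.
  rewrite kfold_tens; last by rewrite /kappa; kbil.
  by rewrite -kfoldZ; apply: eq_kfold => ? ?; rewrite scalerA mulrC.
swx 2; swx 1; rewrite -[LHS]rhoA_sw; last by rewrite /kappa; ktril.
swx 3; (etransitivity; [do 2!(apply: eq_kfold => ? ?);
     (rewrite -[LHS]rhoA_sw; [reflexivity|by rewrite /kappa; ktril])|]).
(etransitivity; [do 4!(apply: eq_kfold => ? ?);
     (rewrite comulA_sw; [reflexivity|by rewrite /kappa; ktril])|]).
swx 1; swx 3; swx 2.
transitivity (\Sw_(l0, l' <- rho l) \Sw_(b0, b' <- rho b) \Sw_(s, h4 <- comul h)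
   \Sw_(b1, b2 <- comul b') \Sw_(h1, r <- comul s) \Sw_(h2, h3 <- comul r)
    ((kappa b1 h2 * omega (l' ⊗ hmul (b2 ⊗ antipode h1) ⊗ h3)) *: (amul (l0 ⊗ b0) ⊗ h4))).
  do 3!apply: eq_kfold => ? ?.
  under [RHS]eq_kfold => ? ? do under eq_kfold => ? ? do rewrite kfoldZr.
  under [RHS]eq_kfold => ? ? do rewrite kfoldZr.
  rewrite [RHS]kfoldZr -kappa_cocycle.
  rewrite -kfoldZr; apply: eq_kfold => ? ?; rewrite -kfoldZr; apply: eq_kfold => ? ?.
  by rewrite -kfoldZr.
symmetry.
transitivity (\Sw_(b', b2 <- rho b) \Sw_(b0, b1 <- rho b') \Sw_(h1, x <- comul h)
  \Sw_(h2, h' <- comul x) \Sw_(h3, h4 <- comul h') \Sw_(l0, l1 <- rho l)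
   ((kappa b1 h2 * omega (l1 ⊗ hmul (b2 ⊗ antipode h1) ⊗ h3)) *: (amul (l0 ⊗ b0) ⊗ h4))).
  apply: eq_kfold => b' b2; under eq_kfold => h1 x do rewrite klift3E.
  by swx 1; swx 0; swx 2; swx 3.
rewrite -rhoA_sw; last by rewrite /kappa; ktril.
symmetry; swx 0; apply: eq_kfold => b0 b'; swx 0; swx 1; symmetry.
etransitivity; [do 2!(apply: eq_kfold => ? ?);
     (rewrite comulA_sw; [reflexivity|by rewrite /kappa; ktril])|].
etransitivity; [do 1!(apply: eq_kfold => ? ?);
     (rewrite comulA_sw; [reflexivity|by rewrite /kappa; ktril])|].
swx 0; apply: eq_kfold => s h4; apply: eq_kfold => b1 b2; symmetry.
by swx 0; swx 1.
Qed.

Lemma cot_kappa_tens (a : A) h : cot_kappa A HL (a ⊗ h) =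
  \Sw_(a0, a1 <- rho a) \Sw_(h1, h2 <- comul h) (kappa a1 h1 *: (a0 ⊗ h2)).
Proof. exact: kliftE. Qed.

(** Apply [cot_kappa]: it turns can(l ⊗ r) into l r_0 ⊗ r_1, and 1 ⊗ h into α(h_1) 1 ⊗ h_2 because
    κ(1, -) = α. *)
Lemma can_tens_mul (s : seq (A * A)) h :
  \sum_(p <- s) can_tens p.1 p.2 = aone ⊗ h ->
  \sum_(p <- s) \Sw_(r0, r1 <- rho p.2) (amul (p.1 ⊗ r0) ⊗ r1) =
  \Sw_(h1, h2 <- comul h) (halpha h1 *: (aone ⊗ h2)).
Proof.
move/(congr1 (cot_kappa A HL)); rewrite linear_sum cot_kappa_tens.
rewrite rho_aone kfold_tens; last by rewrite /kappa; kbil.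
under eq_kfold => ? ? do rewrite kappa_one.
move <-; apply: eq_bigr => p _; rewrite can_tensE cot_kappa_lact ?coinv_of_coinv //.
by rewrite /coinv_of cot_kappaK //; exact: rho_cotensor.
Qed.

Lemma btensor_repr (R : pzRingType) (N : lmodType R^c) (M : lmodType R) (t : btensor N M) :
  exists s : seq (N * M), t = \sum_(p <- s) btens p.1 p.2.
Proof.
elim/btensor_ind: t => [n m|s t [u ->] [v ->]|].
- by exists [:: (n, m)]; rewrite big_seq1.
- by exists (u ++ v); rewrite big_cat.
- by exists [::]; rewrite big_nil.
Qed.

Lemma can_linear : {morph can A : s t / s + t}.
Proof. exact: bfoldD (@can_tens_balanced k H A). Qed.
Lemma can_sum (s : seq (A * A)) :
  can A (\sum_(p <- s) btens (p.1 : right_regular A) (p.2 : left_regular A)) =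
  \sum_(p <- s) can_tens p.1 p.2.
Proof.
elim: s => [|p s IHs]; last by rewrite !big_cons can_linear canE IHs.
by rewrite !big_nil; apply: (addrI (can A 0)); rewrite -can_linear !addr0.
Qed.

(** A combination of coinvariants of A ⊗ H is a combination of elements a · [coinv_of b], which are
    values of can. *)
Lemma gen_left_can : gen_left A -> forall y, exists x, can A x = y.
Proof.
move=> gen y; have [s sc ->] := gen AH (y : AH).
elim: s sc => [|p s IHs] sc.
  by exists (\sum_(p <- [::] : seq (A * A)) btens (p.1 : right_regular A) (p.2 : left_regular A));
    rewrite can_sum !big_nil.
have [|x xE] := IHs; first by move=> q qs; apply: sc; rewrite inE qs orbT.
have [b bE] := coinv_ofP (sc _ (mem_head _ _)).
exists (btens (p.2 : right_regular A) (b : left_regular A) + x).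
by rewrite can_linear canE can_tensE -bE xE big_cons.
Qed.
End Canonical.
(** * Consequences of a total integral *)

Section LeftRetraction.
Variables (k : fieldType) (H : coquasi_hopf k) (T : {linear H -> H}).
Hypotheses (ST : cancel (@antipode k H) T) (TS : cancel T (@antipode k H)).
Variables (A : comodule_algebra H) (gamma : {linear H -> A}).
Hypotheses (gammac : colinear (M := regular_comodule H) gamma) (gamma1 : gamma hone = aone).
Let Hop := coquasi_hopf_op ST TS.
Let Aop : comodule_algebra Hop := comodule_algebra_op A.
Let gamma_op : {linear Hop -> Aop} := gamma.

Definition right_of_left_hom (M N : left_hopf_module A) (f : left_hopf_hom M N) :
  right_hopf_hom (right_of_left M) (right_of_left N).
Proof.
refine (@RightHopfHom k Hop Aop (right_of_left M) (right_of_left N) (lhh_fun f)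
  (lhh_colinear f) _).
move=> m a; rewrite [ract _]ract_opE [RHS]ract_opE; exact: lhh_act.
Defined.

Definition lretr (M : left_hopf_module A) (m : M) (h : H) : M :=
  @retr k Hop Aop gamma_op (right_of_left M) m h.

Lemma lretr_bil (M : left_hopf_module A) : kbilinear (@lretr M).
Proof. exact: (retr_bil (H := Hop) gamma_op (right_of_left M)). Qed.

Lemma lretr_colinear (M : left_hopf_module A) (m : M) h :
  rho (lretr m h) = \Sw_(h1, h2 <- comul h) (lretr m h1 ⊗ h2).
Proof. exact: (retr_colinear (H := Hop) (gamma := gamma_op) gammac (M := right_of_left M)). Qed.

Lemma lretr_rho (M : left_hopf_module A) (m : M) :
  \Sw_(m0, g <- rho m) \Sw_(g1, g2 <- comul g) (halpha (T g1) *: lretr m0 g2) = m.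
Proof.
exact: (@retr_rho k Hop Aop gamma_op (right_of_left M) gamma1 m).
Qed.

Lemma lretr_natural (M N : left_hopf_module A) (f : left_hopf_hom M N) m h :
  f (lretr m h) = lretr (f m) h.
Proof. exact: (retr_natural (H := Hop) gamma_op (right_of_left_hom f)). Qed.

Definition ltrace (M : left_hopf_module A) (m : M) : M :=
  @trace k Hop Aop gamma_op (right_of_left M) m.
Lemma ltrace_coinv (M : left_hopf_module A) (m : M) : ltrace m \in coinvariants M.
Proof. exact: (trace_coinv (H := Hop) (gamma := gamma_op) gammac (M := right_of_left M)). Qed.
Lemma ltrace_id (M : left_hopf_module A) (m : M) : m \in coinvariants M -> ltrace m = m.
Proof. exact: (trace_id (H := Hop) (gamma := gamma_op) gamma1 (M := right_of_left M)). Qed.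
Lemma ltrace_natural (M N : left_hopf_module A) (f : left_hopf_hom M N) m :
  f (ltrace m) = ltrace (f m).
Proof. exact: (trace_natural (H := Hop) gamma_op (right_of_left_hom f)). Qed.

(** The trace of any preimage is a coinvariant preimage, since the trace is natural and fixes n. *)
Lemma total_lift_left : lift_left A.
Proof.
move=> M N f fs n nN; have [m mE] := fs n.
exists (ltrace m); first exact: ltrace_coinv.
by rewrite ltrace_natural mE ltrace_id.
Qed.

Lemma total_lift_right : lift_right A.
Proof.
move=> M N f fs n nN; have [m mE] := fs n.
exists (trace gamma m); first exact: trace_coinv.
by rewrite trace_natural mE trace_id.
Qed.

Section ColinearLift.
Variables (X : comodule H) (M N : left_hopf_module A) (f : left_hopf_hom M N).
Variables (j : {linear X -> N}) (s : {linear X -> M}).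
Hypotheses (jc : colinear j) (fs : forall x, f (s x) = j x).

Let sigma (x : X) := \Sw_(x0, g <- rho x) \Sw_(g1, g2 <- comul g)
  (halpha (T g1) *: lretr (s x0) g2).

(** A Maschke-type averaging of the linear lift s by the retraction: [sigma] is colinear because
    [lretr] is, and it still lifts j because f passes through [lretr] by naturality, after which
    [lretr_rho] restores j(x). *)
Lemma colinear_lift : exists2 t : {linear X -> M}, colinear t & forall x, f (t x) = j x.
Proof.

pose L := klift (lretr_bil M).
have LE m h : lretr m h = L (m ⊗ h) by rewrite kliftE.
have sE x : sigma x = \Sw_(x0, g <- rho x) \Sw_(g1, g2 <- comul g)
  (halpha (T g1) *: L (s x0 ⊗ g2)).
  by rewrite /sigma; under eq_kfold => ? ? do under eq_kfold => ? ? do rewrite LE.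
have sl : linear sigma by move=> c x y; rewrite !sE; klin.
exists (linof sl) => [x|x] /=.
  under [RHS]eq_kfold => ? ? do rewrite sE.
  rewrite /sigma kfold_linear.
  transitivity (\Sw_(x0, g <- rho x) \Sw_(g1, g2 <- comul g) \Sw_(g2, g3 <- comul g2)
    (halpha (T g1) *: (L (s x0 ⊗ g2) ⊗ g3))).
    apply: eq_kfold => ? ?; rewrite kfold_linear; apply: eq_kfold => ? ?.
    rewrite linearZ /= lretr_colinear -kfoldZ; apply: eq_kfold => ? ?.
    by rewrite LE.
  under eq_kfold => ? ? do (rewrite comulA_sw; last by ktril).
  rewrite rhoA_sw; last by ktril.
  apply: eq_kfold => ? ?; rewrite ktens_kfoldl; apply: eq_kfold => ? ?.
  by rewrite ktens_kfoldl; apply: eq_kfold => ? ?; rewrite ktensZl.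
have fb : kbilinear (fun (n : N) g => \Sw_(g1, g2 <- comul g) (halpha (T g1) *: lretr n g2)).
  have e (n : N) g : \Sw_(g1, g2 <- comul g) (halpha (T g1) *: lretr n g2) =
    \Sw_(g1, g2 <- comul g) (halpha (T g1) *: klift (lretr_bil N) (n ⊗ g2)).
    by apply: eq_kfold => ? ?; rewrite kliftE.
  by split=> *; rewrite !e; klin.
rewrite -[RHS]lretr_rho jc kfold_kfold // /sigma kfold_linear; apply: eq_kfold => x0 g.
rewrite kfold_tens // kfold_linear; apply: eq_kfold => ? ?.
by rewrite linearZ /= lretr_natural fs.
Qed.
End ColinearLift.

Section Span.
Variable M : left_hopf_module A.

Definition left_span (m : M) : Prop :=
  exists2 s : seq (M * A), {in s, forall p, p.1 \in coinvariants M} &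
    m = \sum_(p <- s) lact (p.2 ⊗ p.1).

Lemma left_span1 a (m : M) : m \in coinvariants M -> left_span (lact (a ⊗ m)).
Proof.
by move=> mc; exists [:: (m, a)]; rewrite ?big_seq1 // => p; rewrite inE => /eqP ->.
Qed.

Lemma left_spanD (m m' : M) : left_span m -> left_span m' -> left_span (m + m').
Proof.
move=> [s sc ->] [t tc ->]; exists (s ++ t); last by rewrite big_cat.
by move=> p; rewrite mem_cat => /orP [/sc|/tc].
Qed.

Lemma left_span_sum (I : Type) (r : seq I) (F : I -> M) :
  (forall i, left_span (F i)) -> left_span (\sum_(i <- r) F i).
Proof.
move=> Fs; apply: big_ind => //; last exact: left_spanD.
by exists [::]; rewrite ?big_nil.
Qed.

Lemma left_spanZ c (m : M) : left_span m -> left_span (c *: m).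
Proof.
move=> [s sc ->]; rewrite scaler_sumr big_seq big_mkcond /=.
apply: left_span_sum => p; case: ifP => [/sc pc|_]; last by exists [::]; rewrite ?big_nil.
by rewrite -linearZ /= -ktensZl; exact: left_span1.
Qed.

(** The element b_0 β(b_1) f(S(b_2)) is coinvariant, and acting on it by a gives the image of can(a
    ⊗ b) under a ⊗ h ↦ a f(S(h)). A preimage of 1 ⊗ h under can therefore expresses f(S(h)) by
    coinvariants. *)
Lemma can_colinear_span (f : {linear H -> M}) (h : H) :
  colinear (M := regular_comodule H) f -> (forall y, exists x, can A x = y) ->
  left_span (f (antipode h)).
Proof.
move=> fc cans.
have fSc g : rho (f (antipode g)) = \Sw_(g1, g2 <- comul g) (f (antipode g2) ⊗ antipode g1).
  by rewrite fc [LHS]comul_antipode_sw //; kbil.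
pose u b := twist_beta (@lact k H A M) (f \o antipode) b.
have uc b : u b \in coinvariants M by apply: twist_beta_coinv; [exact: rho_lact|exact: fSc].
have Fb : kbilinear (fun (a : A) h => lact (a ⊗ f (antipode h))) by kbil.
have actu a b : lact (a ⊗ u b) = klift Fb (can_tens a b).
  rewrite /u /twist_beta ktens_kfoldr kfold_linear.
  transitivity (\Sw_(b', g <- rho b) \Sw_(g1, g2 <- comul g) \Sw_(a0, a1 <- rho a)
    \Sw_(b0, b1 <- rho b') \Sw_(c, d <- comul g2) (hbeta g1 *:
    (omegaV (a1 ⊗ b1 ⊗ antipode c) *: lact (amul (a0 ⊗ b0) ⊗ f (antipode d))))).
    apply: eq_kfold => b' g; rewrite ktens_kfoldr kfold_linear.
    apply: eq_kfold => g1 g2; rewrite ktensZr linearZ /= lactA_V -kfoldZ.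
    apply: eq_kfold => a0 a1; rewrite -kfoldZ; apply: eq_kfold => b0 b1.
    rewrite fSc kfold_kfold -?kfoldZ; last by kbil.
    by apply: eq_kfold => c d; rewrite kfold_tens //; kbil.
  swx 2; swx 1; rewrite -[LHS]rhoA_sw; last by ktril.
  rewrite /can_tens kfold_linear; symmetry.
  under eq_kfold => a0 a1 do rewrite kfold_linear.
  swx 0; apply: eq_kfold => b0 r.
  under eq_kfold => a0 a1 do rewrite kfold_linear.
  swx 0; apply: eq_kfold => b1 g.
  under eq_kfold => a0 a1 do rewrite kfold_linear.
  swx 0; apply: eq_kfold => g1 g2; apply: eq_kfold => a0 a1.
  rewrite kfold_linear; apply: eq_kfold => c d.
  by rewrite linearZ kliftE !ktensZr !ktensZl linearZ /= -scalerA.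
have [x] := cans (aone ⊗ h); have [s ->] := btensor_repr x.
rewrite can_sum => /(congr1 (klift Fb)); rewrite kliftE [lact _]lact1 => <-.
by rewrite linear_sum; apply: left_span_sum => p; rewrite -actu; exact: left_span1.
Qed.
End Span.

(** By [lretr_rho] each m is a combination of values of the colinear maps [lretr m0], and each
    argument g_2 is S(T(g_2)). *)
Lemma total_gen_left : (forall y, exists x, can A x = y) -> gen_left A.
Proof.
move=> cans M m; rewrite -[m]lretr_rho -/(left_span _).
apply: left_span_sum => -[m0 g] /=; apply: left_span_sum => -[g1 g2] /=.
apply: left_spanZ; rewrite -[g2]TS.
have fl : linear (lretr m0) by move=> ? ? ?; have [_ e] := lretr_bil M; exact: e.
by apply: (@can_colinear_span M (linof fl)) => // h; exact: lretr_colinear.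
Qed.
End LeftRetraction.

(** * A translation map from a total integral *)

Section TrivialComodule.
Variables (k : fieldType) (H : coquasi_bialgebra k) (V : lmodType k).

Lemma rho_trivial_lin : linear (fun v : V => v ⊗ (hone : H)).
Proof. by move=> ? ? ?; klin. Qed.
Definition rho_trivial : {linear V -> (V ⊗ H)%type} := linof rho_trivial_lin.

Let rho_trivialA v :
  \Sw_(m0, m' <- rho_trivial v) \Sw_(m1, m2 <- comul m') (m0 ⊗ m1 ⊗ m2) =
  \Sw_(m', m2 <- rho_trivial v) \Sw_(m0, m1 <- rho_trivial m') (m0 ⊗ m1 ⊗ m2).
Proof.
rewrite kfold_tens; last by kbil.
rewrite kfold_tens; last by kbil.
rewrite [RHS]kfold_tens; last by kbil.
by rewrite comul_one_sw //; kbil.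
Qed.

Let rho_trivial_counit v : \Sw_(m0, m1 <- rho_trivial v) (counit m1 *: m0) = v.
Proof. by rewrite kfold_tens ?counit_one ?scale1r //; kbil. Qed.

Definition trivial_comodule : comodule H := Comodule rho_trivialA rho_trivial_counit.
End TrivialComodule.

Section CanonicalHom.
Variables (k : fieldType) (H : coquasi_hopf k) (A : comodule_algebra H).
Let HD := dual_comodule (regular_lcomodule H).
Let A1 := trivial_comodule H A.

(** This is can before passing to the quotient A ⊗_B A. With the trivial coaction on the right
    factor it is a morphism of free left Hopf modules, so colinear lifting applies to it. *)
Definition can_lin : {linear free_left A A1 -> free_left A HD} := klift (can_tens_bil A).
Lemma can_linE (a b : A) : can_lin (a ⊗ b) = can_tens a b. Proof. exact: kliftE. Qed.

Lemma rho_free_trivial (a b : A) :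
  @rho k H (free_left A A1) (a ⊗ b) = \Sw_(a0, a1 <- rho a) ((a0 ⊗ b : free_left A A1) ⊗ a1).
Proof.
rewrite [LHS]kliftE; apply: eq_kfold => a0 a1.
by rewrite [LHS]kfold_tens ?hmul1r //; kbil.
Qed.

Lemma lact_free_trivial (x a b : A) :
  @lact k H A (free_left A A1) (x ⊗ (a ⊗ b : free_left A A1)) = amul (x ⊗ a) ⊗ b.
Proof.
etransitivity; first exact: free_lactE.
rewrite -[RHS](rho_counit_sw (f := fun x => amul (x ⊗ a) ⊗ b)); last first.
  by move=> ? ? ?; klin.
apply: eq_kfold => x0 x1.
rewrite -[in RHS](rho_counit_sw (f := fun a => amul (x0 ⊗ a) ⊗ b)); last first.
  by move=> ? ? ?; klin.
rewrite -kfoldZ; apply: eq_kfold => a0 a1.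
by rewrite [LHS]kfold_tens ?omegaV_1r ?scalerA //; kbil.
Qed.

Let can_lin_colinear : colinear can_lin.
Proof.
apply: klinear_eq => [? ? ?|? ? ?|a b]; [by klin|by klin|].
rewrite rho_free_trivial kfold_kfold; last by kbil.
rewrite can_linE can_tensE rho_lact; apply: eq_kfold => a0 a1.
rewrite kfold_tens; last by kbil.
rewrite (rho_coinv_sw _ (coinv_of_coinv b)); last by kbil.
by rewrite hmul1r can_linE can_tensE.
Qed.

Let can_lin_act x t : can_lin (lact (x ⊗ t)) = lact (x ⊗ can_lin t).
Proof.
move: t; apply: klinear_eq => [? ? ?|? ? ?|a b]; [by klin|by klin|].
rewrite [in LHS]lact_free_trivial !can_linE !can_tensE.
by rewrite lactA_r // coinv_of_coinv.
Qed.

Definition can_hom : left_hopf_hom (free_left A A1) (free_left A HD) :=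
  @LeftHopfHom k H A (free_left A A1) (free_left A HD) can_lin can_lin_colinear can_lin_act.
End CanonicalHom.

Section TotalTranslation.
Variables (k : fieldType) (H : coquasi_hopf k) (T : {linear H -> H}).
Hypotheses (ST : cancel (@antipode k H) T) (TS : cancel T (@antipode k H)).
Variables (A : comodule_algebra H) (gamma : {linear H -> A}).
Hypotheses (gammac : colinear (M := regular_comodule H) gamma) (gamma1 : gamma hone = aone).
Hypothesis cans : forall y, exists x, can A x = y.
Let HD := dual_comodule (regular_lcomodule H).
Let A1 := trivial_comodule H A.

Lemma can_lin_surj (y : (A ⊗ H)%type) : exists x, can_lin A x = y.
Proof.
have [x <-] := cans y; have [s ->] := btensor_repr x; rewrite can_sum.
exists (\sum_(p <- s) (p.1 ⊗ p.2)); rewrite linear_sum.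
by apply: eq_bigr => p _; rewrite can_linE.
Qed.

Lemma tens_one_lin : linear (fun h : H => aone ⊗ h : (A ⊗ H)%type).
Proof. by move=> ? ? ?; klin. Qed.

(** The map h ↦ 1 ⊗ h is colinear; a linear section of can lifts it linearly, and [colinear_lift]
    makes the lift colinear. *)
Lemma total_section : exists2 t : {linear HD -> free_left A A1}, colinear t &
  forall h, can_lin A (t h) = aone ⊗ h.
Proof.
have [s sK] := linear_section can_lin_surj.
pose j : {linear HD -> free_left A HD} := linof tens_one_lin.
pose s' : {linear HD -> free_left A A1} := s \o linof tens_one_lin.
apply: (@colinear_lift k H T ST TS A gamma gammac gamma1 HD _ _ (can_hom A) j s').
  move=> h; rewrite [LHS]kliftE rho_aone [LHS]kfold_tens; last by kbil.
  by apply: eq_kfold => ? ?; rewrite hmul1l.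
by move=> h; exact: sK.
Qed.

(** The values of this translation map lie in A ⊗_k A, on which all trilinear test maps are
    defined. *)
Definition any_map (Q : lmodType k) (F : A -> H -> A -> Q) : Prop := True.

(** Colinearity of the section is [tau_coact], because the coaction of [HD] is h ↦ h_2 ⊗ S(h_1); the
    section property gives [tau_mul] through [can_tens_mul]. *)
Lemma total_translation : exists tau : H -> seq (A * A), translation any_map tau.
Proof.
have [t tc tK] := total_section.
have /choice [tau tauE] (h : H) : exists s : seq (A * A),
    forall (G : zmodType) (F : A -> A -> G), kfold F (t h) = \sum_(p <- s) F p.1 p.2.
  (* A fold over a tensor is a sum over its chosen representative, which serves as [tau h]. *)
  by eexists=> G F; reflexivity.
exists tau; split=> [Q F x Ft _|Q F Ft _ h|h].
- move=> c h h'; rewrite -!(tauE _ _ (fun l r => F l x r)); apply: kfold_linarg; last exact: linearP.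
  by case: Ft => e1 _ e3; split=> *; [exact: e1|exact: e3].
- have Fb : kbilinear (fun (p : (A ⊗ A)%type) z => \Sw_(l, r <- p) F l z r).
    case: Ft => e1 e2 e3; split=> *; last exact: kfold_lin.
    by apply: kfoldP; split=> *; [exact: e1|exact: e3].
  transitivity (\Sw_(p, z <- @rho k H (free_left A A1) (t h)) \Sw_(l, r <- p) F l z r).
    rewrite -(tauE _ _ (fun l r => \Sw_(l0, l1 <- rho l) F l0 l1 r)) -[in RHS](kfold_id (t h : (A ⊗ A)%type)) kfold_linear kfold_kfold //.
    apply: eq_kfold => l r; rewrite rho_free_trivial kfold_kfold //.
    apply: eq_kfold => l0 l1; rewrite kfold_tens // kfold_tens //.
    by case: Ft => e1 _ e3; split=> *; [exact: e1|exact: e3].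
  rewrite tc kfold_kfold //.
  transitivity (\Sw_(h', z <- rho_dual (regular_lcomodule H) h) \Sw_(l, r <- t h') F l z r).
    by apply: eq_kfold => ? ?; rewrite kfold_tens.
  etransitivity; first apply: (rho_dual_sw (X := regular_lcomodule H)).
    by case: Fb => e1 e2; split=> *; [rewrite linearP; exact: e1|exact: e2].
  by apply: eq_kfold => h1 h2; exact: (tauE _ _ (fun l r => F l (antipode h1) r)).
apply: can_tens_mul; rewrite -tK -(tauE _ _ (fun l r => can_tens l r)) -[t h in RHS](kfold_id (t h : (A ⊗ A)%type)).
by rewrite kfold_linear; apply: eq_kfold => ? ?; rewrite can_linE.
Qed.
End TotalTranslation.

(** * Generation of right Hopf modules *)

Section CoinvariantTensors.
Variables (k : fieldType) (H : coquasi_bialgebra k) (M : comodule H) (A : lmodType k).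

Lemma rho_left_bil : kbilinear (fun (m : M) (a : A) => rho m ⊗ a). Proof. kbil. Qed.
Lemma one_left_bil : kbilinear (fun (m : M) (a : A) => m ⊗ (hone : H) ⊗ a). Proof. kbil. Qed.

(** With independent right factors the equation can be read coefficientwise. *)
Lemma coinvariant_tensor (y : (M ⊗ A)%type) : klift rho_left_bil y = klift one_left_bil y ->
  exists2 s : seq (M * A), {in s, forall p, p.1 \in coinvariants M} &
    y = \sum_(p <- s) (p.1 ⊗ p.2).
Proof.
have [n [m [e [ef ->]]]] := ktens_free_repr y => e0.
have mc i : m i \in coinvariants M.
  apply/coinvariantP/eqP; rewrite -subr_eq0; apply/eqP.
  apply: (ktens_free ef (m := fun i => rho (m i) - m i ⊗ hone)).
  apply/eqP; rewrite (eq_bigr (fun j => rho (m j) ⊗ e j - m j ⊗ hone ⊗ e j)); last first.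
    by move=> j _; rewrite ktensBl.
  rewrite sumrB subr_eq0; apply/eqP; move: e0; rewrite !linear_sum => e0.
  etransitivity; [|etransitivity; first exact: e0]; apply: eq_bigr => j _;
    by rewrite kliftE.
exists [seq (m i, e i) | i <- enum 'I_n].
  by move=> _ /mapP [i _ ->] /=.
by rewrite big_map big_enum.
Qed.
End CoinvariantTensors.

Section TotalGenRight.
Variables (k : fieldType) (H : coquasi_hopf k) (A : comodule_algebra H).
Variables (tau : H -> seq (A * A)).

(** The element y = m_0 β(m_1) l(m_2) ⊗ r(m_2) of M ⊗ A acts to m by [tau_generates], and
    [tau_coinv] makes its left factors coinvariant. *)
Lemma translation_gen_right : translation (@any_map k H A) tau -> gen_right A.
Proof.
move=> tauP M m.
pose y := \Sw_(m0, g <- rho m) \Sw_(g1, g2 <- comul g)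
  (hbeta g1 *: \sum_(p <- tau g2) (ract (m0 ⊗ p.1) ⊗ p.2)).
have [|s sc sE] := @coinvariant_tensor k H M A y.
  rewrite !kfold_linear.
  have e := @tau_coinv k H A (@any_map k H A) tau tauP M _
    (idfun : {linear (M ⊗ H ⊗ A)%type -> _}) m.
  etransitivity; [|etransitivity; first by apply: e].
    apply: eq_kfold => m0 g; rewrite kfold_linear; apply: eq_kfold => g1 g2.
    rewrite linearZ /= linear_sum; congr (_ *: _); apply: eq_bigr => p _.
    by rewrite kliftE -[in LHS](kfold_id (rho _)) ktens_kfoldl.
  apply: eq_kfold => m0 g; rewrite kfold_linear; apply: eq_kfold => g1 g2.
  rewrite linearZ /= [in RHS]linear_sum; congr (_ *: _); apply: eq_bigr => p _.
  by rewrite kliftE.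
exists s; first exact: sc.
transitivity (ract y); last by rewrite sE linear_sum.
rewrite -[LHS](tau_generates _ tauP) // kfold_linear.
apply: eq_kfold => m0 g; rewrite kfold_linear; apply: eq_kfold => g1 g2.
by rewrite [in RHS]linearZ /= [in RHS]linear_sum.
Qed.
End TotalGenRight.
(** * Construction of a total integral *)

Section AdaptedBasis.
Variables (k : fieldType) (U : lmodType k) (D : U -> Prop).
Hypotheses (D0 : D 0) (DL : forall c x y, D x -> D y -> D (c *: x + y)).

Definition kspan n (b : 'I_n -> U) (x : U) : Prop :=
  exists c : 'I_n -> k, x = \sum_i c i *: b i.

Lemma kspanP n (b : 'I_n -> U) c x y : kspan b x -> kspan b y -> kspan b (c *: x + y).
Proof.
move=> [d ->] [e ->]; exists (fun i => c * d i + e i).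
by rewrite scaler_sumr -big_split; apply: eq_bigr => i _; rewrite scalerDl scalerA.
Qed.

Lemma kspan_gen n (b : 'I_n -> U) i : kspan b (b i).
Proof.
exists (fun j => (j == i)%:R); rewrite (bigD1 i) //= eqxx scale1r big1 ?addr0 //.
by move=> j /negPf ->; rewrite scale0r.
Qed.

Lemma kspan_sum n (b : 'I_n -> U) m (c : 'I_m -> k) (x : 'I_m -> U) :
  (forall i, kspan b (x i)) -> kspan b (\sum_i c i *: x i).
Proof.
move=> xb; apply: (big_ind (kspan b)) => [|u v ub vb|i _].
- by exists (fun _ => 0); rewrite big1 // => i _; rewrite scale0r.
- by rewrite -[u]scale1r; exact: kspanP.
- have [d dE] := xb i; exists (fun j => c i * d j).
  by rewrite dE scaler_sumr; apply: eq_bigr => j _; rewrite scalerA.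
Qed.

Definition extend n (b : 'I_n -> U) (x : U) (i : 'I_n.+1) : U := oapp b x (unlift ord_max i).

Lemma extend_lift n (b : 'I_n -> U) x i : extend b x (lift ord_max i) = b i.
Proof. by rewrite /extend liftK. Qed.
Lemma extend_max n (b : 'I_n -> U) x : extend b x ord_max = x.
Proof. by rewrite /extend unlift_none. Qed.

Lemma sum_extend n (b : 'I_n -> U) x (c : 'I_n.+1 -> k) :
  \sum_i c i *: extend b x i = c ord_max *: x + \sum_(i < n) c (lift ord_max i) *: b i.
Proof.
rewrite (bigD1_ord ord_max) //= extend_max; congr (_ + _).
by apply: eq_bigr => i _; rewrite extend_lift.
Qed.

Lemma kspan_extend n (b : 'I_n -> U) x y : kspan (extend b x) y <->
  exists a z, kspan b z /\ y = a *: x + z.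
Proof.
split=> [[c ->]|[a [_ [[c ->] ->]]]].
  exists (c ord_max), (\sum_(i < n) c (lift ord_max i) *: b i); rewrite sum_extend.
  by split=> //; exists (fun i => c (lift ord_max i)).
exists (fun i => oapp c a (unlift ord_max i)); rewrite sum_extend unlift_none; congr (_ + _).
by apply: eq_bigr => i _; rewrite liftK.
Qed.

Lemma kfree_extend n (b : 'I_n -> U) x : kfree b -> ~ kspan b x -> kfree (extend b x).
Proof.
move=> bf xb c; rewrite sum_extend => c0.
have cm : c ord_max = 0.
  apply: contra_notP xb => /eqP cm; exists (fun i => - (c (lift ord_max i) / c ord_max)).
  apply: (scalerI cm); move/eqP: c0; rewrite addr_eq0 => /eqP ->.
  rewrite scaler_sumr -sumrN; apply: eq_bigr => i _.
  by rewrite scalerA mulrN mulrCA mulfV // mulr1 scaleNr.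
move: c0; rewrite cm scale0r add0r => /(bf (fun i => c (lift ord_max i))) cl i.
by case: (unliftP ord_max i) => [j|] ->; [exact: cl|exact: cm].
Qed.

(* The members of [b] flagged by [X] span the intersection of [D] with the span *)
(* of [b].                                                                       *)
Definition adapted n (b : 'I_n -> U) (X : pred 'I_n) : Prop :=
  [/\ kfree b, forall i, X i -> D (b i)
    & forall c, D (\sum_i c i *: b i) -> forall i, ~~ X i -> c i = 0].

(** Induction on the family. If the last vector is congruent, modulo the earlier span, to some d in
    D, then d is adjoined with a flag unless it is already in the span; otherwise the vector itself
    is adjoined without a flag. *)
Lemma adapted_basis n (w : 'I_n -> U) : exists m (b : 'I_m -> U) X,
  [/\ adapted b X, forall i, kspan w (b i) & forall i, kspan b (w i)].
Proof.
elim: n w => [|n IHn] w; first by exists 0%N, w, xpred0; split=> [|[]|[]] //; split=> [c _ []||c _ []].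
have [m [b [X [[bf bD Xb] bw wb]]]] := IHn (fun i => w (lift ord_max i)).
have wE : w = extend (fun i => w (lift ord_max i)) (w ord_max).
  apply/funext => i; case: (unliftP ord_max i) => [j|] ->; rewrite ?extend_lift //.
  by rewrite extend_max.
have bw' x : kspan (fun i => w (lift ord_max i)) x -> kspan w x.
  move=> xw; rewrite wE; apply/kspan_extend; exists 0, x.
  by rewrite scale0r add0r.
have [d_in|w_out] := pselect (exists d z, [/\ D d, kspan b z & w ord_max = d + z]).
  have [d [z [dD zb wd]]] := d_in.
  have [db|db] := pselect (kspan b d).
    exists m, b, X; split=> // i; first exact: bw'.
    case: (unliftP ord_max i) => [j|] ->; first exact: wb.
    by rewrite wd -[d]scale1r; exact: kspanP.
  exists m.+1, (extend b d), (fun i => oapp X true (unlift ord_max i)); split; first split.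
  - exact: kfree_extend.
  - by move=> i; case: (unliftP ord_max i) => [j|] ->; rewrite ?liftK ?unlift_none ?extend_lift ?extend_max //; exact: bD.
  - move=> c cD i; case: (unliftP ord_max i) => [j|] ->; rewrite ?liftK ?unlift_none //= => Xj.
    apply: (Xb (fun i => c (lift ord_max i))) Xj.
    by move: cD; rewrite sum_extend => cD; have := DL (- c ord_max) dD cD; rewrite scaleNr addKr.
  - move=> i; case: (unliftP ord_max i) => [j|] ->.
      by rewrite extend_lift; exact: bw'.
    rewrite extend_max; have -> : d = -1 *: z + w ord_max.
      by rewrite wd scaleN1r addrC addrK.
    apply: kspanP; last exact: kspan_gen.
    by case: zb => c ->; apply: kspan_sum => i'; exact: bw'.
  - move=> i; apply/kspan_extend; case: (unliftP ord_max i) => [j|] ->.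
      by exists 0, (w (lift ord_max j)); rewrite scale0r add0r; split=> //; exact: wb.
    by exists 1, z; rewrite scale1r.
exists m.+1, (extend b (w ord_max)), (fun i => oapp X false (unlift ord_max i)).
have wnb : ~ kspan b (w ord_max).
  by move=> wb'; apply: w_out; exists 0, (w ord_max); rewrite add0r.
split; first split.
- exact: kfree_extend.
- by move=> i; case: (unliftP ord_max i) => [j|] ->; rewrite ?liftK ?unlift_none ?extend_lift //; exact: bD.
- move=> c; rewrite sum_extend => cD.
  have cm : c ord_max = 0.
    apply: contra_notP w_out => /eqP cm.
    exists ((c ord_max)^-1 *: (c ord_max *: w ord_max + \sum_(i < m) c (lift ord_max i) *: b i) + 0),
      (- (c ord_max)^-1 *: \sum_(i < m) c (lift ord_max i) *: b i); split; first exact: DL.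
      by rewrite scaler_sumr; exists (fun i => - (c ord_max)^-1 * c (lift ord_max i));
        apply: eq_bigr => i _; rewrite scalerA.
    by rewrite addr0 scalerDr scalerA mulVf // scale1r scaleNr addrK.
  move=> i; case: (unliftP ord_max i) => [j|] ->; rewrite ?unlift_none ?liftK //=.
  apply: (Xb (fun i => c (lift ord_max i))).
  by move: cD; rewrite cm scale0r add0r.
- move=> i; case: (unliftP ord_max i) => [j|] ->; rewrite ?extend_lift ?extend_max.
    exact: bw'.
  exact: kspan_gen.
- move=> i; apply/kspan_extend; case: (unliftP ord_max i) => [j|] ->.
    by exists 0, (w (lift ord_max j)); rewrite scale0r add0r; split=> //; exact: wb.
  by exists 1, 0; rewrite scale1r addr0; split=> //; exists (fun _ => 0); rewrite big1 // => i' _; rewrite scale0r.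
Qed.
End AdaptedBasis.

(** * Finite-dimensional subcomodules and coefficient matrices *)

Section LeftCoefficients.
Variables (k : fieldType) (U Q : lmodType k).

Lemma lcoef_bil (f : {scalar U}) : kbilinear (fun (u : U) (q : Q) => f u *: q). Proof. kbil. Qed.
Definition lcoef f : {linear (U ⊗ Q)%type -> Q} := klift (lcoef_bil f).
Lemma lcoefE f u q : lcoef f (u ⊗ q) = f u *: q. Proof. exact: kliftE. Qed.

Definition tspan n (b : 'I_n -> U) (t : (U ⊗ Q)%type) : Prop :=
  exists g : 'I_n -> Q, t = \sum_i (b i ⊗ g i).

Lemma tspan_sum n (b : 'I_n -> U) (I : Type) (r : seq I) (F : I -> (U ⊗ Q)%type) :
  (forall i, tspan b (F i)) -> tspan b (\sum_(i <- r) F i).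
Proof.
move=> Fb; apply: (big_ind (tspan b)) => // [|_ _ [g ->] [h ->]].
  by exists (fun _ => 0); rewrite big1 // => i _; rewrite ktens0r.
by exists (fun i => g i + h i); rewrite -big_split; apply: eq_bigr => i _; rewrite ktensDr.
Qed.

Lemma ktens_suml (I : Type) (r : seq I) (F : I -> U) (q : Q) :
  (\sum_(i <- r) F i) ⊗ q = \sum_(i <- r) (F i ⊗ q).
Proof. exact: (linear_sum (linof (fun c x z => ktensPl c x z q))). Qed.

Lemma ktens_sumr (I : Type) (r : seq I) (u : U) (F : I -> Q) :
  u ⊗ (\sum_(i <- r) F i) = \sum_(i <- r) (u ⊗ F i).
Proof. exact: (linear_sum (linof (fun c x z => ktensPr c u x z))). Qed.

Lemma tspan_trans n m (b : 'I_n -> U) (w : 'I_m -> U) t :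
  (forall i, kspan b (w i)) -> tspan w t -> tspan b t.
Proof.
move=> bw [g ->]; apply: tspan_sum => i; have [a ->] := bw i.
exists (fun j => a j *: g i); rewrite ktens_suml.
by apply: eq_bigr => j _; rewrite ktensZl ktensZr.
Qed.

Lemma lcoef_sum n (b : 'I_n -> U) (f : {scalar U}) i (g : 'I_n -> Q) :
  (forall j, f (b j) = (i == j)%:R) -> lcoef f (\sum_j (b j ⊗ g j)) = g i.
Proof.
move=> fb; rewrite linear_sum (bigD1 i) //= lcoefE fb eqxx scale1r big1 ?addr0 //.
by move=> j /negPf ji; rewrite lcoefE fb eq_sym ji scale0r.
Qed.
End LeftCoefficients.

Lemma kfold_klift (k : fieldType) (M N P : lmodType k) (f : M -> N -> P) (fb : kbilinear f) t :
  kfold f t = klift fb t.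
Proof.
by rewrite -[t in RHS]kfold_id kfold_linear; apply: eq_kfold => ? ?; rewrite kliftE.
Qed.

Section FiniteSubcomodules.
Variables (k : fieldType) (C : coalgebra k) (M : comodule C).

(** The fundamental theorem of comodules: the coefficients of ρ(m) with respect to independent
    elements of C span a subcomodule containing m. *)
Lemma finite_subcomodule (m : M) : exists n (w : 'I_n -> M),
  kspan w m /\ forall j, tspan w (rho (w j)).
Proof.
have [n [w [e [ef wE]]]] := ktens_free_repr (rho m).
have [f fE] := kfree_dual ef; exists n, w; split.
  exists (fun i => counit (e i)); rewrite -[LHS]rho_counit wE.
  have b : kbilinear (fun (m : M) (c : C) => counit c *: m) by kbil.
  by rewrite (kfold_klift b) linear_sum; apply: eq_bigr => i _; rewrite kliftE.
move=> i; exists (fun j => \Sw_(c1, c2 <- comul (e j)) (f i c2 *: c1)).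
have Ft : ktrilinear (fun (m : M) (x y : C) => f i y *: (m ⊗ x)) by ktril.
have b1 : kbilinear (fun (m : M) (c : C) => \Sw_(m0, m1 <- rho m) (f i c *: (m0 ⊗ m1))).
  by kbil.
have b2 : kbilinear (fun (m : M) (c : C) => \Sw_(c1, c2 <- comul c) (f i c2 *: (m ⊗ c1))).
  by kbil.
(* Coassociativity with the dual form [f i] on the last factor isolates the coaction of [w i]. *)
have E : klift b1 (rho m) = klift b2 (rho m).
  by rewrite -!kfold_klift -rhoA_sw.
move: E; rewrite wE !linear_sum (bigD1 i) //= kliftE big1 => [|j /negPf ji]; last first.
  rewrite kliftE; rewrite (eq_kfold (g := fun _ _ => 0 *: 0)); last first.
    by move=> ? ?; rewrite fE eq_sym ji !scale0r.
  by rewrite kfoldZ scale0r.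
rewrite addr0 => E; etransitivity; [|etransitivity; first exact: E].
  rewrite -[LHS]kfold_id; apply: eq_kfold => ? ?.
  by rewrite fE eqxx scale1r.
apply: eq_bigr => j _; rewrite kliftE ktens_kfoldr.
by apply: eq_kfold => ? ?; rewrite ktensZr.
Qed.

Variable D : M -> Prop.
Hypotheses (D0 : D 0) (DL : forall c x y, D x -> D y -> D (c *: x + y)).

Lemma adapted_subcomodule (m : M) : exists n (b : 'I_n -> M) X (c : 'I_n -> 'I_n -> C),
  [/\ adapted D b X, kspan b m & forall j, rho (b j) = \sum_i (b i ⊗ c i j)].
Proof.
have [n [w [[a mE] wr]]] := finite_subcomodule m.
have [p [b [X [bX bw wb]]]] := adapted_basis D0 DL w.
have bt j : tspan b (rho (b j)).
  apply: tspan_trans wb _; have [c ->] := bw j.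
  rewrite linear_sum; apply: tspan_sum => i; rewrite linearZ /=.
  have [g ->] := wr i; exists (fun l => c i *: g l).
  by rewrite scaler_sumr; apply: eq_bigr => l _; rewrite ktensZr.
have /choice [c cE] := bt; exists p, b, X, (fun i j => c j i); split=> //.
by rewrite mE; exact: kspan_sum.
Qed.

Section MatrixCoefficients.
Variables (n : nat) (b : 'I_n -> M) (c : 'I_n -> 'I_n -> C).
Hypotheses (bf : kfree b) (cE : forall j, rho (b j) = \sum_i (b i ⊗ c i j)).

Lemma comul_coef i j : comul (c i j) = \sum_l (c i l ⊗ c l j).
Proof.
have [f fE] := kfree_dual bf.
have b1 : kbilinear (fun (m : M) (x : C) => \Sw_(x1, x2 <- comul x) (f i m *: (x1 ⊗ x2))).
  by kbil.
have b2 : kbilinear (fun (m : M) (x : C) => \Sw_(m0, m1 <- rho m) (f i m0 *: (m1 ⊗ x))).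
  by kbil.
have : klift b1 (rho (b j)) = klift b2 (rho (b j)).
  by rewrite -!kfold_klift rhoA_sw //; ktril.
rewrite cE !linear_sum (bigD1 i) //= kliftE big1 => [|l /negPf li]; last first.
  rewrite kliftE; rewrite (eq_kfold (g := fun _ _ => 0 *: 0)); last first.
    by move=> ? ?; rewrite fE eq_sym li !scale0r.
  by rewrite kfoldZ scale0r.
rewrite addr0 => E; etransitivity; [|etransitivity; first exact: E].
  by rewrite -[LHS]kfold_id; apply: eq_kfold => ? ?; rewrite fE eqxx scale1r.
apply: eq_bigr => l _; rewrite kliftE.
rewrite -(lcoef_sum (c^~ l) (fE i)) -cE -[X in lcoef _ _ X]kfold_id.
rewrite kfold_linear ktens_kfoldl; apply: eq_kfold => ? ?.
by rewrite lcoefE ktensZl.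
Qed.

Lemma counit_coef i j : counit (c i j) = (i == j)%:R.
Proof.
have [f fE] := kfree_dual bf.
have b1 : kbilinear (P := k^o) (fun (m : M) (x : C) => counit x * f i m) by kbil.
rewrite -fE -[X in f i X]rho_counit.
have -> : f i (\Sw_(m0, m1 <- rho (b j)) (counit m1 *: m0)) = klift b1 (rho (b j)).
  etransitivity; first exact: (@kfold_linear k M C M k^o (f i)).
  etransitivity; last exact: (kfold_klift b1).
  by apply: eq_kfold => ? ?; rewrite linearZ.
rewrite cE linear_sum (bigD1 i) //= kliftE fE eqxx mulr1 big1 ?addr0 // => l /negPf li.
by rewrite kliftE fE eq_sym li mulr0.
Qed.
End MatrixCoefficients.
End FiniteSubcomodules.

Section MatrixComodule.
Variables (k : fieldType) (C : coalgebra k) (I : finType) (c : I -> I -> C).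
Hypotheses (comul_c : forall i j, comul (c i j) = \sum_l (c i l ⊗ c l j))
  (counit_c : forall i j, counit (c i j) = (i == j)%:R).

Definition fcol : lmodType k := {ffun I -> k^o}.
Definition fdelta (i : I) : fcol := [ffun j => (j == i)%:R].
Definition fcoord (i : I) (x : fcol) : k := x i.

Lemma fcoord_lin i : linear (fcoord i : fcol -> k^o).
Proof. by move=> a x y; rewrite /fcoord !ffunE. Qed.
Definition fproj i : {scalar fcol} := scalof (fcoord_lin i).
Lemma fcoord_delta i j : fcoord i (fdelta j) = (i == j)%:R.
Proof. by rewrite /fcoord ffunE. Qed.
Lemma fproj_delta i j : fproj i (fdelta j) = (i == j)%:R.
Proof. exact: fcoord_delta. Qed.

Lemma fcol_sum (x : fcol) : x = \sum_i fproj i x *: fdelta i.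
Proof.
apply/ffunP => j; rewrite sum_ffunE (bigD1 j) //= !ffunE eqxx big1 ?addr0 => [|i ij].
  by rewrite /fcoord /GRing.scale /= mulr1.
by rewrite !ffunE eq_sym (negPf ij) /GRing.scale /= mulr0.
Qed.

Lemma fcol_eq (Q : lmodType k) (f g : {linear fcol -> Q}) :
  (forall i, f (fdelta i) = g (fdelta i)) -> f =1 g.
Proof.
move=> e x; rewrite [x]fcol_sum !linear_sum; apply: eq_bigr => i _.
by rewrite !linearZ /= e.
Qed.

Lemma lrho_mat_lin :
  linear (fun x : fcol => \sum_i fproj i x *: (\sum_j (c i j ⊗ fdelta j))).
Proof. by move=> ? ? ?; klin. Qed.
Definition lrho_mat : {linear fcol -> (C ⊗ fcol)%type} := linof lrho_mat_lin.
Lemma lrho_matE i : lrho_mat (fdelta i) = \sum_j (c i j ⊗ fdelta j).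
Proof.
rewrite /= (bigD1 i) //= fcoord_delta eqxx scale1r [X in _ + X]big1 ?addr0 // => j /negPf ji.
by rewrite fcoord_delta ji scale0r.
Qed.

Let lrho_matA x :
  \Sw_(h, x0 <- lrho_mat x) \Sw_(h1, h2 <- comul h) (h1 ⊗ h2 ⊗ x0) =
  \Sw_(h1, x' <- lrho_mat x) \Sw_(h2, x0 <- lrho_mat x') (h1 ⊗ h2 ⊗ x0).
Proof.
have b1 : kbilinear (fun (h : C) (x : fcol) => \Sw_(h1, h2 <- comul h) (h1 ⊗ h2 ⊗ x)) by kbil.
have b2 : kbilinear (fun (h : C) (x : fcol) => \Sw_(h2, x0 <- lrho_mat x) (h ⊗ h2 ⊗ x0)).
  by kbil.
rewrite (kfold_klift b1) (kfold_klift b2).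
pose f := klift b1 \o lrho_mat; pose g := klift b2 \o lrho_mat.
rewrite -[LHS]/(f x) -[RHS]/(g x); move: x; apply: fcol_eq => i.
rewrite -[LHS]/(klift b1 (lrho_mat _)) -[RHS]/(klift b2 (lrho_mat _)) lrho_matE !linear_sum; 
transitivity (\sum_j \sum_l (c i l ⊗ c l j ⊗ fdelta j)).
  apply: eq_bigr => j _; rewrite kliftE -[in RHS]ktens_suml -comul_c.
  by rewrite -[in RHS](kfold_id (comul _)) ktens_kfoldl.
rewrite exchange_big; apply: eq_bigr => l _; rewrite kliftE lrho_matE.
have b3 : kbilinear (fun (h : C) (x : fcol) => c i l ⊗ h ⊗ x) by kbil.
by rewrite (kfold_klift b3) linear_sum; apply: eq_bigr => j _; rewrite kliftE.
Qed.

Let lrho_mat_counit x : \Sw_(h, x0 <- lrho_mat x) (counit h *: x0) = x.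
Proof.
have b : kbilinear (fun (h : C) (x : fcol) => counit h *: x) by kbil.
rewrite (kfold_klift b); pose f := klift b \o lrho_mat.
rewrite -[LHS]/(f x) -[RHS]/(@idfun fcol x); move: x; apply: fcol_eq => i.
rewrite -[LHS]/(klift b (lrho_mat _)) lrho_matE linear_sum (bigD1 i) //= kliftE counit_c eqxx scale1r.
rewrite big1 ?addr0 // => j /negPf ji.
by rewrite kliftE counit_c eq_sym ji scale0r.
Qed.

(** The dual, as a left comodule, of the right comodule whose coefficient matrix is c. *)
Definition matrix_lcomodule : lcomodule C := LComodule lrho_matA lrho_mat_counit.
End MatrixComodule.

(** * Right exactness of A □ (-) and colinear maps as cotensors *)

Section CotensorLift.
Variables (k : fieldType) (H : coquasi_hopf k) (A : comodule_algebra H).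
Variables (X Y : lcomodule H) (p : {linear X -> Y}).
Hypotheses (pc : forall x, lrho (p x) = \Sw_(h, x0 <- lrho x) (h ⊗ p x0))
  (ps : forall y, exists x, p x = y).
Let XD := dual_comodule X.
Let YD := dual_comodule Y.

Lemma rtens_map_bil : kbilinear (fun (a : A) (x : X) => a ⊗ p x). Proof. kbil. Qed.
Definition rtens_map : {linear free_left A XD -> free_left A YD} := klift rtens_map_bil.
Lemma rtens_mapE a x : rtens_map (a ⊗ x) = a ⊗ p x. Proof. exact: kliftE. Qed.

Let rtens_map_colinear : colinear rtens_map.
Proof.
apply: klinear_eq => [? ? ?|? ? ?|a x]; [by klin|by klin|].
rewrite rtens_mapE [LHS](rho_tens_dual a (p x)) [in RHS](rho_tens_dual a x).
rewrite kfold_kfold; last by kbil.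
apply: eq_kfold => a0 a1; rewrite pc !kfold_kfold; [|by kbil|by kbil].
apply: eq_kfold => h x0; rewrite !kfold_tens; [|by kbil|by kbil].
by rewrite rtens_mapE.
Qed.

Let rtens_map_act x t : rtens_map (lact (x ⊗ t)) = lact (x ⊗ rtens_map t).
Proof.
move: t; apply: klinear_eq => [? ? ?|? ? ?|b v]; [by klin|by klin|].
rewrite rtens_mapE; etransitivity; last exact/esym/free_lactE.
etransitivity; first exact: (congr1 rtens_map (free_lactE _ _ _)).
rewrite kfold_linear; apply: eq_kfold => ? ?; rewrite kfold_linear; apply: eq_kfold => ? ?.
rewrite kfold_linear rho_dual_sw; last by kbil.
symmetry; etransitivity; first by apply: rho_dual_sw; kbil.
rewrite pc kfold_kfold; last by kbil.
apply: eq_kfold => ? ?; rewrite kfold_tens; last by kbil.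
by rewrite linearZ /= rtens_mapE.
Qed.

Definition rtens_hom : left_hopf_hom (free_left A XD) (free_left A YD) :=
  @LeftHopfHom k H A (free_left A XD) (free_left A YD) rtens_map rtens_map_colinear
    rtens_map_act.

(** Under A □ X = (A ⊗ X')^coH the map induced by p is that of a surjection between free left Hopf
    modules on their coinvariants. *)
Lemma cotensor_lift (y : (A ⊗ Y)%type) : lift_left A -> cotensor y ->
  exists2 u : (A ⊗ X)%type, cotensor u & rtens_map u = y.
Proof.
move=> lift yc.
have rs (t : (A ⊗ Y)%type) : exists u, rtens_hom u = t.
  elim/ktensor_ind: t => [a z|s t [u <-] [v <-]|].
  - by have [x <-] := ps z; exists (a ⊗ x); rewrite [LHS]rtens_mapE.
  - by exists (u + v); rewrite linearD.
  - by exists 0; rewrite linear0.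
have [w wc wE] := lift _ _ rtens_hom rs _ (cot_beta_coinv yc).
exists (cot_kappa A X w); first exact: cot_kappa_cotensor.
rewrite -[RHS](cot_kappaK yc) -wE.
have E : (rtens_map \o cot_kappa A X) =1 (cot_kappa A Y \o rtens_map).
  apply: klinear_eq => [? ? ?|? ? ?|a x]; try exact: linearP.
  rewrite /comp rtens_mapE !kliftE kfold_linear; apply: eq_kfold => ? ?.
  rewrite kfold_linear pc kfold_kfold; last by rewrite /kappa; kbil.
  apply: eq_kfold => ? ?; rewrite kfold_tens; last by rewrite /kappa; kbil.
  by rewrite linearZ /= rtens_mapE.
exact: E.
Qed.
End CotensorLift.

Section MatrixCotensor.
Variables (k : fieldType) (H : coquasi_hopf k) (V : comodule H).
Variables (I : finType) (c : I -> I -> H).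
Hypotheses (comul_c : forall i j, comul (c i j) = \sum_l (c i l ⊗ c l j))
  (counit_c : forall i j, counit (c i j) = (i == j)%:R).
Let X : lcomodule H := matrix_lcomodule comul_c counit_c.

Lemma rcoef_bil (i : I) : kbilinear (fun (v : V) (x : fcol k I) => fproj k i x *: v).
Proof. by split=> *; klin. Qed.
Definition rcoef i : {linear (V ⊗ fcol k I)%type -> V} := klift (rcoef_bil i).
Lemma rcoefE i v x : rcoef i (v ⊗ x) = fproj k i x *: v. Proof. exact: kliftE. Qed.

Lemma rcoef_sum (a : I -> V) i : rcoef i (\sum_j (a j ⊗ fdelta k j)) = a i.
Proof.
rewrite linear_sum (bigD1 i) //= rcoefE fproj_delta eqxx scale1r big1 ?addr0 //.
by move=> j /negPf ji; rewrite rcoefE fproj_delta eq_sym ji scale0r.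
Qed.

Lemma sum_rcoef t : t = \sum_i (rcoef i t ⊗ fdelta k i).
Proof.
have l : linear (fun t => \sum_i (rcoef i t ⊗ fdelta k i)) by move=> ? ? ?; klin.
rewrite -[RHS]/(linof l t); move: t; apply: klinear_eq => [//|? ? ?|v x].
  exact: linearP.
rewrite {1}[x]fcol_sum ktens_sumr; apply: eq_bigr => i _.
by rewrite rcoefE ktensZl ktensZr.
Qed.

(** For a finite-dimensional comodule W this is the identification of V □ W* with the colinear maps
    W → V; the a_j are the images of the basis of W. *)
Lemma matrix_cotensor (a : I -> V) :
  @cotensor k H V X (\sum_j (a j ⊗ fdelta k j)) <->
  forall j, rho (a j) = \sum_i (a i ⊗ c i j).
Proof.
have b1 : kbilinear (fun (v : V) (x : X) => \Sw_(v0, v1 <- rho v) (v0 ⊗ v1 ⊗ x)) by kbil.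
have b2 : kbilinear (fun (v : V) (x : X) => \Sw_(h, x0 <- lrho x) (v ⊗ h ⊗ x0)) by kbil.
have e1 : klift b1 (\sum_j (a j ⊗ fdelta k j)) = \sum_j (rho (a j) ⊗ fdelta k j).
  rewrite linear_sum; apply: eq_bigr => j _; rewrite kliftE.
  by rewrite -[in RHS](kfold_id (rho _)) ktens_kfoldl.
have e2 : klift b2 (\sum_j (a j ⊗ fdelta k j)) = \sum_j ((\sum_i (a i ⊗ c i j)) ⊗ fdelta k j).
  rewrite linear_sum; under [RHS]eq_bigr => j _ do rewrite ktens_suml.
  rewrite [RHS]exchange_big; apply: eq_bigr => i _.
  rewrite kliftE [lrho _]lrho_matE.
  have b3 : kbilinear (fun (h : H) (x : X) => a i ⊗ h ⊗ x) by kbil.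
  by rewrite (kfold_klift b3) linear_sum; apply: eq_bigr => j _; rewrite kliftE.
rewrite /cotensor (kfold_klift b1) (kfold_klift b2) e1 e2.
split=> [E j|E]; last by apply: eq_bigr => j _; rewrite E.
have br : kbilinear (fun (t : (V ⊗ H)%type) (x : X) => fproj k j x *: t) by split=> *; klin.
have S (F : I -> (V ⊗ H)%type) : klift br (\sum_j (F j ⊗ fdelta k j)) = F j.
  rewrite linear_sum (bigD1 j) // kliftE fproj_delta eqxx scale1r.
  rewrite big1 => [|i /negPf ij]; first exact: addr0.
  by rewrite kliftE fproj_delta eq_sym ij scale0r.
by move/(congr1 (klift br)): E; rewrite !S.
Qed.
End MatrixCotensor.
Section MatrixRestriction.
Variables (k : fieldType) (C : coalgebra k) (I : finType) (c : I -> I -> C).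
Hypotheses (comul_c : forall i j, comul (c i j) = \sum_l (c i l ⊗ c l j))
  (counit_c : forall i j, counit (c i j) = (i == j)%:R).
Variable X : {pred I}.
Hypothesis c0 : forall i j, j \in X -> i \notin X -> c i j = 0.
Let J : finType := {i | i \in X}.
Let c' (i j : J) := c (val i) (val j).

Lemma comul_restr (i j : J) : comul (c' i j) = \sum_l (c' i l ⊗ c' l j).
Proof.
rewrite comul_c -(big_sub X (fun l => c (val i) l ⊗ c l (val j))) [LHS](bigID (mem X)) /=.
rewrite [X in _ + X]big1 ?addr0 // => l Xl.
by rewrite (c0 (valP j) Xl) ktens0r.
Qed.

Lemma counit_restr (i j : J) : counit (c' i j) = (i == j)%:R.
Proof. exact: counit_c. Qed.

Let XX : lcomodule C := matrix_lcomodule comul_c counit_c.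
Let YY : lcomodule C := matrix_lcomodule comul_restr counit_restr.

Lemma frestr_lin : linear (fun x : fcol k I => [ffun j : J => x (val j)] : fcol k J).
Proof. by move=> e x y; apply/ffunP => j; rewrite !ffunE. Qed.
(* Opaque, since [simpl] would otherwise unfold its values. *)
Lemma frestr_sig : {f : {linear XX -> YY} |
  forall (x : fcol k I) (j : J), (f x : fcol k J) j = x (val j)}.
Proof. by exists (linof frestr_lin) => x j; rewrite /= ffunE. Qed.
Definition frestr := sval frestr_sig.
Lemma frestrE (x : fcol k I) (j : J) : (frestr x : fcol k J) j = x (val j).
Proof. exact: (svalP frestr_sig). Qed.

Lemma fproj_restr (j : J) x : fproj k j (frestr x) = fproj k (val j) x.
Proof. exact: frestrE. Qed.

Lemma frestr_in (i : J) : frestr (fdelta k (val i)) = fdelta k i.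
Proof. by apply/ffunP => j; rewrite frestrE !ffunE. Qed.

Lemma frestr_out i : i \notin X -> frestr (fdelta k i) = 0.
Proof.
move=> iX; apply/ffunP => j; rewrite frestrE !ffunE.
by case: eqP iX => // <-; rewrite (valP j).
Qed.

Lemma frestr_surj y : exists x, frestr x = y.
Proof.
exists (\sum_(i : J) fproj k i y *: fdelta k (val i)).
rewrite linear_sum [RHS]fcol_sum; apply: eq_bigr => i _.
by rewrite linearZ /= -[LHS]/(_ *: frestr (fdelta k (val i))) frestr_in.
Qed.

(** Block triangularity [c0] says that the basis vectors in X span a subcomodule; restriction of
    coordinates is dual to its inclusion. *)
Lemma lrho_restr x : lrho (frestr x) = \Sw_(h, x0 <- lrho x) (h ⊗ frestr x0).
Proof.
have b2 : kbilinear (fun (h : C) (x : XX) => h ⊗ frestr x) by kbil.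
rewrite (kfold_klift b2).
pose f1 := (@lrho k C YY \o frestr); pose f2 := klift b2 \o @lrho k C XX.
rewrite -[LHS]/(f1 x) -[RHS]/(f2 x); move: x; apply: fcol_eq => i.
rewrite -[LHS]/(lrho (frestr (fdelta k i))) -[RHS]/(klift b2 (lrho (fdelta k i : XX))).
have -> : lrho (frestr (fdelta k i)) = \sum_(j in X) klift b2 (c i j ⊗ fdelta k j).
  have [Xi|Xi] := boolP (i \in X); last first.
    by rewrite frestr_out // linear0 big1 // => j Xj; rewrite kliftE c0 // ktens0l.
  rewrite -[i]/(val (Sub i Xi : J)) frestr_in [LHS]lrho_matE.
  rewrite (big_sub X (fun j => klift b2 (c i j ⊗ fdelta k j))).
  by apply: eq_bigr => j _; rewrite kliftE frestr_in.
rewrite [lrho (fdelta k i : XX)]lrho_matE linear_sum.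
rewrite [RHS](bigID (mem X)) /= [X in _ + X]big1 ?addr0 => [//|l Xl].
by rewrite kliftE frestr_out // ktens0r.
Qed.
End MatrixRestriction.

(** * Extension of colinear maps and Zorn's lemma *)

Section TotalIntegral.
Variables (k : fieldType) (H : coquasi_hopf k) (A : comodule_algebra H).
Hypothesis lift : lift_left A.

(* The condition on a partial linear map from H to A, given by its graph, to have *)
(* a subcomodule as its domain and to be colinear on it.                          *)
Definition locally_colinear (G : H * A -> Prop) (p : H * A) : Prop :=
  exists s : seq ((H * A) * H), [/\ {in s, forall q, G q.1},
    comul p.1 = \sum_(q <- s) (q.1.1 ⊗ q.2) & rho p.2 = \sum_(q <- s) (q.1.2 ⊗ q.2)].

Lemma locally_colinear_mono G G' p : (forall q, G q -> G' q) ->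
  locally_colinear G p -> locally_colinear G' p.
Proof. by move=> GG' [s [sG e1 e2]]; exists s; split=> // q /sG /GG'. Qed.

Lemma locally_colinearP G c u v u' v' :
  locally_colinear G (u, v) -> locally_colinear G (u', v') ->
  locally_colinear G (c *: u + u', c *: v + v').
Proof.
move=> [s [sG e1 e2]] [t [tG e3 e4]].
exists ([seq (q.1, c *: q.2) | q <- s] ++ t); split=> /=.
- by move=> q; rewrite mem_cat => /orP [/mapP [r /sG Gr ->]|/tG].
- rewrite linearP /= e1 e3 big_cat big_map scaler_sumr; congr (_ + _).
  by apply: eq_bigr => q _; rewrite ktensZr.
- rewrite linearP /= e2 e4 big_cat big_map scaler_sumr; congr (_ + _).
  by apply: eq_bigr => q _; rewrite ktensZr.
Qed.

Section Step.
Variables (G : H * A -> Prop) (Gl : lin_graph G) (GL : forall p, G p -> locally_colinear G p).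
Let D (h : H) : Prop := exists a, G (h, a).

Let D0 : D 0. Proof. by exists 0; case: Gl. Qed.
Let DL c x y : D x -> D y -> D (c *: x + y).
Proof. by move=> [a Ga] [b Gb]; exists (c *: a + b); case: Gl => _ GD _; exact: GD. Qed.

Variables (n : nat) (b : 'I_n -> H) (X : pred 'I_n) (c : 'I_n -> 'I_n -> H).
Hypotheses (bX : adapted D b X) (cE : forall j, comul (b j) = \sum_i (b i ⊗ c i j)).

(** By [GL] the comultiplication of an element of D stays in D ⊗ H, so it is killed by a form that
    vanishes on D and takes the coordinate i outside X. *)
Lemma adapted_coef0 i j : X j -> ~~ X i -> c i j = 0.
Proof.
case: bX => bf bD Xb Xj Xi.
(* The form is prescribed on D plus the span of b; it is well defined because the coordinate i
   vanishes where D meets that span. *)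
have [//|//|||f fE _] := @linear_extension k H k^o (fun _ => True)
    (fun p => exists d (z : 'I_n -> k), D d /\ p = (d + \sum_l z l *: b l, z i)).
- by move=> u; exists 0.
- split=> [|e _ _ _ _ [d [z [dD [-> ->]]]] [d' [z' [dD' [-> ->]]]]|v [d [z [dD [E ->]]]]].
  + by exists 0, (fun _ => 0); rewrite big1 ?addr0 // => l _; rewrite scale0r.
  + exists (e *: d + d'), (fun l => e * z l + z' l); split; first exact: DL.
    congr (_, _); rewrite scalerDr addrACA; congr (_ + _).
    rewrite scaler_sumr -big_split; apply: eq_bigr => l _.
    by rewrite scalerDl scalerA.
  + apply: Xb Xi; move/esym/eqP: E; rewrite addrC addr_eq0 => /eqP ->.
    by rewrite -scaleN1r -[_ *: d]addr0; exact: DL.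
- by [].
have fD d : D d -> f d = 0.
  move=> dD; have := fE (d, 0); apply; exists d, (fun _ => 0); split=> //.
  by rewrite big1 ?addr0 // => l _; rewrite scale0r.
have fb l : f (b l) = (i == l)%:R.
  have := fE (b l, (i == l)%:R); apply; exists 0, (fun m => (m == l)%:R); split=> //.
  rewrite add0r (bigD1 l) //= eqxx scale1r big1 ?addr0 // => m /negPf ->.
  by rewrite scale0r.
rewrite -(lcoef_sum (c^~ j) fb) -cE; have [a Ga] := bD _ Xj.
have [s [sG /= -> _]] := GL Ga; rewrite linear_sum big_seq big1 // => q qs.
by rewrite lcoefE fD ?scale0r //; exists q.1.2; rewrite -surjective_pairing; exact: sG.
Qed.

Hypothesis (bA : exists g : {linear H -> A}, forall p, G p -> g p.1 = p.2).

(** Let W be the subcomodule spanned by b; the flagged vectors span the subcomodule of W inside D.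
    The partial map on it is an element of a cotensor product, which [cotensor_lift] lifts to a
    colinear map on W; the two maps glue on D + W. *)
Lemma extend_colinear : exists G', [/\ lin_graph G', forall p, G p -> G' p,
  forall p, G' p -> locally_colinear G' p & forall i, exists a, G' (b i, a)].
Proof.
have [bf bD Xb] := bX; have [g gE] := bA.
have cC := comul_coef (M := regular_comodule H) bf cE.
have c1 := counit_coef (M := regular_comodule H) bf cE.
have c0 i j : j \in X -> i \notin X -> c i j = 0 by exact: adapted_coef0.
pose J : finType := {i | i \in X}.
pose p := frestr cC c1 c0.
have rg j : X j -> rho (g (b j)) = \sum_i (g (b i) ⊗ c i j).
  move=> Xj; have [a Ga] := bD _ Xj; have [s [sG /= e1 e2]] := GL Ga.
  rewrite [g (b j)](gE _ Ga) /= e2.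
  transitivity (tens_map H g (comul (b j))); last first.
    by rewrite cE linear_sum; apply: eq_bigr => i _; rewrite tens_mapE.
  rewrite e1 linear_sum big_seq [RHS]big_seq; apply: eq_bigr => q qs.
  by rewrite tens_mapE (gE _ (sG _ qs)).
have yc : @cotensor k H A (matrix_lcomodule (comul_restr cC c0) (counit_restr c1 (X := X)))
    (\sum_(j : J) (g (b (val j)) ⊗ fdelta k j)).
  apply/matrix_cotensor => j; rewrite rg; last exact: (valP j).
  rewrite -(big_sub X (fun i => g (b i) ⊗ c i (val j))) [LHS](bigID (mem X)) /=.
  rewrite [X in _ + X]big1 ?addr0 // => i Xi.
  by rewrite (c0 _ _ (valP j) Xi) ktens0r.
have ls := cotensor_lift (@lrho_restr k H _ c cC c1 X c0) (@frestr_surj k H _ c cC c1 X c0) lift.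
have [u uc uE] := ls _ yc.
pose a i := rcoef A i u.
have ac j : rho (a j) = \sum_i (a i ⊗ c i j).
  by move: uc; rewrite [u]sum_rcoef => /matrix_cotensor; apply.
have ag j : X j -> a j = g (b j).
  move=> Xj; have := congr1 (rcoef A (Sub j Xj : J)) uE; rewrite rcoef_sum => <-.
  have E : rcoef A j =1 (rcoef A (Sub j Xj : J) \o rtens_map A p).
    apply: klinear_eq => [? ? ?|? ? ?|v x]; try exact: linearP.
    by rewrite /comp rtens_mapE !rcoefE fproj_restr.
  exact: E.
have DG x y : G (x, y) -> D x by exists y.
have bG i : X i -> G (b i, a i).
  by move=> Xi; have [y Gy] := bD _ Xi; rewrite ag // (gE _ Gy).
(* The old map on D and the new one on the span of b are added up; they agree on flagged vectors by
   [bG]. *)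
pose G' (q : H * A) := exists x y (z : 'I_n -> k), G (x, y) /\
  q = (x + \sum_i z i *: b i, y + \sum_i z i *: a i).
have [G0 GD Gf] := Gl.
have GG' q : G q -> G' q.
  case: q => x y Gxy; exists x, y, (fun _ => 0); split=> //.
  by rewrite !big1 ?addr0 // => i _; rewrite scale0r.
have bG' i : G' (b i, a i).
  exists 0, 0, (fun j => (j == i)%:R); split=> //; rewrite !add0r.
  congr (_, _); rewrite (bigD1 i) //= eqxx scale1r big1 ?addr0 // => j /negPf ->;
    by rewrite scale0r.
have G'l : lin_graph G'.
  split=> [|e _ _ _ _ [x [y [z [Gxy [-> ->]]]]] [x' [y' [z' [Gxy' [-> ->]]]]]|v [x [y [z [Gxy [E ->]]]]]].
  - exact: GG'.
  - exists (e *: x + x'), (e *: y + y'), (fun l => e * z l + z' l); split; first exact: GD.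
    congr (_, _); rewrite scalerDr addrACA; congr (_ + _);
      rewrite scaler_sumr -big_split; apply: eq_bigr => l _;
      by rewrite scalerDl scalerA.
  - have zD : D (\sum_i z i *: b i).
      move/esym/eqP: E; rewrite addrC addr_eq0 => /eqP ->.
      by rewrite -scaleN1r -[_ *: x]addr0; apply: DL; [exact: DG Gxy|exact: D0].
    apply: Gf; rewrite [X in G (X, _)]E -[x]scale1r -[y]scale1r; apply: (GD) => //.
    apply: (big_ind2 (fun s t => G (s, t))) => // [s t s' t' Gs Gt|i _].
      by rewrite -[s]scale1r -[t]scale1r; exact: GD.
    have [Xi|Xi] := boolP (X i); last by rewrite (Xb _ zD _ Xi) !scale0r.
    by rewrite -[_ *: b i]addr0 -[_ *: a i]addr0; apply: GD => //; exact: bG.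
exists G'; split=> // [q|i]; last by exists (a i).
case: q => _ _ [x [y [z [Gxy [-> ->]]]]].
rewrite -[x]scale1r -[y]scale1r; apply: locally_colinearP.
  exact: locally_colinear_mono (GL Gxy).
apply: (big_ind2 (fun s t => locally_colinear G' (s, t))) => [|s t s' t' Ls Lt|i _].
- by exists [::]; split; rewrite //= ?linear0 ?big_nil.
- by rewrite -[s]scale1r -[t]scale1r; exact: locally_colinearP.
rewrite -[_ *: b i]addr0 -[_ *: a i]addr0; apply: locally_colinearP; last first.
  by exists [::]; split; rewrite //= ?linear0 ?big_nil.
exists [seq ((b j, a j), c j i) | j <- enum 'I_n]; split=> /=.
- by move=> _ /mapP [j _ ->]; exact: bG'.
- by rewrite big_map big_enum cE.
- by rewrite big_map big_enum ac.
Qed.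
End Step.

(** Start from 1 ↦ 1 and take a maximal locally colinear partial map. It is total, since every h
    lies in a finite-dimensional subcomodule, onto which [extend_colinear] extends the map. *)
Lemma lift_left_total : exists gamma : {linear H -> A}, total_integral gamma.
Proof.
pose G0 (p : H * A) := exists c : k, p = (c *: hone, c *: aone).
have G0l : lin_graph G0.
  split=> [|c _ _ _ _ [d [-> ->]] [e [-> ->]]|v [c [/esym/eqP E ->]]].
  - by exists 0; rewrite !scale0r.
  - by exists (c * d + e); rewrite !scalerDl !scalerA.
  - move: E; rewrite scaler_eq0 => /orP [/eqP ->|/eqP h0]; first by rewrite scale0r.
    have := counit_one H; rewrite h0 linear0 => /esym/eqP.
    by rewrite oner_eq0.
have G0L p : G0 p -> locally_colinear G0 p.
  move=> [c ->]; exists [:: ((hone, aone), c *: hone)]; rewrite !big_seq1 /=; split.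
  - by move=> q; rewrite inE => /eqP -> /=; exists 1; rewrite !scale1r.
  - by rewrite linearZ /= comul_one ktensZr.
  - by rewrite linearZ /= rho_aone ktensZr.
have [G [Gl G0G GL Gmax]] := zorn_lin_graph locally_colinear_mono G0l G0L.
have [//|||//|g gE _] := @linear_extension k H A (fun _ => True) G.
  by move=> u; exists 0.
  exact: Gl.
have gG h : G (h, g h).
  suff [a Ga] : exists a, G (h, a) by rewrite (gE _ Ga).
  pose D (h : H) : Prop := exists a, G (h, a).
  have D0 : D 0 by exists 0; case: Gl.
  have DL c x y : D x -> D y -> D (c *: x + y).
    by move=> [a Ga] [b Gb]; exists (c *: a + b); case: Gl => _ GD _; exact: GD.
  have [n [b [X [c [bX [z ->] cE]]]]] :=
    @adapted_subcomodule k H (regular_comodule H) D D0 DL h.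
  have [|G' [G'l GG' G'L bG']] := extend_colinear Gl GL bX cE; first by exists g.
  have /choice [a Ga] : forall i, exists a, G (b i, a).
    by move=> i; have [a G'a] := bG' i; exists a; exact: (Gmax G').
  exists (\sum_i z i *: a i); case: Gl => G00 GD _.
  apply: (big_ind2 (fun s t => G (s, t))) => // [s t s' t' Gs Gt|i _].
    by rewrite -[s]scale1r -[t]scale1r; exact: GD.
  by rewrite -[_ *: b i]addr0 -[_ *: a i]addr0; exact: GD.
exists g; split; last first.
  by apply: (gE (hone, aone)); apply: G0G; exists 1; rewrite !scale1r.
move=> h; have [s [sG /= e1 ->]] := GL _ (gG h).
rewrite -[RHS](tens_map_fold (P := A) g) [comul h]e1 linear_sum big_seq [RHS]big_seq.
by apply: eq_bigr => q qs; rewrite tens_mapE (gE _ (sG _ qs)).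
Qed.
End TotalIntegral.

(** * Total integrals and the elementary conditions on both sides *)

Section OppositeConditions.
Variables (k : fieldType) (H : coquasi_hopf k) (T : {linear H -> H}).
Hypotheses (ST : cancel (@antipode k H) T) (TS : cancel T (@antipode k H)).
Variable A : comodule_algebra H.
Let Hop := coquasi_hopf_op ST TS.
Let Aop : comodule_algebra Hop := comodule_algebra_op A.

Definition elementary_total : Prop :=
  (exists gamma : {linear H -> A}, total_integral gamma) /\
  (forall y, exists x, can A x = y).

Lemma total_conditions : elementary_total ->
  [/\ gen_right A, lift_right A, gen_left A & lift_left A].
Proof.
move=> [[gamma [gammac gamma1]] cans]; split.
- have [tau tauP] := total_translation ST TS gammac gamma1 cans.
  exact: translation_gen_right tauP.
- exact: total_lift_right gammac gamma1.
- exact: total_gen_left ST TS A gamma gammac gamma1 cans.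
- exact: total_lift_left ST TS A gamma gammac gamma1.
Qed.

Lemma left_conditions_total : gen_left A -> lift_left A -> elementary_total.
Proof.
by move=> gen lift; split; [exact: lift_left_total|exact: gen_left_can].
Qed.

Lemma gen_left_op : gen_right A -> gen_left Aop.
Proof.
move=> gen M m; have [s sc sE] := gen (right_of_left_op M) m.
exists s; first exact: sc.
by rewrite sE; apply: eq_bigr => p _; exact: ract_unopE.
Qed.

Lemma lift_left_op : lift_right A -> lift_left Aop.
Proof.
move=> lift M N f fs n nN.
have fact m a : f (@ract k H A (right_of_left_op M) (m ⊗ a)) =
    @ract k H A (right_of_left_op N) (f m ⊗ a).
  rewrite [@ract k H A _ _]ract_unopE [RHS]ract_unopE; exact: lhh_act.
pose g := @RightHopfHom k H A (right_of_left_op M) (right_of_left_op N) f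
  (lhh_colinear f) fact.
exact: (lift _ _ g fs n nN).
Qed.

Lemma gen_left_unop : gen_right Aop -> gen_left A.
Proof.
move=> gen M m; have [s sc sE] := gen (right_of_left M) m.
exists s; first exact: sc.
by rewrite sE; apply: eq_bigr => p _; exact: ract_opE.
Qed.
End OppositeConditions.

Section RightConditions.
Variables (k : fieldType) (H : coquasi_hopf k) (T : {linear H -> H}).
Hypotheses (ST : cancel (@antipode k H) T) (TS : cancel T (@antipode k H)).
Variable A : comodule_algebra H.

(** Over the opposite algebra the hypotheses are the left-handed ones, which give a total integral
    there, hence also here. Generation of right Hopf modules over the opposite is generation of left
    ones over A, and this makes can for A surjective. *)
Lemma right_conditions_total : gen_right A -> lift_right A -> elementary_total A.
Proof.
move=> gen lift.
have tot : elementary_total (H := coquasi_hopf_op ST TS) (comodule_algebra_op A).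
  by apply: left_conditions_total; [exact: gen_left_op|exact: lift_left_op].
have [genr _ _ _] := total_conditions (H := coquasi_hopf_op ST TS) (T := @antipode k H) TS ST tot.
split; last by apply: gen_left_can; exact: gen_left_unop genr.
by have [[gamma gammat] _] := tot; exists gamma.
Qed.
End RightConditions.
(** * The adjunctions between induction and coinvariants *)

Section RightAdjunction.
Variables (k : fieldType) (H : coquasi_bialgebra k) (A : comodule_algebra H).
Local Notation B := (coinv_algebra A).

Section Counit.
Variable M : right_hopf_module A.

Lemma counit_right_ok : ind_right_lift_ok (N := coinv_right M)
  (fun n a => ract (val (n : coinv_sub M) ⊗ a)).
Proof.
split=> [n n' a|n c a a'|b n a]; [by rewrite /= ktensDl linearD|by klin|].
by rewrite /= ractA_l //; exact: valP.
Qed.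

Definition counit_right_lin : {linear ind_right (coinv_right M) -> M} :=
  linof (ind_right_fold_linear counit_right_ok).
Lemma counit_right_linE n a :
  counit_right_lin (ind_right_tens n a) = ract (val (n : coinv_sub M) ⊗ a).
Proof. exact: (ind_right_foldE counit_right_ok). Qed.

Let counit_right_colinear : colinear counit_right_lin.
Proof.
apply: ind_right_eq => [s t|s t|n a]; first by rewrite !linearD.
  by rewrite linearD kfold_addr //; kbil.
rewrite counit_right_linE rho_ract rho_ind_right rho_coinv_sw; [|by kbil|exact: valP].
rewrite kfold_kfold; last by kbil.
apply: eq_kfold => a0 a1; rewrite kfold_tens; last by kbil.
by rewrite hmul1l counit_right_linE.
Qed.

Let counit_right_act t a : counit_right_lin (ract (t ⊗ a)) = ract (counit_right_lin t ⊗ a).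
Proof.
move: t; apply: ind_right_eq => [s t|s t|n x].
- by rewrite ktensDl [ract _]linearD [LHS]linearD.
- by rewrite [counit_right_lin _]linearD ktensDl [LHS]linearD.
rewrite act_ind_right [LHS]counit_right_linE [in RHS]counit_right_linE ractA_l //.
exact: valP.
Qed.

Definition counit_right : right_hopf_hom (ind_right (coinv_right M)) M :=
  @RightHopfHom k H A (ind_right (coinv_right M)) M counit_right_lin
    counit_right_colinear counit_right_act.
Lemma counit_rightE n a :
  counit_right (ind_right_tens n a) = ract (val (n : coinv_sub M) ⊗ a).
Proof. exact: counit_right_linE. Qed.
End Counit.

Section Unit.
Variable N : lmodType B^c.

Lemma unit_right_coinv (n : N) : ind_right_tens n aone \in coinvariants (ind_right N).
Proof.
apply/coinvariantP; rewrite rho_ind_right rho_aone kfold_tens //.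
by split=> *; rewrite -?linearP /=; klin.
Qed.
Definition unit_right_fun (n : N) : coinv_right (ind_right N) :=
  exist _ (ind_right_tens n aone) (unit_right_coinv n).
Lemma unit_right_linear : linear unit_right_fun.
Proof.
move=> b n n'; apply: val_inj; rewrite /= ind_right_tensDl; congr (_ + _).
rewrite ind_right_tensB [RHS]act_ind_right.
by rewrite amul1r amul1l.
Qed.
Definition unit_right : {linear N -> coinv_right (ind_right N)} :=
  HB.pack unit_right_fun (GRing.isLinear.Build B^c N (coinv_right (ind_right N)) _
    unit_right_fun unit_right_linear).
Lemma unit_rightE n : val (unit_right n : coinv_sub (ind_right N)) = ind_right_tens n aone.
Proof. by []. Qed.
End Unit.

Lemma ind_right_gen (N : lmodType B^c) n a :
  ind_right_tens n a = @ract k H A (ind_right N) (ind_right_tens n aone ⊗ a).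
Proof. by rewrite [RHS]act_ind_right amul1l. Qed.

Definition right_adjoint_bijective : Prop :=
  (forall N, bijective (@unit_right N)) /\ (forall M, bijective (@counit_right M)).

End RightAdjunction.

(** * Consequences of an equivalence of categories *)

Section EquivalenceMono.
Variables (C D : category).

Lemma iso_monic (x y z : C) (f : Defs.hom y z) (u v : Defs.hom x y) :
  is_iso f -> Defs.comp f u = Defs.comp f v -> u = v.
Proof.
case=> g [gf _] /(congr1 (Defs.comp g)).
by rewrite !Defs.compA gf !comp1m.
Qed.

Lemma iso_epic (x y z : C) (f : Defs.hom x y) (u v : Defs.hom y z) :
  is_iso f -> Defs.comp u f = Defs.comp v f -> u = v.
Proof.
case=> g [_ fg] /(congr1 (fun w => Defs.comp w g)).
by rewrite -!Defs.compA fg !compm1.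
Qed.
End EquivalenceMono.

(** After applying F, the isomorphism of FG with the identity reduces the claim to cancelling i; F
    is faithful because GF is isomorphic to the identity. *)
Lemma equivalence_monic (C D : category) (F : functor C D) (G : functor D C)
  (x y : D) (i : Defs.hom x y) : inverse_equivalences F G ->
  (forall z (a b : Defs.hom z x), Defs.comp i a = Defs.comp i b -> a = b) ->
  forall z (u v : Defs.hom z (G x)),
    Defs.comp (fmap G i) u = Defs.comp (fmap G i) v -> u = v.
Proof.
move=> [[psi [psi_nat psi_iso]] [phi [phi_nat phi_iso]]] mono z u v e.
have Fe : fmap F u = fmap F v.
  apply: (iso_monic (phi_iso x)); apply: mono.
  rewrite !Defs.compA -!(phi_nat _ _ i) -!Defs.compA; congr Defs.comp.
  by rewrite -!fmap_comp e.
apply: (iso_epic (psi_iso z)).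
have := psi_nat _ _ u; have := psi_nat _ _ v => /= <- <-.
by rewrite Fe.
Qed.

Lemma cancel_linear (R : pzRingType) (U V : lmodType R) (f : {linear U -> V}) (g : V -> U) :
  cancel f g -> cancel g f -> linear g.
Proof. by move=> fK gK c x y; apply: (can_inj fK); rewrite gK linearP !gK. Qed.

Lemma lmod_iso (R : pzRingType) (U V : lmodType R) (f : {linear U -> V}) :
  bijective f -> exists g : {linear V -> U}, cancel f g /\ cancel g f.
Proof.
case=> g fK gK; pose h : {linear V -> U} :=
  HB.pack g (GRing.isLinear.Build R V U _ g (cancel_linear fK gK)).
by exists h.
Qed.

Section RightEquivalence.
Variables (k : fieldType) (H : coquasi_bialgebra k) (A : comodule_algebra H).
Local Notation B := (coinv_algebra A).

Lemma right_hopf_iso (M N : right_hopf_module A) (f : right_hopf_hom M N) :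
  bijective f -> is_iso (f : @Defs.hom (right_hopf_category A) M N).
Proof.
move/lmod_iso => [g [fK gK]].
have gc : colinear g.
  move=> y; rewrite -[y]gK fK (rhh_colinear f) kfold_kfold; last by kbil.
  rewrite -[LHS]kfold_id; apply: eq_kfold => m0 m1.
  by rewrite kfold_tens ?fK //; kbil.
have ga m a : g (ract (m ⊗ a)) = ract (g m ⊗ a).
  by apply: (can_inj fK); rewrite rhh_act !gK.
exists (RightHopfHom gc ga).
by split; apply: right_hopf_hom_eq => x /=; rewrite ?fK ?gK.
Qed.

Lemma counit_right_natural (M N : right_hopf_module A) (f : right_hopf_hom M N) t :
  counit_right N (ind_right_map (coinv_right_map f) t) = f (counit_right M t).
Proof.
move: t; apply: ind_right_eq => [s t|s t|n a].
- by rewrite [X in counit_right N X]linearD; exact: linearD.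
- by rewrite [counit_right M _]linearD; exact: linearD.
by rewrite ind_right_mapE !counit_rightE rhh_act.
Qed.

Lemma unit_right_natural (N N' : lmodType B^c) (f : {linear N -> N'}) n :
  unit_right N' (f n) = coinv_right_map (ind_right_hom f) (unit_right N n).
Proof. by apply: val_inj; rewrite /= ind_right_mapE. Qed.

Lemma right_adjoint_equivalence : right_adjoint_bijective A ->
  inverse_equivalences (coinv_right_functor A) (ind_right_functor A).
Proof.
move=> [ub cb]; split.
  exists (fun M => counit_right M : @Defs.hom (right_hopf_category A) _ _).
  split=> [M N f|M]; last exact: right_hopf_iso.
  by apply: right_hopf_hom_eq => t; exact: counit_right_natural.
have inv (N : lmodType B^c) : exists g : {linear coinv_right (ind_right N) -> N},
    cancel (unit_right N) g /\ cancel g (unit_right N)  by exact: lmod_iso (ub N).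
pose u N : @Defs.hom (lmod_category B^c) (coinv_right (ind_right N)) N := sval (cid (inv N)).
have uK N : cancel (unit_right N) (u N) by case: (svalP (cid (inv N))).
have Ku N : cancel (u N) (unit_right N) by case: (svalP (cid (inv N))).
exists u; split=> [N N' f|N].
  apply: linear_eq => x; rewrite -[x]Ku.
  rewrite -[LHS]/(u N' (coinv_right_map (ind_right_hom f) (unit_right N (u N x)))).
  by rewrite -[RHS]/(f (u N (unit_right N (u N x)))) uK -unit_right_natural uK.
exists (unit_right N : @Defs.hom (lmod_category B^c) N (coinv_right (ind_right N))).
by split; apply: linear_eq => x; [exact: Ku|exact: uK].
Qed.

Section EquivalenceConditions.
Hypothesis E : inverse_equivalences (coinv_right_functor A) (ind_right_functor A).

(** The isomorphism supplied by the equivalence is arbitrary, but any isomorphism from an induced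
    module carries the coinvariants n ⊗ 1 to coinvariants that generate. *)
Lemma equivalence_gen_right : gen_right A.
Proof.
case: E => [[psi [_ psi_iso]] _] M m.
have [g [gK Kg]] := psi_iso M.
pose p : right_hopf_hom (ind_right (coinv_right M)) M := psi M.
have -> : m = p ((g : right_hopf_hom M (ind_right (coinv_right M))) m).
  by have /esym := congr1 (fun f : right_hopf_hom M M => f m) Kg.
elim/ind_right_ind: (_ m) => [n a|s t [u uc su] [v vc sv]|].
- exists [:: (p (ind_right_tens n aone), a)]; last first.
    rewrite big_seq1; etransitivity; first exact: (congr1 p (ind_right_gen n a)).
    exact: rhh_act.
  move=> q; rewrite inE => /eqP -> /=.
  exact: (coinvariants_colinear (rhh_colinear p) (unit_right_coinv n)).
- exists (u ++ v); last by rewrite big_cat linearD su sv.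
  by move=> q; rewrite mem_cat => /orP [/uc|/vc].
- by exists [::]; rewrite ?big_nil ?linear0.
Qed.

Section Image.
Variables (N N' : lmodType B^c) (f : {linear N -> N'}).
Definition imagep : {pred N'} := fun y => `[< exists x, f x = y >].
Lemma imageP y : reflect (exists x, f x = y) (y \in imagep). Proof. exact: asboolP. Qed.
Lemma image_submod : submod_closed imagep.
Proof.
split; first by apply/imageP; exists 0; rewrite linear0.
move=> c y y' /imageP [x <-] /imageP [x' <-]; apply/imageP.
by exists (c *: x + x'); rewrite linearP.
Qed.
HB.instance Definition _ := GRing.isSubmodClosed.Build B^c N' imagep image_submod.
Definition image_type := {y : N' | y \in imagep}.
HB.instance Definition _ := SubChoice.on image_type.
HB.instance Definition _ := [SubChoice_isSubLmodule of image_type by <:].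
Definition image_space : lmodType B^c := GRing.Lmodule.clone B^c image_type _.
End Image.

(** The inclusion of the kernel and the zero map have the same composite with f. *)
Lemma right_hopf_monic (M N : right_hopf_module A) (f : right_hopf_hom M N) :
  (forall Z (u v : right_hopf_hom Z M), right_hopf_comp f u = right_hopf_comp f v -> u = v) ->
  injective f.
Proof.
move=> mono.
pose K := ker_right f.
have Kc : colinear (M := K) (N := M) (ker_val f) by exact: ker_val_colinear.
have Ka (m : K) a : ker_val f (ract (m ⊗ a)) = ract (ker_val f m ⊗ a) by exact: ker_ractE.
pose u : right_hopf_hom K M := RightHopfHom Kc Ka.
pose z : {linear K -> M} := \0.
have zc : colinear z.
  move=> m; rewrite linear0; apply/esym; rewrite /z /=.
  rewrite (eq_kfold (g := fun _ _ => 0 *: 0)); last by move=> ? ?; rewrite ktens0l scale0r.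
  by rewrite kfoldZ scale0r.
have za (m : K) a : z (ract (m ⊗ a)) = ract (z m ⊗ a) by rewrite /z /= ktens0l linear0.
have uz : u = RightHopfHom zc za.
  by apply: mono; apply: right_hopf_hom_eq => x /=; rewrite ker_valP linear0.
apply: raddf_inj => x fx.
have := congr1 (fun w : right_hopf_hom K M => w (ker_mk fx)) uz.
by [].
Qed.

(** Let i be the inclusion of the image of f. Then i ⊗_B A is onto because f ⊗_B A is, and injective
    because i is monic. Such a bijection identifies coinvariants, so by naturality i is onto. *)
Lemma equivalence_surj (N N' : lmodType B^c) (f : {linear N -> N'}) :
  (forall t, exists s, ind_right_map f s = t) -> forall y, exists x, f x = y.
Proof.
move=> fs y; pose I := image_space f.
have il : linear (fun x : I => \val (x : image_type f) : N') by [].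
pose i : {linear I -> N'} := HB.pack (fun x : I => \val (x : image_type f) : N')
  (GRing.isLinear.Build B^c I N' _ _ il).
have ii : injective i by exact: val_inj.
have eP x : f x \in imagep f by apply/imageP; exists x.
pose e0 x : I := (exist _ (f x) (eP x) : image_type f).
have el : linear e0 by move=> c x x'; apply: val_inj; exact: (linearP f).
pose e : {linear N -> I} := HB.pack e0 (GRing.isLinear.Build B^c N I _ e0 el).
have gis t : exists s, ind_right_hom i s = t.
  have [s <-] := fs t; exists (ind_right_map e s); move: s.
  apply: ind_right_eq => [s t'|s t'|n a].
  - by rewrite [X in ind_right_hom i X](linearD (ind_right_hom e)); exact: linearD.
  - exact: (linearD (ind_right_hom f)).
  - by rewrite !ind_right_mapE; exact: ind_right_mapE.
have gii : injective (ind_right_hom i).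
  apply: right_hopf_monic => Z u v uv.
  apply: (equivalence_monic E (i := i : @Defs.hom (lmod_category B^c) I N')) uv.
  move=> W a b /(congr1 (fun g : {linear W -> N'} => g : W -> N')) ab.
  apply: linear_eq => w; apply: ii; exact: (congr1 (fun g => g w) ab).
case: E => _ [phi [phi_nat phi_iso]].
have [g [gK Kg]] := phi_iso N'.
pose p : {linear coinv_right (ind_right N') -> N'} := phi N'.
pose q : {linear N' -> coinv_right (ind_right N')} := g.
have pq x : p (q x) = x by have := congr1 (fun g : {linear N' -> N'} => g x) Kg.
have [s sE] := gis (val (q y : coinv_sub _)).
(* Injectivity of i ⊗_B A, tensored with H, reflects coinvariance. *)
have sc : s \in coinvariants (ind_right I).
  apply/coinvariantP; apply: (tens_map_inj gii).
  rewrite tens_map_fold -(rhh_colinear (ind_right_hom i)) tens_mapE sE.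
  by apply/coinvariantP; exact: valP.
pose s' : coinv_right (ind_right I) := exist _ s sc.
pose pI : {linear coinv_right (ind_right I) -> I} := phi I.
have : i (pI s') = y.
  have := congr1 (fun g : {linear coinv_right (ind_right I) -> N'} => g s')
    (phi_nat _ _ (i : @Defs.hom (lmod_category B^c) I N')).
  move=> /= <-; rewrite -[RHS]pq; congr (p _).
  by apply: val_inj; rewrite /= -sE.
move <-; have /imageP := valP (pI s' : image_type f); exact.
Qed.

(** By naturality of the isomorphisms [psi], a surjection f induces a surjection between the modules
    induced from M^coH and N^coH, and induction reflects surjections. *)
Lemma equivalence_lift_right : lift_right A.
Proof.
case: (E) => [[psi [psi_nat psi_iso]] _] M N f fs n nN.
have [|x xE] := @equivalence_surj _ _ (coinv_right_map f) _ (exist _ n nN); last first.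
  exists (val (x : coinv_sub M)); first exact: valP.
  by rewrite -[RHS](congr1 val xE).
move=> t.
pose pM : right_hopf_hom (ind_right (coinv_right M)) M := psi M.
pose pN : right_hopf_hom (ind_right (coinv_right N)) N := psi N.
have [gM [_ KgM]] := psi_iso M.
have [gN [gNK _]] := psi_iso N.
have [m mE] := fs (pN t).
exists ((gM : right_hopf_hom M (ind_right (coinv_right M))) m).
have pN_inj : injective pN.
  move=> a b ab; have K x : (gN : right_hopf_hom _ _) (pN x) = x.
    by have := congr1 (fun g : right_hopf_hom (ind_right (coinv_right N)) _ => g x) gNK.
  by rewrite -[a]K ab K.
apply: pN_inj; rewrite -mE.
have := congr1 (fun g : right_hopf_hom (ind_right (coinv_right M)) N =>
  g ((gM : right_hopf_hom M (ind_right (coinv_right M))) m)) (psi_nat _ _ f).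
move=> e; etransitivity; first exact: e.
congr (f _).
by have := congr1 (fun g : right_hopf_hom M M => g m) KgM.
Qed.
End EquivalenceConditions.
End RightEquivalence.

(** * Bijective units and counits and flatness from a total integral, right Hopf modules *)

Definition regular_right (k : fieldType) (H : coquasi_bialgebra k) (A : comodule_algebra H) : right_hopf_module A :=
  @RightHopfModule k H A A amul (@rho_amul k H A) (@amul1r k H A) (@amulA k H A).

Section RightTotal.
Variables (k : fieldType) (H : coquasi_hopf k) (A : comodule_algebra H).
Local Notation B := (coinv_algebra A).
Variables (gamma : {linear H -> A}).
Hypotheses (gammac : colinear (M := regular_comodule H) gamma) (gamma1 : gamma hone = aone).

(** The trace of A over itself, a left B-linear projection of A onto B. *)
Definition trace_algebra (a : A) : B :=
  exist _ (trace gamma (M := regular_right A) a) (trace_coinv gammac (M := regular_right A) a).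

Lemma traceE (M : right_hopf_module A) (m : M) : trace gamma m =
  \Sw_(m0, g <- rho m) \Sw_(g1, g2 <- comul g) (hbeta g1 *: ract (m0 ⊗ gamma (antipode g2))).
Proof. by []. Qed.

Lemma traceD (M : right_hopf_module A) (m m' : M) :
  trace gamma (m + m') = trace gamma m + trace gamma m'.
Proof. by have := twist_beta_linear (@ract k H A M) (antipode_int gamma) 1 m m'; rewrite !scale1r. Qed.

Lemma trace_algebraD a a' : trace_algebra (a + a') = trace_algebra a + trace_algebra a'.
Proof. by apply: val_inj; exact: (traceD (M := regular_right A)). Qed.

Lemma trace_algebraM (b : B) a :
  trace_algebra (amul (coinv_val b ⊗ a)) = b * trace_algebra a.
Proof.
apply: val_inj; rewrite /= -[LHS]/(trace gamma (M := regular_right A) (amul (coinv_val b ⊗ a))).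
rewrite traceE amul_coinv_rho_sw; last by kbil.
rewrite -[RHS]/(amul (coinv_val b ⊗ trace gamma (M := regular_right A) a)) traceE.
rewrite ktens_kfoldr kfold_linear; apply: eq_kfold => a0 g.
rewrite ktens_kfoldr kfold_linear; apply: eq_kfold => g1 g2.
by rewrite ktensZr linearZ; congr (_ *: _); apply: amulA_l; exact: coinv_valP.
Qed.

Lemma trace_algebra1 : trace_algebra aone = 1.
Proof.
apply: val_inj; apply: (trace_id gamma1 (M := regular_right A)).
exact: coinvariants_aone.
Qed.

Section Unit.
Variable N : lmodType B^c.

Lemma ind_right_trace n a :
  trace gamma (M := ind_right N) (ind_right_tens n a) =
  ind_right_tens n (coinv_val (trace_algebra a)).
Proof.
rewrite traceE rho_ind_right kfold_kfold; last by kbil.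
rewrite -[coinv_val _]/(trace gamma (M := regular_right A) a) traceE kfold_linear.
apply: eq_kfold => a0 g; rewrite kfold_tens; last by kbil.
rewrite kfold_linear; apply: eq_kfold => g1 g2.
by rewrite linearZ /=; congr (_ *: _); exact: act_ind_right.
Qed.

Let retract_balanced : rbalanced (M := left_regular A)
  (fun (n : N) (a : left_regular A) => (trace_algebra a : B^c) *: n).
Proof.
split=> [n n' a|n a a'|b n a].
- exact: scalerDr.
- by rewrite [trace_algebra _]trace_algebraD; exact: scalerDl.
- by rewrite scalerA; congr (_ *: _); exact/esym/trace_algebraM.
Qed.

Let retract (t : ind_right N) : N := bfold (N := N) (M := left_regular A)
  (fun n (a : left_regular A) => (trace_algebra a : B^c) *: n) t.

Let retractK n : retract (ind_right_tens n aone) = n.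
Proof.
etransitivity; first exact: (bfold_btens _ _ retract_balanced).
by rewrite -[RHS]scale1r; congr (_ *: _); exact: trace_algebra1.
Qed.

(** The map n ⊗ a ↦ n tr(a) is well defined by left B-linearity of the trace and retracts the
    unit. *)
Lemma unit_right_inj : injective (unit_right N).
Proof.
by move=> n n' /(congr1 val) e; rewrite -[n]retractK -[n']retractK; congr retract.
Qed.

(** A coinvariant equals its trace, and the trace of n ⊗ a is n tr(a) ⊗ 1. *)
Lemma unit_right_surj (x : coinv_right (ind_right N)) : exists n, unit_right N n = x.
Proof.
suff [n nE] : exists n, ind_right_tens n aone =
    trace gamma (M := ind_right N) (val (x : coinv_sub (ind_right N))).
  exists n; apply: val_inj; rewrite /= nE.
  by apply: (trace_id gamma1 (M := ind_right N)); exact: valP.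
move: (val _) => t; elim/ind_right_ind: t => [n a|s t [n nE] [n' n'E]|].
- exists ((trace_algebra a : B^c) *: n); rewrite ind_right_trace ind_right_tensB.
  by rewrite amul1r.
- by exists (n + n'); rewrite traceD -nE -n'E ind_right_tensDl.
- exists 0; rewrite (_ : trace _ 0 = 0); last first.
    by apply: (addrI (trace gamma 0)); rewrite -traceD !addr0.
  by apply: (addrI (ind_right_tens 0 aone)); rewrite -ind_right_tensDl !addr0.
Qed.

Lemma unit_right_bij : bijective (unit_right N).
Proof.
have /choice [g gK] := unit_right_surj; exists g => x; last exact: gK.
by apply: unit_right_inj; rewrite gK.
Qed.
End Unit.

(** Generation gives surjectivity. The kernel is generated by its coinvariants, which have the form
    n ⊗ 1; the counit sends n ⊗ 1 to n, so they vanish. *)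
Lemma counit_right_bij (M : right_hopf_module A) : gen_right A -> bijective (counit_right M).
Proof.
move=> gen.
have surj m : exists t, counit_right M t = m.
  have [s sc ->] := gen M m; elim: s sc => [|p s IHs] sc.
    by exists 0; rewrite big_nil linear0.
  have [|t tE] := IHs; first by move=> q qs; apply: sc; rewrite inE qs orbT.
  have pc := sc _ (mem_head _ _).
  exists (ind_right_tens (exist _ p.1 pc : coinv_right M) p.2 + t).
  by rewrite linearD tE big_cons counit_rightE.
have inj : injective (counit_right M).
  apply: raddf_inj => t t0; have [s sc ->] := gen_right_ker gen t0.
  rewrite big_seq big1 // => p ps; have [pc p0] := sc _ ps.
  have [n nE] := unit_right_surj (exist _ p.1 pc).
  have pE : p.1 = ind_right_tens n aone by rewrite -[LHS](congr1 val nE).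
  have n0 : n = 0.
    apply: val_inj; rewrite -[RHS]p0 pE; etransitivity; last exact/esym/counit_rightE.
    by rewrite ract1.
  by rewrite pE n0 -unit_rightE linear0 ktens0l linear0.
have /choice [g gK] := surj; exists g => x; last exact: gK.
by apply: inj; rewrite gK.
Qed.

(** The kernel of g ⊗ A is generated by coinvariants y ⊗ 1 with g(y) = 0, so exactness at Y passes
    to the tensor products. Exactness is reflected because traces turn preimages into coinvariant
    ones. *)
Lemma total_flat_left : gen_right A -> faithfully_flat_left (left_regular A).
Proof.
move=> gen X Y Z f g.
have mapE (N N' : lmodType B^c) (h : {linear N -> N'}) t :
  btensor_map (M := left_regular A) h id t = ind_right_hom h t by [].
split=> [e t|e y].
  split=> [t0|[s <-]].
    have [s sc ->] := gen_right_ker gen (f := ind_right_hom g) t0.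
    elim: s sc => [|p s IHs] sc.
      by exists 0; rewrite big_nil mapE linear0.
    have [|u uE] := IHs; first by move=> q qs; apply: sc; rewrite inE qs orbT.
    have [pc p0] := sc _ (mem_head _ _).
    have [y yE] := unit_right_surj (exist _ p.1 pc).
    have pE : p.1 = ind_right_tens y aone by rewrite -[LHS](congr1 val yE).
    have gy : g y = 0.
      apply: unit_right_inj; rewrite linear0; apply: val_inj => /=.
      by rewrite -[RHS]p0 pE; exact/esym/ind_right_mapE.
    have [x xE] := (e y).1 gy.
    exists (ind_right_tens x p.2 + u); rewrite big_cons mapE linearD.
    congr (_ + _); last exact: uE.
    etransitivity; first exact: ind_right_mapE.
    by rewrite xE pE -ind_right_gen.
  rewrite !mapE; move: s; apply: ind_right_eq => [s s'|s s'|n a].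
  - by rewrite [X in ind_right_hom g X]linearD; exact: linearD.
  - by rewrite addr0.
  - rewrite [X in ind_right_hom g X]ind_right_mapE [LHS]ind_right_mapE.
    rewrite ((e (f n)).2 (ex_intro _ n erefl)) ind_right_gen -unit_rightE linear0.
    by rewrite ktens0l linear0.
split=> [gy|[x <-]]; first have [e1 _] := e (ind_right_tens y aone).
  have [|s sE] := e1.
    by rewrite mapE [LHS]ind_right_mapE gy -unit_rightE linear0.
  (* The trace of a preimage of y ⊗ 1 is a coinvariant preimage, hence of the form n ⊗ 1. *)
  pose s' : coinv_right (ind_right X) :=
    exist _ (trace gamma (M := ind_right X) s) (trace_coinv gammac (M := ind_right X) s).
  have [n nE] := unit_right_surj s'.
  exists n; apply: unit_right_inj; apply: val_inj => /=.
  rewrite -[RHS](trace_id gamma1 (unit_right_coinv y)) -[in RHS]sE mapE.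
  rewrite -trace_natural -[X in ind_right_hom f X](congr1 val nE).
  exact/esym/ind_right_mapE.
apply: unit_right_inj; rewrite linear0; apply: val_inj => /=.
rewrite -[LHS]ind_right_mapE; have [_] := e (ind_right_tens (f x) aone); apply.
by exists (ind_right_tens x aone); exact: ind_right_mapE.
Qed.
End RightTotal.

(** * Adjunction and equivalence for left Hopf modules *)

Section LeftAdjunction.
Variables (k : fieldType) (H : coquasi_bialgebra k) (A : comodule_algebra H).
Local Notation B := (coinv_algebra A).

Section Counit.
Variable M : left_hopf_module A.

Lemma counit_left_ok : ind_left_lift_ok (N := coinv_left M)
  (fun n a => lact (a ⊗ val (n : coinv_sub M))).
Proof.
split=> [n n' a|n c a a'|b n a]; [by rewrite /= ktensDr linearD|by klin|].
by rewrite /= lactA_r //; exact: valP.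
Qed.

Definition counit_left_lin : {linear ind_left (coinv_left M) -> M} :=
  linof (ind_left_fold_linear counit_left_ok).
Lemma counit_left_linE n a :
  counit_left_lin (ind_left_tens n a) = lact (a ⊗ val (n : coinv_sub M)).
Proof. exact: (ind_left_foldE counit_left_ok). Qed.

Let counit_left_colinear : colinear counit_left_lin.
Proof.
apply: ind_left_eq => [s t|s t|n a]; first by rewrite !linearD.
  by rewrite linearD kfold_addr //; kbil.
rewrite counit_left_linE rho_lact rho_ind_left kfold_kfold; last by kbil.
apply: eq_kfold => a0 a1; rewrite kfold_tens; last by kbil.
rewrite rho_coinv_sw; [|by kbil|exact: valP].
by rewrite hmul1r counit_left_linE.
Qed.

Let counit_left_act a t : counit_left_lin (lact (a ⊗ t)) = lact (a ⊗ counit_left_lin t).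
Proof.
move: t; apply: ind_left_eq => [s t|s t|n x].
- by rewrite ktensDr [lact _]linearD [LHS]linearD.
- by rewrite [counit_left_lin _]linearD ktensDr [LHS]linearD.
rewrite act_ind_left [LHS]counit_left_linE [in RHS]counit_left_linE lactA_r //.
exact: valP.
Qed.

Definition counit_left : left_hopf_hom (ind_left (coinv_left M)) M :=
  @LeftHopfHom k H A (ind_left (coinv_left M)) M counit_left_lin
    counit_left_colinear counit_left_act.
Lemma counit_leftE n a :
  counit_left (ind_left_tens n a) = lact (a ⊗ val (n : coinv_sub M)).
Proof. exact: counit_left_linE. Qed.
End Counit.

Section Unit.
Variable N : lmodType B.

Lemma unit_left_coinv (n : N) : ind_left_tens n aone \in coinvariants (ind_left N).
Proof.
apply/coinvariantP; rewrite rho_ind_left rho_aone kfold_tens //.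
by split=> *; rewrite -?linearP /=; klin.
Qed.
Definition unit_left_fun (n : N) : coinv_left (ind_left N) :=
  exist _ (ind_left_tens n aone) (unit_left_coinv n).
Lemma unit_left_linear : linear unit_left_fun.
Proof.
move=> b n n'; apply: val_inj; rewrite /= ind_left_tensDl; congr (_ + _).
rewrite ind_left_tensB [RHS]act_ind_left.
by rewrite amul1l amul1r.
Qed.
Definition unit_left : {linear N -> coinv_left (ind_left N)} :=
  HB.pack unit_left_fun (GRing.isLinear.Build B N (coinv_left (ind_left N)) _
    unit_left_fun unit_left_linear).
Lemma unit_leftE n : val (unit_left n : coinv_sub (ind_left N)) = ind_left_tens n aone.
Proof. by []. Qed.
End Unit.

Lemma ind_left_gen (N : lmodType B) n a :
  ind_left_tens n a = @lact k H A (ind_left N) (a ⊗ ind_left_tens n aone).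
Proof. by rewrite [RHS]act_ind_left amul1r. Qed.

Definition left_adjoint_bijective : Prop :=
  (forall N, bijective (@unit_left N)) /\ (forall M, bijective (@counit_left M)).

End LeftAdjunction.
Section LeftEquivalence.
Variables (k : fieldType) (H : coquasi_bialgebra k) (A : comodule_algebra H).
Local Notation B := (coinv_algebra A).

Lemma left_hopf_iso (M N : left_hopf_module A) (f : left_hopf_hom M N) :
  bijective f -> is_iso (f : @Defs.hom (left_hopf_category A) M N).
Proof.
move/lmod_iso => [g [fK gK]].
have gc : colinear g.
  move=> y; rewrite -[y]gK fK (lhh_colinear f) kfold_kfold; last by kbil.
  rewrite -[LHS]kfold_id; apply: eq_kfold => m0 m1.
  by rewrite kfold_tens ?fK //; kbil.
have ga a m : g (lact (a ⊗ m)) = lact (a ⊗ g m).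
  by apply: (can_inj fK); rewrite lhh_act !gK.
exists (LeftHopfHom gc ga).
by split; apply: left_hopf_hom_eq => x /=; rewrite ?fK ?gK.
Qed.

Lemma counit_left_natural (M N : left_hopf_module A) (f : left_hopf_hom M N) t :
  counit_left N (ind_left_map (coinv_left_map f) t) = f (counit_left M t).
Proof.
move: t; apply: ind_left_eq => [s t|s t|n a].
- by rewrite [X in counit_left N X]linearD; exact: linearD.
- by rewrite [counit_left M _]linearD; exact: linearD.
by rewrite ind_left_mapE !counit_leftE lhh_act.
Qed.

Lemma unit_left_natural (N N' : lmodType B) (f : {linear N -> N'}) n :
  unit_left N' (f n) = coinv_left_map (ind_left_hom f) (unit_left N n).
Proof. by apply: val_inj; rewrite /= ind_left_mapE. Qed.

Lemma left_adjoint_equivalence : left_adjoint_bijective A ->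
  inverse_equivalences (coinv_left_functor A) (ind_left_functor A).
Proof.
move=> [ub cb]; split.
  exists (fun M => counit_left M : @Defs.hom (left_hopf_category A) _ _).
  split=> [M N f|M]; last exact: left_hopf_iso.
  by apply: left_hopf_hom_eq => t; exact: counit_left_natural.
have inv (N : lmodType B) : exists g : {linear coinv_left (ind_left N) -> N},
    cancel (unit_left N) g /\ cancel g (unit_left N)  by exact: lmod_iso (ub N).
pose u N : @Defs.hom (lmod_category B) (coinv_left (ind_left N)) N := sval (cid (inv N)).
have uK N : cancel (unit_left N) (u N) by case: (svalP (cid (inv N))).
have Ku N : cancel (u N) (unit_left N) by case: (svalP (cid (inv N))).
exists u; split=> [N N' f|N].
  apply: linear_eq => x; rewrite -[x]Ku.
  rewrite -[LHS]/(u N' (coinv_left_map (ind_left_hom f) (unit_left N (u N x)))).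
  by rewrite -[RHS]/(f (u N (unit_left N (u N x)))) uK -unit_left_natural uK.
exists (unit_left N : @Defs.hom (lmod_category B) N (coinv_left (ind_left N))).
by split; apply: linear_eq => x; [exact: Ku|exact: uK].
Qed.

Section EquivalenceConditions.
Hypothesis E : inverse_equivalences (coinv_left_functor A) (ind_left_functor A).

Lemma equivalence_gen_left : gen_left A.
Proof.
case: E => [[psi [_ psi_iso]] _] M m.
have [g [gK Kg]] := psi_iso M.
pose p : left_hopf_hom (ind_left (coinv_left M)) M := psi M.
have -> : m = p ((g : left_hopf_hom M (ind_left (coinv_left M))) m).
  by have /esym := congr1 (fun f : left_hopf_hom M M => f m) Kg.
elim/ind_left_ind: (_ m) => [n a|s t [u uc su] [v vc sv]|].
- exists [:: (p (ind_left_tens n aone), a)]; last first.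
    rewrite big_seq1; etransitivity; first exact: (congr1 p (ind_left_gen n a)).
    exact: lhh_act.
  move=> q; rewrite inE => /eqP -> /=.
  exact: (coinvariants_colinear (lhh_colinear p) (unit_left_coinv n)).
- exists (u ++ v); last by rewrite big_cat linearD su sv.
  by move=> q; rewrite mem_cat => /orP [/uc|/vc].
- by exists [::]; rewrite ?big_nil ?linear0.
Qed.

Section LeftImage.
Variables (N N' : lmodType B) (f : {linear N -> N'}).
Definition limagep : {pred N'} := fun y => `[< exists x, f x = y >].
Lemma limageP y : reflect (exists x, f x = y) (y \in limagep). Proof. exact: asboolP. Qed.
Lemma limage_submod : submod_closed limagep.
Proof.
split; first by apply/limageP; exists 0; rewrite linear0.
move=> c y y' /limageP [x <-] /limageP [x' <-]; apply/limageP.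
by exists (c *: x + x'); rewrite linearP.
Qed.
HB.instance Definition _ := GRing.isSubmodClosed.Build B N' limagep limage_submod.
Definition limage_type := {y : N' | y \in limagep}.
HB.instance Definition _ := SubChoice.on limage_type.
HB.instance Definition _ := [SubChoice_isSubLmodule of limage_type by <:].
Definition limage_space : lmodType B := GRing.Lmodule.clone B limage_type _.
End LeftImage.

Lemma left_hopf_monic (M N : left_hopf_module A) (f : left_hopf_hom M N) :
  (forall Z (u v : left_hopf_hom Z M), left_hopf_comp f u = left_hopf_comp f v -> u = v) ->
  injective f.
Proof.
move=> mono.
pose K := ker_left f.
have Kc : colinear (M := K) (N := M) (ker_val f) by exact: ker_val_colinear.
have Ka a (m : K) : ker_val f (lact (a ⊗ m)) = lact (a ⊗ ker_val f m) by exact: ker_lactE.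
pose u : left_hopf_hom K M := LeftHopfHom Kc Ka.
pose z : {linear K -> M} := \0.
have zc : colinear z.
  move=> m; rewrite linear0; apply/esym; rewrite /z /=.
  rewrite (eq_kfold (g := fun _ _ => 0 *: 0)); last by move=> ? ?; rewrite ktens0l scale0r.
  by rewrite kfoldZ scale0r.
have za a (m : K) : z (lact (a ⊗ m)) = lact (a ⊗ z m) by rewrite /z /= ktens0r linear0.
have uz : u = LeftHopfHom zc za.
  by apply: mono; apply: left_hopf_hom_eq => x /=; rewrite ker_valP linear0.
apply: raddf_inj => x fx.
have := congr1 (fun w : left_hopf_hom K M => w (ker_mk fx)) uz.
by [].
Qed.

Lemma equivalence_surj_left (N N' : lmodType B) (f : {linear N -> N'}) :
  (forall t, exists s, ind_left_map f s = t) -> forall y, exists x, f x = y.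
Proof.
move=> fs y; pose I := limage_space f.
have il : linear (fun x : I => \val (x : limage_type f) : N') by [].
pose i : {linear I -> N'} := HB.pack (fun x : I => \val (x : limage_type f) : N')
  (GRing.isLinear.Build B I N' _ _ il).
have ii : injective i by exact: val_inj.
have eP x : f x \in limagep f by apply/limageP; exists x.
pose e0 x : I := (exist _ (f x) (eP x) : limage_type f).
have el : linear e0 by move=> c x x'; apply: val_inj; exact: (linearP f).
pose e : {linear N -> I} := HB.pack e0 (GRing.isLinear.Build B N I _ e0 el).
have gis t : exists s, ind_left_hom i s = t.
  have [s <-] := fs t; exists (ind_left_map e s); move: s.
  apply: ind_left_eq => [s t'|s t'|n a].
  - by rewrite [X in ind_left_hom i X](linearD (ind_left_hom e)); exact: linearD.
  - exact: (linearD (ind_left_hom f)).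
  - by rewrite !ind_left_mapE; exact: ind_left_mapE.
have gii : injective (ind_left_hom i).
  apply: left_hopf_monic => Z u v uv.
  apply: (equivalence_monic E (i := i : @Defs.hom (lmod_category B) I N')) uv.
  move=> W a b /(congr1 (fun g : {linear W -> N'} => g : W -> N')) ab.
  apply: linear_eq => w; apply: ii; exact: (congr1 (fun g => g w) ab).
case: E => _ [phi [phi_nat phi_iso]].
have [g [gK Kg]] := phi_iso N'.
pose p : {linear coinv_left (ind_left N') -> N'} := phi N'.
pose q : {linear N' -> coinv_left (ind_left N')} := g.
have pq x : p (q x) = x by have := congr1 (fun g : {linear N' -> N'} => g x) Kg.
have [s sE] := gis (val (q y : coinv_sub _)).
have sc : s \in coinvariants (ind_left I).
  apply/coinvariantP; apply: (tens_map_inj gii).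
  rewrite tens_map_fold -(lhh_colinear (ind_left_hom i)) tens_mapE sE.
  by apply/coinvariantP; exact: valP.
pose s' : coinv_left (ind_left I) := exist _ s sc.
pose pI : {linear coinv_left (ind_left I) -> I} := phi I.
have : i (pI s') = y.
  have := congr1 (fun g : {linear coinv_left (ind_left I) -> N'} => g s')
    (phi_nat _ _ (i : @Defs.hom (lmod_category B) I N')).
  move=> /= <-; rewrite -[RHS]pq; congr (p _).
  by apply: val_inj; rewrite /= -sE.
move <-; have /limageP := valP (pI s' : limage_type f); exact.
Qed.

Lemma equivalence_lift_left : lift_left A.
Proof.
case: (E) => [[psi [psi_nat psi_iso]] _] M N f fs n nN.
have [|x xE] := @equivalence_surj_left _ _ (coinv_left_map f) _ (exist _ n nN); last first.
  exists (val (x : coinv_sub M)); first exact: valP.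
  by rewrite -[RHS](congr1 val xE).
move=> t.
pose pM : left_hopf_hom (ind_left (coinv_left M)) M := psi M.
pose pN : left_hopf_hom (ind_left (coinv_left N)) N := psi N.
have [gM [_ KgM]] := psi_iso M.
have [gN [gNK _]] := psi_iso N.
have [m mE] := fs (pN t).
exists ((gM : left_hopf_hom M (ind_left (coinv_left M))) m).
have pN_inj : injective pN.
  move=> a b ab; have K x : (gN : left_hopf_hom _ _) (pN x) = x.
    by have := congr1 (fun g : left_hopf_hom (ind_left (coinv_left N)) _ => g x) gNK.
  by rewrite -[a]K ab K.
apply: pN_inj; rewrite -mE.
have := congr1 (fun g : left_hopf_hom (ind_left (coinv_left M)) N =>
  g ((gM : left_hopf_hom M (ind_left (coinv_left M))) m)) (psi_nat _ _ f).
move=> e; etransitivity; first exact: e.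
congr (f _).
by have := congr1 (fun g : left_hopf_hom M M => g m) KgM.
Qed.
End EquivalenceConditions.
End LeftEquivalence.

(** * Bijective units and counits and flatness from a total integral, left Hopf modules *)

Definition regular_left (k : fieldType) (H : coquasi_bialgebra k) (A : comodule_algebra H) : left_hopf_module A :=
  @LeftHopfModule k H A A amul (@rho_amul k H A) (@amul1l k H A) (@amulA k H A).

Section LeftTotal.
Variables (k : fieldType) (H : coquasi_hopf k) (T : {linear H -> H}).
Hypotheses (ST : cancel (@antipode k H) T) (TS : cancel T (@antipode k H)).
Variables (A : comodule_algebra H) (gamma : {linear H -> A}).
Hypotheses (gammac : colinear (M := regular_comodule H) gamma) (gamma1 : gamma hone = aone).
Local Notation B := (coinv_algebra A).
Local Notation ltr := (ltrace ST TS gamma).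

Lemma ltraceE (M : left_hopf_module A) (m : M) : ltr m =
  \Sw_(m0, g <- rho m) \Sw_(g1, g2 <- comul g) (hbeta (T g1) *: lact (gamma (T g2) ⊗ m0)).
Proof.
by apply: eq_kfold => ? ?; apply: eq_kfold => ? ?; congr (_ *: _); exact: ract_opE.
Qed.

Lemma ltraceD (M : left_hopf_module A) (m m' : M) : ltr (m + m') = ltr m + ltr m'.
Proof. exact: (traceD (H := coquasi_hopf_op ST TS) _ (M := right_of_left M)). Qed.

Definition ltrace_algebra (a : A) : B :=
  exist _ (ltr (a : regular_left A)) (ltrace_coinv ST TS gammac (M := regular_left A) a).

Lemma ltrace_algebraD a a' : ltrace_algebra (a + a') = ltrace_algebra a + ltrace_algebra a'.
Proof. by apply: val_inj; exact: (ltraceD (M := regular_left A)). Qed.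

Lemma ltrace_algebraM (b : B) a :
  ltrace_algebra (amul (a ⊗ coinv_val b)) = ltrace_algebra a * b.
Proof.
apply: val_inj; rewrite /= -[LHS]/(ltr (amul (a ⊗ coinv_val b) : regular_left A)).
rewrite ltraceE amul_rho_coinv_sw; last by kbil.
rewrite -[RHS]/(amul (ltr (a : regular_left A) ⊗ coinv_val b)) ltraceE.
rewrite ktens_kfoldl kfold_linear; apply: eq_kfold => a0 g.
rewrite ktens_kfoldl kfold_linear; apply: eq_kfold => g1 g2.
rewrite ktensZl linearZ; congr (_ *: _); apply/esym; apply: amulA_r; exact: coinv_valP.
Qed.

Lemma ltrace_algebra1 : ltrace_algebra aone = 1.
Proof.
apply: val_inj; apply: (ltrace_id ST TS gamma1 (M := regular_left A)).
exact: coinvariants_aone.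
Qed.

Section Unit.
Variable N : lmodType B.

Lemma ind_left_ltrace n a :
  ltr (ind_left_tens n a : ind_left N) = ind_left_tens n (coinv_val (ltrace_algebra a)).
Proof.
rewrite ltraceE rho_ind_left kfold_kfold; last by kbil.
rewrite -[coinv_val _]/(ltr (a : regular_left A)) ltraceE kfold_linear.
apply: eq_kfold => a0 g; rewrite kfold_tens; last by kbil.
rewrite kfold_linear; apply: eq_kfold => g1 g2.
by rewrite linearZ /=; congr (_ *: _); exact: act_ind_left.
Qed.

Let retract_balanced : rbalanced (N := right_regular A)
  (fun (a : right_regular A) (n : N) => ltrace_algebra a *: n).
Proof.
split=> [a a' n|a n n'|b a n].
- by rewrite [ltrace_algebra _]ltrace_algebraD; exact: scalerDl.
- exact: scalerDr.
- by rewrite scalerA; congr (_ *: _); exact: ltrace_algebraM.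
Qed.

Let retract (t : ind_left N) : N := bfold (N := right_regular A) (M := N)
  (fun (a : right_regular A) (n : N) => ltrace_algebra a *: n) t.

Let retractK n : retract (ind_left_tens n aone) = n.
Proof.
etransitivity; first exact: (bfold_btens _ _ retract_balanced).
by rewrite -[RHS]scale1r; congr (_ *: _); exact: ltrace_algebra1.
Qed.

Lemma unit_left_inj : injective (unit_left N).
Proof.
by move=> n n' /(congr1 val) e; rewrite -[n]retractK -[n']retractK; congr retract.
Qed.

Lemma unit_left_surj (x : coinv_left (ind_left N)) : exists n, unit_left N n = x.
Proof.
suff [n nE] : exists n, ind_left_tens n aone =
    ltr (val (x : coinv_sub (ind_left N)) : ind_left N).
  exists n; apply: val_inj; rewrite /= nE.
  by apply: (ltrace_id ST TS gamma1 (M := ind_left N)); exact: valP.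
move: (val _) => t; elim/ind_left_ind: t => [n a|s t [n nE] [n' n'E]|].
- exists (ltrace_algebra a *: n); rewrite ind_left_ltrace ind_left_tensB.
  by rewrite amul1l.
- by exists (n + n'); rewrite ltraceD -nE -n'E ind_left_tensDl.
- exists 0; rewrite (_ : ltr 0 = 0); last first.
    by apply: (addrI (ltr (0 : ind_left N))); rewrite -ltraceD !addr0.
  by apply: (addrI (ind_left_tens 0 aone)); rewrite -ind_left_tensDl !addr0.
Qed.

Lemma unit_left_bij : bijective (unit_left N).
Proof.
have /choice [g gK] := unit_left_surj; exists g => x; last exact: gK.
by apply: unit_left_inj; rewrite gK.
Qed.
End Unit.

Lemma counit_left_bij (M : left_hopf_module A) : gen_left A -> bijective (counit_left M).
Proof.
move=> gen.
have surj m : exists t, counit_left M t = m.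
  have [s sc ->] := gen M m; elim: s sc => [|p s IHs] sc.
    by exists 0; rewrite big_nil linear0.
  have [|t tE] := IHs; first by move=> q qs; apply: sc; rewrite inE qs orbT.
  have pc := sc _ (mem_head _ _).
  exists (ind_left_tens (exist _ p.1 pc : coinv_left M) p.2 + t).
  by rewrite linearD tE big_cons counit_leftE.
have inj : injective (counit_left M).
  apply: raddf_inj => t t0; have [s sc ->] := gen_left_ker gen t0.
  rewrite big_seq big1 // => p ps; have [pc p0] := sc _ ps.
  have [n nE] := unit_left_surj (exist _ p.1 pc).
  have pE : p.1 = ind_left_tens n aone by rewrite -[LHS](congr1 val nE).
  have n0 : n = 0.
    apply: val_inj; rewrite -[RHS]p0 pE; etransitivity; last exact/esym/counit_leftE.
    by rewrite lact1.
  by rewrite pE n0 -unit_leftE linear0 ktens0r linear0.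
have /choice [g gK] := surj; exists g => x; last exact: gK.
by apply: inj; rewrite gK.
Qed.

Lemma total_flat_right : gen_left A -> faithfully_flat_right (right_regular A).
Proof.
move=> gen X Y Z f g.
have mapE (N N' : lmodType B) (h : {linear N -> N'}) t :
  btensor_map (N := right_regular A) id h t = ind_left_hom h t by [].
split=> [e t|e y].
  split=> [t0|[s <-]].
    have [s sc ->] := gen_left_ker gen (f := ind_left_hom g) t0.
    elim: s sc => [|p s IHs] sc.
      by exists 0; rewrite big_nil mapE linear0.
    have [|u uE] := IHs; first by move=> q qs; apply: sc; rewrite inE qs orbT.
    have [pc p0] := sc _ (mem_head _ _).
    have [y yE] := unit_left_surj (exist _ p.1 pc).
    have pE : p.1 = ind_left_tens y aone by rewrite -[LHS](congr1 val yE).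
    have gy : g y = 0.
      apply: unit_left_inj; rewrite linear0; apply: val_inj => /=.
      by rewrite -[RHS]p0 pE; exact/esym/ind_left_mapE.
    have [x xE] := (e y).1 gy.
    exists (ind_left_tens x p.2 + u); rewrite big_cons mapE linearD.
    congr (_ + _); last exact: uE.
    etransitivity; first exact: ind_left_mapE.
    by rewrite xE pE -ind_left_gen.
  rewrite !mapE; move: s; apply: ind_left_eq => [s s'|s s'|n a].
  - by rewrite [X in ind_left_hom g X]linearD; exact: linearD.
  - by rewrite addr0.
  - rewrite [X in ind_left_hom g X]ind_left_mapE [LHS]ind_left_mapE.
    rewrite ((e (f n)).2 (ex_intro _ n erefl)) ind_left_gen -unit_leftE linear0.
    by rewrite ktens0r linear0.
split=> [gy|[x <-]]; first have [e1 _] := e (ind_left_tens y aone).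
  have [|s sE] := e1.
    by rewrite mapE [LHS]ind_left_mapE gy -unit_leftE linear0.
  pose s' : coinv_left (ind_left X) :=
    exist _ (ltr (s : ind_left X)) (ltrace_coinv ST TS gammac (M := ind_left X) s).
  have [n nE] := unit_left_surj s'.
  exists n; apply: unit_left_inj; apply: val_inj => /=.
  rewrite -[RHS](ltrace_id ST TS gamma1 (unit_left_coinv y)) -[in RHS]sE mapE.
  rewrite -ltrace_natural -[X in ind_left_hom f X](congr1 val nE).
  exact/esym/ind_left_mapE.
apply: unit_left_inj; rewrite linear0; apply: val_inj => /=.
rewrite -[LHS]ind_left_mapE; have [_] := e (ind_left_tens (f x) aone); apply.
by exists (ind_left_tens x aone); exact: ind_left_mapE.
Qed.
End LeftTotal.
(** * Galois extensions and faithfully flat descent *)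

Section CanonicalInjective.
Variables (k : fieldType) (H : coquasi_hopf k) (A : comodule_algebra H).
Local Notation B := (coinv_algebra A).
Let HL := regular_lcomodule H.
Let AH : left_hopf_module A := free_left A (dual_comodule HL).

(** Coinvariants may be compared after [cot_kappa], where [coinv_of] becomes the coaction and the
    action of b plain multiplication. *)
Lemma coinv_of_lin (b : B) (a a' : A) :
  coinv_of (amul (coinv_val b ⊗ a) + a') = lact (coinv_val b ⊗ coinv_of a) + coinv_of a'.
Proof.
rewrite /coinv_of linearD linearD; congr (_ + _).
have c2 : lact (coinv_val b ⊗ coinv_of a) \in coinvariants AH.
  by apply: coinvariants_lact; exact: coinv_of_coinv.
have c1 := coinv_of_coinv (amul (coinv_val b ⊗ a)).
rewrite -[LHS](cot_betaK c1) -[RHS](cot_betaK c2); congr (cot_beta _ _ _).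
rewrite [RHS](cot_kappa_lact _ (coinv_of_coinv a)).
rewrite [LHS](cot_kappaK (rho_cotensor _)) [X in lmulH _ X](cot_kappaK (rho_cotensor _)).
rewrite -[LHS]kfold_id amul_coinv_rho_sw; last by kbil.
by [].
Qed.

Definition coinv_of_fun (a : left_regular A) : coinv_left AH :=
  exist _ (coinv_of (a : A)) (coinv_of_coinv (a : A)).
Lemma coinv_of_linear : linear coinv_of_fun.
Proof. by move=> b a a'; apply: val_inj; exact: coinv_of_lin. Qed.
Definition coinv_of_hom : {linear left_regular A -> coinv_left AH} :=
  HB.pack coinv_of_fun (GRing.isLinear.Build B (left_regular A) (coinv_left AH) _
    coinv_of_fun coinv_of_linear).

Lemma coinv_of_bij : bijective coinv_of_hom.
Proof.
have s w : exists a, coinv_of_hom a = w.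
  have [a aE] := coinv_ofP (valP (w : coinv_sub AH)); exists a.
  by apply: val_inj; rewrite /= -aE.
have /choice [g gK] := s; exists g => // a.
have e := congr1 val (gK (coinv_of_hom a)).
have {e} e : rho (g (coinv_of_hom a) : A) = rho (a : A).
  rewrite -[LHS](cot_kappaK (rho_cotensor _)) -[RHS](cot_kappaK (rho_cotensor _)).
  exact: (congr1 (cot_kappa A HL) e).
by rewrite -[LHS](rho_counit (g (coinv_of_hom a) : A)) e rho_counit.
Qed.

(** Up to the isomorphism of A with (A ⊗ H)^coH, can is a counit of the left adjunction; so
    bijective counits make it injective. *)
Lemma can_counit (t : ind_left (left_regular A)) :
  can A t = counit_left AH (ind_left_hom coinv_of_hom t).
Proof.
move: t; apply: ind_left_eq => [s t|s t|n a].
- exact: can_linear.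
- by rewrite [X in counit_left AH X]linearD; exact: linearD.
rewrite [LHS]canE [RHS](congr1 _ (ind_left_mapE _ _ _)) counit_leftE.
exact: can_tensE.
Qed.

Lemma counit_can_inj : (forall M, bijective (@counit_left k H A M)) -> injective (can A).
Proof.
move=> cb s t; rewrite !can_counit => /(bij_inj (cb AH)).
have [g [gK _]] := lmod_iso coinv_of_bij.
have K u : ind_left_map g (ind_left_map coinv_of_hom u) = u.
  move: u; apply: ind_left_eq => [u v|//|n a].
    by rewrite [X in ind_left_map g X](linearD (ind_left_hom coinv_of_hom)); exact: (linearD (ind_left_hom g)).
  by rewrite !ind_left_mapE gK.
by move/(congr1 (ind_left_map g)); rewrite !K.
Qed.
End CanonicalInjective.

(** * Coinvariants as the kernel of a B-linear map *)

Section RightRestriction.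
Variables (k : fieldType) (H : coquasi_bialgebra k) (A : comodule_algebra H).
Local Notation B := (coinv_algebra A).
Variable M : right_hopf_module A.

Lemma ractA_m (m : M) (b : B) a :
  ract (ract (m ⊗ coinv_val b) ⊗ a) = ract (m ⊗ amul (coinv_val b ⊗ a)).
Proof.
rewrite ractA.
rewrite -(rho_counit_sw (f := fun m => ract (m ⊗ amul (coinv_val b ⊗ a)))); last first.
  by move=> ? ? ?; klin.
apply: eq_kfold => m0 m1; rewrite rho_coinv_sw ?coinv_valP //; last by kbil.
rewrite -(rho_counit_sw (f := fun a => ract (m0 ⊗ amul (coinv_val b ⊗ a)))); last first.
  by move=> ? ? ?; klin.
by rewrite -kfoldZ; apply: eq_kfold => c0 c1; rewrite omega_normal scalerA.
Qed.

Lemma ractA_r (m : M) (b : B) a :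
  ract (ract (m ⊗ a) ⊗ coinv_val b) = ract (m ⊗ amul (a ⊗ coinv_val b)).
Proof.
rewrite ractA.
rewrite -(rho_counit_sw (f := fun m => ract (m ⊗ amul (a ⊗ coinv_val b)))); last first.
  by move=> ? ? ?; klin.
apply: eq_kfold => m0 m1.
rewrite -(rho_counit_sw (f := fun a => ract (m0 ⊗ amul (a ⊗ coinv_val b)))); last first.
  by move=> ? ? ?; klin.
rewrite -kfoldZ; apply: eq_kfold => c0 c1.
rewrite rho_coinv_sw ?coinv_valP //; last by kbil.
by rewrite omega_1r scalerA.
Qed.

Lemma rho_ract_coinv (Q : lmodType k) (F : M -> H -> Q) (m : M) (b : B) : kbilinear F ->
  kfold F (rho (ract (m ⊗ coinv_val b))) =
  \Sw_(m0, m1 <- rho m) F (ract (m0 ⊗ coinv_val b)) m1.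
Proof.
move=> Fb; rewrite rho_ract kfold_kfold //; apply: eq_kfold => m0 m1.
rewrite rho_coinv_sw ?coinv_valP //; last by kbil.
by rewrite hmul1r kfold_tens.
Qed.

Definition act_coinv (b : B) : {linear M -> M} :=
  linof (fun c x y => @lin_app k _ _ c (@ract k H A M) _ _ _ (ktensPl c x y (coinv_val b))).
Lemma act_coinvE b m : act_coinv b m = ract (m ⊗ coinv_val b). Proof. by []. Qed.

Definition res_right_type : Type := M.
HB.instance Definition _ := GRing.Zmodule.on res_right_type.
Let scale (b : B^c) (m : res_right_type) : res_right_type := act_coinv b m.
Let scaleA b c m : scale b (scale c m) = scale (b * c) m.
Proof. by rewrite /scale !act_coinvE ractA_m. Qed.
Let scale1 : left_id 1 scale.
Proof. by move=> m; rewrite /scale act_coinvE ract1. Qed.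
Let scaleDr : right_distributive scale +%R.
Proof. by move=> b m n; exact: linearD. Qed.
Let scaleDl m : {morph scale^~ m : b c / b + c}.
Proof. by move=> b c; rewrite /scale !act_coinvE coinv_valD ktensDr linearD. Qed.
HB.instance Definition _ := GRing.Zmodule_isLmodule.Build B^c res_right_type
  scaleA scale1 scaleDr scaleDl.
Definition res_right : lmodType B^c := GRing.Lmodule.clone B^c res_right_type _.

Definition res_rightH_type : Type := (M ⊗ H)%type.
HB.instance Definition _ := GRing.Zmodule.on res_rightH_type.
Let scaleH (b : B^c) (t : res_rightH_type) : res_rightH_type := tens_map H (act_coinv b) t.
Let scaleHA b c t : scaleH b (scaleH c t) = scaleH (b * c) t.
Proof.
rewrite /scaleH; move: t; apply: klinear_eq => [? ? ?|? ? ?|m h].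
- by rewrite !linearP.
- exact: linearP.
by rewrite !tens_mapE -[act_coinv b _]/(scale b (scale c m)) scaleA.
Qed.
Let scaleH1 : left_id 1 scaleH.
Proof.
rewrite /scaleH; apply: klinear_eq => [? ? ?|? ? ?|m h]; [exact: linearP|by []|].
by rewrite tens_mapE -[act_coinv _ _]/(scale 1 m) scale1.
Qed.
Let scaleHDr : right_distributive scaleH +%R.
Proof. by move=> b m n; exact: linearD. Qed.
Let scaleHDl t : {morph scaleH^~ t : b c / b + c}.
Proof.
move=> b c; rewrite /scaleH; move: t; apply: klinear_eq => [? ? ?|e s t|m h].
- exact: linearP.
- by rewrite !linearP addrACA scalerDr.
by rewrite !tens_mapE -ktensDl; congr (_ ⊗ _); exact: scaleDl.
Qed.
HB.instance Definition _ := GRing.Zmodule_isLmodule.Build B^c res_rightH_type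
  scaleHA scaleH1 scaleHDr scaleHDl.
Definition res_rightH : lmodType B^c := GRing.Lmodule.clone B^c res_rightH_type _.

Lemma res_right_incl_linear : linear (fun n : coinv_right M => val (n : coinv_sub M) : res_right).
Proof. by []. Qed.
Definition res_right_incl : {linear coinv_right M -> res_right} :=
  HB.pack (fun n : coinv_right M => val (n : coinv_sub M) : res_right)
    (GRing.isLinear.Build B^c (coinv_right M) res_right _ _ res_right_incl_linear).

Lemma res_right_coact_linear :
  linear (fun m : res_right => rho (m : M) - (m : M) ⊗ hone : res_rightH).
Proof.
move=> b x y; rewrite -[b *: x]/(ract ((x : M) ⊗ coinv_val b)).
rewrite -[b *: _]/(scaleH b (rho (x : M) - (x : M) ⊗ hone)) /scaleH.
have -> : rho (ract ((x : M) ⊗ coinv_val b) + (y : M)) =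
    tens_map H (act_coinv b) (rho (x : M)) + rho (y : M).
  rewrite linearD; congr (_ + _); rewrite -[LHS]kfold_id rho_ract_coinv; last by kbil.
  by rewrite tens_map_fold.
rewrite ktensDl linearB /= tens_mapE act_coinvE opprD.
by rewrite -!addrA; congr (_ + _); rewrite addrCA.
Qed.
Definition res_right_coact : {linear res_right -> res_rightH} :=
  HB.pack (fun m : res_right => rho (m : M) - (m : M) ⊗ hone : res_rightH)
    (GRing.isLinear.Build B^c res_right res_rightH _ _ res_right_coact_linear).

(** This is the sequence of right B-modules to which flatness is applied. *)
Lemma res_right_exact : exact_at res_right_incl res_right_coact.
Proof.
move=> m; split=> [/eqP|[n <-]].
  rewrite subr_eq0 => /eqP mc.
  have mc' : (m : M) \in coinvariants M by exact/coinvariantP.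
  by exists (exist _ (m : M) mc').
by apply/eqP; rewrite subr_eq0; apply/eqP/coinvariantP; exact: valP.
Qed.
End RightRestriction.

(** * Faithfully flat descent for right Hopf modules *)

Section RightDescent.
Variables (k : fieldType) (H : coquasi_hopf k) (A : comodule_algebra H).
Local Notation B := (coinv_algebra A).
Variables (tau : H -> seq (A * A)) (tauP : translation (@coinv_balanced k H A) tau).
Hypothesis flat : faithfully_flat_left (left_regular A).

(** Scalars act through elements of B, so maps balanced over B are k-linear. *)
Lemma scalar_coinv_sig (c : k) : {b : B | coinv_val b = c *: aone}.
Proof.
have cB : c *: aone \in coinvariants A.
  by apply/coinvariantP; rewrite linearZ /= rho_aone ktensZl.
by exists (exist (fun a => a \in coinvariants A) _ cB).
Qed.

Section Module.
Variable M : right_hopf_module A.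

Lemma res_tens_bil : kbilinear (fun (m : M) (a : A) =>
  ind_right_tens (m : res_right M) a : ind_right (res_right M)).
Proof.
split=> [c m m' a|c m a a']; last exact: ind_right_tens_linear.
have [b bE] := scalar_coinv_sig c.
have -> : (c *: m + m' : M) = ((b : B^c) *: (m : res_right M) + (m' : res_right M) : res_right M).
  congr (_ + _); rewrite -[RHS]/(ract (m ⊗ coinv_val b)) bE ktensZr linearZ /=.
  by rewrite ract1.
rewrite ind_right_tensDl ind_right_tensB; congr (_ + _).
have -> : amul (coinv_val b ⊗ a) = c *: a by rewrite bE ktensZl linearZ /= amul1l.
exact: linearZ.
Qed.
Definition res_tens : {linear (M ⊗ A)%type -> ind_right (res_right M)} := klift res_tens_bil.
Lemma res_tensE m a : res_tens (m ⊗ a) = ind_right_tens (m : res_right M) a.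
Proof. exact: kliftE. Qed.

Lemma res_tensH_bil : kbilinear (fun (t : (M ⊗ H)%type) (a : A) =>
  ind_right_tens (t : res_rightH M) a : ind_right (res_rightH M)).
Proof.
split=> [c m m' a|c m a a']; last exact: ind_right_tens_linear.
have [b bE] := scalar_coinv_sig c.
have -> : c *: m + m' =
    ((b : B^c) *: (m : res_rightH M) + (m' : res_rightH M) : res_rightH M).
  congr (_ + _); rewrite -[RHS]/(tens_map H (act_coinv M b) m).
  move: m; apply: klinear_eq => [? ? ?|? ? ?|m h]; [by klin|exact: linearP|].
  by rewrite tens_mapE act_coinvE bE ktensZr linearZ /= ract1 ktensZl.
rewrite ind_right_tensDl ind_right_tensB; congr (_ + _).
have -> : amul (coinv_val b ⊗ a) = c *: a by rewrite bE ktensZl linearZ /= amul1l.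
exact: linearZ.
Qed.
Definition res_tensH : {linear (M ⊗ H ⊗ A)%type -> ind_right (res_rightH M)} :=
  klift res_tensH_bil.
Lemma res_tensHE t a : res_tensH (t ⊗ a) = ind_right_tens (t : res_rightH M) a.
Proof. exact: kliftE. Qed.

(** The candidate for the inverse of the counit. It is formed in M ⊗_B A, because only the whole
    sum, not each summand, comes from M^coH ⊗_B A. *)
Definition descent (m : M) : ind_right (res_right M) :=
  \Sw_(m0, g <- rho m) \Sw_(g1, g2 <- comul g)
    (hbeta g1 *: \sum_(p <- tau g2) res_tens (ract (m0 ⊗ p.1) ⊗ p.2)).

Lemma res_tensH_balanced (m : M) (z : H) (b : B) a :
  res_tensH (ract (m ⊗ coinv_val b) ⊗ z ⊗ a) = res_tensH (m ⊗ z ⊗ amul (coinv_val b ⊗ a)).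
Proof.
rewrite !res_tensHE -ind_right_tensB; congr ind_right_tens.
by rewrite -[RHS]/(tens_map H (act_coinv M b) (m ⊗ z)) tens_mapE.
Qed.

Lemma res_tens_balanced (m : M) (b : B) a :
  res_tens (ract (m ⊗ coinv_val b) ⊗ a) = res_tens (m ⊗ amul (coinv_val b ⊗ a)).
Proof. by rewrite !res_tensE -ind_right_tensB. Qed.

Lemma descent_core_bil : kbilinear (fun (m : M) (h : H) =>
  \sum_(p <- tau h) res_tens (ract (m ⊗ p.1) ⊗ p.2)).
Proof.
split=> [c m m' h|c m h h']; first by klin.
(* The middle argument demanded by [tau_linear] is set to 1, where its counit is 1. *)
pose F (l : A) (z : H) (r : A) := counit z *: res_tens (ract (m ⊗ l) ⊗ r).
have Ft : ktrilinear F by rewrite /F; ktril.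
have Fb : coinv_balanced F.
  move=> b bB l z r; congr (_ *: _).
  rewrite -[b]/(coinv_val (exist (fun a => a \in coinvariants A) b bB)).
  by rewrite -ractA_r res_tens_balanced.
have FE g : \sum_(p <- tau g) F p.1 hone p.2 = \sum_(p <- tau g) res_tens (ract (m ⊗ p.1) ⊗ p.2).
  by apply: eq_bigr => p _; rewrite /F counit_one scale1r.
by rewrite -!FE; exact: (tau_linear tauP).
Qed.

Lemma descentE m : descent m = \Sw_(m0, g <- rho m) \Sw_(g1, g2 <- comul g)
  (hbeta g1 *: klift descent_core_bil (m0 ⊗ g2)).
Proof. by apply: eq_kfold => ? ?; apply: eq_kfold => ? ?; rewrite kliftE. Qed.

(** [tau_coinv], tested in (M ⊗ H) ⊗_B A. *)
Lemma descent_coinv m : ind_right_hom (res_right_coact M) (descent m) = 0.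
Proof.
have adm1 (m0 : M) : coinv_balanced (fun l z r => res_tensH (ract (m0 ⊗ l) ⊗ z ⊗ r)).
  move=> b bB l z r; rewrite -[b]/(coinv_val (exist (fun a => a \in coinvariants A) b bB)).
  by rewrite -ractA_r res_tensH_balanced.
have adm2 (m' : M) : coinv_balanced (fun l z r => \Sw_(m0, m1 <- rho m')
    res_tensH (ract (m0 ⊗ l) ⊗ hmul (m1 ⊗ z) ⊗ r)).
  by move=> b bB l z r; apply: eq_kfold => m0 m1; exact: adm1.
have e := tau_coinv tauP m adm1 adm2.
have {e} : \Sw_(m0, g <- rho m) \Sw_(g1, g2 <- comul g) (hbeta g1 *:
     \sum_(p <- tau g2) res_tensH (rho (ract (m0 ⊗ p.1)) ⊗ p.2)) =
   \Sw_(m0, g <- rho m) \Sw_(g1, g2 <- comul g) (hbeta g1 *: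
     \sum_(p <- tau g2) res_tensH (ract (m0 ⊗ p.1) ⊗ hone ⊗ p.2)).
  etransitivity; [|exact: e]; apply: eq_kfold => m0 g; apply: eq_kfold => g1 g2.
  congr (_ *: _); apply: eq_bigr => p _.
  by rewrite -[in LHS](kfold_id (rho _)) ktens_kfoldl kfold_linear.
move=> /eqP; rewrite -subr_eq0 => /eqP e; rewrite -[RHS]e {e}.
rewrite /descent kfold_linear -sumrB; apply: eq_bigr => -[m0 g] _ /=.
rewrite kfold_linear -sumrB; apply: eq_bigr => -[g1 g2] _ /=.
rewrite linearZ /= -[RHS]scalerBr; congr (_ *: _); rewrite -sumrB.
etransitivity; first exact: (linear_sum (ind_right_hom (res_right_coact M))).
apply: eq_bigr => p _.
by rewrite res_tensE [LHS]ind_right_mapE -res_tensHE ktensBl linearB.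
Qed.

Definition res_act (t : ind_right (res_right M)) : M :=
  ind_right_fold (N := res_right M) (fun n a => ract ((n : M) ⊗ a)) t.

Let res_act_ok : ind_right_lift_ok (N := res_right M) (fun n a => ract ((n : M) ⊗ a)).
Proof.
split=> [n n' a|n c a a'|b n a]; [by rewrite ktensDl linearD|by klin|].
exact: ractA_m.
Qed.
Lemma res_actE n a : res_act (ind_right_tens n a) = ract ((n : M) ⊗ a).
Proof. exact: (ind_right_foldE res_act_ok). Qed.
Definition res_act_lin : {linear ind_right (res_right M) -> M} :=
  linof (ind_right_fold_linear res_act_ok).

Lemma res_act_descent m : res_act (descent m) = m.
Proof.
rewrite -[LHS]/(res_act_lin (descent m)) /descent kfold_linear.
rewrite -[RHS](tau_generates _ tauP) //.
apply: eq_kfold => m0 g; rewrite kfold_linear; apply: eq_kfold => g1 g2.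
rewrite linearZ /=; congr (_ *: _).
etransitivity; first exact: (linear_sum res_act_lin); apply: eq_bigr => p _.
by rewrite res_tensE; exact: res_actE.
Qed.

Lemma res_act_incl t : res_act (ind_right_hom (res_right_incl M) t) = counit_right M t.
Proof.
rewrite -[LHS]/(res_act_lin _); move: t; apply: ind_right_eq => [s t|s t|n a].
- by rewrite [X in res_act_lin X]linearD; exact: linearD.
- exact: linearD.
rewrite [X in res_act_lin X]ind_right_mapE [RHS]counit_rightE; exact: res_actE.
Qed.

(** Flatness keeps the sequence M^coH → M → M ⊗ H exact after tensoring with A, and [descent m] lies
    in the kernel. *)
Lemma descent_image m : exists t, ind_right_hom (res_right_incl M) t = descent m.
Proof.
have [+ _] := (flat (res_right_incl M) (res_right_coact M)).1 (@res_right_exact _ _ _ M) (descent m).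
by apply; exact: descent_coinv.
Qed.
End Module.

(** For M = A the coinvariants are B, so by [descent_image] the element is 1 ⊗ x for some x, and
    multiplying out shows x = a. *)
Lemma descent_regular (a : A) :
  descent (M := regular_right A) a = ind_right_tens (aone : res_right (regular_right A)) a.
Proof.
have [t tE] := descent_image (M := regular_right A) a.
have E s : ind_right_hom (res_right_incl (regular_right A)) s =
    ind_right_tens (aone : res_right (regular_right A)) (counit_right (regular_right A) s).
  move: s; apply: ind_right_eq => [s s'|s s'|n b].
  - exact: linearD.
  - by rewrite linearD; exact: linearD.
  rewrite [LHS]ind_right_mapE counit_rightE.
  have -> : res_right_incl (regular_right A) n =
      ((n : B) : B^c) *: (aone : res_right (regular_right A)).
    by rewrite -[RHS]/(amul (aone ⊗ coinv_val (n : B))) amul1l.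
  by rewrite ind_right_tensB.
by rewrite -tE E -res_act_incl tE res_act_descent.
Qed.

Section Coinvariant.
Variables (M : right_hopf_module A) (n : M).
Hypothesis nc : n \in coinvariants M.

Lemma ract_coinv_linear : linear (fun a : res_right (regular_right A) =>
  ract (n ⊗ (a : A)) : res_right M).
Proof.
move=> b a a'; rewrite ktensDr linearD; congr (_ + _).
by rewrite -[RHS]/(ract (ract (n ⊗ (a : A)) ⊗ coinv_val b)) ractA_l.
Qed.
Definition ract_coinv : {linear res_right (regular_right A) -> res_right M} :=
  HB.pack (fun a : res_right (regular_right A) => ract (n ⊗ (a : A)) : res_right M)
    (GRing.isLinear.Build B^c (res_right (regular_right A)) (res_right M) _ _ ract_coinv_linear).

(** Since n is coinvariant, a ↦ n a is compatible with coactions and multiplication, so the case M =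
    A is transported along it. *)
Lemma descent_ract (a : A) : descent (ract (n ⊗ a)) = ind_right_tens (n : res_right M) a.
Proof.
transitivity (ind_right_hom ract_coinv (descent (M := regular_right A) a)); last first.
  rewrite descent_regular [LHS]ind_right_mapE; congr ind_right_tens.
  by rewrite -[LHS]/(ract (n ⊗ aone)) ract1.
rewrite !descentE kfold_linear rho_ract rho_coinv_sw //; last by kbil.
rewrite kfold_kfold; last by kbil.
apply: eq_kfold => a0 a1; rewrite kfold_tens; last by kbil.
rewrite hmul1l kfold_linear; apply: eq_kfold => g1 g2.
rewrite linearZ /= !kliftE; congr (_ *: _).
symmetry; etransitivity; first exact: (linear_sum (ind_right_hom ract_coinv)).
apply: eq_bigr => p _; symmetry.
by rewrite !res_tensE ractA_l //; exact/esym/ind_right_mapE.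
Qed.
End Coinvariant.

Lemma res_incl_inj (M : right_hopf_module A) : injective (ind_right_hom (res_right_incl M)).
Proof.
apply: raddf_inj => t t0.
have ex : exact_at (\0 : {linear coinv_right M -> coinv_right M}) (res_right_incl M).
  move=> n; split=> [n0|[x <-]]; last exact: (linear0 (res_right_incl M)).
  by exists 0; apply: val_inj; exact/esym/n0.
have [+ _] := (flat _ _).1 ex t => /(_ t0) [s <-].
elim/ind_right_ind: (s : ind_right (coinv_right M)) => [n a|u v u0 v0|].
- etransitivity; first exact: ind_right_mapE.
  rewrite [X in ind_right_tens X](_ : _ = 0) //.
  by apply: (addrI (ind_right_tens 0 a)); rewrite -ind_right_tensDl !addr0.
- etransitivity; first exact: (linearD (ind_right_hom \0)).
  by rewrite [X in X + _]u0 [X in _ + X]v0 addr0.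
- exact: (linear0 (ind_right_hom \0)).
Qed.

Lemma descent_counit (M : right_hopf_module A) t :
  descent (counit_right M t) = ind_right_hom (res_right_incl M) t.
Proof.
have dl : linear (@descent M) by move=> c m m'; rewrite !descentE; klin.
rewrite -[LHS]/(linof dl (counit_right M t)).
move: t; apply: ind_right_eq => [s t|s t|n a].
- by rewrite [X in linof dl X]linearD; exact: linearD.
- exact: linearD.
rewrite [RHS]ind_right_mapE -[LHS]/(descent (counit_right M _)) counit_rightE.
by apply: descent_ract; exact: valP.
Qed.

(** Composed with [descent] the counit becomes the inclusion of M^coH ⊗_B A into M ⊗_B A, injective
    by flatness; it is onto by [descent_image]. *)
Lemma descent_counit_bij (M : right_hopf_module A) : bijective (counit_right M).
Proof.
have inj : injective (counit_right M).
  move=> s t e; apply: (@res_incl_inj M); rewrite -!descent_counit.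
  by rewrite e.
have surj m : exists t, counit_right M t = m.
  have [t tE] := descent_image m; exists t.
  by rewrite -res_act_incl tE res_act_descent.
have /choice [g gK] := surj; exists g => x; last exact: gK.
by apply: inj; rewrite gK.
Qed.

Section Unit.
Variable N : lmodType B^c.
Let M := ind_right N.

Let eta : {linear N -> res_right M} := res_right_incl M \o unit_right N.

Let eta_act t : res_act (ind_right_hom eta t) = t :> M.
Proof.
rewrite -[LHS]/(res_act_lin M _); move: t; apply: ind_right_eq => [s t|//|n a].
  by rewrite [X in res_act_lin M X]linearD; exact: linearD.
rewrite [X in res_act_lin M X]ind_right_mapE; etransitivity; first exact: res_actE.
by rewrite [RHS]ind_right_gen.
Qed.

Let descent_eta (t : M) : descent t = ind_right_hom eta t.
Proof.
have dl : linear (@descent M) by move=> c m m'; rewrite !descentE; klin.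
rewrite -[LHS]/(linof dl t); move: t; apply: ind_right_eq => [s t|s t|n a].
- exact: linearD.
- exact: linearD.
rewrite [RHS]ind_right_mapE -[LHS]/(descent (ind_right_tens n a : M)) ind_right_gen.
by apply: descent_ract; exact: unit_right_coinv.
Qed.

(** With M = N ⊗_B A, the sequence 0 → N → M → M ⊗ H becomes exact after tensoring with A: there the
    first map is split by the action, and its image is found through [descent]. Faithfulness then
    gives exactness of the sequence itself. *)
Lemma descent_unit_bij : bijective (unit_right N).
Proof.
have inj : injective (unit_right N).
  have ex : exact_at (\0 : {linear N -> N}) eta.
    apply: (flat _ _).2 => t; split=> [t0|[s <-]].
      exists 0; rewrite -[RHS](eta_act t) [X in res_act X]t0.
      by rewrite -[RHS]/(res_act_lin M 0) linear0; exact: (linear0 (ind_right_hom \0)).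
    have -> : btensor_map (M := left_regular A) (\0 : N -> N) id s = 0.
      elim/ind_right_ind: (s : ind_right N) => [n a|u v u0 v0|].
      - etransitivity; first exact: (ind_right_mapE \0).
        rewrite [X in ind_right_tens X](_ : _ = 0) //.
        by apply: (addrI (ind_right_tens 0 a)); rewrite -ind_right_tensDl !addr0.
      - etransitivity; first exact: (linearD (ind_right_hom \0)).
        by rewrite [X in X + _]u0 [X in _ + X]v0 addr0.
      - exact: (linear0 (ind_right_hom \0)).
    exact: (linear0 (ind_right_hom eta)).
  apply: raddf_inj => n n0.
  have [+ _] := ex n; case=> [|x <-//].
  by rewrite -[LHS]/(res_right_incl M (unit_right N n)) n0; exact: linear0.
have ex : exact_at eta (res_right_coact M).
  apply: (flat _ _).2 => t; split=> [t0|[s <-]].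
    have [+ _] := (flat (res_right_incl M) (res_right_coact M)).1 (@res_right_exact _ _ _ M) t.
    move=> /(_ t0) [s sE]; exists (counit_right M s).
    by rewrite -sE -[LHS]/(ind_right_hom eta _) -descent_eta descent_counit.
  rewrite -[X in btensor_map _ _ X]/(ind_right_hom eta s) -descent_eta.
  exact: descent_coinv.
have surj x : exists n, unit_right N n = x.
  have [|n nE] := (ex (val (x : coinv_sub M) : M)).1.
    by apply/eqP; rewrite subr_eq0; apply/eqP/coinvariantP; exact: valP.
  by exists n; apply: val_inj; rewrite -nE.
have /choice [g gK] := surj; exists g => x; last exact: gK.
by apply: inj; rewrite gK.
Qed.
End Unit.

Lemma descent_adjoint_right : right_adjoint_bijective A.
Proof. by split=> [N|M]; [exact: descent_unit_bij|exact: descent_counit_bij]. Qed.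
End RightDescent.

(** * The translation map of a Galois extension *)

Section GaloisTranslation.
Variables (k : fieldType) (H : coquasi_hopf k) (A : comodule_algebra H).
Hypothesis gal : galois_extension A.
Let AH : left_hopf_module A := free_left A (dual_comodule (regular_lcomodule H)).
Let AA : left_hopf_module A := ind_left (left_regular A).

Definition galois_hom : left_hopf_hom AA AH :=
  left_hopf_comp (counit_left AH) (ind_left_hom (coinv_of_hom A)).
Lemma galois_homE t : galois_hom t = can A t. Proof. exact/esym/can_counit. Qed.

Lemma galois_inverse : exists g : left_hopf_hom AH AA,
  cancel galois_hom g /\ cancel g galois_hom.
Proof.
have bij : bijective galois_hom.
  by apply: (eq_bij gal) => t; exact/esym/galois_homE.
have [g [e1 e2]] := left_hopf_iso bij; exists (g : left_hopf_hom AH AA).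
split=> x; first exact: (congr1 (fun f : left_hopf_hom AA AA => f x) e1).
exact: (congr1 (fun f : left_hopf_hom AH AH => f x) e2).
Qed.

Section Fold.
Variables (Q : lmodType k) (F : A -> A -> Q).
Hypotheses (Fb : kbilinear F)
  (Fbal : forall b, b \in coinvariants A -> forall l r, F (amul (l ⊗ b)) r = F l (amul (b ⊗ r))).

Lemma galois_fold_ok : ind_left_lift_ok (N := left_regular A) (fun r l => F l (r : A)).
Proof.
case: Fb => Fl Fr; split=> [r r' l|r c l l'|b r l]; last first.
- exact/esym/(Fbal (coinv_valP b)).
- exact: Fl.
- by have := Fr 1 l r r'; rewrite !scale1r.
Qed.
Definition galois_fold : {linear AA -> Q} := linof (ind_left_fold_linear galois_fold_ok).
Lemma galois_foldE l r : galois_fold (ind_left_tens (r : left_regular A) l) = F l r.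
Proof. exact: (ind_left_foldE galois_fold_ok). Qed.

Lemma galois_fold_sum (s : seq (A * A)) :
  galois_fold (\sum_(p <- s) btens (p.1 : right_regular A) (p.2 : left_regular A)) =
  \sum_(p <- s) F p.1 p.2.
Proof.
etransitivity; first exact: (linear_sum galois_fold).
by apply: eq_bigr => p _; exact: galois_foldE.
Qed.
End Fold.

Lemma galois_fold_comb (Q : lmodType k) (F F1 F2 : A -> A -> Q) Fb Fbal F1b F1bal F2b F2bal c t :
  (forall l r, F l r = c *: F1 l r + F2 l r) ->
  @galois_fold Q F Fb Fbal t = c *: @galois_fold Q F1 F1b F1bal t + @galois_fold Q F2 F2b F2bal t.
Proof.
set f := galois_fold Fb Fbal; set f1 := galois_fold F1b F1bal; set f2 := galois_fold F2b F2bal.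
move=> E; move: t; apply: ind_left_eq => [s t|s t|r l].
- exact: linearD.
- by rewrite (linearD f1) (linearD f2) scalerDr addrACA.
by rewrite /f /f1 /f2 !galois_foldE.
Qed.

Definition galois_tau (tau : H -> seq (A * A)) : Prop :=
  forall h, \sum_(p <- tau h) can_tens p.1 p.2 = aone ⊗ h.

Lemma galois_tau_exists : exists tau, galois_tau tau.
Proof.
have [g [_ gK]] := galois_inverse.
have /choice [tau tauE] (h : H) : exists s : seq (A * A),
    (g (aone ⊗ h) : btensor (right_regular A) (left_regular A)) = \sum_(p <- s) btens (p.1 : right_regular A) (p.2 : left_regular A).
  have [s sE] := btensor_repr (N := right_regular A) (M := left_regular A) (g (aone ⊗ h)).
  by exists s; rewrite sE.
by exists tau => h; rewrite -can_sum -tauE -galois_homE gK.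
Qed.

Variables (tau : H -> seq (A * A)) (tauP : galois_tau tau).
Variables (g : left_hopf_hom AH AA) (gK : cancel g galois_hom) (Kg : cancel galois_hom g).

Lemma galois_tauE h : g (aone ⊗ h) =
  \sum_(p <- tau h) btens (p.1 : right_regular A) (p.2 : left_regular A) :> AA.
Proof. by rewrite -(tauP h) -can_sum -galois_homE Kg. Qed.

(** The inverse of can is colinear, and 1 ⊗ h coacts by (1 ⊗ h_2) ⊗ S(h_1): this is [tau_coact].
    [tau_mul] is [can_tens_mul]. *)
Lemma galois_translation : translation (@coinv_balanced k H A) tau.
Proof.
have FP (Q : lmodType k) (F : A -> H -> A -> Q) z : ktrilinear F -> kbilinear (fun l r => F l z r).
  by case=> F1 F2 F3; split=> *.
split=> [Q F x Ft bal|Q F Ft bal h|h]; last exact: can_tens_mul.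
  have b : forall b, b \in coinvariants A -> forall l r, F (amul (l ⊗ b)) x r = F l x (amul (b ⊗ r)).
    by move=> b bB l r; exact: bal.
  move=> c h h'; rewrite -!(galois_fold_sum (FP _ _ x Ft) b) -!galois_tauE.
  by rewrite ktensPr !linearP.
have b x : forall b, b \in coinvariants A -> forall l r, F (amul (l ⊗ b)) x r = F l x (amul (b ⊗ r)).
  by move=> b bB l r; exact: bal.
pose G (t : AA) (z : H) := galois_fold (FP _ _ z Ft) (b z) t.
have Gb : kbilinear G.
  split=> [c t t' z|c t z z']; first exact: linearP.
  by apply: galois_fold_comb => l r; case: (Ft).
transitivity (kfold G (rho (g (aone ⊗ h)))).
  pose G' := klift Gb; rewrite (kfold_klift Gb) galois_tauE.
  symmetry; etransitivity; first exact: (linear_sum (klift Gb \o @rho k H AA)).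
  apply: eq_bigr => p _; rewrite -[LHS]/(klift Gb (rho (ind_left_tens (p.2 : left_regular A) p.1 : AA))).
  rewrite rho_ind_left kfold_linear; apply: eq_kfold => l0 l1.
  by rewrite kliftE /G galois_foldE.
rewrite (lhh_colinear g) kfold_kfold //.
have Gg : kbilinear (fun t z => G (g t) z).
  by case: Gb => G1 G2; split=> *; rewrite ?linearP; [exact: G1|exact: G2].
transitivity (\Sw_(t, z <- @rho k H AH (aone ⊗ h)) klift Gg (t ⊗ z)).
  by apply: eq_kfold => t z; rewrite kfold_tens // kliftE.
etransitivity.
  by apply: (rho_tens_sw (V := A) (W := dual_comodule (regular_lcomodule H))
    (F := fun t z => klift Gg (t ⊗ z)) aone h); kbil.
rewrite rho_aone kfold_tens; last by kbil.
rewrite rho_dual_sw; last by kbil.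
apply: eq_kfold => h1 h2; rewrite kliftE hmul1l /G galois_tauE.
exact: galois_fold_sum.
Qed.

(** The additional leg of b comes after all legs used in can, so coassociativity moves it behind
    b_4. *)
Lemma can_rho_r (a b : A) :
  \Sw_(b0, b1 <- rho b) (can_tens a b0 ⊗ b1) =
  \Sw_(x, h <- can_tens a b) \Sw_(h1, h2 <- comul h) ((x ⊗ h1 : (A ⊗ H)%type) ⊗ h2).
Proof.
have Kb : kbilinear (fun (x : A) (h : H) =>
  \Sw_(h1, h2 <- comul h) ((x ⊗ h1 : (A ⊗ H)%type) ⊗ h2)) by kbil.
rewrite [RHS](kfold_klift Kb).
transitivity (\Sw_(b', z <- rho b) \Sw_(b0, r1 <- rho b') \Sw_(a0, a1 <- rho a)
  \Sw_(b1, r2 <- comul r1) \Sw_(b2, r3 <- comul r2) \Sw_(b3, b4 <- comul r3)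
    (omegaV (a1 ⊗ (hbeta b2 *: b1) ⊗ antipode b3) *:
      ((amul (a0 ⊗ b0) ⊗ b4 : (A ⊗ H)%type) ⊗ z))).
  apply: eq_kfold => b' z; rewrite /can_tens ktens_kfoldl; symmetry; swx 0; symmetry.
  apply: eq_kfold => a0 a1.
  rewrite ktens_kfoldl; apply: eq_kfold => ? ?; rewrite ktens_kfoldl; apply: eq_kfold => ? ?.
  rewrite ktens_kfoldl; apply: eq_kfold => ? ?; rewrite ktens_kfoldl; apply: eq_kfold => ? ?.
  by rewrite ktensZl.
rewrite -rhoA_sw; last by ktril.
rewrite /can_tens kfold_linear; symmetry.
under eq_kfold => a0 a1 do rewrite kfold_linear.
swx 0; apply: eq_kfold => b0 r1; symmetry; swx 0; apply: eq_kfold => a0 a1.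
rewrite -comulA_sw; last by ktril.
rewrite kfold_linear; apply: eq_kfold => b1 r2.
rewrite -comulA_sw; last by ktril.
rewrite kfold_linear; apply: eq_kfold => b2 r3.
rewrite -comulA_sw; last by ktril.
rewrite kfold_linear; apply: eq_kfold => b3 r4.
by rewrite linearZ /= kliftE -kfoldZ.
Qed.

(** The inverse of can inherits [can_rho_r], which determines the coaction of r(x). On the opposite
    side this becomes the coaction of the left factor. *)
Lemma galois_tau_rho_r (Q : lmodType k) (F : A -> A -> H -> Q) x :
  ktrilinear F ->
  (forall b, b \in coinvariants A -> forall l r h, F (amul (l ⊗ b)) r h = F l (amul (b ⊗ r)) h) ->
  \sum_(p <- tau x) \Sw_(r0, r1 <- rho p.2) F p.1 r0 r1 =
  \Sw_(x1, x2 <- comul x) \sum_(p <- tau x1) F p.1 p.2 x2.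
Proof.
move=> Ft Fbal.
pose tn (l r : A) : AA := ind_left_tens (r : left_regular A) l.
have tnb : kbilinear tn.
  split=> [c l l' r|c l r r']; first exact: ind_left_tens_linear.
  apply: (bij_inj (f := galois_hom)); first by exists g.
  have e a b : galois_hom (tn a b) = can_tens a b by rewrite galois_homE; exact: canE.
  by rewrite linearP !e; case: (can_tens_bil A) => _ E; exact: E.
have Rb : kbilinear (fun l r => \Sw_(r0, r1 <- rho r) (tn l r0 ⊗ r1)).
  by case: tnb => t1 t2; split=> *; first (apply: kfold_lin => *; rewrite t1; klin);
    apply: (kfold_linarg (f := fun r0 r1 => _ ⊗ r1)); rewrite ?linearP //;
    split=> *; rewrite ?t2; klin.
have Rbal b : b \in coinvariants A -> forall l r,
  \Sw_(r0, r1 <- rho r) (tn (amul (l ⊗ b)) r0 ⊗ r1) =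
  \Sw_(r0, r1 <- rho (amul (b ⊗ r))) (tn l r0 ⊗ r1).
  move=> bB l r; rewrite amul_coinv_rho //; last first.
    by case: tnb => t1 t2; split=> *; rewrite ?t2; klin.
  apply: eq_kfold => r0 r1; congr (_ ⊗ _).
  by rewrite /tn -[b]/(coinv_val (exist (fun a => a \in coinvariants A) b bB)) -ind_left_tensB.
(* Both sides are compared after the injective map can ⊗ H. *)
have E : galois_fold Rb Rbal (g (aone ⊗ x)) = \Sw_(x1, x2 <- comul x) (g (aone ⊗ x1) ⊗ x2).
  apply: (tens_map_inj (f := galois_hom)); first by apply: (bij_inj (f := galois_hom)); exists g.
  rewrite kfold_linear.
  transitivity (\Sw_(x1, x2 <- comul x) ((aone ⊗ x1 : AH) ⊗ x2)); last first.
    by apply: eq_kfold => ? ?; rewrite tens_mapE gK.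
  have Kb : kbilinear (fun (x : A) (h : H) =>
    \Sw_(h1, h2 <- comul h) ((x ⊗ h1 : AH) ⊗ h2)) by kbil.
  rewrite -[RHS](kliftE Kb aone x) -[aone ⊗ x in RHS]gK galois_homE.
  move: (g (aone ⊗ x)) => t; rewrite -[LHS]/((tens_map H galois_hom \o galois_fold Rb Rbal) t).
  move: t; apply: ind_left_eq => [s t|s t|r l].
  - exact: linearD.
  - by rewrite can_linear linearD.
  rewrite [can A _]canE -[LHS]/(tens_map H galois_hom (galois_fold Rb Rbal _)) galois_foldE.
  rewrite kfold_linear -(kfold_klift Kb) -[RHS]can_rho_r; apply: eq_kfold => r0 r1.
  by rewrite tens_mapE galois_homE; congr (_ ⊗ _); exact: canE.
have Fb z : kbilinear (fun l r => F l r z) by case: Ft => F1 F2 F3; split=> *.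
have Fbal' z b : b \in coinvariants A -> forall l r, F (amul (l ⊗ b)) r z = F l (amul (b ⊗ r)) z.
  by move=> bB l r; exact: Fbal.
pose G (t : AA) (z : H) := galois_fold (Fb z) (Fbal' z) t.
have Gb : kbilinear G.
  split=> [c t t' z|c t z z']; first exact: linearP.
  by apply: galois_fold_comb => l r; case: (Ft).
have := congr1 (klift Gb) E; rewrite kfold_linear => {}E.
etransitivity; [|etransitivity; first exact: E].
  rewrite galois_tauE [galois_fold _ _ _]galois_fold_sum linear_sum.
  apply: eq_bigr => p _; rewrite kfold_linear; apply: eq_kfold => r0 r1.
  by rewrite kliftE; exact/esym/galois_foldE.
apply: eq_kfold => x1 x2; rewrite kliftE /G galois_tauE; exact: galois_fold_sum.
Qed.
End GaloisTranslation.

(** * Transport of translation maps and flatness to the opposite algebra *)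

Section OppositeTranslation.
Variables (k : fieldType) (H : coquasi_hopf k).
Variable T : {linear H -> H}.
Hypotheses (ST : cancel (@antipode k H) T) (TS : cancel T (@antipode k H)).
Variable A : comodule_algebra H.
Let Hop := coquasi_hopf_op ST TS.
Let Aop : comodule_algebra Hop := comodule_algebra_op A.

Lemma translation_counit (tau : H -> seq (A * A)) :
  translation (@coinv_balanced k H A) tau ->
  forall h, \sum_(p <- tau h) amul (p.1 ⊗ p.2) = halpha h *: aone.
Proof.
move=> tr h.
have eb : kbilinear (fun (a : A) (x : H) => counit x *: a).
  split=> [c a a' x|c a x x']; first by rewrite scalerDr !scalerA mulrC.
  by rewrite linearP /= scalerDl scalerA.
have := congr1 (klift eb) (tau_mul tr h); rewrite linear_sum kfold_linear => e.
transitivity (\sum_(p <- tau h) klift eb (\Sw_(r0, r1 <- rho p.2) (amul (p.1 ⊗ r0) ⊗ r1))).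
  apply: eq_bigr => p _; rewrite kfold_linear.
  rewrite -[LHS](rho_counit_sw (f := fun r => amul (p.1 ⊗ r))); last by move=> ? ? ?; klin.
  by apply: eq_kfold => ? ?; rewrite kliftE.
rewrite e; transitivity (\Sw_(h1, h2 <- comul h) ((counit h2 * halpha h1) *: (aone : A))).
  by apply: eq_kfold => h1 h2; rewrite linearZ /= kliftE scalerA mulrC.
by rewrite kfoldZr counitr_k //; move=> ? ? ?; klin.
Qed.

(** Take r(T(h)) ⊗ l(T(h)). Its coaction rule is [galois_tau_rho_r], T being anti-comultiplicative;
    its product rule is [tau_coact] followed by l(h) r(h) = α(h) 1. *)
Lemma galois_translation_op : galois_extension A ->
  exists tau : Hop -> seq (Aop * Aop), translation (@coinv_balanced k Hop Aop) tau.
Proof.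
move=> gal; have [tau tauP] := galois_tau_exists gal; have [g [Kg gK]] := galois_inverse gal.
have tr := galois_translation tauP Kg.
have comul_T (Q : lmodType k) (F : H -> H -> Q) h : kbilinear F ->
    kfold F (comul (T h)) = \Sw_(h1, h2 <- comul h) F (T h2) (T h1).
  exact: (comul_antipode_sw (H := Hop)).
exists (fun h => [seq (p.2, p.1) | p <- tau (T h)]); split=> [Q F x Ft Fbal|Q F Ft Fbal h|h].
- have Gt : ktrilinear (fun l z r => F r z l : Q) by case: Ft => F1 F2 F3; split=> *.
  have Gbal : coinv_balanced (A := A) (fun l z r => F r z l : Q).
    move=> b bB l z r.
    by rewrite -(amul_opE b l) -(amul_opE r b); exact/esym/(Fbal b bB r z l).
  move=> c h h'; rewrite !big_map linearP; exact: (tau_linear tr x Gt Gbal).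
- rewrite big_map /=.
  have Gt : ktrilinear (fun l r z => F r z l : Q) by case: Ft => F1 F2 F3; split=> *.
  have Gbal b : b \in coinvariants A -> forall (l r : A) z,
      F r z (@amul k H A (l ⊗ b)) = F (@amul k H A (b ⊗ r)) z l.
    move=> bB l r z.
    by rewrite -(amul_opE b l) -(amul_opE r b); exact/esym/(Fbal b bB r z l).
  etransitivity; first exact: (galois_tau_rho_r tauP gK Kg (T h) Gt Gbal).
  have Gt' : ktrilinear (fun l z r => F r z l : Q) by case: Ft => F1 F2 F3; split=> *.
  have Gbal' : coinv_balanced (A := A) (fun l z r => F r z l : Q) by move=> b bB l z r; exact: Gbal.
  have Sb : kbilinear (fun x1 x2 => \sum_(p <- tau x1) F p.2 x2 p.1).
    split=> [c x x' z|c x z z']; first exact: (tau_linear tr z Gt' Gbal').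
    rewrite scaler_sumr -big_split; apply: eq_bigr => p _.
    by case: Ft.
  rewrite comul_T //; apply: eq_kfold => h1 h2; exact/esym/big_map.
rewrite big_map /=.
transitivity (\sum_(p <- tau (T h)) \Sw_(l0, l1 <- rho p.1) (amul (l0 ⊗ p.2) ⊗ l1)).
  by apply: eq_bigr => p _; apply: eq_kfold => l0 l1; rewrite -(amul_opE p.2 l0).
have Ft : ktrilinear (fun (l : A) (z : H) (r : A) => amul (l ⊗ r) ⊗ z) by ktril.
have Fbal : coinv_balanced (fun (l : A) (z : H) (r : A) => amul (l ⊗ r) ⊗ z).
  by move=> b bB l z r; congr (_ ⊗ _); exact: amulA_m.
rewrite (tau_coact tr Ft Fbal).
transitivity (\Sw_(h1, h2 <- comul (T h)) (halpha h2 *: ((aone : A) ⊗ antipode h1))).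
  apply: eq_kfold => h1 h2; rewrite -ktensZl -(translation_counit tr).
  have tb : linear (fun a : A => a ⊗ antipode h1) by move=> ? ? ?; klin.
  by rewrite -[RHS]/(linof tb _) linear_sum.
rewrite comul_T; last by kbil.
by apply: eq_kfold => h1 h2; rewrite TS.
Qed.
End OppositeTranslation.
Section OppositeFlatness.
Variables (k : fieldType) (H : coquasi_bialgebra k) (A : comodule_algebra H).
Let Hop := coquasi_bialgebra_op H.
Let Aop : comodule_algebra Hop := comodule_algebra_op A.
Local Notation B := (coinv_algebra A).
Local Notation Bop := (coinv_algebra Aop).

Lemma coinv_op_sig (b : B) : {b' : Bop | coinv_val b' = coinv_val b}.
Proof.
have bB : (coinv_val b : Aop) \in coinvariants Aop by exact: (coinv_valP b).
by exists (exist (fun a : Aop => a \in coinvariants Aop) _ bB).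
Qed.
(** The coinvariants of the opposite algebra are the same elements but another ring, anti-isomorphic
    to B; its right modules become left B-modules along this map. *)
Definition coinv_op (b : B) : Bop := sval (coinv_op_sig b).
Lemma coinv_opE b : coinv_val (coinv_op b) = coinv_val b.
Proof. exact: (svalP (coinv_op_sig b)). Qed.

Let coinv_val_inj : injective (@coinv_val k Hop Aop).
Proof. by move=> b c; exact: val_inj. Qed.

Lemma coinv_opD b c : coinv_op (b + c) = coinv_op b + coinv_op c.
Proof. by apply: coinv_val_inj; rewrite coinv_opE !coinv_valD !coinv_opE. Qed.
Lemma coinv_opM b c : coinv_op (b * c) = coinv_op c * coinv_op b.
Proof.
by apply: coinv_val_inj; rewrite coinv_opE !coinv_valM !coinv_opE; exact/esym/(amul_opE (coinv_val c) (coinv_val b)).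
Qed.
Lemma coinv_op1 : coinv_op 1 = 1.
Proof. by apply: coinv_val_inj; rewrite coinv_opE. Qed.

Lemma coinv_op_surj (b : Bop) : exists b', coinv_op b' = b.
Proof.
have bB : (coinv_val b : A) \in coinvariants A by exact: (coinv_valP b).
exists (exist (fun a : A => a \in coinvariants A) _ bB).
by apply: coinv_val_inj; rewrite coinv_opE.
Qed.

Section OppositeModule.
Variable X : lmodType Bop^c.
Definition op_type : Type := X.
HB.instance Definition _ := GRing.Zmodule.on op_type.
Let scale (b : B) (x : op_type) : op_type := (coinv_op b : Bop^c) *: (x : X).
Let scaleA b c x : scale b (scale c x) = scale (b * c) x.
Proof. by rewrite /scale scalerA coinv_opM. Qed.
Let scale1 : left_id 1 scale.
Proof. by move=> x; rewrite /scale coinv_op1 scale1r. Qed.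
Let scaleDr : right_distributive scale +%R.
Proof. by move=> b x y; exact: scalerDr. Qed.
Let scaleDl x : {morph scale^~ x : b c / b + c}.
Proof. by move=> b c; rewrite /scale coinv_opD scalerDl. Qed.
HB.instance Definition _ := GRing.Zmodule_isLmodule.Build B op_type
  scaleA scale1 scaleDr scaleDl.
Definition op_module : lmodType B := GRing.Lmodule.clone B op_type _.
End OppositeModule.

Section Maps.
Variables (X Y : lmodType Bop^c) (f : {linear X -> Y}).
Lemma op_linear : linear (f : op_module X -> op_module Y).
Proof. by move=> b x y; exact: linearP. Qed.
Definition op_map : {linear op_module X -> op_module Y} :=
  HB.pack (f : op_module X -> op_module Y)
    (GRing.isLinear.Build B (op_module X) (op_module Y) _ _ op_linear).
End Maps.

Section Swap.
Variable X : lmodType Bop^c.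
Definition op_swap : btensor X (left_regular Aop) -> btensor (right_regular A) (op_module X) :=
  bfold (N := X) (M := left_regular Aop)
    (fun x a => btens ((a : A) : right_regular A) (x : op_module X)).
Definition op_unswap : btensor (right_regular A) (op_module X) -> btensor X (left_regular Aop) :=
  bfold (N := right_regular A) (M := op_module X)
    (fun a x => btens (x : X) ((a : Aop) : left_regular Aop)).

Let swap_balanced : rbalanced (N := X) (M := left_regular Aop)
    (fun x a => btens ((a : A) : right_regular A) (x : op_module X)).
Proof.
have [bl br bs] := @btens_balanced _ (right_regular A) (op_module X).
split=> [x x' a|x a a'|b x a]; [exact: br|exact: bl|].
have [b' bE] := coinv_op_surj b.
rewrite -{1}bE -[LHS]/(btens (a : right_regular A) (b' *: (x : op_module X))) -(bs b').
congr btens; rewrite -[LHS]/(amul ((a : A) ⊗ coinv_val b')) -coinv_opE bE.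
exact/esym/(@amul_opE k H A (coinv_val b) a).
Qed.
Let unswap_balanced : rbalanced (N := right_regular A) (M := op_module X)
    (fun a x => btens (x : X) ((a : Aop) : left_regular Aop)).
Proof.
have [bl br bs] := @btens_balanced _ X (left_regular Aop).
split=> [x x' a|x a a'|b a x]; [exact: br|exact: bl|].
rewrite -[RHS]/(btens ((coinv_op b : Bop^c) *: (x : X)) _).
rewrite (bs (coinv_op b)); congr btens; rewrite -[LHS]/(amul ((a : A) ⊗ coinv_val b)).
by rewrite -coinv_opE; exact/esym/(@amul_opE k H A (coinv_val (coinv_op b)) a).
Qed.
Lemma op_swapE x a : op_swap (btens x a) = btens ((a : A) : right_regular A) (x : op_module X).
Proof. exact: bfold_btens. Qed.
Lemma op_unswapE x a :
  op_unswap (btens ((a : A) : right_regular A) (x : op_module X)) = btens x ((a : Aop) : left_regular Aop).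
Proof. exact: bfold_btens. Qed.
Lemma op_swapD : {morph op_swap : s t / s + t}.
Proof. exact: bfoldD. Qed.
Lemma op_unswapD : {morph op_unswap : s t / s + t}.
Proof. exact: bfoldD. Qed.
Lemma op_swapK : cancel op_swap op_unswap.
Proof.
apply: (btensor_eq (N := X) (M := left_regular Aop)) => [s t|//|x a].
  by rewrite op_swapD op_unswapD.
by rewrite op_swapE op_unswapE.
Qed.
Lemma op_unswapK : cancel op_unswap op_swap.
Proof.
apply: (btensor_eq (N := right_regular A) (M := op_module X)) => [s t|//|a x].
  by rewrite op_unswapD op_swapD.
by rewrite op_unswapE op_swapE.
Qed.
Lemma op_swap0 : op_swap 0 = 0.
Proof. by apply: (addrI (op_swap 0)); rewrite -op_swapD !addr0. Qed.
End Swap.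

Lemma op_swap_map (X Y : lmodType Bop^c) (f : {linear X -> Y}) t :
  op_swap (btensor_map (M := left_regular Aop) f id t) =
  btensor_map (N := right_regular A) id (op_map f) (op_swap t).
Proof.
have b1 := btensor_map_balanced f (idfun : {linear left_regular Aop -> left_regular Aop}).
have b2 := btensor_map_balanced (idfun : {linear right_regular A -> right_regular A}) (op_map f).
move: t; apply: (btensor_eq (N := X) (M := left_regular Aop)) => [s t|s t|x a].
- by rewrite -op_swapD; congr op_swap; exact: bfoldD.
- by rewrite op_swapD; exact: bfoldD.
rewrite op_swapE [RHS](bfold_btens _ _ b2) -op_swapE; congr op_swap.
exact: (bfold_btens _ _ b1).
Qed.

(** Exactness is carried in both directions along the natural bijection [op_swap]. *)
Lemma faithfully_flat_op : faithfully_flat_right (right_regular A) ->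
  faithfully_flat_left (left_regular Aop).
Proof.
move=> flat X Y Z f g; split=> [e y|e y].
  have [e1 e2] := (flat _ _ _ (op_map f) (op_map g)).1 e (op_swap y).
  split=> [y0|[x <-]].
    have [|x xE] := e1; first by rewrite -op_swap_map y0 op_swap0.
    exists (op_unswap x); apply: (can_inj (@op_swapK Y)).
    by rewrite op_swap_map op_unswapK.
  apply: (can_inj (@op_swapK Z)); rewrite !op_swap_map op_swap0.
  have [_] := (flat _ _ _ (op_map f) (op_map g)).1 e
    (btensor_map (N := right_regular A) id (op_map f) (op_swap x)).
  by apply; exists (op_swap x).
apply: (flat _ _ _ (op_map f) (op_map g)).2 => t.
rewrite -[t]op_unswapK -op_swap_map; split=> [t0|[x xE]].
  have [+ _] := e (op_unswap t); case=> [|x xE].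
    by apply: (can_inj (@op_swapK Z)); rewrite t0 op_swap0.
  by exists (op_swap x); rewrite -op_swap_map xE.
have [_ +] := e (op_unswap t) => ->; first exact: op_swap0.
exists (op_unswap x); apply: (can_inj (@op_swapK Y)).
by rewrite op_swap_map op_unswapK.
Qed.
End OppositeFlatness.

(** * The implications between the five conditions *)

Section Equivalences.
Variables (k : fieldType) (H : coquasi_hopf k) (T : {linear H -> H}).
Hypotheses (ST : cancel (@antipode k H) T) (TS : cancel T (@antipode k H)).
Variable A : comodule_algebra H.

Lemma total_adjoint : elementary_total A ->
  right_adjoint_bijective A /\ left_adjoint_bijective A.
Proof.
move=> tot; have [gr _ gl _] := total_conditions ST TS tot.
have [[gamma [gammac gamma1]] _] := tot; split; split.
- exact: (unit_right_bij gammac gamma1).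
- by move=> M; exact: (counit_right_bij gammac gamma1).
- exact: (unit_left_bij ST TS gammac gamma1).
- by move=> M; exact: (counit_left_bij ST TS gammac gamma1).
Qed.

(** Injectivity of can comes from the bijective counit at A ⊗ H. *)
Lemma total_galois : elementary_total A -> galois_extension A.
Proof.
move=> tot; have [_ [_ cb]] := total_adjoint tot; have [_ surj] := tot.
have /choice [g gK] := surj; exists g => // x.
by apply: (counit_can_inj cb); rewrite gK.
Qed.

Lemma total_flat : elementary_total A ->
  faithfully_flat_left (left_regular A) /\ faithfully_flat_right (right_regular A).
Proof.
move=> tot; have [gr _ gl _] := total_conditions ST TS tot.
have [[gamma [gammac gamma1]] _] := tot.
by split; [exact: (total_flat_left gammac gamma1)|exact: (total_flat_right ST TS gammac gamma1)].
Qed.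

Lemma right_equivalence_total :
  inverse_equivalences (coinv_right_functor A) (ind_right_functor A) -> elementary_total A.
Proof.
by move=> e; apply: (right_conditions_total ST TS);
  [exact: equivalence_gen_right|exact: equivalence_lift_right].
Qed.

Lemma left_equivalence_total :
  inverse_equivalences (coinv_left_functor A) (ind_left_functor A) -> elementary_total A.
Proof.
by move=> e; apply: left_conditions_total;
  [exact: equivalence_gen_left|exact: equivalence_lift_left].
Qed.

Lemma flat_left_total :
  faithfully_flat_left (left_regular A) -> galois_extension A -> elementary_total A.
Proof.
move=> flat gal; apply/right_equivalence_total/right_adjoint_equivalence.
have [tau tauP] := galois_tau_exists gal; have [g [Kg _]] := galois_inverse gal.
exact: (descent_adjoint_right (galois_translation tauP Kg) flat).
Qed.
End Equivalences.

(* A total integral over the opposite comodule algebra is one over A, because the *)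
(* two Hopf algebras share their coalgebra; surjectivity of can is part of the    *)
(* Galois condition and need not be transported.                                  *)
Lemma flat_right_total (k : fieldType) (H : coquasi_hopf k) (T : {linear H -> H})
  (ST : cancel (@antipode k H) T) (TS : cancel T (@antipode k H)) (A : comodule_algebra H) :
  faithfully_flat_right (right_regular A) -> galois_extension A -> elementary_total A.
Proof.
move=> flat gal; split=> [|y]; last by have [g _ gK] := gal; exists (g y).
have [tau tauP] := galois_translation_op ST TS gal.
pose Hop := coquasi_hopf_op ST TS; pose Aop : comodule_algebra Hop := comodule_algebra_op A.
have [[gamma [gammac gamma1]] _] : elementary_total Aop.
  apply: (@right_equivalence_total k Hop (@antipode k H) TS ST).
  apply/right_adjoint_equivalence.
  exact: (descent_adjoint_right tauP (faithfully_flat_op flat)).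
by exists gamma.
Qed.

Theorem theorem33 (k : fieldType) (H : coquasi_hopf k)
  (bijS : bijective (@antipode k H)) (A : comodule_algebra H) :
  [<-> (exists gamma : {linear H -> A}, total_integral gamma) /\
         (forall y, exists x, can A x = y);
       inverse_equivalences (coinv_right_functor A) (ind_right_functor A);
       inverse_equivalences (coinv_left_functor A) (ind_left_functor A);
       faithfully_flat_left (left_regular A) /\ galois_extension A;
       faithfully_flat_right (right_regular A) /\ galois_extension A].
Proof.
have [T [ST TS]] := lmod_iso bijS.
(* Every implication that starts from one of the later conditions first recovers the total integral
   and the surjectivity of can. *)
tfae.
- by move=> /(total_adjoint ST TS) [/right_adjoint_equivalence].
- by move=> /(right_equivalence_total ST TS) /(total_adjoint ST TS) [_ /left_adjoint_equivalence].
- move=> /left_equivalence_total tot.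
  by split; [case: (total_flat ST TS tot)|exact: (total_galois ST TS)].
- move=> [flat gal]; have tot := flat_left_total ST TS flat gal.
  by split=> //; case: (total_flat ST TS tot).
- by case; exact: (flat_right_total ST TS).
Qed.
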